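(* Let $\mathcal G$ and $\mathcal H$ be locally compact Hausdorff groupoids with left Haar systems and $\sigma$-compact unit spaces, and let $\Omega$ be an equivalence from $\mathcal G$ to $\mathcal H$. Let $A$ and $B$ be $\mathcal H$-Banach algebras. Then $$\Omega^*:\ \mathrm{KK}^{\mathrm{ban}}_{\mathcal H}(A,B)\to\mathrm{KK}^{\mathrm{ban}}_{\mathcal G}(\Omega^*A,\Omega^*B)$$ is an isomorphism with inverse map $(\Omega^{-1})^*$ (under the natural identifications $(\Omega^{-1})^*\Omega^*A\cong A$, $(\Omega^{-1})^*\Omega^*B\cong B$).
   Context: **Groupoids.** All groupoids $\mathcal G$ have open range and source maps $r,s:\mathcal G\to\mathcal G^{(0)}$; $\mathcal G^x=r^{-1}(x)$. A left Haar system is a family $(\lambda^x)_{x\in\mathcal G^{(0)}}$ of Radon measures on $\mathcal G$ with $\operatorname{supp}\lambda^x=\mathcal G^x$, $x\mapsto\int\varphi\,d\lambda^x$ in $C_c(\mathcal G^{(0)})$ for $\varphi\in C_c(\mathcal G)$, and $\int\varphi(\cdot)\,d\lambda^{r(\gamma)}=\int\varphi(\gamma\,\cdot)\,d\lambda^{s(\gamma)}$. An equivalence $\Omega$ from $\mathcal G$ to $\mathcal H$ is a locally compact Hausdorff space with commuting continuous left $\mathcal G$-action (anchor $\rho:\Omega\to\mathcal G^{(0)}$) and right $\mathcal H$-action (anchor $\sigma:\Omega\to\mathcal H^{(0)}$), both free and proper, such that $\rho,\sigma$ induce homeomorphisms $\Omega/\mathcal H\cong\mathcal G^{(0)}$ and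 $\mathcal G\backslash\Omega\cong\mathcal H^{(0)}$. $\Omega^{-1}$ is $\Omega$ with the actions interchanged, an equivalence from $\mathcal H$ to $\mathcal G$. For $\rho(\omega)=\rho(\omega')$, $\langle\omega,\omega'\rangle\in\mathcal H$ is the unique element with $\omega\langle\omega,\omega'\rangle=\omega'$. On $\Omega$: $\lambda^g_\Omega(\varphi)=\int\varphi(\omega\eta)\,d\lambda_{\mathcal H}^{\sigma(\omega)}(\eta)$ for any $\omega\in\rho^{-1}(g)$. **Fields.** An upper semi-continuous (u.s.c.) field of Banach spaces over a locally compact Hausdorff $X$ is a family $(E_x)_{x\in X}$ of Banach spaces with a linear space of sections $\Gamma(X,E)\subseteq\prod_xE_x$ such that evaluations $\Gamma(X,E)\to E_x$ have dense image, $x\mapsto\|\xi(x)\|$ is u.s.c. for every section, and every selection locally approximable (uniformly on neighbourhoods, up to every $\varepsilon>0$) by sections is a section. Continuous fields of (bi)linear maps are locally bounded families of (bi)linear maps of fibres sending sections to sections. $p^*E$ has fibres $E_{p(y)}$ and sections the selections locally approximable by $\xi\circ p$; $(p^*T)_y=T_{p(y)}$. A $\mathcal G$-Banach space is a u.s.c. field $E$ over $\mathcal G^{(0)}$ with an isometric isomorphism $\alpha:s^*E\to r^*E$, $\alpha_{\gamma\gamma'}=\alpha_\gamma\alpha_{\gamma'}$ ($\gamma e:=\alpha_\gamma e$). A $\mathcal G$-Banach algebra has in addition Banach algebra fibres, continuous multiplication field and multiplicative $\alpha_\gamma$. $B[0,1]$ has fibres $C([0,1],B_x)$ (sections: those $\xi$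 with $(x,t)\mapsto\xi(x)(t)$ a section of the pullback of $B$ to $X\times[0,1]$). **Pairs.** A Banach $B$-pair $E=(E^<,E^>)$ consists of fields of left resp. right Banach $B$-modules and a contractive continuous field of $B$-bilinear maps $\langle\cdot,\cdot\rangle:E^<\times E^>\to B$; non-degenerate if both modules are (the span of the action is dense fibrewise). $\mathrm L_B(E,F)$: bounded pairs $T=(T^<,T^>)$ of continuous fields of $B$-linear maps $T^>:E^>\to F^>$, $T^<:F^<\to E^<$ with $\langle f,T^>e\rangle=\langle T^<f,e\rangle$. For $\eta\in\Gamma(F^>)$, $\xi\in\Gamma(E^<)$: $|\eta\rangle\langle\xi|$ is $e\mapsto\eta\langle\xi,e\rangle$, $f\mapsto\langle f,\eta\rangle\xi$. $T$ is locally compact if it is locally approximable in norm by finite sums of such operators. In an $A$-$B$-pair $A$ also acts contractively on the left of $E^>$ and right of $E^<$ by commuting actions with $\langle ea,f\rangle=\langle e,af\rangle$; $\pi(a)$ denotes the operator of $a$. $\mathcal G$-Banach pairs carry compatible isometric $\mathcal G$-actions on $E^<,E^>$. **$\mathrm{KK}^{\mathrm{ban}}_{\mathcal G}$.** Cycles for $(A,B)$ are $(E,T)$ with $E$ a non-degenerate $\mathbb Z/2$-graded $\mathcal G$-Banach $A$-$B$-pair, $T\in\mathrm L_B(E)$ odd, such that $[\pi(a),T]$, $\pi(a)(1-T^2)$ are locally compact for $a\in\Gamma(\mathcal G^{(0)},A)$, and $\pi(\tilde a)(\gamma T_{s(\gamma)}\gamma^{-1}-T_{r(\gamma)})_{\gamma\in\mathcal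 G}$ is a locally compact operator on $r^*E$ for $\tilde a\in\Gamma(\mathcal G,r^*A)$. The push-forward along an equivariant contractive homomorphism $\psi:B\to B'$ is $\psi_*E=(\widetilde{B'}\otimes_{\widetilde B}E^<,E^>\otimes_{\widetilde B}\widetilde{B'})$ (fibrewise unitalisations, projective balanced tensor products) with $T\otimes1$. A homotopy is a cycle for $(A,B[0,1])$, joining its push-forwards under evaluation at $0,1$ (up to isomorphism); $\mathrm{KK}^{\mathrm{ban}}_{\mathcal G}(A,B)$ is the abelian group (under direct sum) of classes for the generated equivalence relation. **The functor $\Omega^*$.** For an $\mathcal H$-Banach space $E$, $\Omega^*E$ is the $\mathcal G$-Banach space with fibre over $g$ the families $(e_\omega)_{\omega\in\rho^{-1}(g)}$, $e_\omega\in E_{\sigma(\omega)}$, $e_\omega=\eta e_{\omega\eta}$ for $\eta\in\mathcal H^{\sigma(\omega)}$, with the common norm $\|e_\omega\|$; sections are $g\mapsto(\delta(\omega))_{\omega\in\rho^{-1}(g)}$ with $\delta\in\Gamma(\Omega,\sigma^*E)$, $\delta(\omega)=\eta\delta(\omega\eta)$; $(\gamma e)_\omega=e_{\gamma^{-1}\omega}$. Algebra and pair structures are componentwise. On KK: $\Omega^*[(E,T)]=[(\Omega^*E,\tilde T)]$, $\tilde T(e_\omega)_\omega=(\tilde T_\omega e_\omega)_\omega$, $\tilde T_\omega=\int c(\omega')\langle\omega,\omega'\rangle T_{\sigma(\omega')}\langle\omega,\omega'\rangle^{-1}d\lambda_\Omega^{\rho(\omega)}(\omega')$ (in both components of the pair),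 where $c:\Omega\to[0,\infty)$ is continuous, $\int c\,d\lambda_\Omega^g=1$ for all $g$, and $\rho^{-1}(K)\cap\operatorname{supp}c$ is compact for all compact $K\subseteq\mathcal G^{(0)}$ (such $c$ exists as $\mathcal G^{(0)}$ is $\sigma$-compact; the class does not depend on it). *)

(* Defs.v *)
(* Banach spaces are [completeNormedModType R[i]]; norms are then elements of
   [R[i]], and [0 < e] for [e : R[i]] forces [e] to be real.

   The records below carry data together with the fibrewise algebraic axioms
   that the constructions need; the conditions on sections (continuity), and
   for pairs and cycles all remaining axioms, are the predicates [is_usc_field],
   [is_gspace], [is_galg], [is_pair], [is_odd_operator] and [is_cycle]. *)

From Stdlib Require Relation_Operators.
From HB Require Import structures.
From mathcomp Require Import all_boot all_order all_algebra.
From mathcomp Require Import complex.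
From mathcomp Require Import all_classical all_reals all_analysis.

Set Implicit Arguments.
Unset Strict Implicit.
Unset Printing Implicit Defensive.

Import Order.TTheory GRing.Theory Num.Theory.
Import numFieldNormedType.Exports.

Local Open Scope classical_set_scope.
Local Open Scope ring_scope.
Local Open Scope complex_scope.

Section Completeness.
Context {K : numFieldType}.

Lemma cauchy_contract (U V : normedModType K) (f : U -> V) (F : set_system U) :
  (forall a b, `|f a - f b| <= `|a - b|) -> Filter F ->
  cauchy F -> cauchy (f @ F).
Proof.
move=> fc FF /cauchy_ballP Fc; apply/cauchy_ballP => e e0.
have [[P Q] [/= FP FQ PQ]] := Fc e e0.
exists (f @` P, f @` Q).
  split; rewrite /= /nbhs/=.
    by apply: filterS FP => x Px; exists x.
  by apply: filterS FQ => x Qx; exists x.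
move=> [_ _] /= [[x Px <-] [y Qy <-]].
have := PQ (x, y) (conj Px Qy).
rewrite /= -!ball_normE /= => xy; exact: le_lt_trans (fc _ _) xy.
Qed.

Lemma continuous_distP (T : topologicalType) (V : normedModType K) (f : T -> V) :
  continuous f <->
  forall t (e : K), 0 < e -> \forall s \near t, `|f t - f s| < e.
Proof.
by split=> fc t; [move=> e e0; have /cvgrPdist_lt := fc t; exact
  | apply/cvgrPdist_lt => e; exact: fc].
Qed.

End Completeness.

Section L1Sum.
Variable R : realType.

(* The sum [V (+) W] with the norm [|v| + |w|] (the library norm on [V * W] is
   the maximum). *)
Definition l1sum (V W : normedModType R[i]) : Type := (V * W)%type.

Section Norm.
Variables V W : normedModType R[i].

HB.instance Definition _ := GRing.Lmodule.copy (l1sum V W) (V * W)%type.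

Definition l1norm (p : l1sum V W) : R[i] := `|p.1| + `|p.2|.

Lemma l1norm_triangle p q : l1norm (p + q) <= l1norm p + l1norm q.
Proof. by rewrite /l1norm addrACA lerD// ler_normD. Qed.

Lemma l1normZ (a : R[i]) p : l1norm (a *: p) = `|a| * l1norm p.
Proof. by rewrite /l1norm !normrZ mulrDr. Qed.

Lemma l1norm0_eq0 p : l1norm p = 0 -> p = 0.
Proof.
case: p => v w /eqP; rewrite /l1norm paddr_eq0//= !normr_eq0.
by move=> /andP[/eqP-> /eqP->].
Qed.

HB.instance Definition _ := Lmodule_isNormed.Build R[i] (l1sum V W)
  l1norm_triangle l1normZ l1norm0_eq0.

Lemma l1sum_normE (p : l1sum V W) : `|p| = `|p.1| + `|p.2|.
Proof. by []. Qed.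

End Norm.

Section Complete.
Variables V W : completeNormedModType R[i].

Lemma l1sum_complete (F : set_system (l1sum V W)) :
  ProperFilter F -> cauchy F -> cvg F.
Proof.
move=> FF Fc.
have c1 : cvg ((fun p : l1sum V W => p.1) @ F).
  apply: cauchy_cvg; apply: cauchy_contract Fc => a b.
  by rewrite l1sum_normE lerDl.
have c2 : cvg ((fun p : l1sum V W => p.2) @ F).
  apply: cauchy_cvg; apply: cauchy_contract Fc => a b.
  by rewrite l1sum_normE lerDr.
apply/cvg_ex; exists ((lim ((fun p : l1sum V W => p.1) @ F),
  lim ((fun p : l1sum V W => p.2) @ F)) : l1sum V W).
apply/cvgrPdist_le => e e0.
have e20 : 0 < e / 2 by rewrite divr_gt0.
move/cvgrPdist_le : c1 => /(_ _ e20) n1.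
move/cvgrPdist_le : c2 => /(_ _ e20) n2.
near=> p; rewrite l1sum_normE /= [leRHS]splitr lerD//.
  by near: p.
by near: p.
Unshelve. all: by end_near. Qed.

HB.instance Definition _ := Uniform_isComplete.Build (l1sum V W) l1sum_complete.

End Complete.
End L1Sum.

Section Interval.
Variable R : realType.

Definition unitI : topologicalType := set_type [set` `[0%R : R, 1%R]].

Fact unitI_proof (r : R) : 0 <= r <= 1 -> r \in [set` `[0%R : R, 1%R]].
Proof. by move=> r01; rewrite inE/= in_itv. Qed.

Definition mkI (r : R) (r01 : 0 <= r <= 1) : unitI :=
  exist (fun r => r \in [set` `[0%R : R, 1%R]]) r (unitI_proof r01).

Fact unitI0 : 0 <= (0 : R) <= 1. Proof. by rewrite lexx ler01. Qed.
Fact unitI1 : 0 <= (1 : R) <= 1. Proof. by rewrite lexx ler01. Qed.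

Definition i0 : unitI := mkI unitI0.
Definition i1 : unitI := mkI unitI1.

Lemma unitI_compact : compact [set: unitI].
Proof.
have cl (r : R) : 0 <= Num.max 0 (Num.min r 1) <= 1.
  by rewrite le_max lexx/= ge_max ler01/= ge_min lexx orbT.
pose h r : unitI := mkI (cl r).
have hc : continuous h.
  apply: continuous_comp_initial.
  have mc : continuous ((cst 0 : R -> R^o) \max ((id : R -> R^o) \min cst 1)).
    move=> r; apply: continuous_max; first exact: cst_continuous.
    apply: continuous_min; [exact: cvg_id | exact: cst_continuous].
  exact: mc.
have -> : [set: unitI] = h @` [set` `[0%R : R, 1%R]].
  apply/seteqP; split => // -[r r01] _.
  have /andP[r0 r1] : 0 <= r <= 1 by have := r01; rewrite inE/= in_itv.
  exists r => /=; first by rewrite in_itv/= r0.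
  apply: val_inj => /=.
  by rewrite min_l// max_r.
apply: continuous_compact; last exact: segment_compact.
exact: continuous_subspaceT.
Qed.

End Interval.

(* [cpath V] is [C([0,1], V)] with the supremum norm. *)
Section ContinuousPaths.
Variable R : realType.
Local Notation C := R[i].

Lemma Re_norm (V : normedModType C) (v : V) : (complex.Re `|v|)%:C = `|v|.
Proof. by apply: RRe_real; rewrite realE normr_ge0. Qed.

Section Def.
Variable V : normedModType C.

Definition cpath : Type := {f : unitI R -> V | continuous f}.

Definition pval (f : cpath) : unitI R -> V := sval f.

Lemma pvalP (f : cpath) : continuous (pval f). Proof. exact: (svalP f). Qed.

Lemma cpath_ext (f g : cpath) : pval f =1 pval g -> f = g.
Proof. by case: f g => [f fc] [g gc] fg; apply: eq_exist; apply/funext. Qed.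

HB.instance Definition _ := gen_eqMixin cpath.
HB.instance Definition _ := gen_choiceMixin cpath.

Definition mkpath (f : unitI R -> V) (fc : continuous f) : cpath :=
  exist (fun f : unitI R -> V => continuous f) f fc.

Fact path0_cts : continuous (fun _ : unitI R => 0 : V).
Proof. exact: cst_continuous. Qed.
Fact pathN_cts f : continuous (fun t => - pval f t).
Proof. move=> t; exact: continuousN (@pvalP f t). Qed.
Fact pathD_cts f g : continuous (fun t => pval f t + pval g t).
Proof. move=> t; exact: continuousD (@pvalP f t) (@pvalP g t). Qed.
Fact pathZ_cts (a : C) f : continuous (fun t => a *: pval f t).
Proof. move=> t; exact: continuousZl_tmp (@pvalP f t). Qed.

Definition path0 : cpath := mkpath path0_cts.
Definition pathN f : cpath := mkpath (@pathN_cts f).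
Definition pathD f g : cpath := mkpath (@pathD_cts f g).
Definition pathZ (a : C) f : cpath := mkpath (@pathZ_cts a f).

Fact pathA : associative pathD.
Proof. by move=> f g h; apply: cpath_ext => t; apply: addrA. Qed.
Fact pathC : commutative pathD.
Proof. by move=> f g; apply: cpath_ext => t; apply: addrC. Qed.
Fact path0D : left_id path0 pathD.
Proof. by move=> f; apply: cpath_ext => t; apply: add0r. Qed.
Fact pathND : left_inverse path0 pathN pathD.
Proof. by move=> f; apply: cpath_ext => t; apply: addNr. Qed.

HB.instance Definition _ := GRing.isZmodule.Build cpath pathA pathC path0D pathND.

Fact pathZA a b f : pathZ a (pathZ b f) = pathZ (a * b) f.
Proof. by apply: cpath_ext => t; apply: scalerA. Qed.
Fact path1Z : left_id 1 pathZ.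
Proof. by move=> f; apply: cpath_ext => t; apply: scale1r. Qed.
Fact pathZDr : right_distributive pathZ +%R.
Proof. by move=> a f g; apply: cpath_ext => t; apply: scalerDr. Qed.
Fact pathZDl f : {morph pathZ^~ f : a b / a + b}.
Proof. by move=> a b; apply: cpath_ext => t; apply: scalerDl. Qed.

HB.instance Definition _ := GRing.Zmodule_isLmodule.Build C cpath
  pathZA path1Z pathZDr pathZDl.

Definition path_norms (f : cpath) : set R := [set complex.Re `|pval f t| | t in setT].

Definition path_norm (f : cpath) : C := (sup (path_norms f))%:C.

Fact path_norms_sup f : has_sup (path_norms f).
Proof.
apply: compact_has_sup; first by exists (complex.Re `|pval f (i0 R)|); exists (i0 R).
apply: continuous_compact (@unitI_compact R).
apply: continuous_subspaceT; apply/(@continuous_distP _ _ R^o) => t e e0.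
have eC : (0 : C) < e%:C by rewrite ltcR.
have /continuous_distP/(_ t _ eC) := @pvalP f.
apply: filterS => s fs.
rewrite -ltcR; apply: le_lt_trans fs.
apply: le_trans (ler_dist_dist (pval f t) (pval f s)).
rewrite -[in leRHS](Re_norm (pval f t)) -[in leRHS](Re_norm (pval f s)).
by rewrite -rmorphB/= normc_def/= expr0n/= addr0 sqrtr_sqr.
Qed.

Lemma path_norm_ub f t : `|pval f t| <= path_norm f.
Proof.
rewrite -Re_norm lecR; apply: ub_le_sup; first by case: (path_norms_sup f).
by exists t.
Qed.

Lemma path_norm_le f (M : R) : (forall t, `|pval f t| <= M%:C) -> path_norm f <= M%:C.
Proof.
move=> fM; rewrite lecR; apply: ge_sup.
  by case: (path_norms_sup f).
by move=> _ [t _ <-]; rewrite -lecR Re_norm.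
Qed.

Lemma path_norm_ge0 f : 0 <= path_norm f.
Proof. exact: le_trans (normr_ge0 _) (path_norm_ub f (i0 R)). Qed.

Fact path_normD f g : path_norm (f + g) <= path_norm f + path_norm g.
Proof.
rewrite -rmorphD/=; apply: path_norm_le => t.
by rewrite rmorphD/=; apply: le_trans (ler_normD _ _) _; rewrite lerD// path_norm_ub.
Qed.

Fact path_normZ a f : path_norm (a *: f) = `|a| * path_norm f.
Proof.
have H b g : path_norm (b *: g) <= `|b| * path_norm g.
  rewrite -[`|b|](Re_norm (b : C^o)) -rmorphM/=; apply: path_norm_le => t.
  rewrite rmorphM/= (Re_norm (b : C^o)) normrZ.
  by rewrite ler_wpM2l// path_norm_ub.
apply/eqP; rewrite eq_le H/=.
have [->|a0] := eqVneq a 0; first by rewrite normr0 mul0r path_norm_ge0.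
have := H a^-1 (a *: f); rewrite scalerA mulVf// scale1r normfV.
by rewrite ler_pdivlMl// normr_gt0.
Qed.

Fact path_norm0_eq0 f : path_norm f = 0 -> f = 0.
Proof.
move=> f0; apply: cpath_ext => t; apply/eqP.
by rewrite -normr_le0 -f0 path_norm_ub.
Qed.

HB.instance Definition _ := Lmodule_isNormed.Build C cpath
  path_normD path_normZ path_norm0_eq0.

Lemma cpath_normE (f : cpath) : `|f| = path_norm f. Proof. by []. Qed.

End Def.

Lemma cpath_complete (V : completeNormedModType C) (F : set_system (cpath V)) :
  ProperFilter F -> cauchy F -> cvg F.
Proof.
move=> FF Fc.
pose l t := lim ((fun f : cpath V => pval f t) @ F).
have lP t : (fun f : cpath V => pval f t) @ F --> l t.
  apply: cauchy_cvg; apply: cauchy_contract Fc => a b.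
  exact: (path_norm_ub (a - b) t).
have unif (e : C) : 0 < e -> \forall f \near F, forall t, `|l t - pval f t| <= e.
  move=> e0; have e20 : 0 < e / 2 by rewrite divr_gt0.
  move/cauchy_ballP : (Fc) => /(_ _ e20)[[P Q] [/= FP FQ PQ]].
  apply: filterS FP => f Pf t.
  have /cvgrPdist_le /(_ _ e20) lt := lP t.
  have [g [Qg lg]] := filter_ex (filterI FQ lt).
  rewrite [e]splitr; apply: le_trans (ler_distD (pval g t) _ _) _.
  rewrite lerD//= distrC.
  have := PQ (f, g) (conj Pf Qg); rewrite /= -ball_normE/= => /ltW; apply: le_trans.
  exact: (path_norm_ub (f - g) t).
have lc : continuous l.
  apply/continuous_distP => t e e0.
  have e30 : 0 < e / 3 by rewrite divr_gt0.
  have [f lf] := filter_ex (unif _ e30).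
  have /continuous_distP /(_ t _ e30) := @pvalP _ f.
  apply: filterS => s fs.
  have -> : e = e / 3 + e / 3 + e / 3.
    by rewrite -!mulrDl (_ : e + e + e = e * 3) ?mulfK// mulr_natr mulrSr mulr2n.
  apply: le_lt_trans (ler_distD (pval f s) _ _) _.
  rewrite ltr_leD//; last by rewrite distrC lf.
  apply: le_lt_trans (ler_distD (pval f t) _ _) _.
  by rewrite ler_ltD.
apply/cvg_ex; exists (mkpath lc); apply/cvgrPdist_le => e e0.
apply: filterS (unif _ e0) => f lf.
have er : e = (complex.Re e)%:C by rewrite RRe_real// gtr0_real.
by rewrite cpath_normE er; apply: path_norm_le => t; rewrite -er; exact: lf.
Qed.

HB.instance Definition _ (V : completeNormedModType C) :=
  Uniform_isComplete.Build (cpath V) (@cpath_complete V).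

End ContinuousPaths.

Section Fields.
Variable R : realType.
Local Notation C := R[i].

Record bfield (X : Type) := BField {
  fib :> X -> completeNormedModType C;
  sec : set (forall x, fib x) }.

Arguments sec {X} b.

Section LinearMaps.
Variables U V W : lmodType C.

Definition is_bilinear (m : U -> V -> W) : Prop :=
  (forall u, linear (m u)) /\ (forall v, linear (m^~ v)).

Lemma lin0 (f : U -> V) : linear f -> f 0 = 0.
Proof. by move=> fl; have := fl 1 0 0; rewrite !scale1r !add0r => /eqP; rewrite -subr_eq0 opprD addrA subrr sub0r oppr_eq0 => /eqP. Qed.

Lemma linD (f : U -> V) : linear f -> {morph f : u v / u + v}.
Proof. by move=> fl u v; have := fl 1 u v; rewrite !scale1r. Qed.

Lemma linZ (f : U -> V) : linear f -> forall a, {morph f : u / a *: u}.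
Proof. by move=> fl a u; have := fl a u 0; rewrite (lin0 fl) !addr0. Qed.

Lemma linN (f : U -> V) : linear f -> {morph f : u / - u}.
Proof. by move=> fl u; rewrite -scaleN1r linZ// scaleN1r. Qed.

End LinearMaps.

(* The selections that are locally approximable by elements of [S]. *)
Definition approx (X : topologicalType) (E : X -> completeNormedModType C)
    (S : set (forall x, E x)) : set (forall x, E x) :=
  [set xi | forall (x : X) (e : C), 0 < e ->
    exists2 zeta, S zeta & \forall y \near x, `|xi y - zeta y| <= e].

Record is_usc_field (X : topologicalType) (E : bfield X) : Prop := {
  sec_zero : sec E (fun=> 0);
  sec_lin : forall (a : C) xi zeta, sec E xi -> sec E zeta ->
    sec E (fun x => a *: xi x + zeta x);
  sec_dense : forall x (v : E x) (e : C), 0 < e ->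
    exists2 xi, sec E xi & `|v - xi x| < e;
  sec_usc : forall xi, sec E xi -> forall (x : X) (r : C), `|xi x| < r ->
    \forall y \near x, `|xi y| < r;
  sec_approx : approx (sec E) `<=` sec E }.

Definition pull (X Y : topologicalType) (p : Y -> X) (E : bfield X) : bfield Y :=
  BField (approx [set zeta : forall y, E (p y) |
    exists2 xi, sec E xi & zeta = fun y => xi (p y)]).

Record cont_linear (X : topologicalType) (E F : bfield X)
    (T : forall x, E x -> F x) : Prop := {
  cl_linear : forall x, linear (@T x);
  cl_bounded : forall x : X, exists M : C,
    \forall y \near x, forall e, `|T y e| <= M * `|e|;
  cl_sec : forall xi, sec E xi -> sec F (fun x => T x (xi x)) }.

Record cont_bilinear (X : topologicalType) (E F K : bfield X)
    (m : forall x, E x -> F x -> K x) : Prop := {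
  cb_bilinear : forall x, is_bilinear (@m x);
  cb_bounded : forall x : X, exists M : C,
    \forall y \near x, forall e f, `|m y e f| <= M * `|e| * `|f|;
  cb_sec : forall xi zeta, sec E xi -> sec F zeta ->
    sec K (fun x => m x (xi x) (zeta x)) }.

Definition contractive (X : Type) (E F K : bfield X)
    (m : forall x, E x -> F x -> K x) : Prop :=
  forall x e f, `|m x e f| <= `|e| * `|f|.

End Fields.

Arguments sec {R X} b.
Arguments contractive {R X} E F K m.
Arguments cont_linear {R X} E F T.
Arguments cont_bilinear {R X} E F K m.


(* [gmul a b] is meaningful only when [src a = rng b]; the unit space [obj] is
   embedded in [arr] by [gid]. *)
Record groupoid := Groupoid {
  arr : topologicalType;
  obj : topologicalType;
  rng : arr -> obj;
  src : arr -> obj;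
  gid : obj -> arr;
  ginv : arr -> arr;
  gmul : arr -> arr -> arr;
  rng_id : forall x, rng (gid x) = x;
  src_id : forall x, src (gid x) = x;
  rng_inv : forall a, rng (ginv a) = src a;
  src_inv : forall a, src (ginv a) = rng a;
  rng_mul : forall a b, src a = rng b -> rng (gmul a b) = rng a;
  src_mul : forall a b, src a = rng b -> src (gmul a b) = src b;
  gmulA : forall a b c, src a = rng b -> src b = rng c ->
    gmul a (gmul b c) = gmul (gmul a b) c;
  gmul1l : forall a, gmul (gid (rng a)) a = a;
  gmul1r : forall a, gmul a (gid (src a)) = a;
  gmulVl : forall a, gmul (ginv a) a = gid (src a);
  gmulVr : forall a, gmul a (ginv a) = gid (rng a);
  arr_lc : locally_compact [set: arr];
  arr_haus : hausdorff_space arr;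
  rng_cts : continuous rng;
  src_cts : continuous src;
  gid_cts : continuous gid;
  ginv_cts : continuous ginv;
  gmul_cts : {within [set p : arr * arr | src p.1 = rng p.2],
    continuous (fun p => gmul p.1 p.2)};
  rng_open : forall U : set arr, open U -> open (rng @` U);
  src_open : forall U : set arr, open U -> open (src @` U) }.

Section GSpaces.
Variable R : realType.
Local Notation C := R[i].

(* [act hs hr : E x -> E y] is the isometry attached to an arrow from [x] to
   [y]. The end points are kept as variables, with equations, instead of being
   [src g] and [rng g]: this avoids transports along [src (gmul a b) = src b]
   etc. *)
Record gspace (G : groupoid) := GSpace {
  gfield :> bfield R (obj G);
  act : forall (g : arr G) x y, src g = x -> rng g = y -> gfield x -> gfield y;
  act_linear : forall g x y (hs : src g = x) (hr : rng g = y), linear (act hs hr);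
  act_norm : forall g x y (hs : src g = x) (hr : rng g = y) v,
    `|act hs hr v| = `|v|;
  act_id : forall x (hs : src (gid x) = x) (hr : rng (gid x) = x) v,
    act hs hr v = v;
  act_mul : forall a b x y z (hsa : src a = y) (hra : rng a = z)
    (hsb : src b = x) (hrb : rng b = y)
    (hs : src (gmul a b) = x) (hr : rng (gmul a b) = z) v,
    act hs hr v = act hsa hra (act hsb hrb v) }.

Definition is_gspace (G : groupoid) (E : gspace G) : Prop :=
  is_usc_field E /\
  forall xi : forall g, E (src g), sec (pull (@src G) E) xi ->
    sec (pull (@rng G) E) (fun g => act erefl erefl (xi g)).

Definition equivariant1 (G : groupoid) (E F : gspace G)
    (f : forall x, E x -> F x) : Prop :=
  forall g x y (hs : src g = x) (hr : rng g = y) e,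
    act hs hr (f x e) = f y (act hs hr e).

Definition equivariant2 (G : groupoid) (E F K : gspace G)
    (m : forall x, E x -> F x -> K x) : Prop :=
  forall g x y (hs : src g = x) (hr : rng g = y) e f,
    act hs hr (m x e f) = m y (act hs hr e) (act hs hr f).

Record galg (G : groupoid) := GAlg {
  aspace :> gspace G;
  amul : forall x, aspace x -> aspace x -> aspace x;
  amul_bilinear : forall x, is_bilinear (@amul x);
  amulA : forall x, associative (@amul x);
  amul_contractive : contractive aspace aspace aspace amul;
  amul_equivariant : equivariant2 amul }.

Definition is_galg (G : groupoid) (A : galg G) : Prop :=
  is_gspace A /\ cont_bilinear A A A (@amul G A).

End GSpaces.

(* [lmv g w] and [rmv w h] are the actions, meaningful when [src g = rho w],
   resp. [sig w = rng h]. *)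
Record equivalence (G H : groupoid) := Equivalence {
  pts : topologicalType;
  rho : pts -> obj G;
  sig : pts -> obj H;
  lmv : arr G -> pts -> pts;
  rmv : pts -> arr H -> pts;
  pts_lc : locally_compact [set: pts];
  pts_haus : hausdorff_space pts;
  rho_cts : continuous rho;
  sig_cts : continuous sig;
  rho_lmv : forall g w, src g = rho w -> rho (lmv g w) = rng g;
  sig_lmv : forall g w, src g = rho w -> sig (lmv g w) = sig w;
  lmv1 : forall w, lmv (gid (rho w)) w = w;
  lmvM : forall a b w, src a = rng b -> src b = rho w ->
    lmv (gmul a b) w = lmv a (lmv b w);
  lmv_cts : {within [set p : arr G * pts | src p.1 = rho p.2],
    continuous (fun p => lmv p.1 p.2)};
  rho_rmv : forall w h, sig w = rng h -> rho (rmv w h) = rho w;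
  sig_rmv : forall w h, sig w = rng h -> sig (rmv w h) = src h;
  rmv1 : forall w, rmv w (gid (sig w)) = w;
  rmvM : forall w a b, sig w = rng a -> src a = rng b ->
    rmv w (gmul a b) = rmv (rmv w a) b;
  rmv_cts : {within [set p : pts * arr H | sig p.1 = rng p.2],
    continuous (fun p => rmv p.1 p.2)};
  lmv_rmv : forall g w h, src g = rho w -> sig w = rng h ->
    lmv g (rmv w h) = rmv (lmv g w) h;
  lmv_free : forall g w, src g = rho w -> lmv g w = w -> g = gid (rho w);
  rmv_free : forall w h, sig w = rng h -> rmv w h = w -> h = gid (sig w);
  lmv_proper : forall K : set (pts * pts), compact K ->
    compact [set p : arr G * pts | src p.1 = rho p.2 /\ K (lmv p.1 p.2, p.2)];
  rmv_proper : forall K : set (pts * pts), compact K ->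
    compact [set p : pts * arr H | sig p.1 = rng p.2 /\ K (p.1, rmv p.1 p.2)];
  (* [rho] is continuous and constant on [H]-orbits; it induces a homeomorphism
     [Om / H -> obj G] iff it is onto, its fibres are single orbits, and it is a
     quotient map. Similarly for [sig]. *)
  rho_onto : forall x, exists w, rho w = x;
  rho_orbit : forall w w', rho w = rho w' ->
    exists2 h, sig w = rng h & rmv w h = w';
  rho_quotient : forall U : set (obj G), open (rho @^-1` U) -> open U;
  sig_onto : forall y, exists w, sig w = y;
  sig_orbit : forall w w', sig w = sig w' ->
    exists2 g, src g = rho w & lmv g w = w';
  sig_quotient : forall U : set (obj H), open (sig @^-1` U) -> open U }.

Section GroupoidLemmas.
Variable G : groupoid.
Implicit Types a b : arr G.

Lemma ginv_uniq a b : src b = rng a -> gmul b a = gid (src a) -> b = ginv a.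
Proof.
move=> ba e; rewrite -(gmul1l (ginv a)) rng_inv -e -gmulA ?rng_inv//.
by rewrite gmulVr -ba gmul1r.
Qed.

Lemma ginvK : involutive (@ginv G).
Proof.
move=> a; apply/esym/ginv_uniq; first by rewrite rng_inv.
by rewrite gmulVr src_inv.
Qed.

Lemma ginv_id (x : obj G) : ginv (gid x) = gid x.
Proof.
apply/esym/ginv_uniq; first by rewrite src_id rng_id.
by rewrite -{1}(rng_id x) gmul1l src_id.
Qed.

Lemma ginvM a b : src a = rng b -> ginv (gmul a b) = gmul (ginv b) (ginv a).
Proof.
move=> ab; apply/esym/ginv_uniq.
  by rewrite src_mul ?rng_mul ?src_inv ?rng_inv.
rewrite src_mul// -gmulA ?rng_mul ?src_inv ?rng_inv//.
rewrite (@gmulA _ (ginv a)) ?src_inv ?rng_inv// gmulVl ab gmul1l.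
exact: gmulVl.
Qed.

End GroupoidLemmas.

Lemma within_comp (X Y Z : topologicalType) (A : set X) (B : set Y)
    (f : Y -> Z) (phi : X -> Y) :
  continuous phi -> (forall x, A x -> B (phi x)) ->
  {within B, continuous f} -> {within A, continuous (fun x => f (phi x))}.
Proof.
move=> pc AB /subspace_continuousP fc; apply/subspace_continuousP => x Ax U fU.
have fU' : nbhs (phi x) (fun y => B y -> U (f y)) := fc _ (AB _ Ax) U fU.
have {}fU' : nbhs x (fun z => B (phi z) -> U (f (phi z))) := pc x _ fU'.
suff: nbhs x (fun z => A z -> U (f (phi z))) by [].
by apply: filterS fU' => z zU /AB.
Qed.

Lemma pair_cts (Z X Y : topologicalType) (f : Z -> X) (g : Z -> Y) :
  continuous f -> continuous g -> continuous (fun z => (f z, g z)).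
Proof. move=> fc gc z; exact: cvg_pair (fc z) (gc z). Qed.

Lemma comp_cts (Z X Y : topologicalType) (f : Z -> X) (g : X -> Y) :
  continuous f -> continuous g -> continuous (fun z => g (f z)).
Proof. move=> fc gc z; exact: continuous_comp (fc z) (gc (f z)). Qed.

Lemma fst_cts (X Y : topologicalType) : continuous (@fst X Y).
Proof. by move=> p; exact: cvg_fst. Qed.

Lemma snd_cts (X Y : topologicalType) : continuous (@snd X Y).
Proof. by move=> p; exact: cvg_snd. Qed.

Section Inverse.
Variables (G H : groupoid) (Om : equivalence G H).

Definition ilmv (h : arr H) (w : pts Om) : pts Om := rmv w (ginv h).
Definition irmv (w : pts Om) (g : arr G) : pts Om := lmv (ginv g) w.

Fact irho_lmv h w : src h = sig w -> sig (ilmv h w) = rng h.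
Proof. by move=> hw; rewrite sig_rmv ?src_inv ?rng_inv. Qed.
Fact isig_lmv h w : src h = sig w -> rho (ilmv h w) = rho w.
Proof. by move=> hw; rewrite rho_rmv ?src_inv ?rng_inv. Qed.
Fact ilmv1 w : ilmv (gid (sig w)) w = w.
Proof. by rewrite /ilmv ginv_id rmv1. Qed.
Fact ilmvM a b w : src a = rng b -> src b = sig w ->
  ilmv (gmul a b) w = ilmv a (ilmv b w).
Proof.
by move=> ab bw; rewrite /ilmv ginvM// rmvM ?src_inv ?rng_inv.
Qed.
Fact irho_rmv w g : rho w = rng g -> sig (irmv w g) = sig w.
Proof. by move=> wg; rewrite sig_lmv ?src_inv. Qed.
Fact isig_rmv w g : rho w = rng g -> rho (irmv w g) = src g.
Proof. by move=> wg; rewrite rho_lmv ?src_inv ?rng_inv. Qed.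
Fact irmv1 w : irmv w (gid (rho w)) = w.
Proof. by rewrite /irmv ginv_id lmv1. Qed.
Fact irmvM w a b : rho w = rng a -> src a = rng b ->
  irmv w (gmul a b) = irmv (irmv w a) b.
Proof.
by move=> wa ab; rewrite /irmv ginvM// lmvM ?src_inv ?rng_inv.
Qed.
Fact ilmv_rmv h w g : src h = sig w -> rho w = rng g ->
  ilmv h (irmv w g) = irmv (ilmv h w) g.
Proof.
by move=> hw wg; rewrite /ilmv /irmv lmv_rmv ?src_inv ?rng_inv.
Qed.
Fact ilmv_free h w : src h = sig w -> ilmv h w = w -> h = gid (sig w).
Proof.
move=> hw e; rewrite -(ginvK h).
by rewrite (@rmv_free _ _ Om w (ginv h)) ?rng_inv// ginv_id.
Qed.
Fact irmv_free w g : rho w = rng g -> irmv w g = w -> g = gid (rho w).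
Proof.
move=> wg e; rewrite -(ginvK g).
by rewrite (@lmv_free _ _ Om (ginv g) w) ?src_inv// ginv_id.
Qed.

Fact ilmv_cts : {within [set p : arr H * pts Om | src p.1 = sig p.2],
  continuous (fun p => ilmv p.1 p.2)}.
Proof.
apply: (within_comp (phi := fun p : arr H * pts Om => (p.2, ginv p.1)))
  (@rmv_cts _ _ Om) => [|p /= hp]; last by rewrite rng_inv.
apply: pair_cts; first exact: snd_cts.
exact: comp_cts (@fst_cts _ _) (@ginv_cts H).
Qed.
Fact irmv_cts : {within [set p : pts Om * arr G | rho p.1 = rng p.2],
  continuous (fun p => irmv p.1 p.2)}.
Proof.
apply: (within_comp (phi := fun p : pts Om * arr G => (ginv p.2, p.1)))
  (@lmv_cts _ _ Om) => [|p /= hp]; last by rewrite src_inv.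
apply: pair_cts; last exact: fst_cts.
exact: comp_cts (@snd_cts _ _) (@ginv_cts G).
Qed.

Fact swap_cts (X Y : topologicalType) : continuous (fun p : X * Y => (p.2, p.1)).
Proof. by apply: pair_cts; [exact: snd_cts | exact: fst_cts]. Qed.

Fact ilmv_proper (K : set (pts Om * pts Om)) : compact K ->
  compact [set p : arr H * pts Om |
    src p.1 = sig p.2 /\ K (ilmv p.1 p.2, p.2)].
Proof.
move=> Kc.
have K'c : compact ((fun p : pts Om * pts Om => (p.2, p.1)) @` K).
  by apply: continuous_compact Kc; apply: continuous_subspaceT; exact: swap_cts.
have := rmv_proper K'c; set B := (X in compact X) => Bc.
set A := (X in compact X).
have -> : A = (fun p : pts Om * arr H => (ginv p.2, p.1)) @` B.
  apply/seteqP; split.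
    move=> [h w] /= [hw Kh]; exists (w, ginv h) => /=; last by rewrite ginvK.
    split; first by rewrite rng_inv.
    by exists (ilmv h w, w).
  move=> _ [[w k] /= [wk [[x y] Kxy [exy yw]]] <-] /=.
  split; first by rewrite src_inv.
  by rewrite /ilmv ginvK -yw -exy.
apply: continuous_compact Bc; apply: continuous_subspaceT.
apply: pair_cts; last exact: fst_cts.
exact: comp_cts (@snd_cts _ _) (@ginv_cts H).
Qed.

Fact irmv_proper (K : set (pts Om * pts Om)) : compact K ->
  compact [set p : pts Om * arr G |
    rho p.1 = rng p.2 /\ K (p.1, irmv p.1 p.2)].
Proof.
move=> Kc.
have K'c : compact ((fun p : pts Om * pts Om => (p.2, p.1)) @` K).
  by apply: continuous_compact Kc; apply: continuous_subspaceT; exact: swap_cts.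
have := lmv_proper K'c; set B := (X in compact X) => Bc.
set A := (X in compact X).
have -> : A = (fun p : arr G * pts Om => (p.2, ginv p.1)) @` B.
  apply/seteqP; split.
    move=> [w g] /= [wg Kg]; exists (ginv g, w) => /=; last by rewrite ginvK.
    split; first by rewrite src_inv.
    by exists (w, irmv w g).
  move=> _ [[k w] /= [kw [[x y] Kxy [exy yw]]] <-] /=.
  split; first by rewrite rng_inv.
  by rewrite /irmv ginvK -exy -yw.
apply: continuous_compact Bc; apply: continuous_subspaceT.
apply: pair_cts; first exact: snd_cts.
exact: comp_cts (@fst_cts _ _) (@ginv_cts G).
Qed.

Fact irho_orbit w w' : sig w = sig w' ->
  exists2 g, rho w = rng g & irmv w g = w'.
Proof.
move=> /sig_orbit[g gw gw']; exists (ginv g); first by rewrite rng_inv.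
by rewrite /irmv ginvK.
Qed.
Fact isig_orbit w w' : rho w = rho w' ->
  exists2 h, src h = sig w & ilmv h w = w'.
Proof.
move=> /rho_orbit[h hw hw']; exists (ginv h); first by rewrite src_inv.
by rewrite /ilmv ginvK.
Qed.

(* [Om^-1]: [h w := w h^-1] and [w g := g^-1 w]. *)
Definition inv_equiv : equivalence H G := @Equivalence H G (pts Om)
  (@sig _ _ Om) (@rho _ _ Om) ilmv irmv
  (@pts_lc _ _ Om) (@pts_haus _ _ Om) (@sig_cts _ _ Om) (@rho_cts _ _ Om)
  irho_lmv isig_lmv ilmv1 ilmvM ilmv_cts
  irho_rmv isig_rmv irmv1 irmvM irmv_cts
  ilmv_rmv ilmv_free irmv_free ilmv_proper irmv_proper
  (@sig_onto _ _ Om) irho_orbit (@sig_quotient _ _ Om)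
  (@rho_onto _ _ Om) isig_orbit (@rho_quotient _ _ Om).

End Inverse.

Section DirectSum.
Variables (R : realType) (G : groupoid) (E F : gspace R G).

Definition dsum_field : bfield R (obj G) :=
  @BField R (obj G) (fun x => l1sum (E x) (F x))
    [set xi | sec E (fun x => (xi x).1) /\ sec F (fun x => (xi x).2)].

Definition dsum_act g x y (hs : src g = x) (hr : rng g = y)
  (p : dsum_field x) : dsum_field y := (act hs hr p.1, act hs hr p.2).

Fact dsum_act_linear g x y (hs : src g = x) (hr : rng g = y) :
  linear (dsum_act hs hr).
Proof. by move=> a [u u'] [v v']; congr pair; apply: act_linear. Qed.

Fact dsum_act_norm g x y (hs : src g = x) (hr : rng g = y) v :
  `|dsum_act hs hr v| = `|v|.
Proof. by rewrite !l1sum_normE /= !act_norm. Qed.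

Fact dsum_act_id x (hs : src (gid x) = x) (hr : rng (gid x) = x) v :
  dsum_act hs hr v = v.
Proof. by case: v => u v; congr pair; apply: act_id. Qed.

Fact dsum_act_mul a b x y z (hsa : src a = y) (hra : rng a = z)
    (hsb : src b = x) (hrb : rng b = y)
    (hs : src (gmul a b) = x) (hr : rng (gmul a b) = z) v :
  dsum_act hs hr v = dsum_act hsa hra (dsum_act hsb hrb v).
Proof. by congr pair; apply: act_mul. Qed.

Definition dsum : gspace R G :=
  GSpace dsum_act_linear dsum_act_norm dsum_act_id dsum_act_mul.

End DirectSum.

(* [B[0,1]] *)
Section Paths.
Variables (R : realType) (G : groupoid) (B : galg R G).
Local Notation C := R[i].

Definition path_field : bfield R (obj G) :=
  @BField R (obj G) (fun x => cpath (B x))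
    [set xi | sec (pull (fun p : obj G * unitI R => p.1) B)
                (fun p => pval (xi p.1) p.2)].

Section Act.
Variables (g : arr G) (x y : obj G) (hs : src g = x) (hr : rng g = y).

Fact path_act_cts (f : cpath (B x)) :
  continuous (fun t => act hs hr (pval f t)).
Proof.
apply/continuous_distP => t e e0.
have /continuous_distP/(_ t _ e0) := @pvalP _ _ f.
apply: filterS => s.
by rewrite -(linN (act_linear hs hr)) -(linD (act_linear hs hr)) act_norm.
Qed.

Definition path_act (f : path_field x) : path_field y := mkpath (@path_act_cts f).

Fact path_act_linear : linear path_act.
Proof. by move=> a u v; apply: cpath_ext => t; apply: act_linear. Qed.

Fact path_act_norm f : `|path_act f| = `|f|.
Proof.
rewrite !cpath_normE /path_norm /path_norms; congr ((sup _)%:C).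
by apply: eq_imagel => t _ /=; rewrite act_norm.
Qed.

End Act.

Fact path_act_id x (hs : src (gid x) = x) (hr : rng (gid x) = x) f :
  path_act hs hr f = f.
Proof. by apply: cpath_ext => t; apply: act_id. Qed.

Fact path_act_mul a b x y z (hsa : src a = y) (hra : rng a = z)
    (hsb : src b = x) (hrb : rng b = y)
    (hs : src (gmul a b) = x) (hr : rng (gmul a b) = z) f :
  path_act hs hr f = path_act hsa hra (path_act hsb hrb f).
Proof. by apply: cpath_ext => t; apply: act_mul. Qed.

Definition path_space : gspace R G :=
  GSpace path_act_linear path_act_norm path_act_id path_act_mul.

Fact path_mul_cts x (f g : cpath (B x)) :
  continuous (fun t => amul (pval f t) (pval g t)).
Proof.
have [mr ml] := amul_bilinear B x.
apply/continuous_distP => t e e0.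
have [M [M0 [fM gM]]] : exists M : C, (0 < M) /\
    ((forall s, `|pval f s| <= M) /\ (forall s, `|pval g s| <= M)).
  exists (`|f| + `|g| + 1); split; first by rewrite ltr_wpDl ?addr_ge0.
  split=> s; apply: le_trans (path_norm_ub _ s) _; rewrite -cpath_normE.
    by rewrite -addrA lerDl addr_ge0.
  by rewrite addrAC lerDr addr_ge0.
have eM : 0 < e / 2 / M by rewrite !divr_gt0.
have /continuous_distP/(_ t _ eM) nf := @pvalP _ _ f.
have /continuous_distP/(_ t _ eM) ng := @pvalP _ _ g.
apply: filterS2 nf ng => s nf ng.
set a := pval f t; set a' := pval f s; set b := pval g t; set b' := pval g s.
have -> : amul a b - amul a' b' = amul (a - a') b + amul a' (b - b').
  rewrite (linD (ml b)) (linN (ml b)) (linD (mr a')) (linN (mr a')).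
  by rewrite addrA subrK.
apply: le_lt_trans (ler_normD _ _) _; rewrite [e]splitr ltrD//.
  apply: le_lt_trans (amul_contractive _ _) _.
  apply: le_lt_trans (ler_wpM2l (normr_ge0 _) (gM t)) _.
  by rewrite -ltr_pdivlMr.
apply: le_lt_trans (amul_contractive _ _) _.
apply: le_lt_trans (ler_wpM2r (normr_ge0 _) (fM s)) _.
by rewrite mulrC -ltr_pdivlMr.
Qed.

Definition path_mul x (f g : path_space x) : path_space x :=
  mkpath (@path_mul_cts x f g).

Fact path_mul_bilinear x : is_bilinear (@path_mul x).
Proof.
have [mr ml] := amul_bilinear B x.
by split=> f a u v; apply: cpath_ext => t; [apply: mr | apply: ml].
Qed.

Fact path_mulA x : associative (@path_mul x).
Proof. by move=> f g h; apply: cpath_ext => t; apply: amulA. Qed.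

Fact path_mul_contractive : contractive path_space path_space path_space path_mul.
Proof.
move=> x f g.
have er : `|f| * `|g| = (complex.Re (`|f| * `|g|))%:C.
  by rewrite RRe_real// realE mulr_ge0.
rewrite er cpath_normE; apply: path_norm_le => t; rewrite -er.
apply: le_trans (amul_contractive _ _) _.
by rewrite ler_pM// path_norm_ub.
Qed.

Fact path_mul_equivariant : equivariant2 path_mul.
Proof.
move=> g x y hs hr e f; apply: cpath_ext => t; exact: amul_equivariant.
Qed.

Definition path_alg : galg R G :=
  GAlg path_mul_bilinear path_mulA path_mul_contractive path_mul_equivariant.

Definition path_ev (t : unitI R) (x : obj G) (f : path_alg x) : B x := pval f t.

End Paths.

Section PullSpace.
Variables (R : realType) (G H : groupoid) (Om : equivalence G H).
Variable E : gspace R H.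
Local Notation C := R[i].

Section Fibre.
Variable g : obj G.

(* [e w x wg wx] is the component [e_w], where [rho w = g]; it lies in [E x] with
   [x = sig w] (as for [act], [x] is a variable to avoid transports). *)
Definition family :=
  forall (w : pts Om) (x : obj H), rho w = g -> sig w = x -> E x.

Definition coherent (e : family) : Prop :=
  forall w h x y (wg : rho w = g) (wx : sig w = x)
    (whg : rho (rmv w h) = g) (why : sig (rmv w h) = y)
    (hs : src h = y) (hr : rng h = x),
  e w x wg wx = act hs hr (e (rmv w h) y whg why).

Definition omfib : Type := {e : family | coherent e}.

Definition mkom (e : family) (ec : coherent e) : omfib := exist coherent e ec.

Definition at_ (e : omfib) : family := sval e.

Lemma at_coherent (e : omfib) : coherent (at_ e). Proof. exact: svalP e. Qed.

Lemma omfib_ext (e f : omfib) :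
  (forall w x wg wx, @at_ e w x wg wx = @at_ f w x wg wx) -> e = f.
Proof.
case: e f => [e ec] [f fc] /= ef; apply: eq_exist.
by do 4!(apply: functional_extensionality_dep => ?); exact: ef.
Qed.

Lemma at_eq (e : omfib) w w' x wg wx wg' wx' :
  w = w' -> @at_ e w x wg wx = @at_ e w' x wg' wx'.
Proof.
by move=> ww'; subst w'; rewrite (Prop_irrelevance wg wg') (Prop_irrelevance wx wx').
Qed.

HB.instance Definition _ := gen_eqMixin omfib.
HB.instance Definition _ := gen_choiceMixin omfib.

Fact om0_coherent : coherent (fun w x wg wx => 0).
Proof. by move=> *; rewrite (lin0 (act_linear _ _)). Qed.
Fact omN_coherent (e : omfib) : coherent (fun w x wg wx => - @at_ e w x wg wx).
Proof.
move=> w h x y wg wx whg why hs hr.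
by rewrite (linN (act_linear _ _)) -(at_coherent e wg wx).
Qed.
Fact omD_coherent (e f : omfib) :
  coherent (fun w x wg wx => @at_ e w x wg wx + @at_ f w x wg wx).
Proof.
move=> w h x y wg wx whg why hs hr.
by rewrite (linD (act_linear _ _)) -(at_coherent e wg wx) -(at_coherent f wg wx).
Qed.
Fact omZ_coherent (a : C) (e : omfib) :
  coherent (fun w x wg wx => a *: @at_ e w x wg wx).
Proof.
move=> w h x y wg wx whg why hs hr.
by rewrite (linZ (act_linear _ _)) -(at_coherent e wg wx).
Qed.

Definition om0 := mkom om0_coherent.
Definition omN e := mkom (omN_coherent e).
Definition omD e f := mkom (omD_coherent e f).
Definition omZ a e := mkom (omZ_coherent a e).

Fact omDA : associative omD.
Proof. by move=> e f k; apply: omfib_ext => *; apply: addrA. Qed.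
Fact omDC : commutative omD.
Proof. by move=> e f; apply: omfib_ext => *; apply: addrC. Qed.
Fact om0D : left_id om0 omD.
Proof. by move=> e; apply: omfib_ext => *; apply: add0r. Qed.
Fact omND : left_inverse om0 omN omD.
Proof. by move=> e; apply: omfib_ext => *; apply: addNr. Qed.

HB.instance Definition _ := GRing.isZmodule.Build omfib omDA omDC om0D omND.

Fact omZA a b e : omZ a (omZ b e) = omZ (a * b) e.
Proof. by apply: omfib_ext => *; apply: scalerA. Qed.
Fact om1Z : left_id 1 omZ.
Proof. by move=> e; apply: omfib_ext => *; apply: scale1r. Qed.
Fact omZDr : right_distributive omZ +%R.
Proof. by move=> a e f; apply: omfib_ext => *; apply: scalerDr. Qed.
Fact omZDl e : {morph omZ^~ e : a b / a + b}.
Proof. by move=> a b; apply: omfib_ext => *; apply: scalerDl. Qed.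

HB.instance Definition _ := GRing.Zmodule_isLmodule.Build C omfib
  omZA om1Z omZDr omZDl.

(* An arbitrary point of the fibre over [g]; by [om_normE] the norm below does
   not depend on it. *)
Definition base : {w : pts Om | rho w = g} := cid (rho_onto Om g).

Definition om_norm (e : omfib) : C := `|at_ e (svalP base) erefl|.

Lemma om_normE (e : omfib) w x (wg : rho w = g) (wx : sig w = x) :
  om_norm e = `|at_ e wg wx|.
Proof.
rewrite /om_norm; move: (sval base) (svalP base) => w0 w0g.
have [h w0h hw] := rho_orbit (etrans w0g (esym wg)).
have whg : rho (rmv w0 h) = g by rewrite hw.
have whx : sig (rmv w0 h) = x by rewrite hw.
have hs : src h = x by rewrite -whx sig_rmv.
rewrite (at_coherent e w0g erefl whg whx hs (esym w0h)) act_norm.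
by rewrite (at_eq _ _ _ wg wx hw).
Qed.

Fact om_normD e f : om_norm (e + f) <= om_norm e + om_norm f.
Proof. exact: ler_normD. Qed.
Fact om_normZ a e : om_norm (a *: e) = `|a| * om_norm e.
Proof. exact: normrZ. Qed.
Fact om_norm0_eq0 e : om_norm e = 0 -> e = 0.
Proof.
move=> e0; apply: omfib_ext => w x wg wx.
by apply/eqP; rewrite -normr_eq0 -om_normE e0.
Qed.

HB.instance Definition _ := Lmodule_isNormed.Build C omfib
  om_normD om_normZ om_norm0_eq0.

Lemma omfib_normE (e : omfib) w x (wg : rho w = g) (wx : sig w = x) :
  `|e| = `|at_ e wg wx|.
Proof. exact: om_normE. Qed.

Lemma omfib_complete (F : set_system omfib) :
  ProperFilter F -> cauchy F -> cvg F.
Proof.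
move=> FF Fc.
pose l : family := fun w x wg wx => lim ((fun e => @at_ e w x wg wx) @ F).
have lP w x wg wx : (fun e => @at_ e w x wg wx) @ F --> l w x wg wx.
  apply: cauchy_cvg; apply: cauchy_contract Fc => a b.
  by rewrite (omfib_normE (a - b) wg wx).
have lc : coherent l.
  move=> w h x y wg wx whg why hs hr.
  apply: (cvg_unique (@norm_hausdorff _ _) (lP w x wg wx)).
  apply/cvgrPdist_lt => e e0.
  have /cvgrPdist_lt/(_ _ e0) := lP (rmv w h) y whg why.
  apply: filterS => f.
  rewrite (at_coherent f wg wx whg why hs hr).
  by rewrite -(linN (act_linear hs hr)) -(linD (act_linear hs hr)) act_norm.
apply/cvg_ex; exists (mkom lc); apply/cvgrPdist_lt => e e0.
case: base => w0 w0g.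
have /cvgrPdist_lt/(_ _ e0) := lP w0 _ w0g erefl.
by apply: filterS => f; rewrite (omfib_normE _ w0g erefl).
Qed.

HB.instance Definition _ := Uniform_isComplete.Build omfib omfib_complete.

End Fibre.

(* A section [s] corresponds to the selection [delta w := (s (rho w))_w] of
   [sig^* E], whose equivariance is built into the fibres. *)
Definition om_field : bfield R (obj G) :=
  @BField R (obj G) (fun g => omfib g)
    [set s : forall g, omfib g | sec (pull (@sig _ _ Om) E) (fun w => at_ (s (rho w)) erefl erefl)].

Section Act.
Variables (a : arr G) (x y : obj G) (hs : src a = x) (hr : rng a = y).

Fact om_src w : rho w = y -> src (ginv a) = @rho _ _ Om w.
Proof. by move=> wy; rewrite src_inv hr wy. Qed.
Fact om_rho w : rho w = y -> @rho _ _ Om (lmv (ginv a) w) = x.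
Proof. by move=> wy; rewrite rho_lmv ?rng_inv// src_inv hr wy. Qed.
Fact om_sig w z : rho w = y -> sig w = z -> @sig _ _ Om (lmv (ginv a) w) = z.
Proof. by move=> wy wz; rewrite sig_lmv// src_inv hr wy. Qed.

Fact om_act_coherent (e : omfib x) : coherent (g := y)
  (fun w z wy wz => at_ e (om_rho wy) (om_sig wy wz)).
Proof.
move=> w h z z' wy wz why whz' khs khr.
have wh : sig w = rng h by rewrite khr.
have e1 : lmv (ginv a) (rmv w h) = rmv (lmv (ginv a) w) h.
  by rewrite lmv_rmv// (om_src wy).
have p1 : rho (rmv (lmv (ginv a) w) h) = x by rewrite -e1 om_rho.
have p2 : sig (rmv (lmv (ginv a) w) h) = z' by rewrite -e1 (om_sig why whz').
rewrite (at_coherent e _ _ p1 p2 khs khr); congr (act _ _ _).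
exact/at_eq/esym.
Qed.

Definition om_act (e : om_field x) : om_field y := mkom (om_act_coherent e).

Fact om_act_linear : linear om_act.
Proof. by move=> b u v; apply: omfib_ext. Qed.

Fact om_act_norm e : `|om_act e| = `|e|.
Proof.
case: (base y) => w wy; rewrite (omfib_normE _ wy erefl) /=.
by rewrite -omfib_normE.
Qed.

End Act.

Fact om_act_id x (hs : src (gid x) = x) (hr : rng (gid x) = x) e :
  om_act hs hr e = e.
Proof.
apply: omfib_ext => w z wx wz; apply: (@at_eq _ e (lmv (ginv (gid x)) w) w).
by rewrite ginv_id -wx lmv1.
Qed.

Fact om_act_mul a b x y z (hsa : src a = y) (hra : rng a = z)
    (hsb : src b = x) (hrb : rng b = y)
    (hs : src (gmul a b) = x) (hr : rng (gmul a b) = z) e :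
  om_act hs hr e = om_act hsa hra (om_act hsb hrb e).
Proof.
apply: omfib_ext => w v wz wv.
apply: (@at_eq _ e (lmv (ginv (gmul a b)) w) (lmv (ginv b) (lmv (ginv a) w))).
by rewrite ginvM ?lmvM ?src_inv ?rng_inv ?hsa ?hrb ?hra ?wz.
Qed.

Definition om_space : gspace R G :=
  GSpace om_act_linear om_act_norm om_act_id om_act_mul.

End PullSpace.

Section PullAlgebra.
Variables (R : realType) (G H : groupoid) (Om : equivalence G H).

Section Lift.
Variables E F K : gspace R H.

Section Lift1.
Variables (f : forall x, E x -> F x) (feq : equivariant1 f) (g : obj G).

Fact om_lift1_coherent (e : om_space Om E g) :
  coherent (fun w x (wg : rho w = g) (wx : sig w = x) => f (at_ e wg wx)).
Proof.
move=> w h x y wg wx whg why hs hr.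
by rewrite (at_coherent e wg wx whg why hs hr) feq.
Qed.

Definition om_lift1 (e : om_space Om E g) : om_space Om F g :=
  mkom (om_lift1_coherent e).

End Lift1.

Section Lift2.
Variables (m : forall x, E x -> F x -> K x) (meq : equivariant2 m) (g : obj G).

Fact om_lift2_coherent (e : om_space Om E g) (f : om_space Om F g) :
  coherent (fun w x (wg : rho w = g) (wx : sig w = x) =>
    m (at_ e wg wx) (at_ f wg wx)).
Proof.
move=> w h x y wg wx whg why hs hr.
rewrite (at_coherent e wg wx whg why hs hr).
by rewrite (at_coherent f wg wx whg why hs hr) meq.
Qed.

Definition om_lift2 (e : om_space Om E g) (f : om_space Om F g) :
  om_space Om K g := mkom (om_lift2_coherent e f).

End Lift2.

Lemma om_lift1_equivariant f (feq : equivariant1 f) : equivariant1 (om_lift1 feq).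
Proof. by move=> a x y hs hr e; apply: omfib_ext. Qed.

Lemma om_lift2_equivariant m (meq : equivariant2 m) : equivariant2 (om_lift2 meq).
Proof. by move=> a x y hs hr e f; apply: omfib_ext. Qed.

End Lift.

Section Algebra.
Variable A : galg R H.

Definition om_mul := om_lift2 (@amul_equivariant _ _ A).

Fact om_mul_bilinear g : is_bilinear (@om_mul g).
Proof.
by split=> u a v v'; apply: omfib_ext => w x wg wx;
  have [mr ml] := amul_bilinear A x; [apply: mr | apply: ml].
Qed.

Fact om_mulA g : associative (@om_mul g).
Proof. by move=> a b c; apply: omfib_ext => w x wg wx; apply: amulA. Qed.

Fact om_mul_contractive :
  contractive (om_space Om A) (om_space Om A) (om_space Om A) om_mul.
Proof.
move=> g a b; have [w wg] := rho_onto Om g.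
rewrite (omfib_normE a wg erefl) (omfib_normE b wg erefl).
rewrite (omfib_normE (om_mul a b) wg erefl).
exact: amul_contractive.
Qed.

Fact om_mul_equivariant : equivariant2 om_mul.
Proof. exact: om_lift2_equivariant. Qed.

Definition om_alg : galg R G :=
  GAlg om_mul_bilinear om_mulA om_mul_contractive om_mul_equivariant.

End Algebra.
End PullAlgebra.

Section KKData.
Variable R : realType.
Local Notation C := R[i].

(* The data of a cycle: [lp = E^<], [rp = E^>], the actions of [B] ([bl], [rb])
   and [A] ([la], [ar]), the pairing [pr], the grading involutions [gl], [gr] and
   the two components [tl = T^<], [tr = T^>] of the operator. *)
Record kkdata (G : groupoid) (A B : galg R G) := KKData {
  lp : gspace R G;
  rp : gspace R G;
  bl : forall x, B x -> lp x -> lp x;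
  rb : forall x, rp x -> B x -> rp x;
  pr : forall x, lp x -> rp x -> B x;
  la : forall x, lp x -> A x -> lp x;
  ar : forall x, A x -> rp x -> rp x;
  gl : forall x, lp x -> lp x;
  gr : forall x, rp x -> rp x;
  tl : forall x, lp x -> lp x;
  tr : forall x, rp x -> rp x;
  bl_eq : @equivariant2 R G B lp lp bl;
  rb_eq : @equivariant2 R G rp B rp rb;
  pr_eq : @equivariant2 R G lp rp B pr;
  la_eq : @equivariant2 R G lp A lp la;
  ar_eq : @equivariant2 R G A rp rp ar;
  gl_eq : @equivariant1 R G lp lp gl;
  gr_eq : @equivariant1 R G rp rp gr }.

(* [g T_(src g) g^-1] on the fibre at [y = rng g]. *)
Definition conj_act (G : groupoid) (E : gspace R G) (T : forall x, E x -> E x)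
    (g : arr G) (y : obj G) (hr : rng g = y) (e : E y) : E y :=
  act erefl hr (T (src g) (act (etrans (src_inv g) hr) (rng_inv g) e)).

Section Cycle.
Variables (G : groupoid) (A B : galg R G) (E : kkdata A B).

(* Local compactness of an operator on [p^* E]. For [p = idfun] the sections of
   [idfun^* E] are those of [E], by [sec_approx]. *)
Definition locally_compact_op (Y : topologicalType) (p : Y -> obj G)
    (Tl : forall y, lp E (p y) -> lp E (p y))
    (Tr : forall y, rp E (p y) -> rp E (p y)) : Prop :=
  forall (y : Y) (eps : C), 0 < eps ->
  exists n, exists2 eta : 'I_n -> forall y, rp E (p y),
    (forall i, sec (pull p (rp E)) (eta i)) &
  exists2 xi : 'I_n -> forall y, lp E (p y),
    (forall i, sec (pull p (lp E)) (xi i)) &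
  \forall z \near y,
    (forall e, `|Tr z e - \sum_(i < n) rb (eta i z) (pr (xi i z) e)|
       <= eps * `|e|) /\
    (forall f, `|Tl z f - \sum_(i < n) bl (pr f (eta i z)) (xi i z)|
       <= eps * `|f|).

(* [E] is a non-degenerate graded equivariant Banach pair. *)
Record is_pair : Prop := {
  cyc_lp : is_gspace (lp E);
  cyc_rp : is_gspace (rp E);
  cyc_bl : cont_bilinear B (lp E) (lp E) (@bl _ _ _ E);
  cyc_rb : cont_bilinear (rp E) B (rp E) (@rb _ _ _ E);
  cyc_pr : cont_bilinear (lp E) (rp E) B (@pr _ _ _ E);
  cyc_la : cont_bilinear (lp E) A (lp E) (@la _ _ _ E);
  cyc_ar : cont_bilinear A (rp E) (rp E) (@ar _ _ _ E);
  cyc_bl_contr : contractive B (lp E) (lp E) (@bl _ _ _ E);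
  cyc_rb_contr : contractive (rp E) B (rp E) (@rb _ _ _ E);
  cyc_pr_contr : contractive (lp E) (rp E) B (@pr _ _ _ E);
  cyc_la_contr : contractive (lp E) A (lp E) (@la _ _ _ E);
  cyc_ar_contr : contractive A (rp E) (rp E) (@ar _ _ _ E);
  cyc_blA : forall x (b b' : B x) (f : lp E x), bl (amul b b') f = bl b (bl b' f);
  cyc_rbA : forall x (b b' : B x) (e : rp E x), rb e (amul b b') = rb (rb e b) b';
  cyc_laA : forall x (a a' : A x) (f : lp E x), la f (amul a a') = la (la f a) a';
  cyc_arA : forall x (a a' : A x) (e : rp E x), ar (amul a a') e = ar a (ar a' e);
  cyc_prl : forall x (b : B x) (f : lp E x) (e : rp E x),
    pr (bl b f) e = amul b (pr f e);
  cyc_prr : forall x (b : B x) (f : lp E x) (e : rp E x),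
    pr f (rb e b) = amul (pr f e) b;
  cyc_pra : forall x (a : A x) (f : lp E x) (e : rp E x),
    pr (la f a) e = pr f (ar a e);
  cyc_lab : forall x (a : A x) (b : B x) (f : lp E x),
    la (bl b f) a = bl b (la f a);
  cyc_arb : forall x (a : A x) (b : B x) (e : rp E x),
    rb (ar a e) b = ar a (rb e b);
  cyc_nondeg_l : forall x (f : lp E x) (eps : C), 0 < eps ->
    exists n (b : 'I_n -> B x) (f' : 'I_n -> lp E x),
      `|f - \sum_(i < n) bl (b i) (f' i)| < eps;
  cyc_nondeg_r : forall x (e : rp E x) (eps : C), 0 < eps ->
    exists n (e' : 'I_n -> rp E x) (b : 'I_n -> B x),
      `|e - \sum_(i < n) rb (e' i) (b i)| < eps;
  cyc_gl : cont_linear (lp E) (lp E) (@gl _ _ _ E);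
  cyc_gr : cont_linear (rp E) (rp E) (@gr _ _ _ E);
  cyc_glK : forall x, involutive (@gl _ _ _ E x);
  cyc_grK : forall x, involutive (@gr _ _ _ E x);
  cyc_gl_norm : forall x (f : lp E x), `|gl f| = `|f|;
  cyc_gr_norm : forall x (e : rp E x), `|gr e| = `|e|;
  cyc_gl_bl : forall x (b : B x) (f : lp E x), gl (bl b f) = bl b (gl f);
  cyc_gr_rb : forall x (b : B x) (e : rp E x), gr (rb e b) = rb (gr e) b;
  cyc_g_pr : forall x (f : lp E x) (e : rp E x), pr (gl f) (gr e) = pr f e;
  cyc_gl_la : forall x (a : A x) (f : lp E x), gl (la f a) = la (gl f) a;
  cyc_gr_ar : forall x (a : A x) (e : rp E x), gr (ar a e) = ar a (gr e) }.

(* [(tl E, tr E)] is an odd element of [L_B(E)]. *)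
Record is_odd_operator : Prop := {
  cyc_tl : cont_linear (lp E) (lp E) (@tl _ _ _ E);
  cyc_tr : cont_linear (rp E) (rp E) (@tr _ _ _ E);
  cyc_t_bounded : exists M : C, forall x,
    (forall f : lp E x, `|tl f| <= M * `|f|) /\
    (forall e : rp E x, `|tr e| <= M * `|e|);
  cyc_tl_bl : forall x (b : B x) (f : lp E x), tl (bl b f) = bl b (tl f);
  cyc_tr_rb : forall x (b : B x) (e : rp E x), tr (rb e b) = rb (tr e) b;
  cyc_t_pr : forall x (f : lp E x) (e : rp E x), pr f (tr e) = pr (tl f) e;
  cyc_tl_odd : forall x (f : lp E x), tl (gl f) = - gl (tl f);
  cyc_tr_odd : forall x (e : rp E x), tr (gr e) = - gr (tr e) }.

Record is_cycle : Prop := {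
  cyc_pair : is_pair;
  cyc_op : is_odd_operator;
  (* The component on [E^<] of a composite [S T] is [T^< S^<], and that of
     [pi(a)] is [f |-> f a]. *)
  cyc_commutator : forall a, sec A a ->
    locally_compact_op (p := idfun)
      (fun x f => tl (la f (a x)) - la (tl f) (a x))
      (fun x e => ar (a x) (tr e) - tr (ar (a x) e));
  cyc_square : forall a, sec A a ->
    locally_compact_op (p := idfun)
      (fun x f => la f (a x) - tl (tl (la f (a x))))
      (fun x e => ar (a x) (e - tr (tr e)));
  cyc_equivariance : forall a, sec (pull (@rng G) A) a ->
    locally_compact_op (p := @rng G)
      (fun g f => conj_act (@tl _ _ _ E) erefl (la f (a g)) - tl (la f (a g)))
      (fun g e => ar (a g) (conj_act (@tr _ _ _ E) erefl e - tr e)) }.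

End Cycle.

Section CycleSum.
Variables (G : groupoid) (A B : galg R G) (E F : kkdata A B).

Let L := dsum (lp E) (lp F).
Let S := dsum (rp E) (rp F).

Definition sum_bl x (b : B x) (f : L x) : L x := (bl b f.1, bl b f.2).
Definition sum_rb x (e : S x) (b : B x) : S x := (rb e.1 b, rb e.2 b).
Definition sum_pr x (f : L x) (e : S x) : B x := pr f.1 e.1 + pr f.2 e.2.
Definition sum_la x (f : L x) (a : A x) : L x := (la f.1 a, la f.2 a).
Definition sum_ar x (a : A x) (e : S x) : S x := (ar a e.1, ar a e.2).
Definition sum_gl x (f : L x) : L x := (gl f.1, gl f.2).
Definition sum_gr x (e : S x) : S x := (gr e.1, gr e.2).
Definition sum_tl x (f : L x) : L x := (tl f.1, tl f.2).
Definition sum_tr x (e : S x) : S x := (tr e.1, tr e.2).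

Fact sum_bl_eq : equivariant2 sum_bl.
Proof. by move=> g x y hs hr b f; congr pair; apply: bl_eq. Qed.
Fact sum_rb_eq : equivariant2 sum_rb.
Proof. by move=> g x y hs hr e b; congr pair; apply: rb_eq. Qed.
Fact sum_pr_eq : equivariant2 sum_pr.
Proof.
by move=> g x y hs hr f e; rewrite /sum_pr (linD (act_linear hs hr)) !pr_eq.
Qed.
Fact sum_la_eq : equivariant2 sum_la.
Proof. by move=> g x y hs hr f a; congr pair; apply: la_eq. Qed.
Fact sum_ar_eq : equivariant2 sum_ar.
Proof. by move=> g x y hs hr a e; congr pair; apply: ar_eq. Qed.
Fact sum_gl_eq : equivariant1 sum_gl.
Proof. by move=> g x y hs hr f; congr pair; apply: gl_eq. Qed.
Fact sum_gr_eq : equivariant1 sum_gr.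
Proof. by move=> g x y hs hr e; congr pair; apply: gr_eq. Qed.

Definition kksum : kkdata A B :=
  KKData sum_tl sum_tr sum_bl_eq sum_rb_eq sum_pr_eq sum_la_eq sum_ar_eq
    sum_gl_eq sum_gr_eq.

End CycleSum.

(* The unitalisation [B~ = B (+) C], as a family of normed spaces. *)
Definition unitization (G : groupoid) (B : galg R G) (x : obj G) : normedModType C :=
  l1sum (B x) C^o.

Section Unitization.
Variables (G : groupoid) (B : galg R G).

Definition umul x (b c : unitization B x) : unitization B x :=
  (amul b.1 c.1 + c.2 *: b.1 + b.2 *: c.1, b.2 * c.2).
Definition uact g x y (hs : src g = x) (hr : rng g = y) (b : unitization B x) :
  unitization B y := (act hs hr b.1, b.2).
Definition uincl x (b : B x) : unitization B x := (b, 0).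
Definition usec : set (forall x, unitization B x) :=
  [set beta | sec B (fun x => (beta x).1) /\
    continuous (fun x : obj G => (beta x).2 : C^o)].

End Unitization.

(* The projective balanced tensor product, by its universal property: [t] is a
   contractive balanced bilinear map through which every bounded balanced
   bilinear map [m] factors uniquely, with the same bound. *)
Definition bounded_balanced (D : Type) (U V : normedModType C)
    (ru : U -> D -> U) (lv : D -> V -> V) (M : C) (W : normedModType C)
    (m : U -> V -> W) : Prop :=
  [/\ is_bilinear m, forall u v, `|m u v| <= M * `|u| * `|v| &
      forall u d v, m (ru u d) v = m u (lv d v)].

Definition is_projective_tensor (D : Type) (U V : normedModType C)
    (ru : U -> D -> U) (lv : D -> V -> V) (X : completeNormedModType C)
    (t : U -> V -> X) : Prop :=
  bounded_balanced ru lv 1 t /\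
  forall (W : completeNormedModType C) (m : U -> V -> W) (M : C), 0 <= M ->
    bounded_balanced ru lv M m ->
    exists! l : X -> W,
      [/\ linear l, forall z, `|l z| <= M * `|z| & forall u v, l (t u v) = m u v].

Section Pushforward.
Variables (G : groupoid) (A B B' : galg R G) (psi : forall x, B x -> B' x).
Arguments psi {x} _.

Definition upsi x (b : unitization B x) : unitization B' x := (psi b.1, b.2).

Variable E : kkdata A B.

Definition urb x (e : rp E x) (b : unitization B x) : rp E x :=
  rb e b.1 + b.2 *: e.
Definition ubl x (b : unitization B x) (f : lp E x) : lp E x :=
  bl b.1 f + b.2 *: f.

(* [F] is the push-forward of [E] along [psi] up to isomorphism: [tR] and [tL]
   exhibit the fibres of [F] as [E^> (x)_(B~) B'~] and [B'~ (x)_(B~) E^<], the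
   sections of [F] are the selections locally approximable by finite sums of
   elementary tensors of sections, and the structure maps and the operator are
   determined on elementary tensors. *)
Record pushes_to (F : kkdata A B')
    (tR : forall x, rp E x -> unitization B' x -> rp F x)
    (tL : forall x, unitization B' x -> lp E x -> lp F x) : Prop := {
  push_tR : forall x, is_projective_tensor (@urb x)
    (fun d c => umul (upsi d) c) (@tR x);
  push_tL : forall x, is_projective_tensor (fun c d => umul c (upsi d))
    (@ubl x) (@tL x);
  push_secR : sec (rp F) = approx [set zeta | exists n,
    exists2 xi : 'I_n -> forall x, rp E x, (forall i, sec (rp E) (xi i)) &
    exists2 beta : 'I_n -> forall x, unitization B' x,
      (forall i, @usec _ B' (beta i)) &
    zeta = fun x => \sum_(i < n) tR x (xi i x) (beta i x)];
  push_secL : sec (lp F) = approx [set zeta | exists n,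
    exists2 xi : 'I_n -> forall x, lp E x, (forall i, sec (lp E) (xi i)) &
    exists2 beta : 'I_n -> forall x, unitization B' x,
      (forall i, @usec _ B' (beta i)) &
    zeta = fun x => \sum_(i < n) tL x (beta i x) (xi i x)];
  push_actR : forall g x y (hs : src g = x) (hr : rng g = y) e c,
    act hs hr (tR x e c) = tR y (act hs hr e) (uact hs hr c);
  push_actL : forall g x y (hs : src g = x) (hr : rng g = y) c f,
    act hs hr (tL x c f) = tL y (uact hs hr c) (act hs hr f);
  push_rb : forall x e c (b : B' x), rb (tR x e c) b = tR x e (umul c (uincl b));
  push_bl : forall x c f (b : B' x), bl b (tL x c f) = tL x (umul (uincl b) c) f;
  push_pr : forall x c f e c', uincl (pr (tL x c f) (tR x e c')) =
    umul (umul c (uincl (psi (pr f e)))) c';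
  push_ar : forall x (a : A x) e c, ar a (tR x e c) = tR x (ar a e) c;
  push_la : forall x (a : A x) c f, la (tL x c f) a = tL x c (la f a);
  push_gr : forall x e c, gr (tR x e c) = tR x (gr e) c;
  push_gl : forall x c f, gl (tL x c f) = tL x c (gl f);
  push_tr : forall x e c, tr (tR x e c) = tR x (tr e) c;
  push_tl : forall x c f, tl (tL x c f) = tL x c (tl f) }.

Definition is_pushforward (F : kkdata A B') : Prop :=
  exists tR tL, @pushes_to F tR tL.

End Pushforward.

(* A class is represented by the predicate of its members (the type [set] of
   the library lives in too small a universe for [kkdata]). *)
Section KK.
Variables (G : groupoid) (A B : galg R G).

Definition homotopic (E F : kkdata A B) : Prop :=
  [/\ is_cycle E, is_cycle F & exists P : kkdata A (path_alg B),
    [/\ is_cycle P, is_pushforward (@path_ev R G B (i0 R)) P E &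
        is_pushforward (@path_ev R G B (i1 R)) P F]].

Definition kk_class (E F : kkdata A B) : Prop :=
  is_cycle F /\ Relation_Operators.clos_refl_sym_trans _ homotopic E F.

Definition KKban (X : kkdata A B -> Prop) : Prop :=
  exists2 E, is_cycle E & X = kk_class E.

Definition kk_add (X Y : kkdata A B -> Prop) (Z : kkdata A B) : Prop :=
  exists E F, [/\ X E, Y F & kk_class (kksum E F) Z].

End KK.

(* [(ul, ur)] is an isomorphism of cycles compatible with the isomorphisms of
   coefficient algebras [iA], [iB]. *)
Record iso_over (G : groupoid) (A A' B B' : galg R G)
    (iA : forall x, A x -> A' x) (iB : forall x, B x -> B' x)
    (E : kkdata A B) (F : kkdata A' B')
    (ul : forall x, lp E x -> lp F x) (ur : forall x, rp E x -> rp F x) : Prop := {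
  iso_ul_linear : forall x, linear (ul x);
  iso_ur_linear : forall x, linear (ur x);
  iso_ul_norm : forall x f, `|ul x f| = `|f|;
  iso_ur_norm : forall x e, `|ur x e| = `|e|;
  iso_ul_onto : forall x f', exists f, ul x f = f';
  iso_ur_onto : forall x e', exists e, ur x e = e';
  iso_ul_sec : forall xi, sec (lp F) (fun x => ul x (xi x)) <-> sec (lp E) xi;
  iso_ur_sec : forall xi, sec (rp F) (fun x => ur x (xi x)) <-> sec (rp E) xi;
  iso_ul_act : equivariant1 ul;
  iso_ur_act : equivariant1 ur;
  iso_bl : forall x b f, ul x (bl b f) = bl (iB x b) (ul x f);
  iso_rb : forall x e b, ur x (rb e b) = rb (ur x e) (iB x b);
  iso_pr : forall x f e, iB x (pr f e) = pr (ul x f) (ur x e);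
  iso_la : forall x f a, ul x (la f a) = la (ul x f) (iA x a);
  iso_ar : forall x a e, ur x (ar a e) = ar (iA x a) (ur x e);
  iso_gl : forall x f, ul x (gl f) = gl (ul x f);
  iso_gr : forall x e, ur x (gr e) = gr (ur x e);
  iso_tl : forall x f, ul x (tl f) = tl (ul x f);
  iso_tr : forall x e, ur x (tr e) = tr (ur x e) }.

Definition kk_transport (G : groupoid) (A A' B B' : galg R G)
    (iA : forall x, A x -> A' x) (iB : forall x, B x -> B' x)
    (X : kkdata A B -> Prop) (F : kkdata A' B') : Prop :=
  is_cycle F /\
  exists2 E, X E & exists ul ur, @iso_over _ _ _ _ _ iA iB E F ul ur.

Section Haar.

(* The library requires measurable types to be pointed. *)
Definition pointed_at (T : Type) (x : T) : Type := T.
HB.instance Definition _ (T : choiceType) (x : T) :=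
  Choice.copy (pointed_at x) T.
HB.instance Definition _ (T : choiceType) (x : T) :=
  isPointed.Build (pointed_at x) x.

Definition borel (T : topologicalType) (x : T) :=
  g_sigma_algebraType (@open T : set (set (pointed_at x))).

Definition Cc (X : topologicalType) : set (X -> R) :=
  [set f | continuous (f : X -> R^o) /\ compact (closure [set x | f x != 0])].

Definition is_radon (T : topologicalType) (x : T)
    (m : {measure set (borel x) -> \bar R}) : Prop :=
  [/\ forall K : set T, compact K -> (m K < +oo)%E,
      forall A : set (borel x), measurable A ->
        m A = ereal_inf [set m U | U in [set U : set T | open U /\ A `<=` U]] &
      forall U : set T, open U ->
        m U = ereal_sup [set m K | K in [set K : set T | compact K /\ K `<=` U]]].

Definition msupport (T : topologicalType) (x : T)
    (m : {measure set (borel x) -> \bar R}) : set T :=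
  [set y | forall U : set T, open U -> U y -> (0 < m U)%E].

Record haar_system (G : groupoid) := HaarSystem {
  haar :> forall x : obj G, {measure set (borel (gid x)) -> \bar R};
  haar_radon : forall x, is_radon (haar x);
  haar_supp : forall x, msupport (haar x) = [set a | rng a = x];
  haar_cts : forall phi : arr G -> R, Cc phi ->
    Cc (fun x => \int[haar x]_(a in setT) phi a)%R;
  haar_inv : forall (g : arr G) (phi : arr G -> R), Cc phi ->
    (\int[haar (rng g)]_(a in [set a | rng a = rng g]) phi a =
     \int[haar (src g)]_(a in [set a | rng a = src g]) phi (gmul g a))%R }.

(* [v = \int_D f dm] in the weak sense; since [phi] ranges over all complex
   linear functionals, the real parts suffice. *)
Definition is_weak_integral d (T : measurableType d)
    (m : {measure set T -> \bar R}) (D : set T) (V : normedModType C)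
    (f : T -> V) (v : V) : Prop :=
  forall phi : {linear V -> C^o}, continuous phi ->
    complex.Re (phi v) = (\int[m]_(a in D) complex.Re (phi (f a)))%R.

End Haar.

Section PullCycle.
Variables (G H : groupoid) (Om : equivalence G H) (lam : haar_system H).

(* [lambda_Om^(rho w)] is the image of the Haar measure on [H^(sig w)] under
   [h |-> w h]; it does not depend on the choice of [w] in a fibre of [rho]. *)
Definition is_cutoff (c : pts Om -> R) : Prop :=
  [/\ continuous (c : pts Om -> R^o), forall w, 0 <= c w,
      forall w : pts Om,
        (\int[lam (sig w)]_(h in [set h | rng h = sig w]) c (rmv w h) = 1)%R &
      forall K : set (obj G), compact K ->
        compact (@rho _ _ Om @^-1` K `&` closure [set w | c w != 0])].

Variable c : pts Om -> R.

(* The integrand of [T~_w e] after the substitution [w' = w h], for which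
   [<w, w'> = h] and [sig w' = src h]. *)
Definition om_integrand (E : gspace R H) (T : forall x, E x -> E x)
    (w : pts Om) (x : obj H) (e : E x) (h : arr H) : E x :=
  if pselect (rng h = x) is left hr
  then (c (rmv w h))%:C *: conj_act T hr e else 0.

(* [T~], as the element whose components are the integrals [T~_w e_w]. *)
Definition om_op (E : gspace R H) (T : forall x, E x -> E x) (g : obj G)
    (e : om_space Om E g) : om_space Om E g :=
  xget 0 [set e' | forall w x (wg : rho w = g) (wx : sig w = x),
    is_weak_integral (lam x) [set h | rng h = x]
      (om_integrand T w (at_ e wg wx)) (at_ e' wg wx)].

Variables (A B : galg R H) (E : kkdata A B).

Definition om_cycle : kkdata (om_alg Om A) (om_alg Om B) :=
  @KKData G (om_alg Om A) (om_alg Om B) (om_space Om (lp E)) (om_space Om (rp E))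
    _ _ _ _ _ _ _
    (@om_op _ (@tl _ _ _ E)) (@om_op _ (@tr _ _ _ E))
    (om_lift2_equivariant (Om := Om) (@bl_eq _ _ _ E))
    (om_lift2_equivariant (Om := Om) (@rb_eq _ _ _ E))
    (om_lift2_equivariant (Om := Om) (@pr_eq _ _ _ E))
    (om_lift2_equivariant (Om := Om) (@la_eq _ _ _ E))
    (om_lift2_equivariant (Om := Om) (@ar_eq _ _ _ E))
    (om_lift1_equivariant (Om := Om) (@gl_eq _ _ _ E))
    (om_lift1_equivariant (Om := Om) (@gr_eq _ _ _ E)).

End PullCycle.

Arguments is_cutoff {G H} Om lam c.
Arguments om_cycle {G H} Om lam c {A B} E.

(* [Om^* X] is the union of the classes of [(Om^* E, T~)] over all
   representatives and cut-off functions; that it is a single class is part of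
   the claim that [Om^*] maps [KKban A B] to [KKban]. *)
Definition om_star (G H : groupoid) (Om : equivalence G H) (lam : haar_system H)
    (A B : galg R H) (X : kkdata A B -> Prop)
    (F : kkdata (om_alg Om A) (om_alg Om B)) : Prop :=
  exists E c,
    [/\ X E, is_cutoff Om lam c & kk_class (om_cycle Om lam c E) F].

Arguments om_star {G H} Om lam {A B} X F.

(* [(Om^-1)^* Om^* E] at [y] consists of the [e_{w,w'} : E (sig w')] with
   [sig w = y], [rho w = rho w']; the isomorphism onto [E] is [e |-> e_{w,w}]. *)
Definition om_inv_om (G H : groupoid) (Om : equivalence G H) (E : gspace R H)
    (y : obj H) (e : om_space (inv_equiv Om) (om_space Om E) y) : E y :=
  let b := base (inv_equiv Om) y in
  at_ (at_ e (svalP b) erefl) erefl (svalP b).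

(* [(Om^-1)^*], followed by the identifications of [(Om^-1)^* Om^* A] with [A]
   and of [(Om^-1)^* Om^* B] with [B]. *)
Definition om_inv_star (G H : groupoid) (Om : equivalence G H)
    (lam : haar_system G) (A B : galg R H)
    (Y : kkdata (om_alg Om A) (om_alg Om B) -> Prop) : kkdata A B -> Prop :=
  kk_transport (A := om_alg (inv_equiv Om) (om_alg Om A)) (A' := A)
    (B := om_alg (inv_equiv Om) (om_alg Om B)) (B' := B)
    (@om_inv_om G H Om A) (@om_inv_om G H Om B) (om_star (inv_equiv Om) lam Y).

End KKData.

Arguments is_cutoff {R G H} Om lam c.
Arguments om_cycle {R G H} Om lam c {A B} E.
Arguments om_star {R G H} Om lam {A B} X F.
Arguments om_inv_star {R G H} Om lam {A B} Y F.

Definition sigma_compact (X : topologicalType) : Prop :=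
  exists K : nat -> set X,
    (forall n, compact (K n)) /\ \bigcup_n K n = [set: X].

(* Main.v *)
(* Evaluation at a point w of Om identifies the fibre of Om^* E over rho w
   isometrically with the fibre of E over sig w, and since rho and sig are open,
   local statements over Om descend to the unit spaces. Integrating the
   equivariance condition on T against the cut-off function shows that, over Om,
   a(T~ - T) is locally compact for a in A. Hence (Om^* E, T~) is a cycle, and it
   does not depend on c up to homotopy, since operators that agree modulo locally
   compact ones are joined by the straight line in E[0,1]. Om^* commutes with
   push-forwards (fibrewise, by evaluation) and with B |-> B[0,1], so it respects
   homotopies. Finally e |-> e_{w,w} identifies (Om^-1)^* Om^* E with E up to a
   locally compact perturbation of the operator. The same for Om^-1 shows that
   (Om^-1)^* is injective, so the one-sided inverse is two-sided. *)

From Stdlib Require Relation_Operators.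
From Stdlib Require List.
From HB Require Import structures.
Require Import Defs.
From mathcomp Require Import all_boot all_order all_algebra.
From mathcomp Require Import complex.
From mathcomp Require Import all_classical all_reals all_analysis.
From mathcomp Require Import ring lra.

Set Implicit Arguments.
Unset Strict Implicit.
Unset Printing Implicit Defensive.

Import Order.TTheory GRing.Theory Num.Theory.
Import numFieldNormedType.Exports.

Local Open Scope classical_set_scope.
Local Open Scope ring_scope.
Local Open Scope complex_scope.

(** * Locally compact spaces *)

(** Selections and operators live over [obj G], over [Om], over arrows and over fibred products of
    these, with fibres that vary with the point. So continuity and local compactness are stated
    along a map into the base and a filter ([near_sec], [near_compact]), always with approximants
    taken from sections over the base; changing the parameter space then means changing the filter.
    The integral defining [T~] is only characterised by functionals. Hahn-Banach gives uniqueness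
    and norm bounds, and statements about integrals are reduced to one device: an integrand is
    approximated by a finite sum of [chi_k u_k] for a partition of unity, with an error [e psi] in
    which [psi] does not depend on the partition. The obstacle on the side of fields is that
    [Om^* E] must have enough sections: they come from averaging a section of [E] against a bump
    function on [Om], so that the Haar system already enters the structure of the pull-back. On the
    side of homotopies, non-degeneracy is what identifies the push-forward of [E[0,1]] under an
    evaluation with [E]. *)

Section Topology.

(** Compactness in its near-covering form, applied to the filter of finite lists of indices ordered
    by inclusion: a point is covered by every list that contains one suitable index, hence some
    single list covers [K]. *)
Lemma compact_finite_cover (T : topologicalType) (I : Type) (K : set T)
    (Q : I -> T -> Prop) :
  compact K -> (forall x, K x -> exists i, \forall y \near x, Q i y) ->
  exists n (i : 'I_n -> I), forall y, K y -> exists k, Q (i k) y.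
Proof.
move=> /compact_near_coveringP Kc KQ.
pose sub (s t : seq I) := forall i, List.In i s -> List.In i t.
pose F : set_system (seq I) := filter_from setT (fun s => [set t | sub s t]).
have FF : Filter F.
  apply: filter_from_filter; first by exists [::].
  move=> s t _ _; exists (s ++ t) => // u su; split=> i iu; apply: su;
    apply: List.in_or_app; [by left | by right].
have := Kc _ F (fun s y => exists i, List.In i s /\ Q i y) FF.
case=> [x Kx|s _ /(_ s) sP].
  have [i ix] := KQ x Kx.
  exists ([set y | Q i y], [set t | sub [:: i] t]); first by split=> //; exists [:: i].
  move=> [y t] /= [Qy it]; exists i; split=> //; apply: it; by left.
have {sP} Ks := sP (fun i h => h).
exists (size s), (fun k => tnth (in_tuple s) k) => y /Ks[i [si Qi]].
elim: s si {Ks} => [|j s IH] //= [->|].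
  by exists ord0; rewrite (tnth_nth j).
by move=> /IH[k kP]; exists (lift ord0 k); move: kP; rewrite !(tnth_nth j).
Qed.

Variables (R : realType) (T : topologicalType).
Hypotheses (Tlc : locally_compact [set: T]) (Thaus : hausdorff_space T).

Lemma lc_nbhs (x : T) (U : set T) : nbhs x U ->
  exists V K : set T, [/\ nbhs x V, compact K, closed K, V `<=` K & V `<=` U].
Proof.
move=> xU; have := @Tlc x I; rewrite withinET => -[K xK [Kc Kcl]].
by exists (K `&` U), K; split=> //; exact: filterI.
Qed.

(** [1 - f] for a function [f] that separates [x] from the complement of the interior of [V]. It
    vanishes outside [V], so its support lies in the closed compact set [K]. *)
Lemma lc_bump x (U : set T) : nbhs x U ->
  exists f : T -> R, [/\ Cc f, forall y, 0 <= f y <= 1, f x = 1 &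
    forall y, f y != 0 -> U y].
Proof.
move=> /lc_nbhs[V [K [xV Kc Kcl VK VU]]].
have : uniform_separator [set x] (~` (interior V)).
  apply: (@locally_compact_completely_regular T R Tlc Thaus).
    by apply: open_closedC; exact: open_interior.
  by apply; exact: xV.
move/(uniform_separatorP (R := R)) => [f [fc f01 f0 f1]].
have fV y : 1 - f y != 0 -> V y.
  move=> fy; have [//|/(contra_not (@interior_subset _ V y)) nVy] := pselect (V y).
  suff : f y = 1 by move=> e; rewrite e subrr eqxx in fy.
  by apply: f1; exists y.
exists (fun y => 1 - f y); split.
- split; first by move=> y; apply: (@continuousB _ R^o); [exact: cst_continuous | exact: fc].
  apply: subclosed_compact Kc _; first exact: closed_closure.
  by rewrite closureE => y; apply; split=> // z /= /fV /VK.
- move=> y; have /andP[y0 y1] : 0 <= f y <= 1.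
    by have := f01 (f y) (ex_intro2 _ _ y I erefl); rewrite /= in_itv.
  by rewrite subr_ge0 y1 gerBl.
- suff -> : f x = 0 by rewrite subr0.
  by apply: f0; exists x.
- by move=> y /fV /VU.
Qed.

Lemma Cc0 : Cc (fun _ : T => 0 : R).
Proof.
split; first by move=> ?; exact: cst_continuous.
have -> : [set x : T | (0 : R) != 0] = set0 by apply/seteqP; split=> z /=; rewrite ?eqxx.
by rewrite closure0; exact: compact0.
Qed.

Lemma CcD (f g : T -> R) : Cc f -> Cc g -> Cc (fun x => f x + g x).
Proof.
move=> [fc fK] [gc gK]; split.
  by move=> x; apply: (@continuousD R R^o); [exact: fc|exact: gc].
apply: (@subclosed_compact _ _ (closure [set x | f x != 0] `|` closure [set x | g x != 0])).
- exact: closed_closure.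
- exact: compactU.
rewrite closureE => y; apply; split; first by apply: closedU; exact: closed_closure.
move=> x /= fgx; have [fx|] := eqVneq (f x) 0; last by left; exact: subset_closure.
by right; apply: subset_closure => /=; rewrite fx add0r in fgx.
Qed.

Lemma Cc_sum I (s : seq I) (f : I -> T -> R) : (forall k, Cc (f k)) ->
  Cc (fun x => \sum_(k <- s) f k x).
Proof.
move=> fC; elim: s => [|k s IH]; first by under eq_fun do rewrite big_nil; exact: Cc0.
by under eq_fun do rewrite big_cons; exact: CcD.
Qed.

Lemma Cc_mul (f g : T -> R) : Cc f -> continuous (g : T -> R^o) ->
  Cc (fun x => f x * g x).
Proof.
move=> [fc fK] gc; split.
  by move=> x; apply: (@continuousM _ _ (f : T -> R^o)); [exact: fc|exact: gc].
apply: subclosed_compact fK _; first exact: closed_closure.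
rewrite closureE => y; apply; split; first exact: closed_closure.
move=> x /=; rewrite mulf_eq0 negb_or => /andP[fx _]; exact: subset_closure.
Qed.

(** The parameter [w] with its filter serves families of functions: a partition found at one
    parameter value stays subordinate for all [w] near [F], so that estimates hold uniformly in the
    parameter. *)
Lemma partition_of_unity (I : Type) (W : Type) (F : set_system W) (K : set T)
    (Q : I -> W -> T -> Prop) : Filter F -> compact K ->
  (forall h, K h -> exists i, \forall h' \near h & w \near F, Q i w h') ->
  exists n (i : 'I_n -> I) (chi : 'I_n -> T -> R),
    [/\ forall k, Cc (chi k), forall k h, 0 <= chi k h,
        forall h, \sum_k chi k h <= 1, forall h, K h -> \sum_k chi k h = 1 &
        \forall w \near F, forall k h, chi k h != 0 -> Q (i k) w h].
Proof.
move=> FF Kc KQ.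
pose J : Type := {p : I * (T -> R) | [/\ Cc p.2, forall y, 0 <= p.2 y &
   \forall w \near F, forall h, p.2 h != 0 -> Q p.1 w h]}.
have [|n [j jP]] := @compact_finite_cover T J K (fun j y => 2^-1 < (sval j).2 y) Kc.
  move=> h /KQ[i [[U S] /= [hU FS] US]].
  have [f [fC f01 fh fU]] := lc_bump hU.
  have fP : [/\ Cc (i, f).2, forall y, 0 <= (i, f).2 y &
     \forall w \near F, forall h, (i, f).2 h != 0 -> Q (i, f).1 w h].
    split=> //= [y|]; first by case/andP: (f01 y).
    by apply: filterS FS => w Sw h' /fU Uh'; exact: (US (h', w)).
  exists (exist _ (i, f) fP) => /=.
  have /cvgrPdist_lt/(_ 2^-1) := proj1 fC h.
  rewrite fh invr_gt0 ltr0n => /(_ isT); apply: filterS => y /= fy.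
  by have := ler_norm (1 - f y); move=> H; have := le_lt_trans H fy; lra.
pose f k := (sval (j k)).2.
have fC k : Cc (f k) by rewrite /f; case: (svalP (j k)).
have f0 k y : 0 <= f k y by rewrite /f; case: (svalP (j k)).
pose s y := \sum_k f k y.
(* [s] is at least 1/2 on [K], so [m] equals [s] there and the quotients add up to 1; elsewhere the
   bound 1/2 keeps them continuous and [m >= s] keeps their sum at most 1. *)
pose m y := Num.max 2^-1 (s y).
have m0 y : 0 < m y by rewrite /m lt_max invr_gt0 ltr0n.
have mc : continuous (m : T -> R^o).
  have mc : continuous ((cst 2^-1 : T -> R^o) \max (s : T -> R^o)).
    move=> y; apply: continuous_max; first exact: cst_continuous.
    exact: (proj1 (Cc_sum _ fC)).
  exact: mc.
have mVc : continuous ((fun y => (m y)^-1) : T -> R^o).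
  by move=> y; apply: (@continuousV R T m); [rewrite gt_eqF|exact: mc].
exists n, (fun k => (sval (j k)).1), (fun k y => f k y / m y).
split=> [k|k h|h|h Kh|].
- exact: Cc_mul.
- by rewrite divr_ge0// ltW.
- by rewrite -mulr_suml ler_pdivrMr// mul1r /m le_max lexx orbT.
- have [k fk] := jP h Kh.
  have : 2^-1 <= s h.
    rewrite /s (bigD1 k)//=; apply: le_trans (ltW fk) _.
    by rewrite lerDl sumr_ge0.
  move=> sh; rewrite -mulr_suml /m max_r// divff// gt_eqF//.
  by apply: lt_le_trans sh; rewrite invr_gt0.
- have : \forall w \near F, forall k, forall h, f k h != 0 -> Q (sval (j k)).1 w h.
    by apply: filter_forall => k; rewrite /f; case: (svalP (j k)).
  by apply: filterS => w wP k h; rewrite mulf_eq0 negb_or => /andP[fk _]; exact: wP.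
Qed.

(** [psi] is fixed before the covering is given, so an error bounded by [e psi] has integral at most
    [e] times a constant that does not depend on the partition. To this end every partition is
    multiplied by the fixed sum [psi], which is 1 on [K]. *)
Lemma partition_cutoff (K : set T) : compact K ->
  exists psi : T -> R, [/\ Cc psi, forall h, 0 <= psi h &
  forall (I W : Type) (F : set_system W) (Q : I -> W -> T -> Prop), Filter F ->
  (forall h, K h -> exists i, \forall h' \near h & w \near F, Q i w h') ->
  exists n (i : 'I_n -> I) (chi : 'I_n -> T -> R),
    [/\ forall k, Cc (chi k), forall k h, 0 <= chi k h,
        forall h, \sum_k chi k h <= psi h, forall h, K h -> \sum_k chi k h = 1 &
        \forall w \near F, forall k h, chi k h != 0 -> Q (i k) w h]].
Proof.
move=> Kc.
have [|n0 [_ [chi0 [c0C c00 _ c0K _]]]] := @partition_of_unity unit unit (globally setT)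
  K (fun _ _ _ => True) _ Kc.
  by move=> h _; exists tt; exists (setT, setT) => //=; split; [exact: filterT|].
exists (fun h => \sum_k chi0 k h); split.
- exact: Cc_sum.
- by move=> h; rewrite sumr_ge0.
move=> I W F Q FF KQ.
have [n [i [chi [cC c0 c1 cK cQ]]]] := partition_of_unity FF Kc KQ.
exists n, i, (fun k h => chi k h * \sum_k chi0 k h); split.
- by move=> k; apply: Cc_mul => //; exact: (proj1 (Cc_sum _ c0C)).
- by move=> k h; rewrite mulr_ge0// sumr_ge0.
- by move=> h; rewrite -mulr_suml ler_piMl// sumr_ge0.
- by move=> h Kh; rewrite -mulr_suml cK// mul1r c0K.
- by apply: filterS cQ => w wQ k h; rewrite mulf_eq0 negb_or => /andP[/wQ].
Qed.

End Topology.

Lemma within_continuous_near (X Z : topologicalType) (A : set X) (f : X -> Z) (x : X) (U : set Z) :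
  {within A, continuous f} -> A x -> nbhs (f x) U -> \forall y \near x, A y -> U (f y).
Proof. by move/subspace_continuousP => fc Ax; exact: fc Ax U. Qed.

(** * The Hahn-Banach theorem *)

Section HahnBanach.
Variables (R : realType).
Local Notation C := R[i].
Variable V : normedModType C.

Definition nrm (v : V) : R := complex.Re `|v|.
Lemma nrmE v : (nrm v)%:C = `|v|. Proof. exact: Re_norm. Qed.
Lemma nrmD u v : nrm (u + v) <= nrm u + nrm v.
Proof. by rewrite -lecR rmorphD/= !nrmE ler_normD. Qed.
Lemma nrmZ (r : R) v : nrm (r%:C *: v) = `|r| * nrm v.
Proof.
apply: complexI; rewrite rmorphM/= !nrmE normrZ; congr (_ * _).
by rewrite normc_def/= expr0n/= addr0 sqrtr_sqr.
Qed.
Lemma nrm_ge0 v : 0 <= nrm v. Proof. by rewrite -lecR nrmE normr_ge0. Qed.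

(** A partial real-linear functional below the norm, encoded by its graph. Single-valuedness is a
    consequence of the two clauses, see [norming_real_functional]. *)
Definition dominated_graph (G : set (V * R)) : Prop :=
  (forall u a v b (r : R), G (u, a) -> G (v, b) -> G (r%:C *: u + v, r * a + b)) /\
  (forall u a, G (u, a) -> a <= nrm u).

(** One-dimensional step: the value [c] at [v1] must satisfy [a - |u - v1| <= c <= |u + v1| - a] for
    all [(u, a)] in the graph. The triangle inequality allows [c] to be the supremum of the
    left-hand sides. *)
Lemma dominated_graph_extend G v1 : G !=set0 -> dominated_graph G ->
  exists G', [/\ dominated_graph G', G `<=` G' & exists c, G' (v1, c)].
Proof.
move=> [[u0 a0] G0] [Glin Gdom].
have Gopp u a : G (u, a) -> G (- u, - a).
  move=> Gu; have := Glin _ _ _ _ (-1) Gu (Glin _ _ _ _ (-1) Gu Gu).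
  by rewrite !rmorphN/= !scaleN1r !addNr !mulN1r addNr !addr0.
have G00 : G (0, 0).
  have := Glin _ _ _ _ 1 (Gopp _ _ G0) G0.
  by rewrite !scale1r !mul1r !addNr.
pose S' : set R := [set x | exists u a, G (u, a) /\ x = a - nrm (u - v1)].
have S'ub u a : G (u, a) -> ubound S' (nrm (u + v1) - a).
  move=> Gu x [v [b [Gv ->]]].
  have := Gdom _ _ (Glin _ _ _ _ 1 Gu Gv).
  rewrite scale1r mul1r => H.
  have := nrmD (u + v1) (v - v1); rewrite addrACA subrr addr0 => H'.
  lra.
have S'0 : S' !=set0 by exists (0 - nrm (0 - v1)); exists 0, 0.
pose c := sup S'.
have c1 u a : G (u, a) -> a - nrm (u - v1) <= c.
  by move=> Gu; apply: ub_le_sup; [exists (nrm (0 + v1) - 0); exact: S'ub|exists u, a].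
have c2 u a : G (u, a) -> c <= nrm (u + v1) - a.
  by move=> Gu; apply: ge_sup => //; exact: S'ub.
exists [set p | exists u a (r : R), G (u, a) /\ p = (u + r%:C *: v1, a + r * c)].
split.
- split=> [u a v b r [u' [a' [s [Gu [-> ->]]]]] [v' [b' [t [Gv [-> ->]]]]]|].
    exists (r%:C *: u' + v'), (r * a' + b'), (r * s + t); split; first exact: Glin.
    congr pair; last by ring.
    by rewrite rmorphD rmorphM /= scalerDl scalerDr scalerA addrACA.
  move=> _ _ [u [a [r [Gu [-> ->]]]]].
  have Gs (s : R) : G (s%:C *: u, s * a).
    by have := Glin _ _ _ _ s Gu G00; rewrite !addr0.
  have [r0|r0|->] := ltgtP r 0; last by rewrite mul0r scale0r !addr0 Gdom.
    have := c1 _ _ (Gs (- r^-1)).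
    have -> : (- r^-1)%:C *: u - v1 = (- r^-1)%:C *: (u + r%:C *: v1).
      rewrite scalerDr scalerA -rmorphM/= mulNr mulVf ?lt_eqF//.
      by rewrite (rmorphN1 (real_complex R)) scaleN1r.
    rewrite nrmZ normrN ltr0_norm ?invr_lt0// => H.
    have {}H : (- r) * (- r^-1 * a - - r^-1 * nrm (u + r%:C *: v1)) <= - r * c.
      by rewrite ler_wpM2l// oppr_ge0 ltW.
    move: H; rewrite mulrBr !mulrA mulrNN mulfV ?lt_eqF// !mul1r.
    lra.
  have := c2 _ _ (Gs (r^-1)).
  have -> : (r^-1)%:C *: u + v1 = (r^-1)%:C *: (u + r%:C *: v1).
    by rewrite scalerDr scalerA -rmorphM/= mulVf ?gt_eqF// rmorph1 scale1r.
  rewrite nrmZ gtr0_norm ?invr_gt0// => H.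
  have {}H : r * c <= r * (r^-1 * nrm (u + r%:C *: v1) - r^-1 * a).
    by rewrite ler_wpM2l// ltW.
  move: H; rewrite mulrBr !mulrA mulfV ?gt_eqF// !mul1r.
  lra.
- by move=> [u a] Gu; exists u, a, 0; rewrite scale0r mul0r !addr0.
- by exists c; exists 0, 0, 1; rewrite scale1r mul1r !add0r.
Qed.

Lemma norming_real_functional v0 : exists f : V -> R,
  [/\ forall (r : R) u v, f (r%:C *: u + v) = r * f u + f v,
      forall u, f u <= nrm u & f v0 = nrm v0].
Proof.
pose G0 : set (V * R) := [set p | exists r : R, p = (r%:C *: v0, r * nrm v0)].
have G0P : dominated_graph G0.
  split=> [u a v b r [s [-> ->]] [t [-> ->]]|u a [r [-> ->]]].
    exists (r * s + t); rewrite rmorphD rmorphM /= scalerDl scalerA.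
    by rewrite mulrDl mulrA.
  by rewrite nrmZ ler_wpM2r ?nrm_ge0// ler_norm.
(* The premise [G !=set0] admits the empty set, which is the union of the empty chain in Zorn's
   lemma. *)
pose P (G : set (V * R)) := G !=set0 -> dominated_graph G /\ G0 `<=` G.
have [F FP Ftot|A [PA Amax]] := @Zorn_bigcup _ P.
  move=> [p [G FG Gp]].
  have GP H : F H -> H !=set0 -> dominated_graph H /\ G0 `<=` H by move=> /FP.
  split; last by move=> q G0q; exists G => //; apply: (GP _ FG _).2 => //; exists p.
  split=> [u a v b r [H FH Hu] [H' FH' Hv]|u a [H FH Hu]]; last first.
    by have [[_ Hd] _] := GP _ FH (ex_intro _ _ Hu); exact: Hd.
  case: (Ftot _ _ FH FH') => HH.
    have [[Hl _] _] := GP _ FH' (ex_intro _ _ Hv).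
    by exists H' => //; apply: Hl => //; exact: HH.
  have [[Hl _] _] := GP _ FH (ex_intro _ _ Hu).
  by exists H => //; apply: Hl => //; exact: HH.
have A0 : A !=set0.
  apply/set0P/negP => /eqP A0; apply: (Amax G0) => [|_]; last by split.
  rewrite properEneq; split=> //; last by rewrite A0.
  rewrite A0 eq_sym; apply/set0P; exists (1%:C *: v0, 1 * nrm v0); by exists 1.
have [AP G0A] := PA A0.
have total v : exists a, A (v, a).
  have [G' [G'P AG' [c G'c]]] := dominated_graph_extend v A0 AP.
  exists c; suff -> : A = G' by [].
  apply: contrapT => /eqP AG; apply: (Amax G') => [|_].
    by rewrite properEneq.
  by split=> //; exact: subset_trans AG'.
have [Al Ad] := AP.
have Auniq v a b : A (v, a) -> A (v, b) -> a = b.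
  have H a' b' : A (v, a') -> A (v, b') -> b' <= a'.
    move=> Aa Ab; have := Ad _ _ (Al _ _ _ _ (-1) Aa Ab).
    rewrite rmorphN rmorph1 scaleN1r addNr mulN1r -[0](scale0r (0 : V)).
    by rewrite -(rmorph0 (real_complex R)) nrmZ normr0 mul0r addrC subr_le0.
  by move=> Aa Ab; apply/eqP; rewrite eq_le !H.
have [f fP] := choice total.
exists f; split=> [r u v|u|].
- by apply: Auniq (fP _) _; exact: Al.
- exact: Ad.
- by apply: Auniq (fP _) _; apply: G0A; exists 1; rewrite scale1r mul1r.
Qed.

(** Complexification: [f u - i f (i u)] is complex linear with real part [f]. Rotating [u] until the
    value is real transfers the bound from [f]; at [v0] the real part already exhausts the bound, so
    the imaginary part is 0. *)
Lemma hahn_banach v0 : exists phi : {linear V -> C^o},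
  [/\ continuous phi, forall u, `|phi u : C| <= `|u| & phi v0 = `|v0|].
Proof.
have [f [fl fd fv]] := norming_real_functional v0.
have f0 : f 0 = 0.
  by have := fl 1 0 0; rewrite scale1r mul1r addr0 => /eqP; rewrite -subr_eq subrr eq_sym => /eqP.
have fD u v : f (u + v) = f u + f v by have := fl 1 u v; rewrite scale1r mul1r.
have fZ r u : f (r%:C *: u) = r * f u by have := fl r u 0; rewrite f0 !addr0.
have fN u : f (- u) = - f u.
  by have := fZ (-1) u; rewrite rmorphN rmorph1 scaleN1r mulN1r.
pose p u : C^o := (f u +i* - f ('i *: u))%C.
have pl : linear p.
  move=> [a b] u v; rewrite /p.
  have abE : (a +i* b)%C = a%:C + 'i * b%:C.
    by rewrite [LHS]complexE/=.
  have e1 : (a +i* b)%C *: u = a%:C *: u + b%:C *: ('i *: u).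
    by rewrite abE scalerDl mulrC -scalerA.
  have e2 : 'i *: ((a +i* b)%C *: u) = a%:C *: ('i *: u) + (- b)%:C *: u.
    rewrite !scalerA -scalerDl; congr (_ *: _); apply/eqP.
    by rewrite eq_complex /=; apply/andP; split; apply/eqP; ring.
  rewrite scalerDr e2 e1 !fD !fZ.
  by rewrite /GRing.scale/=; simpc; congr (_ +i* _)%C; ring.
pose phi : {linear V -> C^o} := HB.pack p (GRing.isLinear.Build _ _ _ _ p pl).
have Rephi u : complex.Re (phi u) = f u by [].
have phib u : `|phi u : C| <= `|u|.
  have [->|pu0] := eqVneq (phi u : C) 0; first by rewrite normr0.
  pose z : C := `|phi u : C| / phi u.
  have z1 : `|z| = 1 by rewrite normrM normr_id normfV mulfV// normr_eq0.
  have zu : phi (z *: u) = `|phi u : C|.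
    by rewrite [LHS](linZ pl) [LHS]mulfVK.
  rewrite -[leRHS]mul1r -z1 -normrZ -[leLHS]zu -nrmE.
  have -> : phi (z *: u) = (complex.Re (phi (z *: u)))%:C.
    by rewrite zu RRe_real// realE normr_ge0.
  by rewrite lecR Rephi fd.
exists phi; split=> //.
  apply/(@continuous_distP _ _ C^o) => t e e0.
  have : \forall s \near t, `|t - s| < e by apply: cvgr_dist_lt e0; exact: cvg_id.
  by apply: filterS => s; rewrite -linearB; exact: le_lt_trans.
apply/eqP; rewrite -nrmE eq_complex /= fv eqxx/=.
have := phib v0; rewrite -nrmE normc_def/= lecR fv => H.
have : Num.sqrt (nrm v0 ^+ 2 + (- f ('i *: v0)) ^+ 2) ^+ 2 <= nrm v0 ^+ 2.
  by rewrite lerXn2r// ?nnegrE ?sqrtr_ge0 ?nrm_ge0.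
rewrite sqr_sqrtr ?addr_ge0 ?sqr_ge0// gerDl => H'.
by rewrite -sqrf_eq0 eq_le H' sqr_ge0.
Qed.

End HahnBanach.

(** * Sections near a filter *)

Section NearSections.
Variable R : realType.
Local Notation C := R[i].

Lemma lin_sum (U V : lmodType C) (f : U -> V) I (r : seq I) (P : pred I) (u : I -> U) :
  linear f -> f (\sum_(i <- r | P i) u i) = \sum_(i <- r | P i) f (u i).
Proof. by move=> fl; apply: (big_morph f (linD fl) (lin0 fl)). Qed.

Lemma linB (U V : lmodType C) (f : U -> V) :
  linear f -> {morph f : u v / u - v}.
Proof. by move=> fl u v; rewrite (linD fl) (linN fl). Qed.

(** On a zero space any complex [M] is a bound; passing to [|M|] makes it nonnegative. *)
Lemma real_bound (U V : normedModType C) (f : U -> V) (M : C) :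
  (forall u, `|f u| <= M * `|u|) -> forall u, `|f u| <= `|M| * `|u|.
Proof.
move=> fM u; apply: le_trans (fM u) _.
rewrite -[X in _ <= _ * X]normr_id -normrM ger0_norm//.
exact: le_trans (normr_ge0 _) (fM u).
Qed.

Lemma scaled_eps (M e : C) : 0 <= M -> 0 < e ->
  exists d, [/\ 0 < d, d <= 1 & M * d <= e].
Proof.
move=> M0 e0; have h : 0 < M + 1 + e by rewrite addr_gt0// ltr_wpDl.
exists (e / (M + 1 + e)); split.
- by rewrite divr_gt0.
- by rewrite ler_pdivrMr// mul1r lerDr addr_ge0.
- rewrite mulrA ler_pdivrMr// mulrC ler_wpM2l ?ltW//.
  by rewrite -addrA ltrDl addr_gt0.
Qed.

Section Def.
Variables (X : topologicalType) (E : bfield R X) (Z : Type).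

(** Approximability along [q], near the filter [F], by sections over the base. With [F] a
    neighbourhood filter at each point this is membership in the pull-back field ([sec_pullP]);
    other filters cover fibred products and products with the interval. *)
Definition near_sec (F : set_system Z) (q : Z -> X) (zeta : forall z, E (q z)) :
  Prop := forall e : C, 0 < e ->
  exists2 xi, sec E xi & \forall z \near F, `|zeta z - xi (q z)| <= e.

Variables (F : set_system Z) (q : Z -> X) (x0 : X).
Hypotheses (FF : Filter F) (qF : q @ F --> x0) (Eu : is_usc_field E).

Lemma near_sec_base xi : sec E xi -> near_sec F (fun z => xi (q z)).
Proof.
by move=> sxi e e0; exists xi => //; apply: nearW => z; rewrite subrr normr0 ltW.
Qed.

Lemma near_sec0 : near_sec F (fun z => 0 : E (q z)).
Proof. exact: (near_sec_base (sec_zero Eu)). Qed.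

(** The restriction [d <= 1] allows the constant [M] to contain bounds for the approximants
    themselves, such as [M1 + 1]. *)
Lemma near_sec_scaled (zeta : forall z, E (q z)) (M : C) : 0 <= M ->
  (forall d : C, 0 < d -> d <= 1 -> exists2 zeta', near_sec F zeta' &
    \forall z \near F, `|zeta z - zeta' z| <= M * d) -> near_sec F zeta.
Proof.
move=> M0 H e e0; have e20 : 0 < e / 2 by rewrite divr_gt0.
have [d [d0 d1 Md]] := scaled_eps M0 e20.
have [zeta' zs zz] := H d d0 d1.
have [xi sxi xz] := zs _ e20.
exists xi => //; apply: filterS2 zz xz => z h1 h2.
rewrite [e]splitr; apply: le_trans (ler_distD (zeta' z) _ _) _.
by rewrite lerD// (le_trans h1).
Qed.

Lemma near_sec_approx (zeta : forall z, E (q z)) :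
  (forall d : C, 0 < d -> exists2 zeta', near_sec F zeta' &
    \forall z \near F, `|zeta z - zeta' z| <= d) -> near_sec F zeta.
Proof.
move=> H; apply: (near_sec_scaled ler01) => d d0 _.
by have [zeta' ? ?] := H d d0; exists zeta' => //; rewrite mul1r.
Qed.

Lemma near_sec_bounded (zeta : forall z, E (q z)) : near_sec F zeta ->
  exists2 M : C, 0 <= M & \forall z \near F, `|zeta z| <= M.
Proof.
move=> /(_ 1 ltr01)[xi sxi xz].
exists (`|xi x0| + 1 + 1); first by rewrite !addr_ge0.
have : \forall y \near x0, `|xi y| < `|xi x0| + 1.
  by apply: sec_usc Eu _ sxi _ _ _; rewrite ltrDl.
move/qF; apply: filterS2 xz => z h1 h2.
rewrite -[zeta z](subrK (xi (q z))) addrC; apply: le_trans (ler_normD _ _) _.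
by rewrite lerD// ltW.
Qed.

Lemma near_sec_lin a (z1 z2 : forall z, E (q z)) :
  near_sec F z1 -> near_sec F z2 -> near_sec F (fun z => a *: z1 z + z2 z).
Proof.
move=> h1 h2; apply: (@near_sec_scaled _ (`|a| + 1)); first by rewrite addr_ge0.
move=> d d0 _; have [xi1 s1 n1] := h1 d d0; have [xi2 s2 n2] := h2 d d0.
exists (fun z => a *: xi1 (q z) + xi2 (q z)).
  by apply: (near_sec_base (xi := fun x => a *: xi1 x + xi2 x)); apply: sec_lin.
apply: filterS2 n1 n2 => z n1 n2.
rewrite opprD addrACA -scalerBr mulrDl mul1r.
apply: le_trans (ler_normD _ _) _; rewrite normrZ lerD//.
by rewrite ler_wpM2l.
Qed.

Lemma near_secD (z1 z2 : forall z, E (q z)) :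
  near_sec F z1 -> near_sec F z2 -> near_sec F (fun z => z1 z + z2 z).
Proof.
move=> h1 h2; have := near_sec_lin 1 h1 h2; congr (near_sec _ _).
by apply: functional_extensionality_dep => z; rewrite scale1r.
Qed.

Lemma near_secZ a (z1 : forall z, E (q z)) :
  near_sec F z1 -> near_sec F (fun z => a *: z1 z).
Proof.
move=> h1; have := near_sec_lin a h1 near_sec0; congr (near_sec _ _).
by apply: functional_extensionality_dep => z; rewrite addr0.
Qed.

Lemma near_secN (z1 : forall z, E (q z)) :
  near_sec F z1 -> near_sec F (fun z => - z1 z).
Proof.
move=> h1; have := near_secZ (-1) h1; congr (near_sec _ _).
by apply: functional_extensionality_dep => z; rewrite scaleN1r.
Qed.

Lemma near_sec_sum I (r : seq I) (zeta : I -> forall z, E (q z)) :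
  (forall i, near_sec F (zeta i)) -> near_sec F (fun z => \sum_(i <- r) zeta i z).
Proof.
move=> h; elim: r => [|i r IH].
  have := near_sec0; congr (near_sec _ _).
  by apply: functional_extensionality_dep => z; rewrite big_nil.
have := near_secD (h i) IH; congr (near_sec _ _).
by apply: functional_extensionality_dep => z; rewrite big_cons.
Qed.

Lemma near_sec_scale (f : Z -> C) a (z1 : forall z, E (q z)) :
  (forall e : C, 0 < e -> \forall z \near F, `|f z - a| <= e) ->
  near_sec F z1 -> near_sec F (fun z => f z *: z1 z).
Proof.
move=> fa h1; have [M M0 z1M] := near_sec_bounded h1.
apply: (near_sec_scaled M0) => d d0 _; exists (fun z => a *: z1 z).
  exact: near_secZ.
apply: filterS2 (fa d d0) z1M => z fd zM.
by rewrite -scalerBl normrZ mulrC ler_pM.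
Qed.

End Def.

Lemma near_sec_linear (X : topologicalType) (E K : bfield R X) (T : forall x, E x -> K x)
    (Z : Type) (F : set_system Z) (q : Z -> X) (x0 : X) (zeta : forall z, E (q z)) :
  Filter F -> q @ F --> x0 -> cont_linear E K T ->
  near_sec F zeta -> near_sec F (fun z => T (q z) (zeta z)).
Proof.
move=> FF qF Tc h; have [M TM] := cl_bounded Tc x0.
apply: (@near_sec_scaled _ _ _ F q FF _ `|M|) => // d d0 _.
have [xi sxi xz] := h d d0; exists (fun z => T (q z) (xi (q z))).
  by apply: (@near_sec_base X K Z F q FF (fun x => T x (xi x))); exact: cl_sec Tc _ sxi.
move/qF : TM; apply: filterS2 xz => z xz TM.
have Tl : linear (T (q z)) := @cl_linear _ _ _ _ _ Tc (q z).
 rewrite -(linB Tl).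
by apply: le_trans (real_bound TM _) _; rewrite ler_wpM2l.
Qed.

Lemma near_sec_bilinear (X : topologicalType) (E K L : bfield R X)
    (m : forall x, E x -> K x -> L x)
    (Z : Type) (F : set_system Z) (q : Z -> X) (x0 : X)
    (z1 : forall z, E (q z)) (z2 : forall z, K (q z)) :
  is_usc_field E -> is_usc_field K ->
  Filter F -> q @ F --> x0 -> cont_bilinear E K L m ->
  near_sec F z1 -> near_sec F z2 -> near_sec F (fun z => m (q z) (z1 z) (z2 z)).
Proof.
move=> Eu Ku FF qF mc h1 h2; have [M mM] := cb_bounded mc x0.
have [M1 M10 n1] := near_sec_bounded FF qF Eu h1.
have [M2 M20 n2] := near_sec_bounded FF qF Ku h2.
apply: (@near_sec_scaled _ _ _ F q FF _ (`|M| * (M2 + M1 + 1))).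
  by rewrite mulr_ge0// !addr_ge0.
move=> d d0 d1.
have [xi1 s1 a1] := h1 d d0; have [xi2 s2 a2] := h2 d d0.
exists (fun z => m (q z) (xi1 (q z)) (xi2 (q z))).
  by apply: (@near_sec_base X L Z F q FF (fun x => m x (xi1 x) (xi2 x))); exact: cb_sec.
have {}mM := qF _ mM.
near=> z.
have mMz : forall e f, `|m (q z) e f| <= M * `|e| * `|f| by near: z.
have {}mMz e f : `|m (q z) e f| <= `|M| * (`|e| * `|f|).
  rewrite mulrA; apply: le_trans (mMz e f) _.
  rewrite -[X in _ <= _ * X * _]normr_id -[X in _ <= _ * X]normr_id -!normrM.
  by rewrite ger0_norm//; exact: le_trans (normr_ge0 _) (mMz e f).
have [mr ml] := cb_bilinear mc (q z).
have -> : m (q z) (z1 z) (z2 z) - m (q z) (xi1 (q z)) (xi2 (q z)) =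
    m (q z) (z1 z - xi1 (q z)) (z2 z) + m (q z) (xi1 (q z)) (z2 z - xi2 (q z)).
  by rewrite (linB (ml _)) (linB (mr _)) addrA subrK.
have a1z : `|z1 z - xi1 (q z)| <= d by near: z.
have a2z : `|z2 z - xi2 (q z)| <= d by near: z.
have n1z : `|z1 z| <= M1 by near: z.
have n2z : `|z2 z| <= M2 by near: z.
have x1z : `|xi1 (q z)| <= M1 + 1.
  rewrite -[xi1 _](subrK (z1 z)) addrC; apply: le_trans (ler_normD _ _) _.
  by rewrite lerD// distrC (le_trans a1z).
apply: le_trans (ler_normD _ _) _.
rewrite -addrA mulrDr mulrDl lerD//.
  apply: le_trans (mMz _ _) _; rewrite -mulrA ler_wpM2l// mulrC ler_pM//.
by apply: le_trans (mMz _ _) _; rewrite -mulrA ler_wpM2l// ler_pM.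
Unshelve. all: by end_near. Qed.

(** Since the action is isometric, it suffices to treat [xi (q z)] for a section [xi], where
    continuity of the action is part of [is_gspace]; the resulting approximation near [a0] is pulled
    back along [a]. *)
Lemma near_sec_act (G : groupoid) (E : gspace R G) (Z : Type)
    (F : set_system Z) (a : Z -> arr G) (a0 : arr G) (q q' : Z -> obj G)
    (hs : forall z, src (a z) = q z) (hr : forall z, rng (a z) = q' z)
    (zeta : forall z, E (q z)) :
  is_gspace E -> Filter F -> a @ F --> a0 ->
  near_sec F zeta -> near_sec F (fun z => act (hs z) (hr z) (zeta z)).
Proof.
move=> [Eu Ea] FF aF h; apply: near_sec_approx => d d0.
have [xi sxi xz] := h d d0.
exists (fun z => act (hs z) (hr z) (xi (q z))); last first.
  apply: filterS xz => z; rewrite -(linB (act_linear _ _)) act_norm; exact.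
have /Ea sa : sec (pull (@src G) E) (fun g => xi (src g)).
  move=> g e e0; exists (fun g => xi (src g)); first by exists xi.
  by apply: nearW => y; rewrite subrr normr0 ltW.
move=> e e0; have [_ [xi' s' ->] xi'P] := sa a0 e e0.
exists xi' => //; have xi'F : F (a @^-1` _) := aF _ xi'P; apply: filterS xi'F => z /=.
by case: _ / (hs z); case: _ / (hr z).
Qed.

Lemma sec_pullP (X Y : topologicalType) (p : Y -> X) (E : bfield R X) zeta :
  sec (pull p E) zeta <-> forall y : Y, @near_sec X E Y (nbhs y) p zeta.
Proof.
split=> [h y e e0|h y e e0].
  by have [_ [xi s ->] n] := h y e e0; exists xi.
by have [xi s n] := h y e e0; exists (fun y => xi (p y)) => //; exists xi.
Qed.

Lemma sec_nearP (X : topologicalType) (E : bfield R X) (zeta : forall x, E x) :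
  is_usc_field E ->
  sec E zeta <-> forall x : X, @near_sec X E X (nbhs x) idfun zeta.
Proof.
move=> Eu; split=> [h y|h]; first exact: (@near_sec_base X E X _ idfun).
by apply: sec_approx => // x e e0; exact: h.
Qed.

(** The point [z0] lies in every member of [F], so the approximating section has norm below [r - e]
    at [p z0], hence also near it, and the margin [e] absorbs the error of approximation. *)
Lemma near_sec_usc (X : topologicalType) (Z : Type) (F : set_system Z) (z0 : Z)
    (p : Z -> X) (E : bfield R X)
    (zeta : forall z, E (p z)) (r : C) : is_usc_field E -> Filter F ->
  (forall S, F S -> S z0) -> p @ F --> p z0 -> near_sec F zeta -> `|zeta z0| < r ->
  \forall z \near F, `|zeta z| < r.
Proof.
move=> Eu FF F0 pc h zr; pose e := (r - `|zeta z0|) / 4.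
have e0 : 0 < e by rewrite divr_gt0// subr_gt0.
have rE : r = `|zeta z0| + e + e + (e + e) :> C.
  by rewrite /e; field.
have [xi sxi xz] := h e e0.
have xy0 : `|xi (p z0)| < r - e.
  have := F0 _ xz; rewrite /= distrC => xy.
  rewrite -[xi _](subrK (zeta z0)) addrC; apply: le_lt_trans (ler_normD _ _) _.
  apply: (@le_lt_trans _ _ (`|zeta z0| + e)); first by rewrite lerD.
  by rewrite ltrBrDr rE -[ltRHS]addrA ltrD2l// ltrDl addr_gt0.
have n : F (p @^-1` _) := pc _ (sec_usc Eu sxi xy0); apply: filterS2 xz n => z h1 h2.
rewrite -[zeta z](subrK (xi (p z))) addrC; apply: le_lt_trans (ler_normD _ _) _.
rewrite -[r](subrK e); exact: ltr_leD.
Qed.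

(** The neighbourhoods of [y0], traced on a subtype such as a fibred product. The point [y0] itself
    may fail [P]; the filter can then be improper. *)
Definition sub_nbhs (Y : topologicalType) (P : Y -> Prop) (y0 : Y) :
  set_system {y | P y} := [set S | \forall y \near y0, forall p : P y, S (exist P y p)].

Global Instance sub_nbhs_filter (Y : topologicalType) (P : Y -> Prop) (y0 : Y) :
  Filter (sub_nbhs (P := P) y0).
Proof.
split.
- by apply: nearW.
- move=> S S' h h'.
  have n : \forall y \near y0, (forall p, S (exist P y p)) /\ (forall p, S' (exist P y p)).
    by apply: filterI.
  have {}n : nbhs y0 _ := n.
  by apply: filterS n => y [yS yS'] p; split.
- move=> S S' SS' h; have n : nbhs y0 _ := h.
  by apply: filterS n => y yS p; apply: SS'.
Qed.

Lemma sub_nbhs_point (Y : topologicalType) (P : Y -> Prop) (y0 : {y | P y}) S :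
  sub_nbhs (sval y0) S -> S y0.
Proof. by case: y0 => y0 Py0 /nbhs_singleton; exact. Qed.

Lemma sub_nbhs_cvg (Y T : topologicalType) (P : Y -> Prop) (f : Y -> T) (y0 : Y) :
  {for y0, continuous f} -> (fun z : {y | P y} => f (sval z)) @ sub_nbhs y0 --> f y0.
Proof.
move=> fc U fU; have n : nbhs y0 (f @^-1` U) := fc U fU.
suff : \forall y \near y0, forall p : P y, U (f y) by [].
by apply: filterS n => y yU p.
Qed.

End NearSections.

Section ActLinear.
Variables (R : realType) (G : groupoid) (E : gspace R G) (g : arr G) (x y : obj G).
Variables (hs : src g = x) (hr : rng g = y).

Let al : linear (@act R G E g x y hs hr) := act_linear hs hr.

Lemma act0 : act hs hr (0 : E x) = 0. Proof. exact: (lin0 al). Qed.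
Lemma actN (v : E x) : act hs hr (- v) = - act hs hr v. Proof. exact: (linN al). Qed.
Lemma actB (u v : E x) : act hs hr (u - v) = act hs hr u - act hs hr v.
Proof. exact: (linB al). Qed.
Lemma actZ (a : R[i]) (v : E x) : act hs hr (a *: v) = a *: act hs hr v.
Proof. exact: (linZ al). Qed.
Lemma act_sum I (r : seq I) (P : pred I) (u : I -> E x) :
  act hs hr (\sum_(i <- r | P i) u i) = \sum_(i <- r | P i) act hs hr (u i).
Proof. exact: (lin_sum _ _ _ al). Qed.

End ActLinear.

(** * Locally compact operators *)

Section CompactOperators.
Variable R : realType.
Local Notation C := R[i].
Variables (G : groupoid) (A B : galg R G) (E : kkdata A B).

Definition rankr x (eta : rp E x) (xi : lp E x) (e : rp E x) : rp E x :=
  rb eta (pr xi e).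
Definition rankl x (eta : rp E x) (xi : lp E x) (f : lp E x) : lp E x :=
  bl (pr f eta) xi.

Section Near.
Variables (Z : Type) (F : set_system Z) (q : Z -> obj G).

Definition near_op_le (Sl : forall z, lp E (q z) -> lp E (q z))
    (Sr : forall z, rp E (q z) -> rp E (q z)) (e : C) : Prop :=
  \forall z \near F, (forall v, `|Sr z v| <= e * `|v|) /\
    (forall v, `|Sl z v| <= e * `|v|).

Local Notation secpair := ((forall x, rp E x) * (forall x, lp E x))%type.

Definition base_pairs (s : seq secpair) : Prop :=
  List.Forall (fun p => sec (rp E) p.1 /\ sec (lp E) p.2) s.

(* Local compactness at a filter. Unlike in [locally_compact_op], [eta] and [xi]
   are sections over the base, evaluated along [q]. *)
Definition near_compact (Sl : forall z, lp E (q z) -> lp E (q z))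
    (Sr : forall z, rp E (q z) -> rp E (q z)) : Prop :=
  forall e : C, 0 < e -> exists2 s, base_pairs s &
    near_op_le (fun z f => Sl z f - \sum_(p <- s) rankl (p.1 (q z)) (p.2 (q z)) f)
      (fun z v => Sr z v - \sum_(p <- s) rankr (p.1 (q z)) (p.2 (q z)) v) e.

Hypothesis FF : Filter F.

Lemma near_compact_approx Sl Sr (M : C) : 0 <= M ->
  (forall d : C, 0 < d -> d <= 1 -> exists Sl' Sr', near_compact Sl' Sr' /\
    near_op_le (fun z f => Sl z f - Sl' z f) (fun z v => Sr z v - Sr' z v) (M * d)) ->
  near_compact Sl Sr.
Proof.
move=> M0 H e e0; have e20 : 0 < e / 2 by rewrite divr_gt0.
have [d [d0 d1 Md]] := scaled_eps M0 e20.
have [Sl' [Sr' [S'c S'd]]] := H d d0 d1.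
have [s sP sn] := S'c _ e20.
exists s => //; apply: filterS2 S'd sn => z [h1 h2] [h3 h4].
split=> v; rewrite [e]splitr mulrDl.
  apply: le_trans (ler_distD (Sr' z v) _ _) _; rewrite lerD//.
  by apply: le_trans (h1 v) _; rewrite ler_wpM2r.
apply: le_trans (ler_distD (Sl' z v) _ _) _; rewrite lerD//.
by apply: le_trans (h2 v) _; rewrite ler_wpM2r.
Qed.

Lemma near_compact_ext Sl Sr Sl' Sr' :
  (forall z f, Sl z f = Sl' z f) -> (forall z v, Sr z v = Sr' z v) ->
  near_compact Sl Sr -> near_compact Sl' Sr'.
Proof.
move=> hl hr; have -> : Sl' = Sl.
  by apply: functional_extensionality_dep => z; apply/funext => f.
have -> // : Sr' = Sr.
by apply: functional_extensionality_dep => z; apply/funext => f.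
Qed.

Lemma near_compact0 : near_compact (fun z f => 0) (fun z v => 0).
Proof.
move=> e e0; exists [::]; first exact: List.Forall_nil.
by apply: nearW => z; split=> v; rewrite big_nil subr0 normr0 mulr_ge0// ltW.
Qed.

Lemma near_compactD Sl Sr Sl' Sr' : near_compact Sl Sr -> near_compact Sl' Sr' ->
  near_compact (fun z f => Sl z f + Sl' z f) (fun z v => Sr z v + Sr' z v).
Proof.
move=> h h' e e0; have e20 : 0 < e / 2 by rewrite divr_gt0.
have [s sP sn] := h _ e20; have [s' sP' sn'] := h' _ e20.
exists (s ++ s'); first exact/List.Forall_app.
apply: filterS2 sn sn' => z [h1 h2] [h3 h4].
by split=> v; rewrite [e]splitr mulrDl big_cat/= opprD addrACA;
  apply: le_trans (ler_normD _ _) _; rewrite lerD.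
Qed.

Lemma near_compact_sum I (r : seq I) (Sl : I -> forall z, lp E (q z) -> lp E (q z))
    (Sr : I -> forall z, rp E (q z) -> rp E (q z)) :
  (forall i, near_compact (Sl i) (Sr i)) ->
  near_compact (fun z f => \sum_(i <- r) Sl i z f) (fun z v => \sum_(i <- r) Sr i z v).
Proof.
move=> h; elim: r => [|i r IH].
  by apply: near_compact_ext near_compact0 => *; rewrite big_nil.
by apply: near_compact_ext (near_compactD (h i) IH) => *; rewrite big_cons.
Qed.

Variable x0 : obj G.
Hypotheses (qF : q @ F --> x0) (EP : is_pair E).

Let lu : is_usc_field (lp E) := proj1 (cyc_lp EP).
Let ru : is_usc_field (rp E) := proj1 (cyc_rp EP).

Lemma rankr_le x (eta : rp E x) xi v : `|rankr eta xi v| <= `|eta| * `|xi| * `|v|.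
Proof.
apply: le_trans (cyc_rb_contr EP _ _) _; rewrite -mulrA ler_wpM2l//.
exact: (cyc_pr_contr EP).
Qed.

Lemma rankl_le x (eta : rp E x) xi v : `|rankl eta xi v| <= `|eta| * `|xi| * `|v|.
Proof.
apply: le_trans (cyc_bl_contr EP _ _) _; rewrite mulrAC ler_wpM2r//.
by rewrite mulrC; exact: (cyc_pr_contr EP).
Qed.

Lemma rankr_bilinear x v : is_bilinear (fun (eta : rp E x) xi => rankr eta xi v).
Proof.
have [rbr rbl] := cb_bilinear (cyc_rb EP) x; have [prr prl] := cb_bilinear (cyc_pr EP) x.
split=> [eta a u u'|xi a u u']; last exact: rbl.
by rewrite /rankr (prl v) (rbr eta).
Qed.

Lemma rankl_bilinear x v : is_bilinear (fun (eta : rp E x) xi => rankl eta xi v).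
Proof.
have [blr bll] := cb_bilinear (cyc_bl EP) x; have [prr prl] := cb_bilinear (cyc_pr EP) x.
split=> [eta a u u'|xi a u u']; first exact: blr.
by rewrite /rankl (prr v) (bll xi).
Qed.

Lemma rank_dist (V : normedModType C) x (m : rp E x -> lp E x -> V) (v d M1 M2 : C)
    eta eta' xi xi' : 0 <= v -> 0 <= M1 -> 0 <= M2 -> 0 <= d ->
  is_bilinear m -> (forall a b, `|m a b| <= `|a| * `|b| * v) ->
  `|eta - eta'| <= d -> `|xi - xi'| <= d -> `|eta'| <= M1 -> `|xi| <= M2 ->
  `|m eta xi - m eta' xi'| <= (M1 + M2) * d * v.
Proof.
move=> v0 M10 M20 d0 [mr ml] mb h1 h2 h3 h4.
have -> : m eta xi - m eta' xi' = m (eta - eta') xi + m eta' (xi - xi').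
  by rewrite (linB (ml _)) (linB (mr _)) addrA subrK.
apply: le_trans (ler_normD _ _) _; rewrite addrC !mulrDl lerD//.
  by apply: le_trans (mb _ _) _; rewrite ler_wpM2r// ler_pM.
by apply: le_trans (mb _ _) _; rewrite ler_wpM2r// mulrC ler_pM.
Qed.

(** [near_compact] asks for sections over the base; here [eta] and [xi] are merely approximable by
    such, and rank-one operators depend continuously on them ([rank_dist]). *)
Lemma near_compact_rank (eta : forall z, rp E (q z)) (xi : forall z, lp E (q z)) :
  near_sec F eta -> near_sec F xi ->
  near_compact (fun z => rankl (eta z) (xi z)) (fun z => rankr (eta z) (xi z)).
Proof.
move=> h1 h2.
have [M1 M10 n1] := near_sec_bounded FF qF ru h1.
have [M2 M20 n2] := near_sec_bounded FF qF lu h2.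
apply: (@near_compact_approx _ _ (M1 + 1 + M2)); first by rewrite !addr_ge0.
move=> d d0 d1; have [eta' s1 a1] := h1 d d0; have [xi' s2 a2] := h2 d d0.
exists (fun z => rankl (eta' (q z)) (xi' (q z))), (fun z => rankr (eta' (q z)) (xi' (q z))).
split.
  move=> e e0; exists [:: (eta', xi')]; first by apply: List.Forall_cons => //; exact: List.Forall_nil.
  by apply: nearW => z; split=> v; rewrite big_seq1 subrr normr0 mulr_ge0// ltW.
near=> z.
have a1z : `|eta z - eta' (q z)| <= d by near: z.
have a2z : `|xi z - xi' (q z)| <= d by near: z.
have n1z : `|eta z| <= M1 by near: z.
have n2z : `|xi z| <= M2 by near: z.
have x1z : `|eta' (q z)| <= M1 + 1.
  rewrite -[eta' _](subrK (eta z)) addrC; apply: le_trans (ler_normD _ _) _.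
  by rewrite lerD// distrC (le_trans a1z).
split=> v.
  apply: (rank_dist (m := fun a b => rankr a b v)) => //; rewrite ?addr_ge0 ?(ltW d0)//.
    exact: rankr_bilinear.
  by move=> *; exact: rankr_le.
apply: (rank_dist (m := fun a b => rankl a b v)) => //; rewrite ?addr_ge0 ?(ltW d0)//.
  exact: rankl_bilinear.
by move=> *; exact: rankl_le.
Unshelve. all: by end_near. Qed.

Lemma near_compactZ (a : C) Sl Sr : near_compact Sl Sr ->
  near_compact (fun z f => a *: Sl z f) (fun z v => a *: Sr z v).
Proof.
move=> h; apply: (@near_compact_approx _ _ `|a|) => // d d0 _.
have [s sP sn] := h d d0.
exists (fun z f => \sum_(p <- s) rankl (a *: p.1 (q z)) (p.2 (q z)) f),
  (fun z v => \sum_(p <- s) rankr (a *: p.1 (q z)) (p.2 (q z)) v); split.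
  elim: s sP {sn} => [|p s IH] sP.
    by apply: near_compact_ext near_compact0 => *; rewrite big_nil.
  have [[s1 s2] sP'] := (List.Forall_cons_iff _ _ _).1 sP.
  have := near_compactD _ (IH sP').
  move=> /(_ (fun z => rankl (a *: p.1 (q z)) (p.2 (q z)))
             (fun z => rankr (a *: p.1 (q z)) (p.2 (q z)))) H.
  apply: near_compact_ext (H _) => [*|*|]; rewrite ?big_cons//.
  apply: near_compact_rank; last exact: near_sec_base.
  by apply: near_secZ => //; exact: near_sec_base.
apply: filterS sn => z [h1 h2]; split=> v.
  rewrite (eq_bigr (fun p : secpair => a *: rankr (p.1 (q z)) (p.2 (q z)) v)).
    by rewrite -scaler_sumr -scalerBr normrZ -mulrA ler_wpM2l.
  by move=> p _; rewrite (linZ ((rankr_bilinear v).2 _)).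
rewrite (eq_bigr (fun p : secpair => a *: rankl (p.1 (q z)) (p.2 (q z)) v)).
  by rewrite -scaler_sumr -scalerBr normrZ -mulrA ler_wpM2l.
by move=> p _; rewrite (linZ ((rankl_bilinear v).2 _)).
Qed.

Lemma near_compactN Sl Sr : near_compact Sl Sr ->
  near_compact (fun z f => - Sl z f) (fun z v => - Sr z v).
Proof. by move/(near_compactZ (-1)); apply: near_compact_ext => *; rewrite scaleN1r. Qed.

Lemma near_compactB Sl Sr Sl' Sr' : near_compact Sl Sr -> near_compact Sl' Sr' ->
  near_compact (fun z f => Sl z f - Sl' z f) (fun z v => Sr z v - Sr' z v).
Proof. by move=> h /near_compactN h'; exact: near_compactD. Qed.

Lemma base_pairs_compact s : base_pairs s ->
  near_compact (fun z f => \sum_(p <- s) rankl (p.1 (q z)) (p.2 (q z)) f)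
    (fun z v => \sum_(p <- s) rankr (p.1 (q z)) (p.2 (q z)) v).
Proof.
move=> sP e e0; exists s => //.
by apply: nearW => z; split=> v; rewrite subrr normr0 mulr_ge0// ltW.
Qed.

(** Gives local boundedness of locally compact operators, used when the scalar factor in
    [near_compact_scale] is replaced by its limit. *)
Lemma rank_sums_bounded s : base_pairs s -> exists2 M : C, 0 <= M &
  near_op_le (fun z f => \sum_(p <- s) rankl (p.1 (q z)) (p.2 (q z)) f)
    (fun z v => \sum_(p <- s) rankr (p.1 (q z)) (p.2 (q z)) v) M.
Proof.
elim: s => [|p s IH] sP.
  by exists 0 => //; apply: nearW => z; split=> v; rewrite big_nil normr0 mul0r.
have [[s1 s2] sP'] := (List.Forall_cons_iff _ _ _).1 sP.
have [M M0 n] := IH sP'.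
have [M1 M10 n1] := near_sec_bounded FF qF ru (near_sec_base q FF s1).
have [M2 M20 n2] := near_sec_bounded FF qF lu (near_sec_base q FF s2).
exists (M1 * M2 + M); first by rewrite addr_ge0// mulr_ge0.
apply: filterS3 n n1 n2 => z [h1 h2] h3 h4; split=> v; rewrite big_cons mulrDl;
  apply: le_trans (ler_normD _ _) _; rewrite lerD//.
  by apply: le_trans (rankr_le _ _ _) _; rewrite ler_wpM2r// ler_pM.
by apply: le_trans (rankl_le _ _ _) _; rewrite ler_wpM2r// ler_pM.
Qed.

Lemma near_compact_scale (f : Z -> C) a Sl Sr :
  (forall e : C, 0 < e -> \forall z \near F, `|f z - a| <= e) ->
  near_compact Sl Sr ->
  near_compact (fun z u => f z *: Sl z u) (fun z v => f z *: Sr z v).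
Proof.
move=> fa h; have [s sP sn] := h 1 ltr01.
have [M M0 sM] := rank_sums_bounded sP.
apply: (@near_compact_approx _ _ (M + 1)); first by rewrite addr_ge0.
move=> d d0 _; exists (fun z u => a *: Sl z u), (fun z v => a *: Sr z v); split.
  exact: near_compactZ.
apply: filterS3 sn sM (fa d d0) => z [h1 h2] [h3 h4] fz.
split=> v; rewrite -scalerBl normrZ -[_ * d]mulrC -mulrA ler_pM// mulrDl mul1r.
  rewrite -[X in `|X|](subrK (\sum_(p <- s) rankr (p.1 (q z)) (p.2 (q z)) v)) addrC.
  apply: le_trans (ler_normD _ _) _; rewrite lerD//.
  by have := h1 v; rewrite mul1r.
rewrite -[X in `|X|](subrK (\sum_(p <- s) rankl (p.1 (q z)) (p.2 (q z)) v)) addrC.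
apply: le_trans (ler_normD _ _) _; rewrite lerD//.
by have := h2 v; rewrite mul1r.
Qed.

(** What makes composition with an operator preserve local compactness: the properties of an element
    of [L_B], stated along [q] near [F]. *)
Record near_adjointable (Sl : forall z, lp E (q z) -> lp E (q z))
    (Sr : forall z, rp E (q z) -> rp E (q z)) : Prop := {
  na_linl : forall z, linear (Sl z);
  na_linr : forall z, linear (Sr z);
  na_bounded : exists2 M : C, 0 <= M & near_op_le Sl Sr M;
  na_secl : forall xi, near_sec F xi -> near_sec F (fun z => Sl z (xi z));
  na_secr : forall xi, near_sec F xi -> near_sec F (fun z => Sr z (xi z));
  na_bl : forall z b f, Sl z (bl b f) = bl b (Sl z f);
  na_rb : forall z v b, Sr z (rb v b) = rb (Sr z v) b;
  na_pr : forall z f v, pr f (Sr z v) = pr (Sl z f) v }.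

(** [T |eta><xi| = |T eta><xi|]. The component on [E^<] of a composite is taken in the opposite
    order. *)
Lemma near_compact_mull Sl Sr Al Ar : near_adjointable Al Ar -> near_compact Sl Sr ->
  near_compact (fun z f => Sl z (Al z f)) (fun z v => Ar z (Sr z v)).
Proof.
move=> AP h; have [M M0 AM] := na_bounded AP.
apply: (@near_compact_approx _ _ M) => // d d0 _.
have [s sP sn] := h d d0.
exists (fun z f => \sum_(p <- s) rankl (Ar z (p.1 (q z))) (p.2 (q z)) f),
  (fun z v => \sum_(p <- s) rankr (Ar z (p.1 (q z))) (p.2 (q z)) v); split.
  elim: s sP {sn} => [|p s IH] sP.
    by apply: near_compact_ext near_compact0 => *; rewrite big_nil.
  have [[s1 s2] sP'] := (List.Forall_cons_iff _ _ _).1 sP.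
  have := near_compactD _ (IH sP').
  move=> /(_ (fun z => rankl (Ar z (p.1 (q z))) (p.2 (q z)))
             (fun z => rankr (Ar z (p.1 (q z))) (p.2 (q z)))) H.
  apply: near_compact_ext (H _) => [*|*|]; rewrite ?big_cons//.
  apply: near_compact_rank; last exact: near_sec_base.
  by apply: na_secr AP _ _; exact: near_sec_base.
apply: filterS2 sn AM => z [h1 h2] [h3 h4]; split=> v.
  rewrite (eq_bigr (fun p : secpair => Ar z (rankr (p.1 (q z)) (p.2 (q z)) v))).
    have Arl : linear (Ar z) by case: AP.
    rewrite -(lin_sum _ _ _ Arl) -(linB Arl).
    by apply: le_trans (h3 _) _; rewrite -mulrA ler_wpM2l.
  by move=> p _; rewrite /rankr (na_rb AP).
rewrite (eq_bigr (fun p : secpair => rankl (p.1 (q z)) (p.2 (q z)) (Al z v))).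
  by apply: le_trans (h2 _) _; rewrite -mulrA mulrCA ler_wpM2l// ltW.
by move=> p _; rewrite /rankl (na_pr AP).
Qed.

(** [|eta><xi| T = |eta><T^< xi|], by adjointness. *)
Lemma near_compact_mulr Sl Sr Al Ar : near_adjointable Al Ar -> near_compact Sl Sr ->
  near_compact (fun z f => Al z (Sl z f)) (fun z v => Sr z (Ar z v)).
Proof.
move=> AP h; have [M M0 AM] := na_bounded AP.
apply: (@near_compact_approx _ _ M) => // d d0 _.
have [s sP sn] := h d d0.
exists (fun z f => \sum_(p <- s) rankl (p.1 (q z)) (Al z (p.2 (q z))) f),
  (fun z v => \sum_(p <- s) rankr (p.1 (q z)) (Al z (p.2 (q z))) v); split.
  elim: s sP {sn} => [|p s IH] sP.
    by apply: near_compact_ext near_compact0 => *; rewrite big_nil.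
  have [[s1 s2] sP'] := (List.Forall_cons_iff _ _ _).1 sP.
  have := near_compactD _ (IH sP').
  move=> /(_ (fun z => rankl (p.1 (q z)) (Al z (p.2 (q z))))
             (fun z => rankr (p.1 (q z)) (Al z (p.2 (q z))))) H.
  apply: near_compact_ext (H _) => [*|*|]; rewrite ?big_cons//.
  apply: near_compact_rank; first exact: near_sec_base.
  by apply: na_secl AP _ _; exact: near_sec_base.
apply: filterS2 sn AM => z [h1 h2] [h3 h4]; split=> v.
  rewrite (eq_bigr (fun p : secpair => rankr (p.1 (q z)) (p.2 (q z)) (Ar z v))).
    by apply: le_trans (h1 _) _; rewrite -mulrA mulrCA ler_wpM2l// ltW.
  by move=> p _; rewrite /rankr (na_pr AP).
rewrite (eq_bigr (fun p : secpair => Al z (rankl (p.1 (q z)) (p.2 (q z)) v))).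
  have All : linear (Al z) by case: AP.
  rewrite -(lin_sum _ _ _ All) -(linB All).
  by apply: le_trans (h4 _) _; rewrite -mulrA ler_wpM2l.
by move=> p _; rewrite /rankl (na_bl AP).
Qed.

End Near.

(** [locally_compact_op] uses sections of the pull-back fields, [near_compact] sections over the
    base; the former are locally approximable by the latter. *)
Lemma locally_compact_opP (Y : topologicalType) (p : Y -> obj G) Sl Sr :
  is_pair E -> continuous p ->
  locally_compact_op (p := p) Sl Sr <->
  forall y : Y, @near_compact Y (nbhs y) p Sl Sr.
Proof.
move=> EP pc; split=> [h y|h y e e0].
  apply: (@near_compact_approx _ _ _ _ Sl Sr 1) => // d d0 _.
  have [n [eta seta [xi sxi H]]] := h y d d0.
  exists (fun z f => \sum_(i < n) rankl (eta i z) (xi i z) f),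
    (fun z v => \sum_(i < n) rankr (eta i z) (xi i z) v); split.
    apply: near_compact_sum => i.
    apply: (@near_compact_rank _ _ p _ (p y)) => //; first exact: pc.
      by move/sec_pullP: (seta i); apply.
    by move/sec_pullP: (sxi i); apply.
  by rewrite /near_op_le mul1r.
have [s sP sn] := h y e e0.
exists (size s), (fun i z => (tnth (in_tuple s) i).1 (p z)).
  move=> i; apply/sec_pullP => z; apply: near_sec_base.
  have /List.Forall_forall/(_ (tnth (in_tuple s) i)) := sP.
  case=> //; elim: s i {sP sn} => [[]//|a s IH] i.
  case: (unliftP ord0 i) => [j|] ->; last by left; rewrite (tnth_nth a).
  right; have := IH j; rewrite !(tnth_nth a); exact.
exists (fun i z => (tnth (in_tuple s) i).2 (p z)).
  move=> i; apply/sec_pullP => z; apply: near_sec_base.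
  have /List.Forall_forall/(_ (tnth (in_tuple s) i)) := sP.
  case=> //; elim: s i {sP sn} => [[]//|a s IH] i.
  case: (unliftP ord0 i) => [j|] ->; last by left; rewrite (tnth_nth a).
  right; have := IH j; rewrite !(tnth_nth a); exact.
move: sn; apply: filterS => z [h1 h2]; split=> v.
  by have := h1 v; rewrite big_tnth.
by have := h2 v; rewrite big_tnth.
Qed.

End CompactOperators.

(** * Integration along Haar systems *)

Section UnitSpace.
Variable G : groupoid.

(** [gid] is continuous and injective into the Hausdorff space of arrows. *)
Lemma obj_hausdorff : hausdorff_space (obj G).
Proof.
move=> x y xy; rewrite -(rng_id x) -(rng_id y); congr rng; apply: (@arr_haus G).
move=> A B xA yB; have [] := xy (@gid G @^-1` A) (@gid G @^-1` B).
- exact: gid_cts xA.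
- exact: gid_cts yB.
- by move=> z [Az Bz]; exists (gid z).
Qed.

(** The image under [rng] of a compact neighbourhood of a unit is compact, and a neighbourhood
    because [rng] is open. *)
Lemma obj_locally_compact : locally_compact [set: obj G].
Proof.
move=> x _; rewrite withinET; have := @arr_lc G (gid x) I.
rewrite withinET => -[K xK [Kc Kcl]].
have Kc' : compact (@rng G @` K).
  by apply: continuous_compact Kc; apply: continuous_subspaceT; exact: rng_cts.
exists (@rng G @` K); last first.
  by split=> //; apply: compact_closed Kc'; exact: obj_hausdorff.
have : open_nbhs x (@rng G @` (interior K)).
  split; first by apply: rng_open; exact: open_interior.
  by exists (gid x); [exact: xK|exact: rng_id].
move/open_nbhs_nbhs; apply: filterS => _ [h Kh <-]; exists h => //.
exact: interior_subset.
Qed.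

Lemma rng_fibre_closed (x : obj G) : closed [set h : arr G | rng h = x].
Proof.
have -> : [set h : arr G | rng h = x] = @rng G @^-1` [set x] by [].
apply: closed_comp => [h _|]; first exact: rng_cts.
exact: accessible_closed_set1 (hausdorff_accessible obj_hausdorff) x.
Qed.

End UnitSpace.

Section HaarIntegral.
Variables (R : realType) (H : groupoid) (lam : haar_system R H).
Local Notation C := R[i].
Local Notation fibre x := [set h : arr H | rng h = x].

Lemma borel_open (x : obj H) (U : set (arr H)) :
  open U -> measurable (U : set (borel (gid x))).
Proof. by move=> Uo; apply: sub_sigma_algebra. Qed.

Lemma borel_closed (x : obj H) (U : set (arr H)) :
  closed U -> measurable (U : set (borel (gid x))).
Proof.
by move=> Uc; rewrite -[U]setCK; apply: measurableC; apply: borel_open; exact: closed_openC.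
Qed.

Lemma fibre_measurable (x : obj H) : measurable (fibre x : set (borel (gid x))).
Proof. apply: (@borel_closed x _); exact: rng_fibre_closed. Qed.

(** Continuity of the restriction to the fibre over [x]. The values elsewhere are arbitrary, because
    the integrands are only meaningful on the fibre. *)
Definition fibre_continuous (x : obj H) (f : arr H -> R) : Prop :=
  forall h0, rng h0 = x -> forall e : R, 0 < e ->
  \forall h \near h0, rng h = x -> `|f h - f h0| < e.

Definition fibre_support (x : obj H) (V : zmodType) (f : arr H -> V) : Prop :=
  exists2 K, compact K & forall h, rng h = x -> ~ K h -> f h = 0.

(** On the fibre, the preimage of an open interval is the trace of an open set: the interior of the
    set of arrows that satisfy the condition whenever they lie on the fibre. *)
Lemma fibre_continuous_measurable x f : fibre_continuous x f ->
  measurable_fun (fibre x : set (borel (gid x))) f.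
Proof.
move=> fc; apply: (measurability _ (measurable_realfun.RGenOpens.measurableE R)).
move=> _ [_ [a [b ->] <-]].
set I := [set` _].
have -> : fibre x `&` f @^-1` I = fibre x `&` (interior [set h | rng h = x -> I (f h)]).
  apply/seteqP; split=> h [hx Ih]; split=> //; last by exact: (interior_subset Ih).
  have /(nbhs_ballP (f h : R^o)) [e e0 eI] : nbhs (f h : R^o) I.
    by apply: open_nbhs_nbhs; split=> //; exact: interval_open.
  have := fc h hx e e0; apply: filterS => h' H' /H' h'e; apply: eI.
  by rewrite /ball /= distrC.
apply: measurableI; first exact: fibre_measurable.
apply: (@borel_open x _); exact: open_interior.
Qed.

Lemma fibre_integrable x f : fibre_continuous x f -> fibre_support x f ->
  (lam x).-integrable (fibre x) (EFin \o f).
Proof.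
move=> fc [K Kc fK].
have mK : measurable (K : set (borel (gid x))).
  by apply: (@borel_closed x _); apply: compact_closed => //; exact: arr_haus.
have mD := @fibre_measurable x.
have mDK : measurable (fibre x `&` K : set (borel (gid x))) by exact: measurableI.
suff h : (lam x).-integrable (fibre x `&` K) (EFin \o f).
  apply/integrable_mkcond => //; move/(integrable_mkcond _ mDK) : h.
  congr (_.-integrable _ _); apply/funext => h; rewrite !patchE.
  case: ifPn => [|hD]; first by rewrite in_setI => /andP[-> _].
  case: ifPn => // hD'; move: hD; rewrite in_setI hD'/= notin_setE => nK /=.
  by rewrite fK//; rewrite inE in hD'.
apply: measurable_bounded_integrable => //.
- have [+ _ _] := haar_radon lam x => /(_ _ Kc); apply: le_lt_trans.
  by apply: le_measure => //; rewrite ?inE//; exact: subIsetr.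
- by apply: measurable_funS (fibre_continuous_measurable fc) => // h [].
have DKc : compact (fibre x `&` K).
  by rewrite setIC; apply: compact_closedI => //; exact: rng_fibre_closed.
have [|n [M MP]] := compact_finite_cover (I := R)
  (Q := fun M h => rng h = x -> `|f h| <= M) DKc.
  move=> h0 [h0x _]; exists (`|f h0| + 1); have := fc h0 h0x 1 ltr01.
  apply: filterS => h + hx => /(_ hx) hh.
  have := ler_normD (f h0) (f h - f h0); rewrite addrC subrK => h1.
  by apply: le_trans h1 _; rewrite lerD// ltW.
exists (\sum_k `|M k|); split; first exact: num_real.
move=> r /ltW rM h /= [hx Kh]; have [k fk] := MP h (conj hx Kh).
apply: le_trans (fk hx) _; apply: le_trans rM; rewrite (bigD1 k)//=.
by apply: le_trans (ler_norm _) _; rewrite lerDl sumr_ge0.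
Qed.

(** The complement of the support is open, and inner regularity reduces its measure to that of
    compact subsets, each covered by finitely many open null sets. *)
Lemma haar_fibre_null x : lam x (~` fibre x) = 0%E.
Proof.
have oU : open (~` fibre x) by exact/closed_openC/rng_fibre_closed.
have [_ _ inner] := haar_radon lam x.
rewrite [LHS](inner _ oU); apply/eqP; rewrite eq_le; apply/andP; split; last first.
  by apply: ereal_sup_ubound; exists set0; rewrite ?measure0//; split=> //; exact: compact0.
apply: ge_ereal_sup => _ [K [Kc KU] <-].
have [|n [U UP]] := compact_finite_cover (I := {U : set (arr H) | open U /\ lam x U = 0%E})
  (Q := fun U y => sval U y) Kc.
  move=> y Ky; have : ~ msupport (lam x) y by rewrite (haar_supp lam x); exact: KU.
  move=> /existsNP[U /not_implyP[Uo /not_implyP[Uy /negP U0]]].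
  have {}U0 : lam x U = 0%E.
    by apply/eqP; rewrite eq_le measure_ge0 andbT leNgt.
  exists (exist _ U (conj Uo U0)) => /=; exact: open_nbhs_nbhs.
have [Vo V0] : open (\big[setU/set0]_(k < n) sval (U k)) /\
    lam x (\big[setU/set0]_(k < n) sval (U k)) = 0%E.
  elim/big_ind : _ => [|A B [Ao A0] [Bo B0]|k _]; last exact: svalP (U k).
    by split; [exact: open0|rewrite measure0].
  split; first exact: openU.
  apply/eqP; rewrite eq_le measure_ge0 andbT.
  have aux (a b c : \bar R) : a = 0%E -> b = 0%E -> (c <= a + b -> c <= 0)%E.
    by move=> -> ->; rewrite adde0.
  exact: aux A0 B0 (measureU2 (lam x) (@borel_open x _ Ao) (@borel_open x _ Bo)).
rewrite -V0; apply: le_measure.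
- by rewrite inE; apply: (@borel_closed x _); apply: compact_closed => //; exact: arr_haus.
- by rewrite inE; exact: borel_open.
- by move=> y /UP[k Uk]; rewrite -bigcup_seq; exists k => //=; rewrite mem_index_enum.
Qed.

Lemma Cc_fibre_continuous x (f : arr H -> R) : Cc f -> fibre_continuous x f.
Proof.
move=> [fc _] h0 _ e e0; have /cvgr_dist_lt/(_ e e0) := fc h0.
by apply: filterS => h hh _; rewrite distrC.
Qed.

Lemma Cc_fibre_support x (f : arr H -> R) : Cc f -> fibre_support x f.
Proof.
move=> [_ fK]; exists (closure [set x | f x != 0]) => // h _ nK.
by apply/eqP; apply: contrapT => /negP fh; apply: nK; exact: subset_closure.
Qed.

Lemma Cc_integrable x (f : arr H -> R) : Cc f ->
  (lam x).-integrable (fibre x) (EFin \o f).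
Proof. by move=> h; apply: fibre_integrable; [exact: Cc_fibre_continuous|exact: Cc_fibre_support]. Qed.

Definition hint x (f : arr H -> R) : R := (\int[lam x]_(h in fibre x) f h)%R.

(** Reconciles [haar_cts], which integrates over all arrows, with integrals over the fibre: the
    complement of the fibre is a null set. *)
Lemma hint_setT x f : Cc f -> hint x f = (\int[lam x]_(h in setT) f h)%R.
Proof.
move=> fC; rewrite /hint /Rintegral; congr fine.
have mf : measurable_fun [set: borel (gid x)] f.
  apply: (measurability _ (measurable_realfun.RGenOpens.measurableE R)).
  move=> _ [_ [a [b ->] <-]]; rewrite setTI; apply: (@borel_open x _).
  have /continuousP := proj1 fC; apply; exact: interval_open.
apply/esym; rewrite (negligible_integral (N := (~` fibre x : set (borel (gid x))))) ?setTD ?setCK//.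
- by apply: measurableC; exact: fibre_measurable.
- apply/integrableP; split; first exact/measurable_realfun.measurable_EFinP.
  rewrite (ge0_negligible_integral (N := (~` fibre x : set (borel (gid x)))))//; last first.
  + exact: haar_fibre_null.
  + have := measurableT_comp (@measurable_realfun.normr_measurable R setT) mf.
    by move/measurable_realfun.measurable_EFinP; congr (measurable_fun _ _); apply/funext => z.
  + by apply: measurableC; exact: fibre_measurable.
  rewrite setTD setCK.
  by have /integrableP[] := Cc_integrable x fC.
- exact: haar_fibre_null.
Qed.

Lemma hint_continuous f : Cc f -> continuous ((fun x => hint x f) : obj H -> R^o).
Proof.
move=> fC; have [+ _] := haar_cts lam fC.
have -> // : (fun x => \int[lam x]_a f a) = hint^~ f.
by apply/funext => x; rewrite hint_setT.
Qed.

Lemma hint_ge0 x f : (forall h, 0 <= f h) -> 0 <= hint x f.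
Proof. by move=> f0; apply: Rintegral_ge0. Qed.

(** The difference equals the sum of [chi_k (F - u_k)]: on [K] the [chi_k] add up to 1, and off [K]
    the function [F] vanishes. *)
Lemma partition_close (x : obj H) (V : normedModType C) (F : arr H -> V) (K : set (arr H))
    n (chi : 'I_n -> arr H -> R) (psi : arr H -> R) (u : 'I_n -> V) (e : R) :
  (forall h, rng h = x -> ~ K h -> F h = 0) -> 0 <= e ->
  (forall k h, 0 <= chi k h) -> (forall h, \sum_k chi k h <= psi h) ->
  (forall h, K h -> \sum_k chi k h = 1) ->
  (forall k h, chi k h != 0 -> rng h = x -> `|F h - u k| <= e%:C) ->
  forall h, rng h = x ->
    `|F h - \sum_k (chi k h)%:C *: u k| <= (e * psi h)%:C.
Proof.
move=> FK e0 chi0 chipsi chiK chiu h hx.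
have -> : F h - \sum_k (chi k h)%:C *: u k = \sum_k (chi k h)%:C *: (F h - u k).
  under [RHS]eq_bigr do rewrite scalerBr.
  rewrite sumrB -scaler_suml; congr (_ - _).
  rewrite -(rmorph_sum (real_complex R)).
  have [Kh|nK] := pselect (K h); first by rewrite chiK// scale1r.
  by rewrite FK// scaler0.
apply: le_trans (ler_norm_sum _ _ _) _.
apply: (@le_trans _ _ (\sum_k (chi k h * e)%:C)).
  apply: ler_sum => k _; rewrite normrZ rmorphM.
  have -> : `|(chi k h)%:C| = (chi k h)%:C by rewrite ger0_norm// lecR.
  have [->|ck] := eqVneq (chi k h) 0; first by rewrite !mul0r.
  by rewrite ler_wpM2l ?lecR//; exact: chiu.
by rewrite -rmorph_sum -mulr_suml lecR mulrC ler_wpM2l.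
Qed.

Section Vector.
Variables (x : obj H) (V : completeNormedModType C).

(** Continuity and compact support along the fibre. The vector [u] need not be [F h0]: it is
    typically the value of an approximating section, see [fibred_regular]. *)
Definition fibre_regular (F : arr H -> V) : Prop :=
  (forall h0, rng h0 = x -> forall e : C, 0 < e ->
    exists u, \forall h \near h0, rng h = x -> `|F h - u| <= e) /\
  fibre_support x F.

Definition weak_int (F : arr H -> V) (v : V) : Prop :=
  is_weak_integral (lam x) (fibre x) F v.

Lemma Re_le (z : C) : `|complex.Re z|%:C <= `|z|.
Proof.
case: z => a b; rewrite normc_def/= lecR -sqrtr_sqr.
by rewrite ler_wsqrtr// lerDl sqr_ge0.
Qed.

Lemma ReB (z w : C) : complex.Re (z - w) = complex.Re z - complex.Re w.
Proof. by case: z => a b; case: w. Qed.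

Lemma fibre_regular_functional (F : arr H -> V) (phi : {linear V -> C^o}) (M : C) :
  0 < M -> (forall u, `|phi u : C| <= M * `|u|) ->
  fibre_regular F -> fibre_continuous x (fun h => complex.Re (phi (F h) : C)).
Proof.
move=> M0 phiM [Fc _] h0 h0x e e0.
have d0 : 0 < e%:C / (M * 4) by rewrite divr_gt0 ?ltcR// mulr_gt0.
have [u uP] := Fc h0 h0x _ d0.
have u0 := nbhs_singleton uP h0x.
apply: filterS uP => h hP hx; have {}hP := hP hx.
rewrite -ltcR -ReB; apply: le_lt_trans (Re_le _) _.
rewrite -linearB; apply: le_lt_trans (phiM _) _.
rewrite -ltr_pdivlMl//; apply: le_lt_trans (ler_distD u _ _) _.
rewrite [`|u - _|]distrC.
apply: le_lt_trans (lerD hP u0) _.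
have -> : e%:C / (M * 4) + e%:C / (M * 4) = M^-1 * e%:C * (2 / 4).
  by field; rewrite gt_eqF.
rewrite gtr_pMr; last by rewrite mulr_gt0 ?invr_gt0 ?ltcR.
by rewrite ltr_pdivrMr// mul1r ltr_nat.
Qed.

Lemma continuous_functional_bounded (phi : {linear V -> C^o}) : continuous phi ->
  exists2 M : C, 0 < M & forall u, `|phi u : C| <= M * `|u|.
Proof.
move=> phic.
have /continuous_linear_bounded/linear_boundedP[M [Mreal MP]] := phic 0.
have M1 : 0 < `|M| + 1 by rewrite ltr_wpDl.
exists (`|M| + 1) => // u; apply: MP.
by apply: le_lt_trans (real_ler_norm Mreal) _; rewrite ltrDl.
Qed.

Lemma functional_support F (phi : {linear V -> C^o}) : fibre_support x F ->
  fibre_support x (fun h => complex.Re (phi (F h) : C)).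
Proof. by move=> [K Kc KF]; exists K => // h hx nK; rewrite KF// linear0. Qed.

Lemma functional_integrable F (phi : {linear V -> C^o}) : continuous phi ->
  fibre_regular F ->
  (lam x).-integrable (fibre x) (EFin \o (fun h => complex.Re (phi (F h) : C))).
Proof.
move=> /continuous_functional_bounded[M M0 phiM] Fr.
apply: fibre_integrable; first exact: (fibre_regular_functional M0 phiM Fr).
exact: functional_support Fr.2.
Qed.

Lemma Re_phi_sum n (chi : 'I_n -> R) (u : 'I_n -> V) (phi : {linear V -> C^o}) :
  complex.Re (phi (\sum_k (chi k)%:C *: u k) : C) =
  \sum_k chi k * complex.Re (phi (u k) : C).
Proof.
rewrite linear_sum /=; elim: (index_enum _) => [|k s IH]; first by rewrite !big_nil.
rewrite !big_cons -IH linearZ/= -[X in _ = _ * complex.Re X + _]/(_).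
case: (\sum_(i <- s) _) => c d.
by case: (phi (u k)) => a b; rewrite /GRing.scale/=; simpc.
Qed.

Lemma RintegralS n (chi : 'I_n -> arr H -> R) (r : 'I_n -> R) :
  (forall k, Cc (chi k)) ->
  hint x (fun h => \sum_k chi k h * r k) = \sum_k hint x (chi k) * r k.
Proof.
move=> chiC; rewrite /hint.
elim: (index_enum _) => [|k s IH].
  rewrite big_nil; under eq_Rintegral do rewrite big_nil.
  by rewrite Rintegral_cst ?mul0r//; exact: fibre_measurable.
rewrite big_cons -IH; under eq_Rintegral do rewrite big_cons.
have mD := @fibre_measurable x.
have intc : (lam x).-integrable (fibre x) (EFin \o (fun h => chi k h * r k)).
  by apply: Cc_integrable; apply: Cc_mul => // h; exact: cst_continuous.
rewrite RintegralD//; last first.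
  apply: (@Cc_integrable x (fun h => \sum_(j <- s) chi j h * r j)).
  by apply: Cc_sum => j; apply: Cc_mul => // h; exact: cst_continuous.
by rewrite RintegralZr//; exact: Cc_integrable.
Qed.

(** Applying [phi] pointwise turns the vector estimate into one between integrable real functions;
    the Riemann sum on the right is the integral of its own integrand. *)
Lemma functional_estimate F n (chi : 'I_n -> arr H -> R) (u : 'I_n -> V)
    (psi : arr H -> R) (e M : R) (phi : {linear V -> C^o}) :
  continuous phi -> 0 <= M -> (forall u, `|phi u : C| <= M%:C * `|u|) ->
  fibre_regular F -> (forall k, Cc (chi k)) -> Cc psi ->
  (forall h, rng h = x -> `|F h - \sum_k (chi k h)%:C *: u k| <= (e * psi h)%:C) ->
  `|(\int[lam x]_(h in fibre x) complex.Re (phi (F h) : C))%R -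
    complex.Re (phi (\sum_k (hint x (chi k))%:C *: u k) : C)| <= M * e * hint x psi.
Proof.
move=> phic M0 phiM Fr chiC psiC Fe.
have mD := @fibre_measurable x.
have ints : (lam x).-integrable (fibre x)
    (EFin \o (fun h => \sum_k chi k h * complex.Re (phi (u k) : C))).
  apply: Cc_integrable; apply: Cc_sum => k.
  by apply: Cc_mul => // h; exact: cst_continuous.
have intF := functional_integrable phic Fr.
have intB := integrableB mD intF ints.
rewrite Re_phi_sum -RintegralS// /hint -RintegralB//.
rewrite -RintegralZl//; last exact: Cc_integrable.
apply: le_trans (le_normr_Rintegral mD intB) _.
apply: le_Rintegral => //.
- by have := integrable_abse intB; congr (_.-integrable _ _); apply/funext => h.
- by apply: Cc_integrable; under eq_fun do rewrite mulrC; apply: Cc_mul => // h; exact: cst_continuous.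
move=> h hx; rewrite -Re_phi_sum -ReB -linearB.
rewrite -lecR; apply: le_trans (Re_le _) _; apply: le_trans (phiM _) _.
by rewrite -mulrA rmorphM ler_wpM2l ?lecR//; exact: Fe.
Qed.

(** A norming functional for the difference reduces the norm estimate to the scalar one. *)
Lemma weak_int_estimate F v n (chi : 'I_n -> arr H -> R) (u : 'I_n -> V)
    (psi : arr H -> R) (e : R) :
  fibre_regular F -> weak_int F v -> (forall k, Cc (chi k)) -> Cc psi ->
  (forall h, rng h = x -> `|F h - \sum_k (chi k h)%:C *: u k| <= (e * psi h)%:C) ->
  `|v - \sum_k (hint x (chi k))%:C *: u k| <= (e * hint x psi)%:C.
Proof.
move=> Fr Fv chiC psiC Fe.
set v' := \sum_k _.
have [phi [phic phi1 phiv]] := hahn_banach (v - v').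
have -> : `|v - v'| = (complex.Re (phi (v - v') : C))%:C.
  by rewrite phiv RRe_real// realE normr_ge0.
have := functional_estimate phic ler01 _ Fr chiC psiC Fe.
rewrite mul1r -(Fv _ phic) -ReB -linearB lecR => H1.
by apply: le_trans (ler_norm _) (H1 _) => w; rewrite mul1r.
Qed.

Lemma weak_int_uniq F v v' : weak_int F v -> weak_int F v' -> v = v'.
Proof.
move=> Fv Fv'; apply/eqP; rewrite -subr_eq0 -normr_eq0.
have [phi [phic phi1 phiv]] := hahn_banach (v - v').
have -> : `|v - v'| = (complex.Re (phi (v - v') : C))%:C.
  by rewrite phiv RRe_real// realE normr_ge0.
by rewrite linearB ReB (Fv _ phic) (Fv' _ phic) subrr.
Qed.

Lemma fibre_regular_sum n (chi : 'I_n -> arr H -> R) (u : 'I_n -> V) :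
  (forall k, Cc (chi k)) -> fibre_regular (fun h => \sum_k (chi k h)%:C *: u k).
Proof.
move=> chiC; split=> [h0 _ e e0|].
  exists (\sum_k (chi k h0)%:C *: u k).
  have uc : continuous (fun h => \sum_k (chi k h)%:C *: u k).
    elim: (index_enum _) => [|k s IH] h.
      by under eq_fun do rewrite big_nil; exact: cst_continuous.
    under eq_fun do rewrite big_cons.
    apply: cvgD; last exact: IH.
    apply/cvgrPdist_lt => d d0.
    have d'0 : 0 < d / (`|u k| + 1) by rewrite divr_gt0// ltr_wpDl.
    have [d' d'E] : exists d' : R, d / (`|u k| + 1) = d'%:C.
      by exists (complex.Re (d / (`|u k| + 1))); rewrite RRe_real// gtr0_real.
    rewrite d'E ltcR in d'0.
    have /cvgr_dist_lt/(_ _ d'0) := proj1 (chiC k) h.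
    apply: filterS => h'; rewrite -scalerBl normrZ -rmorphB/= => hh.
    have : `|(chi k h - chi k h')%:C| < d / (`|u k| + 1).
      by rewrite d'E normc_def/= expr0n/= addr0 sqrtr_sqr ltcR.
    rewrite ltr_pdivlMr ?ltr_wpDl//; apply: le_lt_trans.
    by rewrite ler_wpM2l// lerDl.
  have /cvgr_dist_lt/(_ _ e0) := uc h0.
  by apply: filterS => h /ltW + _; rewrite distrC.
exists (\bigcup_(k in [set: 'I_n]) closure [set x | chi k x != 0]).
  rewrite (_ : \bigcup_(_ in _) _ = \big[setU/set0]_(k < n) closure [set x | chi k x != 0]).
    by apply: bigsetU_compact => k _; case: (chiC k).
  by rewrite -bigcup_seq; apply: eq_bigcupl; split=> k //= _; rewrite mem_index_enum.
move=> h _ nK; rewrite big1// => k _.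
have [->|ck] := eqVneq (chi k h) 0; first by rewrite scale0r.
by exfalso; apply: nK; exists k => //; exact: subset_closure.
Qed.

Lemma weak_int_sum n (chi : 'I_n -> arr H -> R) (u : 'I_n -> V) :
  (forall k, Cc (chi k)) -> weak_int (fun h => \sum_k (chi k h)%:C *: u k)
    (\sum_k (hint x (chi k))%:C *: u k).
Proof.
move=> chiC phi phic; rewrite Re_phi_sum -RintegralS//.
by apply: eq_Rintegral => h _; rewrite Re_phi_sum.
Qed.

(** Riemann sums for partitions of unity: two sums of mesh [e] and [e'] differ by at most [(e + e')]
    times the integral of the common [psi], so they generate a Cauchy filter. Its limit has the
    right integrals by [functional_estimate]. *)
Lemma weak_int_exists F : fibre_regular F -> exists v, weak_int F v.
Proof.
move=> Fr; have [Fc [K Kc FK]] := Fr.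
have [psi [psiC psi0 part]] := partition_cutoff R (@arr_lc H) (@arr_haus H) Kc.
pose P (e : R) v := exists n (chi : 'I_n -> arr H -> R) (u : 'I_n -> V),
  [/\ forall k, Cc (chi k), forall h, rng h = x ->
      `|F h - \sum_k (chi k h)%:C *: u k| <= (e * psi h)%:C &
      v = \sum_k (hint x (chi k))%:C *: u k].
have Pex (e : R) : 0 < e -> exists v, P e v.
  move=> e0.
  have [|n [u [chi [cC c0 cp cK /(_ tt I) cQ]]]] := part V unit (globally setT)
    (fun u _ h => rng h = x -> `|F h - u| <= e%:C).
    move=> h0 _; have [h0x|h0x] := pselect (rng h0 = x).
      have [|u uP] := Fc h0 h0x e%:C; first by rewrite ltcR.
      exists u, ([set h | rng h = x -> `|F h - u| <= e%:C], setT) => //=.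
      by move=> [h []] [].
    exists 0, (~` fibre x, setT) => /=; last by move=> [h []] [].
    split=> //; apply: open_nbhs_nbhs; split=> //.
    exact/closed_openC/rng_fibre_closed.
  exists (\sum_k (hint x (chi k))%:C *: u k), n, chi, u; split=> //.
  exact: (partition_close FK (ltW e0)).
have Pdist e e' v v' : P e v -> P e' v' -> `|v - v'| <= ((e + e') * hint x psi)%:C.
  move=> [n [chi [u [cC cF ->]]]] [n' [chi' [u' [cC' cF' ->]]]].
  apply: weak_int_estimate (fibre_regular_sum u cC) (weak_int_sum u cC) cC' psiC _.
  move=> h hx; rewrite mulrDl rmorphD/=.
  by apply: le_trans (ler_distD (F h) _ _) _; rewrite lerD ?cF'// distrC cF.
pose Fl : set_system V := filter_from [set e : R | 0 < e]
  (fun e => [set v | exists2 e', 0 < e' <= e & P e' v]).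
have PFl : ProperFilter Fl.
  apply: filter_from_proper; last first.
    by move=> e /= e0; have [v Pv] := Pex e e0; exists v, e => //; rewrite e0 lexx.
  apply: filter_from_filter; first by exists 1 => /=.
  move=> d e d0 e0; exists (Num.min d e) => /=; first by rewrite lt_min d0.
  move=> v [e' /andP[e'0]]; rewrite le_min => /andP[h1 h2] Pv.
  by split; exists e'; rewrite ?e'0.
have hp0 : 0 < hint x psi + 1 by rewrite ltr_wpDl// hint_ge0.
have Fc' : cauchy Fl.
  apply/cauchy_ballP => e e0.
  have [er erE] : exists r : R, e = r%:C by exists (complex.Re e); rewrite RRe_real// gtr0_real.
  rewrite erE ltcR in e0.
  pose d := er / 2 / (hint x psi + 1).
  have d0 : 0 < d by rewrite !divr_gt0.
  exists ([set v | exists2 e', 0 < e' <= d & P e' v], [set v | exists2 e', 0 < e' <= d & P e' v]).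
    by split; exists d.
  move=> [v v'] /= [[e1 /andP[e10 e1d] Pv] [e2 /andP[e20 e2d] Pv']].
  rewrite -ball_normE/= erE; apply: le_lt_trans (Pdist _ _ _ _ Pv Pv') _.
  rewrite ltcR; apply: (@le_lt_trans _ _ ((d + d) * hint x psi)).
    by rewrite ler_wpM2r ?hint_ge0// lerD.
  have -> : (d + d) * hint x psi = er * (hint x psi / (hint x psi + 1)).
    by rewrite /d; field; rewrite gt_eqF.
  by rewrite gtr_pMr// ltr_pdivrMr// mul1r ltrDl.
have /cvg_ex[v vP] : cvg Fl by apply: cauchy_cvg.
exists v => phi phic.
have [M' M'0 phiM] := continuous_functional_bounded phic.
have [M ME] : exists r : R, M' = r%:C by exists (complex.Re M'); rewrite RRe_real// gtr0_real.
rewrite ME ltcR in M'0; rewrite ME in phiM.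
apply/eqP; rewrite -subr_eq0 -normr_le0; apply/ler_addgt0Pl => e e0; rewrite addr0.
pose d := e / 2 / M; have d0 : 0 < d by rewrite !divr_gt0.
pose d' := e / 2 / M / (hint x psi + 1); have d'0 : 0 < d' by rewrite !divr_gt0.
have vd : Fl [set v' | `|v - v'| < d%:C].
  have dC : (0 : C) < d%:C by rewrite ltcR.
  by apply: vP; have := nbhsx_ballx v _ dC; rewrite -ball_normE.
have [v' [vv' [e' /andP[e'0 e'd] [n [chi [u [cC cF v'E]]]]]]] :
    exists v', `|v - v'| < d%:C /\ exists2 e', 0 < e' <= d' & P e' v'.
  apply: (@filter_ex _ Fl); apply: filterI => //; by exists d'.
have := functional_estimate phic (ltW M'0) phiM Fr cC psiC cF.
rewrite -v'E => H1.
rewrite [e]splitr; apply: le_trans (ler_distD (complex.Re (phi v' : C)) _ _) _.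
rewrite lerD//.
  rewrite -ReB -linearB -lecR; apply: le_trans (Re_le _) _; apply: le_trans (phiM _) _.
  have -> : (e / 2)%:C = M%:C * d%:C :> C.
    by rewrite -rmorphM/=; congr (_%:C); rewrite /d; field; rewrite gt_eqF.
  by rewrite ler_wpM2l ?lecR ?(ltW M'0)// ltW.
rewrite distrC; apply: le_trans H1 _.
apply: (@le_trans _ _ (M * d' * (hint x psi + 1))).
  by rewrite ler_pM ?mulr_ge0 ?hint_ge0 ?ler_wpM2l ?lerDl// ltW.
have -> // : M * d' * (hint x psi + 1) = e / 2.
by rewrite /d'; field; rewrite !gt_eqF.
Qed.

(** The norm of [v] is attained at a functional of norm at most 1, which can be moved under the
    integral. *)
Lemma weak_int_norm F v (g : arr H -> R) : fibre_regular F -> weak_int F v ->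
  (lam x).-integrable (fibre x) (EFin \o g) ->
  (forall h, rng h = x -> `|F h| <= (g h)%:C) ->
  `|v| <= (hint x g)%:C.
Proof.
move=> Fr Fv gi Fg; have [phi [phic phi1 phiv]] := hahn_banach v.
have -> : `|v| = (complex.Re (phi v : C))%:C by rewrite phiv RRe_real// realE normr_ge0.
rewrite lecR (Fv _ phic); apply: le_Rintegral => //.
- exact: fibre_measurable.
- exact: functional_integrable.
move=> h hx; rewrite -lecR; apply: le_trans (Fg h hx); apply: le_trans (phi1 _).
by apply: le_trans (Re_le _); rewrite lecR ler_norm.
Qed.

Lemma weak_int_ext F F' v : (forall h, rng h = x -> F h = F' h) ->
  weak_int F v -> weak_int F' v.
Proof.
move=> FF' Fv phi phic; rewrite (Fv _ phic); apply: eq_Rintegral => h.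
by rewrite inE /= => hx; rewrite FF'.
Qed.

Lemma weak_int_lin F F' a v v' : fibre_regular F -> fibre_regular F' ->
  weak_int F v -> weak_int F' v' -> weak_int (fun h => a *: F h + F' h) (a *: v + v').
Proof.
move=> Fr Fr' Fv Fv'.
have FvZ (b : C) : weak_int (fun h => b *: F h) (b *: v).
  move=> phi phic.
  pose p : V -> C^o := fun u => phi (b *: u).
  have pl : linear p by move=> t u u'; rewrite /p scalerDr linearD !scalerA mulrC -scalerA linearZ.
  pose phi' : {linear V -> C^o} := HB.pack p (GRing.isLinear.Build _ _ _ _ p pl).
  apply: (Fv phi') => w.
  by apply: continuous_comp; [exact: scaler_continuous|exact: phic].
move=> phi phic; rewrite linearD.
have ReD (z w : C) : complex.Re (z + w) = complex.Re z + complex.Re w by case: z => ? ?; case: w.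
rewrite ReD (FvZ a _ phic) (Fv' _ phic) -RintegralD.
- by apply: eq_Rintegral => h _; rewrite linearD ReD.
- exact: fibre_measurable.
- apply: functional_integrable => //.
  have [Fc [K Kc FK]] := Fr; split; last by exists K => // h hx nK; rewrite FK// scaler0.
  move=> h0 h0x e e0; have d0 : 0 < e / (`|a| + 1) by rewrite divr_gt0// ltr_wpDl.
  have [u uP] := Fc h0 h0x _ d0; exists (a *: u); apply: filterS uP => h + hx.
  move=> /(_ hx); rewrite ler_pdivlMr ?ltr_wpDl// => ue.
  by rewrite -scalerBr normrZ mulrC; apply: le_trans ue; rewrite ler_wpM2l// lerDl.
- exact: functional_integrable.
Qed.

End Vector.

Lemma weak_int_map (x : obj H) (V W : completeNormedModType C) (L : V -> W) (M : C) F v :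
  linear L -> (forall u, `|L u| <= M * `|u|) ->
  weak_int x F v -> weak_int x (fun h => L (F h)) (L v).
Proof.
move=> Ll LM Fv phi phic.
pose p : V -> C^o := fun u => phi (L u).
have pl : linear p by move=> t u u'; rewrite /p Ll linearD linearZ.
pose phi' : {linear V -> C^o} := HB.pack p (GRing.isLinear.Build _ _ _ _ p pl).
apply: (Fv phi').
have [N N0 phiN] := continuous_functional_bounded phic.
apply/(@continuous_distP _ _ C^o) => t e e0.
have h0 : 0 < N * (`|M| + 1) by rewrite mulr_gt0// ltr_wpDl.
have d0 : 0 < e / (N * (`|M| + 1)) by rewrite divr_gt0.
have : \forall s \near t, `|t - s| < e / (N * (`|M| + 1)) by apply: cvgr_dist_lt d0; exact: cvg_id.
apply: filterS => s; rewrite ltr_pdivlMr// => ts.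
rewrite -linearB; apply: le_lt_trans (phiN (L (t - s))) _.
apply: le_lt_trans ts; rewrite mulrCA ler_wpM2l ?(ltW N0)//.
apply: le_trans (real_bound LM _) _.
by rewrite mulrC ler_wpM2l// lerDl.
Qed.

Lemma fibre_regular_map (x : obj H) (V W : completeNormedModType C) (L : V -> W) (M : C) F :
  linear L -> (forall u, `|L u| <= M * `|u|) ->
  fibre_regular x F -> fibre_regular x (fun h => L (F h)).
Proof.
move=> Ll LM [Fc [K Kc FK]].
split; last by exists K => // h hx nK; rewrite FK// lin0.
move=> h0 h0x e e0; have d0 : 0 < e / (`|M| + 1) by rewrite divr_gt0// ltr_wpDl.
have [u uP] := Fc h0 h0x _ d0; exists (L u); apply: filterS uP => h + hx.
move=> /(_ hx); rewrite ler_pdivlMr ?ltr_wpDl// => ue.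
rewrite -(linB Ll); apply: le_trans (real_bound LM _) _; apply: le_trans ue.
by rewrite mulrC ler_wpM2l// lerDl.
Qed.

Lemma gmul_near (g a0 : arr H) (U : set (arr H)) : rng a0 = src g ->
  nbhs (gmul g a0) U -> \forall a \near a0, rng a = src g -> U (gmul g a).
Proof.
move=> ag gU; have [[S1 S2] /= [gS1 aS2] S] :=
  within_continuous_near (@gmul_cts H) (esym ag : [set p | src p.1 = rng p.2] (g, a0)) gU.
apply: filterS aS2 => a aS ag'; apply: (S (g, a)); first by split=> //=; exact: nbhs_singleton.
exact/esym.
Qed.

Lemma fibre_continuous_shift (g : arr H) (f : arr H -> R) :
  fibre_continuous (rng g) f -> fibre_continuous (src g) (fun a => f (gmul g a)).
Proof.
move=> fc a0 a0g e e0.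
have := fc (gmul g a0) _ e e0; rewrite rng_mul// => /(_ erefl)/(gmul_near a0g).
by apply: filterS => a + ag => /(_ ag); rewrite rng_mul//; apply.
Qed.

Lemma fibre_support_shift (g : arr H) (V : zmodType) (f : arr H -> V) :
  fibre_support (rng g) f -> fibre_support (src g) (fun a => f (gmul g a)).
Proof.
move=> [K Kc fK]; exists ((fun a => gmul (ginv g) a) @` (K `&` fibre (rng g))).
  apply: continuous_compact; last first.
    by apply: compact_closedI => //; exact: rng_fibre_closed.
  apply/subspace_continuousP => a [_ ag] U gU.
  rewrite /= in ag; have ag' : rng a = src (ginv g) by rewrite src_inv.
  have := gmul_near ag' gU; rewrite src_inv => n.
  suff : nbhs a (fun z => (K `&` fibre (rng g)) z -> U (gmul (ginv g) z)) by [].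
  by apply: filterS n => z zP [_ zg]; exact: zP.
move=> a ag nK; apply: fK; rewrite ?rng_mul// => Kga; apply: nK.
exists (gmul g a); first by split=> //=; rewrite rng_mul.
by rewrite gmulA ?src_inv// gmulVl -ag gmul1l.
Qed.

(** [haar_inv] speaks of [Cc] functions on all arrows, while the integrands are continuous only
    along a fibre. This approximates the latter by the former, with one [psi] for all [e]. *)
Lemma Cc_approx (x : obj H) (f : arr H -> R) :
  fibre_continuous x f -> fibre_support x f ->
  exists psi, Cc psi /\ forall e : R, 0 < e -> exists2 s, Cc s &
    forall h, rng h = x -> `|f h - s h| <= e * psi h.
Proof.
move=> fc [K Kc fK].
have [psi [psiC psi0 part]] := partition_cutoff R (@arr_lc H) (@arr_haus H) Kc.
exists psi; split=> // e e0.
have [|n [u [chi [cC c0 cp cK /(_ tt I) cQ]]]] := part R unit (globally setT)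
    (fun u _ h => rng h = x -> `|f h - u| <= e).
  move=> h0 _; have [h0x|h0x] := pselect (rng h0 = x).
    exists (f h0), ([set h | rng h = x -> `|f h - f h0| <= e], setT) => //=.
      by split=> //; have := fc h0 h0x e e0; apply: filterS => h + hx => /(_ hx)/ltW.
    by move=> [h []] [].
  exists 0, (~` fibre x, setT) => /=; last by move=> [h []] [].
  split=> //; apply: open_nbhs_nbhs; split=> //.
  exact/closed_openC/rng_fibre_closed.
exists (fun h => \sum_k chi k h * u k).
  by apply: Cc_sum => k; apply: Cc_mul => // h; exact: cst_continuous.
have RCn (r : R) : `|r%:C : C| = `|r|%:C by rewrite normc_def/= expr0n/= addr0 sqrtr_sqr.
move=> h hx; have := @partition_close x C^o (fun h => (f h)%:C) K n chi psi
  (fun k => (u k)%:C) e.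
move=> /(_ _ (ltW e0) c0 cp cK); rewrite -lecR -RCn rmorphB rmorph_sum.
have -> : \sum_(i < n) (chi i h * u i)%:C = \sum_(i < n) (chi i h)%:C *: ((u i)%:C : C^o).
  by apply: eq_bigr => k _; rewrite rmorphM.
apply=> // [k hk nK|k k' ck kx]; first by rewrite fK.
by rewrite -rmorphB [`|_|]RCn lecR; exact: cQ.
Qed.

(** Left invariance passes to the limit in [Cc_approx]: the error on either side is controlled by
    the integral of [psi], which is the same on both sides because [psi] is in [Cc]. *)
Lemma haar_inv_fibre (g : arr H) (f : arr H -> R) :
  fibre_continuous (rng g) f -> fibre_support (rng g) f ->
  hint (rng g) f = hint (src g) (fun a => f (gmul g a)).
Proof.
move=> fc fs; have [psi [psiC app]] := Cc_approx fc fs.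
have close (x : obj H) (f1 s1 psi1 : arr H -> R) (e : R) : fibre_continuous x f1 ->
    fibre_support x f1 -> fibre_continuous x s1 -> fibre_support x s1 ->
    fibre_continuous x psi1 -> fibre_support x psi1 ->
    (forall h, rng h = x -> `|f1 h - s1 h| <= e * psi1 h) ->
    `|hint x f1 - hint x s1| <= e * hint x psi1.
  move=> f1c f1s s1c s1s p1c p1s H1.
  have fi := fibre_integrable f1c f1s; have si := fibre_integrable s1c s1s.
  have pi := fibre_integrable p1c p1s; have mD := @fibre_measurable x.
  rewrite /hint -RintegralB// -RintegralZl//.
  have intB := integrableB mD fi si.
  apply: le_trans (le_normr_Rintegral mD intB) _.
  apply: le_Rintegral => //.
    by have := integrable_abse intB; congr (_.-integrable _ _); apply/funext => h.
  by have := integrableZl mD e pi; congr (_.-integrable _ _); apply/funext => h.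
have Cs := fun f fC => conj (@Cc_fibre_continuous (rng g) f fC) (@Cc_fibre_support (rng g) f fC).
have [pc ps] := Cs _ psiC.
have hpsi : hint (rng g) psi = hint (src g) (fun a => psi (gmul g a)) := haar_inv lam g psiC.
apply/eqP; rewrite -subr_eq0 -normr_le0; apply/ler_addgt0Pl => e e0; rewrite addr0.
have p0 : 0 < `|hint (rng g) psi| + 1 by rewrite ltr_wpDl.
have d0 : 0 < e / 2 / (`|hint (rng g) psi| + 1) by rewrite !divr_gt0.
have [s sC sf] := app _ d0; have [sc ss] := Cs _ sC.
have h1 := close _ _ _ _ _ fc fs sc ss pc ps sf.
have h2 := close _ _ _ _ _ (fibre_continuous_shift fc) (fibre_support_shift fs)
  (fibre_continuous_shift sc) (fibre_support_shift ss)
  (fibre_continuous_shift pc) (fibre_support_shift ps)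
  (fun a ag => sf (gmul g a) (rng_mul (esym ag))).
have hs : hint (rng g) s = hint (src g) (fun a => s (gmul g a)) := haar_inv lam g sC.
rewrite -hpsi -hs in h2.
have h3 : e / 2 / (`|hint (rng g) psi| + 1) * hint (rng g) psi <= e / 2.
  rewrite -mulrA ler_piMr ?divr_ge0 ?(ltW e0)//.
  rewrite mulrC ler_pdivrMr// mul1r; apply: le_trans (ler_norm _) _; by rewrite lerDl.
rewrite [e]splitr; apply: le_trans (ler_distD (hint (rng g) s) _ _) _.
by rewrite lerD//; [exact: le_trans h1 h3|rewrite distrC; exact: le_trans h2 h3].
Qed.
End HaarIntegral.

Lemma near_pair_swap (X Y : topologicalType) (x : X) (y : Y) (P : X -> Y -> Prop) :
  (\forall p \near (x, y), P p.1 p.2) -> \forall p \near (y, x), P p.2 p.1.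
Proof. by move=> [[A B] /= [hA hB] AB]; exists (B, A) => // -[b a] /= [? ?]; exact: (AB (a, b)). Qed.

(** * Pulled-back fields *)

Section EquivalenceTopology.
Variables (G H : groupoid) (Om : equivalence G H).
Implicit Types (w : pts Om) (h : arr H) (g : arr G).

Lemma rmv_near w0 h0 (U : set (pts Om)) : sig w0 = rng h0 -> nbhs (rmv w0 h0) U ->
  \forall p \near (w0, h0), sig p.1 = rng p.2 -> U (rmv p.1 p.2).
Proof.
move=> e wU; exact: (within_continuous_near (@rmv_cts _ _ Om)
  (e : [set p | sig p.1 = rng p.2] (w0, h0)) wU).
Qed.

Lemma lmv_near g0 w0 (U : set (pts Om)) : src g0 = rho w0 -> nbhs (lmv g0 w0) U ->
  \forall p \near (g0, w0), src p.1 = rho p.2 -> U (lmv p.1 p.2).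
Proof.
move=> e wU; exact: (within_continuous_near (@lmv_cts _ _ Om)
  (e : [set p | src p.1 = rho p.2] (g0, w0)) wU).
Qed.

Lemma near_pair2 (X Y : topologicalType) (x : X) (y : Y) (P : X * Y -> Prop) :
  (\forall p \near (x, y), P p) -> \forall y' \near y, P (x, y').
Proof.
by move=> [[S1 S2] /= [/nbhs_singleton h1 h2] S]; apply: filterS h2 => z hz; exact: S.
Qed.

Lemma rmvK w h : sig w = rng h -> rmv (rmv w h) (ginv h) = w.
Proof. by move=> e; rewrite -rmvM ?rng_inv// gmulVr -e rmv1. Qed.

Lemma rmv_inj w h h' : sig w = rng h -> sig w = rng h' -> rmv w h = rmv w h' -> h = h'.
Proof.
move=> e e' hh'.
have ss : src h = src h' by rewrite -(sig_rmv e) -(sig_rmv e') hh'.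
have s1 : src h' = rng (ginv h) by rewrite rng_inv.
have k : sig w = rng (gmul h' (ginv h)) by rewrite rng_mul.
have := rmv_free k; rewrite rmvM// -hh' rmvK// => /(_ erefl).
move=> kE; have : gmul (gmul h' (ginv h)) h = h'.
  by rewrite -gmulA ?src_inv// gmulVl ss gmul1r.
by rewrite kE e gmul1l.
Qed.

(** [rho] is a quotient map, so it suffices that the saturation of an open [V] is open. If [w1 h]
    lies in [V], then for [w'] near [w1] openness of [rng] supplies an arrow [k] near [h] with
    [rng k = sig w'], and [w' k] still lies in [V]. *)
Lemma nbhs_rho_image w0 (U : set (pts Om)) : nbhs w0 U ->
  nbhs (rho w0) (@rho _ _ Om @` U).
Proof.
rewrite nbhsE => -[V [Vo Vw0] VU].
have : open (@rho _ _ Om @` V).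
  apply: rho_quotient; rewrite openE => w1 [w Vw ww1].
  have [h w1h hw] := rho_orbit (esym ww1).
  have := rmv_near w1h; rewrite hw => /(_ V (open_nbhs_nbhs (conj Vo Vw))).
  case=> [[S1 S2] /= [S1w1 S2h] S].
  have : nbhs (rng h) (@rng H @` S2).
    move: S2h; rewrite nbhsE => -[V' [Vo' Vh'] VS2].
    have : open_nbhs (rng h) (@rng H @` V') by split; [exact: rng_open|exists h].
    by move/open_nbhs_nbhs; apply: filterS => _ [k Vk <-]; exists k => //; exact: VS2.
  rewrite -w1h => /(sig_cts (e := Om)) S3.
  have {}S3 : nbhs w1 (@sig _ _ Om @^-1` (@rng H @` S2)) := S3.
  suff : nbhs w1 (@rho _ _ Om @^-1` (@rho _ _ Om @` V)) by [].
  apply: filterS2 S1w1 S3 => w' S1w' [k S2k kw'].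
  exists (rmv w' k); last by rewrite rho_rmv.
  exact: (S (w', k)).
move=> Vo'; apply: (@filterS _ _ _ (@rho _ _ Om @` V)); first exact: image_subset.
by apply: open_nbhs_nbhs; split=> //; exists w0.
Qed.

(* This is the openness of [rho], see [nbhs_rho_image]. *)
Lemma near_descent (Y : topologicalType) (p : Y -> obj G) (y0 : Y) w0
    (P : Y -> pts Om -> Prop) : {for y0, continuous p} -> p y0 = rho w0 ->
  (\forall z \near (y0, w0), p z.1 = rho z.2 -> P z.1 z.2) ->
  \forall y \near y0, exists2 w, rho w = p y & P y w.
Proof.
move=> pc yw [[S1 S2] /= [S1y S2w] S].
have := nbhs_rho_image S2w; rewrite -yw => /pc S3.
have {}S3 : nbhs y0 (p @^-1` (@rho _ _ Om @` S2)) := S3.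
apply: filterS2 S1y S3 => y S1y' [w S2w' wy].
by exists w => //; apply: (S (y, w)).
Qed.

(** The projection to [arr H] of the compact set that properness of the action attaches to the
    product of [N] and [K]. *)
Lemma fibre_translate_compact (N K : set (pts Om)) : compact N -> compact K ->
  compact [set h : arr H | exists2 w, N w & sig w = rng h /\ K (rmv w h)].
Proof.
move=> Nc Kc; have NKc := compact_setX Nc Kc.
have := rmv_proper NKc; set S := (X in compact X) => Sc.
have -> : [set h : arr H | exists2 w, N w & sig w = rng h /\ K (rmv w h)] =
    (fun p : pts Om * arr H => p.2) @` S.
  apply/seteqP; split=> [h [w Nw [e Kwh]]|_ [[w h] /= [e [Nw Kw]] <-]].
    by exists (w, h).
  by exists w.
by apply: continuous_compact Sc; apply: continuous_subspaceT; exact: snd_cts.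
Qed.

(** Continuity at [w0] of the inverse of [h |-> w0 h]. By properness, the arrows moving [w0] into a
    compact neighbourhood form a compact set; by freeness, those other than the unit move [w0] to
    points that can be separated from it. *)
Lemma translate_near_unit w0 (P : arr H -> Prop) :
  (\forall h \near gid (sig w0), P h) ->
  \forall w \near w0, forall h, sig w0 = rng h -> rmv w0 h = w -> P h.
Proof.
move=> Punit; have := @pts_lc _ _ Om w0 I; rewrite withinET => -[K w0K [Kc Kcl]].
have c1 : compact [set w0] by exact: compact_set1.
have := fibre_translate_compact c1 Kc; set S := (X in compact X) => Sc.
have H1 : forall h, S h -> \forall h' \near h & w \near w0,
    sig w0 = rng h' -> rmv w0 h' = w -> P h'.
  move=> h [_ -> [e Kwh]].
  have [hu|hu] := pselect (h = gid (sig w0)).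
    rewrite hu; exists (P, setT) => /=; first by split=> //; exact: filterT.
    by move=> [h' w'] /= [].
  have ne : rmv w0 h <> w0.
    by move=> /(rmv_free e).
  have [[A B] /= [[hA w0B] AB]] : exists AB : set (pts Om) * set (pts Om),
      (nbhs (rmv w0 h) AB.1 /\ nbhs w0 AB.2) /\ AB.1 `&` AB.2 = set0.
    apply: contrapT => nAB; apply: ne; apply: (@pts_haus _ _ Om) => A B hA hB.
    apply: contrapT => /set0P/negP; rewrite negbK => /eqP AB0.
    by apply: nAB; exists (A, B).
  have n := near_pair2 (rmv_near e hA).
  exists ([set h' | sig w0 = rng h' -> A (rmv w0 h')], B) => //=.
  move=> [h' w'] /= [h'A w'B] e' ww'.
  have : (A `&` B) w' by split=> //; rewrite -ww'; exact: h'A.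
  by rewrite AB.
have := (compact_near_coveringP _).1 Sc _ (nbhs w0) (fun w h => sig w0 = rng h -> rmv w0 h = w -> P h) (nbhs_filter w0) H1.
apply: filterS2 w0K => w Kw Sw h e hw.
by apply: Sw => //; exists w0 => //; rewrite hw.
Qed.

End EquivalenceTopology.

(** * Integrals depending continuously on a parameter *)

Section FibredIntegral.
Variables (R : realType) (H : groupoid) (lam : haar_system R H).
Local Notation C := R[i].
Local Notation fibre x := [set h : arr H | rng h = x].
Variables (W : topologicalType) (q : W -> obj H).
Hypothesis qc : continuous q.

Definition fibred : W * arr H -> Prop := fun p => rng p.2 = q p.1.

(** Away from the fibred product the covering condition is locally void, so partitions of unity on
    the whole space of arrows can be used. *)
Lemma near_not_fibred w0 h0 : rng h0 <> q w0 ->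
  \forall p \near (h0, w0), ~ rng p.1 = q p.2.
Proof.
move=> ne; have [A [B [hA wB AB]]] : exists A B : set (obj H),
    [/\ nbhs (rng h0) A, nbhs (q w0) B & A `&` B = set0].
  apply: contrapT => nAB; apply: ne; apply: (@obj_hausdorff H) => A B hA wB.
  apply: contrapT => /set0P/negP; rewrite negbK => /eqP AB0.
  by apply: nAB; exists A, B.
exists (@rng H @^-1` A, q @^-1` B) => /=.
  by split; [exact: rng_cts hA|exact: qc wB].
move=> [h w] /= [hA' wB'] e; have : (A `&` B) (rng h) by split=> //; rewrite e.
by rewrite AB.
Qed.

Lemma hint_near (w0 : W) chi (e : R) : Cc chi -> 0 < e ->
  \forall w \near w0, `|hint lam (q w) chi - hint lam (q w0) chi| < e.
Proof.
move=> chiC e0; have /cvgr_dist_lt/(_ e e0) n := @hint_continuous R H lam _ chiC (q w0).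
have {}n : nbhs w0 (q @^-1` _) := qc n.
by apply: filterS n => w; rewrite /= distrC.
Qed.

Lemma hint_nearC (w0 : W) chi (e : C) : Cc chi -> 0 < e ->
  \forall w \near w0, `|(hint lam (q w) chi)%:C - (hint lam (q w0) chi)%:C| <= e.
Proof.
move=> chiC e0.
have [er erE] : exists r : R, e = r%:C by exists (complex.Re e); rewrite RRe_real// gtr0_real.
rewrite erE ltcR in e0; have := hint_near w0 chiC e0; apply: filterS => w.
by rewrite -rmorphB erE normc_def/= expr0n/= addr0 sqrtr_sqr lecR => /ltW.
Qed.

Section Sections.
Variables (E : bfield R (obj H)) (F : forall w, arr H -> E (q w)) (w0 : W).
Hypothesis Eu : is_usc_field E.

(** Joint continuity of the integrand in [(w, h)] on the fibred product, at the points over [w0]. *)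
Definition fibred_sec : Prop := forall h0, rng h0 = q w0 ->
  @near_sec R _ E _ (sub_nbhs (P := fibred) (w0, h0)) (fun z => q (sval z).1)
    (fun z => F (sval z).1 (sval z).2).

Definition fibred_support : Prop := exists2 K, compact K &
  \forall w \near w0, forall h, rng h = q w -> ~ K h -> F w h = 0.

Lemma fibred_regular : fibred_sec -> fibred_support -> fibre_regular (q w0) (F w0).
Proof.
move=> Fs [K Kc FK]; split; last by exists K => //; exact: nbhs_singleton FK.
move=> h0 h0x e e0; have [xi _ n] := Fs h0 h0x e e0.
exists (xi (q w0)); have := near_pair2 (n : \forall p \near (w0, h0), _).
by apply: filterS => h + hx => /(_ hx).
Qed.

(** At [w0] the integrand is approximated by a partition of unity with base sections as
    coefficients. The same partition works for [w] near [w0], and the integrals of its members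
    depend continuously on [q w]. *)
Lemma near_sec_integral (v : forall w, E (q w)) :
  fibred_sec -> fibred_support -> (forall w, fibre_regular (q w) (F w)) ->
  (forall w, weak_int lam (q w) (F w) (v w)) -> near_sec (nbhs w0) v.
Proof.
move=> Fs [K Kc FK] Fr Fv.
have [psi [psiC psi0 part]] := partition_cutoff R (@arr_lc H) (@arr_haus H) Kc.
(* [M] bounds the integral of [psi] for all [w] near [w0]; the summand 1 is the oscillation allowed
   by [hint_near]. *)
pose M := hint lam (q w0) psi + 1.
have M0 : 0 <= M by rewrite addr_ge0// hint_ge0.
apply: (@near_sec_scaled _ _ _ _ (nbhs w0) q _ _ M%:C); first by rewrite lecR.
move=> d d0 _.
have [dr drE] : exists r : R, d = r%:C by exists (complex.Re d); rewrite RRe_real// gtr0_real.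
rewrite drE ltcR in d0.
pose I := {xi : forall x, E x | sec E xi}.
have [|n [xi [chi [cC c0 cp cK cQ]]]] := part I _ (nbhs w0)
    (fun xi w h => rng h = q w -> `|F w h - sval xi (q w)| <= dr%:C) _.
  move=> h0 _; have [h0x|h0x] := pselect (rng h0 = q w0).
    have [|xi sxi n] := Fs h0 h0x dr%:C; first by rewrite ltcR.
    exists (exist _ xi sxi); have {}n : \forall p \near (w0, h0), fibred p ->
      `|F p.1 p.2 - xi (q p.1)| <= dr%:C by [].
    exact: (@near_pair_swap _ _ w0 h0 (fun w h => rng h = q w -> `|F w h - xi (q w)| <= dr%:C) n).
  exists (exist _ _ (sec_zero Eu)); have := near_not_fibred h0x.
  by apply: filterS => p np /np.
exists (fun w => \sum_k (hint lam (q w) (chi k))%:C *: sval (xi k) (q w)).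
  apply: near_sec_sum => //.
  move=> k; apply: (near_sec_scale (a := (hint lam (q w0) (chi k))%:C) _ (@qc w0) Eu).
  - by move=> e e0; apply: hint_nearC.
  - by apply: near_sec_base; exact: (svalP (xi k)).
apply: filterS3 FK cQ (hint_near w0 psiC ltr01) => w FKw cQw psiw.
have := weak_int_estimate (e := dr) (Fr w) (Fv w) cC psiC.
move=> /(_ (fun k => sval (xi k) (q w))) H1; apply: le_trans (H1 _) _.
  by apply: partition_close FKw (ltW d0) c0 cp cK _ => k h ck hx; exact: cQw.
rewrite drE -rmorphM lecR mulrC ler_wpM2r ?(ltW d0)// /M -lerBlDl.
by apply: le_trans (ler_norm _) (ltW _).
Qed.

End Sections.

Section Operators.
Variables (A B : galg R H) (E : kkdata A B) (EP : is_pair E).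
Variables (Fl : forall w, arr H -> lp E (q w) -> lp E (q w))
  (Fr : forall w, arr H -> rp E (q w) -> rp E (q w))
  (Sl : forall w, lp E (q w) -> lp E (q w)) (Sr : forall w, rp E (q w) -> rp E (q w))
  (w0 : W).

(** The argument of [near_sec_integral] with finite sums of rank-one operators in the role of
    sections. All estimates are relative to the norm of the vector, so one partition serves all
    vectors. *)
Lemma near_compact_integral :
  (forall h0, rng h0 = q w0 -> @near_compact R H A B E _
    (sub_nbhs (P := fibred) (w0, h0)) (fun z => q (sval z).1)
    (fun z => Fl (sval z).2) (fun z => Fr (sval z).2)) ->
  (exists2 K, compact K & \forall w \near w0, forall h, rng h = q w -> ~ K h ->
    (forall f, Fl h f = 0 :> lp E (q w)) /\ (forall v, Fr h v = 0 :> rp E (q w))) ->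
  (forall w (f : lp E (q w)), fibre_regular (q w) (fun h => Fl h f)) ->
  (forall w (v : rp E (q w)), fibre_regular (q w) (fun h => Fr h v)) ->
  (forall w (f : lp E (q w)), weak_int lam (q w) (fun h => Fl h f) (Sl f)) ->
  (forall w (v : rp E (q w)), weak_int lam (q w) (fun h => Fr h v) (Sr v)) ->
  near_compact (nbhs w0) Sl Sr.
Proof.
move=> Fs [K Kc FK] Flr Frr Flv Frv.
have [psi [psiC psi0 part]] := partition_cutoff R (@arr_lc H) (@arr_haus H) Kc.
pose M := hint lam (q w0) psi + 1.
have M0 : 0 <= M by rewrite addr_ge0// hint_ge0.
apply: (@near_compact_approx _ _ _ _ _ _ (nbhs w0) q _ _ _ M%:C); first by rewrite lecR.
move=> d d0 _.
have [dr drE] : exists r : R, d = r%:C by exists (complex.Re d); rewrite RRe_real// gtr0_real.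
rewrite drE ltcR in d0.
pose Lk (s : seq ((forall x, rp E x) * (forall x, lp E x))) x f :=
  \sum_(p <- s) rankl (p.1 x) (p.2 x) f.
pose Rk (s : seq ((forall x, rp E x) * (forall x, lp E x))) x v :=
  \sum_(p <- s) rankr (p.1 x) (p.2 x) v.
have [|n [s [chi [cC c0 cp cK cQ]]]] := part {s | base_pairs (E := E) s} _ (nbhs w0)
    (fun s w h => rng h = q w -> (forall v, `|Fr h v - Rk (sval s) (q w) v| <= dr%:C * `|v|) /\
      (forall f, `|Fl h f - Lk (sval s) (q w) f| <= dr%:C * `|f|)) _.
  move=> h0 _; have [h0x|h0x] := pselect (rng h0 = q w0).
    have [|s sP n] := Fs h0 h0x dr%:C; first by rewrite ltcR.
    exists (exist _ s sP); have {}n : \forall p \near (w0, h0), fibred p ->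
      (forall v, `|Fr p.2 v - Rk s (q p.1) v| <= dr%:C * `|v|) /\
      (forall f, `|Fl p.2 f - Lk s (q p.1) f| <= dr%:C * `|f|) by [].
    exact: (@near_pair_swap _ _ w0 h0 (fun w h => rng h = q w ->
      (forall v, `|Fr h v - Rk s (q w) v| <= dr%:C * `|v|) /\
      (forall f, `|Fl h f - Lk s (q w) f| <= dr%:C * `|f|)) n).
  exists (exist _ [::] (List.Forall_nil _)); have := near_not_fibred h0x.
  by apply: filterS => p np /np.
exists (fun w f => \sum_k (hint lam (q w) (chi k))%:C *: Lk (sval (s k)) (q w) f),
  (fun w v => \sum_k (hint lam (q w) (chi k))%:C *: Rk (sval (s k)) (q w) v); split.
  apply: near_compact_sum => k.
  apply: (near_compact_scale _ (@qc w0) EP (a := (hint lam (q w0) (chi k))%:C)).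
  - by move=> e e0; apply: hint_nearC.
  - by apply: base_pairs_compact; exact: (svalP (s k)).
apply: filterS3 FK cQ (hint_near w0 psiC ltr01) => w FKw cQw psiw.
have bound (n' : R) : 0 <= n' -> ((dr * n') * hint lam (q w) psi)%:C <= M%:C * d * n'%:C.
  move=> n'0; rewrite drE -!rmorphM lecR.
  have -> : M * dr * n' = dr * n' * M by ring.
  rewrite ler_wpM2l ?mulr_ge0 ?(ltW d0)// /M -lerBlDl.
  by apply: le_trans (ler_norm _) (ltW _).
split=> v; rewrite -(nrmE v).
  have := weak_int_estimate (e := dr * nrm v) (Frr w v) (Frv w v) cC psiC.
  move=> /(_ (fun k => Rk (sval (s k)) (q w) v)) H1; apply: le_trans (H1 _) (bound _ (nrm_ge0 v)).
  apply: partition_close (mulr_ge0 (ltW d0) (nrm_ge0 v)) c0 cp cK _.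
    by move=> h hx nK; have [_ ->] := FKw h hx nK.
  by move=> k h ck hx; rewrite rmorphM/= nrmE; have [+ _] := cQw k h ck hx; apply.
have := weak_int_estimate (e := dr * nrm v) (Flr w v) (Flv w v) cC psiC.
move=> /(_ (fun k => Lk (sval (s k)) (q w) v)) H1; apply: le_trans (H1 _) (bound _ (nrm_ge0 v)).
apply: partition_close (mulr_ge0 (ltW d0) (nrm_ge0 v)) c0 cp cK _.
  by move=> h hx nK; have [-> _] := FKw h hx nK.
by move=> k h ck hx; rewrite rmorphM/= nrmE; have [_ +] := cQw k h ck hx; apply.
Qed.

End Operators.
End FibredIntegral.

(** * Invariant sections obtained by averaging *)

Section PulledBackSections.
Variables (R : realType) (G H : groupoid) (Om : equivalence G H) (E : gspace R H).
Local Notation C := R[i].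
Local Notation fibre x := [set h : arr H | rng h = x].
Hypothesis HE : is_gspace E.

Lemma om_secP (s : forall g, om_space Om E g) :
  sec (om_space Om E) s <->
  forall w : pts Om, @near_sec R _ E _ (nbhs w) (@sig _ _ Om) (fun w => at_ (s (rho w)) erefl erefl).
Proof. exact: sec_pullP. Qed.

Lemma act_irr (a b : arr H) x y (hs : src a = x) (hr : rng a = y)
    (hs' : src b = x) (hr' : rng b = y) v : a = b -> @act R H E a x y hs hr v = @act R H E b x y hs' hr' v.
Proof. by move=> ab; subst b; rewrite (Prop_irrelevance hs hs') (Prop_irrelevance hr hr'). Qed.

Lemma at_norm_le g (e e' : om_space Om E g) w (wg : rho w = g) x (wx : sig w = x) :
  `|e - e'| = `|at_ e wg wx - at_ e' wg wx|.
Proof. by rewrite (omfib_normE _ wg wx). Qed.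

(** Coherence and freeness determine the family from its value at [w]: at [w' = w h] it is [h^-1 v],
    and [h] is unique. *)
Lemma om_at_onto w g x (wg : rho w = g) (wx : sig w = x) (v : E x) :
  exists e : om_space Om E g, at_ e wg wx = v.
Proof.
have h_of w' : rho w' = g -> {h | sig w = rng h /\ rmv w h = w'}.
  by move=> w'g; apply: cid; have [h ? ?] := rho_orbit (etrans wg (esym w'g)); exists h.
pose hh w' w'g := sval (h_of w' w'g).
have h1 w' w'g : src (ginv (hh w' w'g)) = x.
  by rewrite src_inv; have [<- _] := svalP (h_of w' w'g).
have h2 w' x' w'g (w'x' : sig w' = x') : rng (ginv (hh w' w'g)) = x'.
  by have [e1 e2] := svalP (h_of w' w'g); rewrite rng_inv -(sig_rmv e1) e2.
pose f : @Defs.family R G H Om E g := fun w' x' w'g w'x' => act (h1 w' w'g) (h2 w' x' w'g w'x') v.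
have fE w' x' w'g w'x' h (e1 : sig w = rng h) (e2 : rmv w h = w')
    (hs : src (ginv h) = x) (hr : rng (ginv h) = x') :
    f w' x' w'g w'x' = act hs hr v.
  apply: act_irr; congr ginv; have [e1' e2'] := svalP (h_of w' w'g).
  by apply: (rmv_inj e1' e1); rewrite e2'.
have fc : coherent f.
  move=> w' k x' y w'g w'x' wkg wky ks kr.
  have [h e1 e2] := rho_orbit (etrans wg (esym w'g)).
  have hk : src h = rng k by rewrite -(sig_rmv e1) e2 w'x' kr.
  have p1 : sig w = rng (gmul h k) by rewrite rng_mul.
  have p2 : rmv w (gmul h k) = rmv w' k by rewrite rmvM// e2.
  have i1 : src (ginv h) = x by rewrite src_inv -e1.
  have i2 : rng (ginv h) = x' by rewrite rng_inv hk.
  have j1 : src (ginv (gmul h k)) = x by rewrite src_inv -p1.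
  have j2 : rng (ginv (gmul h k)) = y by rewrite rng_inv src_mul.
  rewrite (fE _ _ _ _ h e1 e2 i1 i2) (fE _ _ _ _ _ p1 p2 j1 j2).
  have gk : gmul k (ginv (gmul h k)) = ginv h.
    rewrite ginvM//; rewrite gmulA; [|by rewrite rng_inv|by rewrite src_inv rng_inv].
    by rewrite gmulVr -hk -(rng_inv h) gmul1l.
  have m1 : src (gmul k (ginv (gmul h k))) = x by rewrite gk.
  have m2 : rng (gmul k (ginv (gmul h k))) = x' by rewrite gk.
  rewrite -(act_mul ks kr j1 j2 m1 m2 v).
  exact: act_irr.
exists (mkom fc) => /=.
have e1 : sig w = rng (gid (sig w)) by rewrite rng_id.
have hs : src (ginv (gid (sig w))) = x by rewrite ginv_id src_id.
have hr : rng (ginv (gid (sig w))) = x by rewrite ginv_id rng_id.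
rewrite (fE w x wg wx _ e1 (rmv1 w) hs hr).
have hs' : src (gid x) = x by rewrite src_id.
have hr' : rng (gid x) = x by rewrite rng_id.
rewrite (act_irr hs hr hs' hr') ?act_id// ginv_id; congr gid; exact: wx.
Qed.

Lemma om_at_inj w g x (wg : rho w = g) (wx : sig w = x) (e e' : om_space Om E g) :
  at_ e wg wx = at_ e' wg wx -> e = e'.
Proof.
move=> ee'; apply/eqP; rewrite -subr_eq0 -normr_eq0 (at_norm_le _ _ wg wx).
by rewrite ee' subrr normr0.
Qed.

Variable lam : haar_system R H.

Lemma weak_int_shift (V : completeNormedModType C) (g : arr H) x y
    (hs : src g = x) (hr : rng g = y) (F : arr H -> V) v :
  fibre_regular y F -> weak_int lam x (fun a => F (gmul g a)) v -> weak_int lam y F v.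
Proof.
subst x y => Fr Fv phi phic; rewrite (Fv _ phic); apply/esym.
have [M M0 phiM] := continuous_functional_bounded phic.
apply: haar_inv_fibre; first exact: fibre_regular_functional M0 phiM Fr.
by apply: functional_support; case: Fr.
Qed.

(** Left invariance of the Haar system turns equivariance of the integrands under left translation
    into coherence of the integrals. *)
Lemma average_exists g (F : forall w x, rho w = g -> sig w = x -> arr H -> E x) :
  (forall w x wg wx, fibre_regular x (F w x wg wx)) ->
  (forall w h x y (wg : rho w = g) (wx : sig w = x) (whg : rho (rmv w h) = g)
     (why : sig (rmv w h) = y) (hs : src h = y) (hr : rng h = x) k, rng k = y ->
     F w x wg wx (gmul h k) = act hs hr (F (rmv w h) y whg why k)) ->
  exists e : om_space Om E g, forall w x wg wx,
    weak_int lam x (F w x wg wx) (@at_ _ _ _ _ _ _ e w x wg wx).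
Proof.
move=> Fr Feq.
pose f : @Defs.family R G H Om E g := fun w x wg wx =>
  sval (cid (weak_int_exists lam (Fr w x wg wx))).
have fP w x wg wx : weak_int lam x (F w x wg wx) (f w x wg wx).
  exact: svalP (cid (weak_int_exists lam (Fr w x wg wx))).
have fc : coherent f.
  move=> w h x y wg wx whg why hs hr; apply: (weak_int_uniq (fP _ _ _ _)).
  apply: (weak_int_shift hs hr (Fr _ _ _ _)).
  apply: weak_int_ext (weak_int_map (M := 1) (act_linear hs hr) _ (fP (rmv w h) y whg why)).
    by move=> k ky; exact/esym/Feq.
  by move=> u; rewrite act_norm mul1r.
by exists (mkom fc).
Qed.

(** The form in which properness of the action enters for integrands: locally uniformly in [w], the
    function [h |-> f (w h)] has compact support. Compactly supported functions and cut-off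
    functions both have this property. *)
Definition proper_support (f : pts Om -> R) : Prop := forall w1 : pts Om,
  exists2 K, compact K & \forall w \near w1, forall h, rng h = sig w -> ~ K h -> f (rmv w h) = 0.

Lemma Cc_proper_support f : Cc f -> proper_support f.
Proof.
move=> [_ Kc] w1; have := @pts_lc _ _ Om w1 I; rewrite withinET => -[N w1N [Nc _]].
exists [set h : arr H | exists2 w, N w & sig w = rng h /\ closure [set x | f x != 0] (rmv w h)].
  exact: fibre_translate_compact.
apply: filterS w1N => w Nw h hw nK; apply/eqP; apply: contrapT => /negP fh.
by apply: nK; exists w => //; split=> //; exact: subset_closure.
Qed.

Lemma near_sec_real_scale (Z : Type) (F : set_system Z) (T : topologicalType) (t : Z -> T)
    (t0 : T) (q : Z -> obj H) (x0 : obj H) (f : T -> R) (K : bfield R (obj H))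
    (zeta : forall z, K (q z)) : is_usc_field K -> Filter F -> q @ F --> x0 -> t @ F --> t0 ->
  {for t0, continuous (f : T -> R^o)} -> near_sec F zeta ->
  near_sec F (fun z => (f (t z))%:C *: zeta z).
Proof.
move=> Ku FF qF tF fc; apply: (near_sec_scale (a := (f t0)%:C) FF qF Ku) => e e0.
have [er erE] : exists r : R, e = r%:C by exists (complex.Re e); rewrite RRe_real// gtr0_real.
rewrite erE ltcR in e0; have /cvgr_dist_lt/(_ er e0) n := fc.
have {}n : F (t @^-1` _) := tF _ n; apply: filterS n => z /=.
by rewrite -rmorphB erE normc_def/= expr0n/= addr0 sqrtr_sqr lecR distrC => /ltW.
Qed.

(* The integrand [chi(w h) h xi(src h)] that makes a section invariant. *)
Definition avg_integrand (chi : pts Om -> R) (xi : forall x, E x) w x (h : arr H) : E x :=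
  if pselect (rng h = x) is left hr then (chi (rmv w h))%:C *: act erefl hr (xi (src h))
  else 0.

Lemma fibred_src_cvg (w0 : pts Om) h0 : (fun z : {p | fibred (@sig _ _ Om) p} => (sval z).2) @ sub_nbhs (w0, h0) --> h0.
Proof. by have := @sub_nbhs_cvg _ _ (fibred (@sig _ _ Om)) snd (w0, h0) (@snd_cts _ _ _). Qed.

Lemma fibred_sig_cvg (w0 : pts Om) h0 : (fun z : {p | fibred (@sig _ _ Om) p} => sig (sval z).1) @ sub_nbhs (w0, h0) --> sig w0.
Proof.
apply: (@sub_nbhs_cvg _ _ (fibred (@sig _ _ Om)) (fun p => sig p.1) (w0, h0)).
by apply: continuous_comp; [exact: fst_cts|exact: sig_cts].
Qed.

Lemma fibred_rmv_cvg (w0 : pts Om) h0 : rng h0 = sig w0 ->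
  (fun z : {p | fibred (@sig _ _ Om) p} => rmv (sval z).1 (sval z).2) @ sub_nbhs (w0, h0) --> rmv w0 h0.
Proof.
move=> hw U wU; have n := rmv_near (esym hw) wU.
suff : \forall p \near (w0, h0), forall pp : fibred (@sig _ _ Om) p, U (rmv p.1 p.2) by [].
by apply: filterS n => p pU pp; exact/pU/esym.
Qed.

Lemma avg_integrand_sec chi xi (w0 : pts Om) : continuous (chi : pts Om -> R^o) ->
  sec E xi -> fibred_sec (q := @sig _ _ Om) (fun w => avg_integrand chi xi w (sig w)) w0.
Proof.
move=> chic sxi h0 hw0; have [Eu _] := HE.
pose Z := {p | fibred (@sig _ _ Om) p}.
pose F : set_system Z := sub_nbhs (w0, h0).
have h1 : near_sec F (fun z : Z => (chi (rmv (sval z).1 (sval z).2))%:C *: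
    act (g := (sval z).2) erefl (svalP z) (xi (src (sval z).2))).
  apply: (near_sec_real_scale (x0 := sig w0) (t0 := rmv w0 h0)) => //.
  - exact: fibred_sig_cvg.
  - exact: fibred_rmv_cvg.
  - exact: chic.
  apply: (near_sec_act (a0 := h0) (q := fun z : Z => src (sval z).2)) => //.
    exact: fibred_src_cvg.
  exact: near_sec_base.
move: h1; congr near_sec; apply: functional_extensionality_dep => -[[w h] /= hw].
rewrite /avg_integrand; case: pselect => // hr.
congr (_ *: act _ _ _); exact: Prop_irrelevance.
Qed.

Lemma avg_integrand_support chi xi (w0 : pts Om) : proper_support chi ->
  fibred_support (q := @sig _ _ Om) (fun w => avg_integrand chi xi w (sig w)) w0.
Proof.
move=> /(_ w0)[K Kc n]; exists K => //; apply: filterS n => w wK h hw nK.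
by rewrite /avg_integrand; case: pselect => // hr; rewrite wK// scale0r.
Qed.

Lemma avg_integrand_regular chi xi w x : sig w = x -> continuous (chi : pts Om -> R^o) ->
  proper_support chi -> sec E xi -> fibre_regular x (avg_integrand chi xi w x).
Proof.
move=> wx chic chip sxi; subst x; apply: (@fibred_regular R H (pts Om) (@sig _ _ Om) E
   (fun w => avg_integrand chi xi w (sig w)) w).
  exact: avg_integrand_sec.
exact: avg_integrand_support.
Qed.

(** Coherence of the average amounts to [(h k) xi = h (k xi)] together with [w (h k) = (w h) k] in
    the argument of [chi]. *)
Lemma avg_section chi xi : continuous (chi : pts Om -> R^o) -> proper_support chi -> sec E xi ->
  exists2 s, sec (om_space Om E) s & forall g w x (wg : rho w = g) (wx : sig w = x),
    weak_int lam x (avg_integrand chi xi w x) (at_ (s g) wg wx).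
Proof.
move=> chic chip sxi.
have ex g : exists e : om_space Om E g, forall w x wg wx,
    weak_int lam x (avg_integrand chi xi w x) (@at_ _ _ _ _ _ _ e w x wg wx).
  apply: (average_exists (F := fun w x wg wx => avg_integrand chi xi w x)).
    by move=> w x wg wx; exact: avg_integrand_regular.
  move=> w h x y wg wx whg why hs hr k ky.
  have hk : src h = rng k by rewrite hs ky.
  have wh : sig w = rng h by rewrite wx hr.
  rewrite /avg_integrand; case: pselect => [p1|]; last by rewrite rng_mul.
  case: pselect => [p2|//]; rewrite actZ rmvM//; congr (_ *: _).
  have p3 : src (gmul h k) = src k by rewrite src_mul.
  rewrite -(act_mul hs hr erefl p2 p3 p1 (xi (src k))).
  by case: _ / p3.
exists (fun g => sval (cid (ex g))); last first.
  by move=> g w x wg wx; exact: svalP (cid (ex g)) w x wg wx.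
apply/om_secP => w0; have [Eu _] := HE.
apply: (@near_sec_integral R H lam (pts Om) (@sig _ _ Om) (@sig_cts _ _ Om) E
  (fun w => avg_integrand chi xi w (sig w)) w0 Eu) => //.
- exact: avg_integrand_sec.
- exact: avg_integrand_support.
- by move=> w; exact: avg_integrand_regular.
- by move=> w; exact: svalP (cid (ex (rho w))) w (sig w) erefl erefl.
Qed.

(** [gid x] lies in the support of [lam x], and the mass of a neighbourhood of it is carried by the
    fibre, whose complement is null. *)
Lemma hint_gt0 x (f : arr H -> R) : fibre_continuous x f -> fibre_support x f ->
  (forall h, rng h = x -> 0 <= f h) -> 0 < f (gid x) -> 0 < hint lam x f.
Proof.
move=> fc fs f0 fx.
have e0 : 0 < f (gid x) / 2 by rewrite divr_gt0.
have n : nbhs (gid x) [set h | rng h = x -> `|f h - f (gid x)| < f (gid x) / 2].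
  exact: fc (gid x) (rng_id x) _ e0.
move: n; rewrite nbhsE => -[U [Uo Ux] UP].
have mU := @borel_open H x U Uo.
have mD := @fibre_measurable H x.
have mUD : measurable (fibre x `&` U : set (borel (gid x))) by exact: measurableI.
have fi := fibre_integrable lam fc fs.
have Upos : (0 < lam x U)%E.
  have : msupport (lam x) (gid x) by rewrite haar_supp /= rng_id.
  by apply.
have UDpos : (0 < lam x (fibre x `&` U))%E.
  have aux (a b c : \bar R) : (0 < a)%E -> b = 0%E -> (a <= c + b)%E -> (0 < c)%E.
    by move=> a0 ->; rewrite adde0; exact: lt_le_trans.
  apply: aux Upos (haar_fibre_null lam x) _.
  have mN : measurable (~` fibre x : set (borel (gid x))) by exact: measurableC.
  apply: le_trans (measureU2 (lam x) mUD mN); apply: le_measure; rewrite ?inE//.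
    exact: measurableU.
  by move=> h Uh; have [?|?] := pselect (rng h = x); [left|right].
have /integrableP[mf finf] := fi.
have fabs : (\int[lam x]_(h in fibre x) `|(EFin \o f) h| = \int[lam x]_(h in fibre x) (EFin \o f) h)%E.
  by apply: eq_integral => h; rewrite inE /= => hx; rewrite ger0_norm// f0.
rewrite fabs in finf.
apply: fine_gt0; rewrite finf andbT.
apply: (@lt_le_trans _ _ (\int[lam x]_(h in fibre x `&` U) cst (f (gid x) / 2)%:E h)%E).
  by rewrite integral_cst// mule_gt0.
apply: (@le_trans _ _ (\int[lam x]_(h in fibre x `&` U) (EFin \o f) h)%E).
  apply: ge0_le_integral => //.
  - by move=> h _; rewrite lee_fin ltW.
  - by apply: measurable_funS mf => // h [].
  - move=> h [hx Uh]; rewrite lee_fin; have := UP h Uh hx.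
    by rewrite ltr_norml => /andP[+ _]; lra.
by apply: ge0_subset_integral.
Qed.

Lemma weak_int_scale x (V : completeNormedModType C) (f : arr H -> R) (v : V) :
  fibre_continuous x f -> fibre_support x f ->
  weak_int lam x (fun h => (f h)%:C *: v) ((hint lam x f)%:C *: v).
Proof.
move=> fc fs phi phic; rewrite linearZ/=.
have ReZ (r : R) (z : C) : complex.Re (r%:C *: (z : C^o) : C) = r * complex.Re z.
  by case: z => a b; rewrite /GRing.scale/=; simpc.
rewrite ReZ -RintegralZr//; last first.
- exact: fibre_integrable.
- exact: fibre_measurable.
by apply: eq_Rintegral => h _; rewrite linearZ/= ReZ.
Qed.

Lemma fibre_regular_scale x (V : completeNormedModType C) (f : arr H -> R) (v : V) :
  fibre_continuous x f -> fibre_support x f ->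
  fibre_regular x (fun h => (f h)%:C *: v).
Proof.
move=> fc [K Kc fK]; split; last by exists K => // h hx nK; rewrite fK// scale0r.
move=> h0 h0x e e0; exists ((f h0)%:C *: v).
have d0 : 0 < e / (`|v| + 1) by rewrite divr_gt0// ltr_wpDl.
have [d dE] : exists d : R, e / (`|v| + 1) = d%:C.
  by exists (complex.Re (e / (`|v| + 1))); rewrite RRe_real// gtr0_real.
rewrite dE ltcR in d0; have := fc h0 h0x d d0; apply: filterS => h + hx.
move=> /(_ hx) hd; rewrite -scalerBl normrZ -rmorphB.
have : `|(f h - f h0)%:C : C| <= e / (`|v| + 1).
  by rewrite dE normc_def/= expr0n/= addr0 sqrtr_sqr lecR ltW.
rewrite ler_pdivlMr ?ltr_wpDl//; apply: le_trans.
by rewrite ler_wpM2l// lerDl.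
Qed.

Lemma translate_fibre_continuous (f : pts Om -> R) (w : pts Om) x : sig w = x ->
  continuous (f : pts Om -> R^o) -> fibre_continuous x (fun h => f (rmv w h)).
Proof.
move=> wx fc h0 h0x e e0; have /cvgr_dist_lt/(_ e e0) n := fc (rmv w h0).
have wh : sig w = rng h0 by rewrite h0x.
have := near_pair2 (rmv_near wh n); apply: filterS => h /= + hx.
by rewrite wx hx distrC => /(_ erefl).
Qed.

Lemma translate_fibre_support (f : pts Om -> R) (w : pts Om) x : sig w = x ->
  proper_support f -> fibre_support x (fun h => f (rmv w h)).
Proof.
move=> <- /(_ w)[K Kc n]; exists K => // h hw nK.
by apply: (nbhs_singleton n h _ nK).
Qed.

(** A section [xi] of [E] close to the component of [v] at [w0] is averaged against a bump function
    at [w0]. Only arrows near the unit contribute to the component at [w0], so after division by the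
    total weight [N] it is close to that of [v]. *)
Lemma om_dense g (v : om_space Om E g) (e : C) : 0 < e ->
  exists2 s, sec (om_space Om E) s & `|v - s g| < e.
Proof.
move=> e0; have [w0 w0g] := rho_onto Om g; have [Eu _] := HE.
pose x0 := sig w0; pose v0 : E x0 := at_ v w0g erefl.
have e40 : 0 < e / 4 by rewrite divr_gt0.
have [xi sxi v0xi] := sec_dense Eu v0 e40.
(* Near the unit [h xi (src h)] is compared with a section [xi'] that approximates it; the errors
   are [e/8] twice for passing through [xi'] and [e/4] for [xi] against [v0]. *)
have good : \forall h \near gid x0, forall hr : rng h = x0,
    `|act erefl hr (xi (src h)) - v0| <= e / 2.
  have s1 : @near_sec R _ E _ (nbhs (gid x0)) (@rng H)
      (fun h => act erefl erefl (xi (src h))).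
    apply: (near_sec_act (a0 := gid x0) (q := @src H)) => //.
    exact: near_sec_base.
  have e80 : 0 < e / 8 by rewrite divr_gt0.
  have [xi' _ n] := s1 _ e80.
  have id_act (a : arr H) x (p : src a = x) (q : rng a = x) : a = gid x ->
      act p q (xi x) = xi x by move=> aE; subst a; rewrite act_id.
  have n0 : `|xi x0 - xi' x0| <= e / 8.
    have := nbhs_singleton n; move: (erefl (src (gid x0))) (erefl (rng (gid x0))).
    move: {-2}(src (gid x0)) (src_id x0) => y yE; move: {-2}(rng (gid x0)) (rng_id x0) => z zE.
    by subst y z => p q; rewrite act_id.
  apply: filterS n => h n1 hr; subst x0.
  have eE : e / 2 = e / 8 + e / 8 + e / 4 by field.
  rewrite eE; apply: le_trans (ler_distD (xi (sig w0)) _ _) _; rewrite lerD//; last first.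
    by rewrite distrC ltW.
  apply: le_trans (ler_distD (xi' (sig w0)) _ _) _; rewrite lerD//; last by rewrite distrC.
  have aux y (p : rng h = y) : `|act erefl p (xi (src h)) - xi' y| <= e / 8.
    by case: _ / p.
  exact: aux.
(* From arrows near the unit to points near [w0]: a bump function at [w0] sees only good arrows. *)
have n := translate_near_unit good.
have [chi [chiC chi01 chi1 chiU]] := lc_bump R (@pts_lc _ _ Om) (@pts_haus _ _ Om) n.
have chip := Cc_proper_support chiC; have [chic _] := chiC.
have [s ss sP] := avg_section chic chip sxi.
have cc := translate_fibre_continuous (erefl x0) chic.
have cs := translate_fibre_support (erefl x0) chip.
pose N := hint lam x0 (fun h => chi (rmv w0 h)).
have N0 : 0 < N.
  apply: hint_gt0 => //; first by move=> h _; case/andP: (chi01 (rmv w0 h)).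
  by rewrite rmv1 chi1.
have NC0 : (0 : C) < N%:C by rewrite ltcR.
exists (fun g => N^-1%:C *: s g).
  by apply/om_secP => w; apply: near_secZ => //; move/om_secP: ss; apply.
rewrite (at_norm_le _ _ w0g erefl) -/v0 /=.
(* [N v0] minus the component of [s] is the integral of [chi (w0 h) (v0 - h xi (src h))], whose norm
   is at most [e/2] times [N]. *)
have wi := weak_int_lin (-1) (avg_integrand_regular erefl chic chip sxi)
  (fibre_regular_scale v0 cc cs) (sP g w0 x0 w0g erefl) (weak_int_scale v0 cc cs).
have wr : fibre_regular x0 (fun h => -1 *: avg_integrand chi xi w0 x0 h + (chi (rmv w0 h))%:C *: v0).
  have [r1 [K1 K1c r1s]] := avg_integrand_regular (erefl x0) chic chip sxi.
  have [r2 [K2 K2c r2s]] := fibre_regular_scale v0 cc cs.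
  split; last first.
    exists (K1 `|` K2); first exact: compactU.
    by move=> h hx /not_orP[n1 n2]; rewrite r1s// r2s// scaler0 addr0.
  move=> h0 h0x d d0; have d20 : 0 < d / 2 by rewrite divr_gt0.
  have [u1 n1] := r1 h0 h0x _ d20; have [u2 n2] := r2 h0 h0x _ d20.
  exists (- u1 + u2); apply: filterS2 n1 n2 => h + + hx => /(_ hx) h1 /(_ hx) h2.
  rewrite scaleN1r opprD addrACA -opprD; apply: le_trans (ler_normD _ _) _.
  by rewrite [d]splitr lerD// normrN.
have H0 := weak_int_norm wr wi (g := fun h => complex.Re (e / 2) * chi (rmv w0 h)).
have eR : (complex.Re (e / 2))%:C = e / 2 by rewrite RRe_real// gtr0_real// divr_gt0.
have ci := fibre_integrable lam cc cs; have mD := @fibre_measurable H x0.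
have H1 : `|-1 *: at_ (s g) w0g erefl + N%:C *: v0| <=
    (hint lam x0 (fun h => complex.Re (e / 2) * chi (rmv w0 h)))%:C.
  apply: H0.
    by have := integrableZl mD (complex.Re (e / 2)) ci; congr (_.-integrable _ _); apply/funext.
  move=> h hx; rewrite rmorphM/= eR /avg_integrand; case: pselect => // hr.
  have [->|c0] := eqVneq (chi (rmv w0 h)) 0.
    by rewrite mulr0 !scale0r scaler0 addr0 normr0.
  have H2 := chiU _ c0 h (esym hr) erefl hr.
  have cp : 0 <= chi (rmv w0 h) by case/andP: (chi01 (rmv w0 h)).
  rewrite scaleN1r -scalerN addrC -scalerDr normrZ mulrC.
  have -> : `|(chi (rmv w0 h))%:C : C| = (chi (rmv w0 h))%:C by rewrite ger0_norm// lecR.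
  by rewrite ler_wpM2r ?lecR//; rewrite distrC in H2.
have : `|N%:C *: (v0 - N^-1%:C *: at_ (s g) w0g erefl)| <= e / 2 * N%:C.
  rewrite scalerBr scalerA -rmorphM mulfV ?gt_eqF// scale1r addrC -scaleN1r.
  by apply: le_trans H1 _; rewrite /hint RintegralZl// rmorphM/= eR.
rewrite normrZ gtr0_norm// mulrC ler_pM2r// => H3.
by apply: le_lt_trans H3 _; rewrite ltr_pdivrMr// mulr_natr mulr2n ltrDl.
Qed.

End PulledBackSections.

(** * Pulled-back algebras and pairs *)

Section OmStructure.
Variables (R : realType) (G H : groupoid) (Om : equivalence G H) (lam : haar_system R H).
Local Notation C := R[i].

(** The norm of [s] over [rho w] is that of its component at [w], and upper semicontinuity over [Om]
    descends along the open map [rho]. *)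
Lemma om_section_usc (E : gspace R H) (HE : is_gspace E) (s : forall g, om_space Om E g)
    (g : obj G) (r : C) :
  sec (om_space Om E) s -> `|s g| < r -> \forall g' \near g, `|s g'| < r.
Proof.
move=> /om_secP ss sr; have [w0 w0g] := rho_onto Om g; have [Eu _] := HE.
have n := near_sec_usc Eu (nbhs_filter w0) (@nbhs_singleton _ w0) (@sig_cts _ _ Om w0) (ss w0).
have {}n : \forall w \near w0, `|at_ (s (rho w)) (erefl (rho w)) (erefl (sig w))| < r.
  apply: n; rewrite -omfib_normE; move: w0g sr; case: _ / => //.
have gc : {for g, continuous (@idfun (obj G))} by exact: cvg_id.
have nd := @near_descent G H Om (obj G) idfun g w0 (fun g w => `|s g| < r) gc (esym w0g).
have {nd} : \forall y \near g, exists2 w : pts Om, rho w = idfun y & `|s y| < r.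
  apply: nd; exists (setT, [set w | `|at_ (s (rho w)) (erefl (rho w)) (erefl (sig w))| < r]).
    by split=> //; exact: filterT.
  by move=> [y w] /= [_ H1] yw; subst y; rewrite (omfib_normE _ (erefl (rho w)) erefl).
by apply: filterS => y [].
Qed.

Lemma om_usc (E : gspace R H) : is_gspace E -> is_usc_field (om_space Om E).
Proof.
move=> HE; have [Eu _] := HE; split.
- by apply/om_secP => w; exact: near_sec0.
- move=> a s s' /om_secP h /om_secP h'; apply/om_secP => w.
  exact: near_sec_lin.
- by move=> g v e e0; have [s ss sv] := om_dense HE lam v e0; exists s.
- by move=> s ss g r; exact: om_section_usc.
move=> s sa; apply/om_secP => w0; apply: near_sec_approx => d d0.
have [s' /om_secP ss' n] := sa (rho w0) d d0.
exists (fun w => at_ (s' (rho w)) erefl erefl); first exact: ss'.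
have {}n : nbhs w0 (@rho _ _ Om @^-1` _) := @rho_cts _ _ Om w0 _ n.
by apply: filterS n => w /=; rewrite (at_norm_le _ _ (erefl (rho w)) (erefl (sig w))).
Qed.

Lemma at_section_irr (E : gspace R H) (s : forall g, om_space Om E g) w g g' x
    (wg : rho w = g) (wg' : rho w = g') (wx : sig w = x) : at_ (s g) wg wx = at_ (s g') wg' wx.
Proof. by subst g g'. Qed.

(** On pairs [(a, w)] with [rng a = rho w], the component at [w] of [a s(src a)] is that of [s] at
    [a^-1 w], a point with the same [sig]. So the difference is approximable by sections of [E],
    upper semicontinuity applies on the fibred product, and [near_descent] removes [w]. *)
Lemma om_act_close (E : gspace R H) (HE : is_gspace E) s s' (a0 : arr G) (e : C) :
  sec (om_space Om E) s -> sec (om_space Om E) s' ->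
  `|act erefl erefl (s (src a0)) - s' (rng a0)| < e ->
  \forall a \near a0, `|act erefl erefl (s (src a)) - s' (rng a)| < e.
Proof.
move=> /om_secP ss /om_secP ss' h0; have [Eu _] := HE.
have [w0 w0g] := rho_onto Om (rng a0).
pose P (p : arr G * pts Om) := rng p.1 = rho p.2.
pose m (z : {p | P p}) := lmv (ginv (sval z).1) (sval z).2.
have sm (z : {p | P p}) : sig (m z) = sig (sval z).2.
  by rewrite sig_lmv// src_inv; exact: (svalP z).
have rm (z : {p | P p}) : rho (m z) = src (sval z).1.
  by rewrite rho_lmv ?rng_inv// src_inv; exact: (svalP z).
have z0P : P (a0, w0) by rewrite /P /= w0g.
pose z0 : {p | P p} := exist P (a0, w0) z0P.
pose FF := sub_nbhs (P := P) (a0, w0).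
have mF : m @ FF --> m z0.
  move=> U mU; have e1 : src (ginv a0) = rho w0 by rewrite src_inv w0g.
  have [[S1 S2] /= [n1 n2] SU] := lmv_near e1 mU.
  suff : \forall p \near (a0, w0), forall pp : P p, U (m (exist P p pp)) by [].
  exists (@ginv G @^-1` S1, S2) => /=; first by split=> //; exact: ginv_cts n1.
  move=> [a w] /= [Sa Sw] pp; apply: (SU (ginv a, w)) => //=.
  by rewrite src_inv.
have qF : (fun z : {p | P p} => sig (sval z).2) @ FF --> sig w0.
  apply: (@sub_nbhs_cvg _ _ P (fun p => sig p.2) (a0, w0)).
  by apply: continuous_comp; [exact: snd_cts|exact: sig_cts].
have wF : (fun z : {p | P p} => (sval z).2) @ FF --> w0.
  exact: (@sub_nbhs_cvg _ _ P snd (a0, w0) (@snd_cts _ _ _)).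
pose zeta (z : {p | P p}) : E (sig (sval z).2) := at_ (s (rho (m z))) erefl (sm z).
have zs : near_sec FF zeta.
  move=> d d0; have [xi sxi n] := ss (m z0) d d0.
  exists xi => //; have {}n : FF (m @^-1` _) := mF _ n; apply: filterS n => z /=.
  rewrite /zeta; move: (sm z); case: _ / => //.
have zs' : near_sec FF (fun z : {p | P p} => at_ (s' (rho (sval z).2)) erefl erefl : E (sig (sval z).2)).
  move=> d d0; have [xi sxi n] := ss' w0 d d0.
  by exists xi => //; have {}n : FF (_ @^-1` _) := wF _ n; apply: filterS n.
have key (z : {p | P p}) : zeta z - at_ (s' (rho (sval z).2)) erefl erefl =
    at_ (act erefl erefl (s (src (sval z).1)) - s' (rng (sval z).1)) (esym (svalP z)) erefl.
  rewrite /zeta /=; case: z => -[a w] /= aw; congr (_ - _).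
    move: (rm (exist P (a, w) aw)) => /= r1; rewrite /om_act /=.
    move: (sm _) (om_rho _ _) (om_sig _ _ _); rewrite /m /= in r1 *.
    by case: _ / r1 => *; apply: at_eq.
  exact: at_section_irr.
have bs : near_sec FF (fun z : {p | P p} => zeta z - at_ (s' (rho (sval z).2)) erefl erefl).
  by apply: near_secD => //; exact: near_secN.
have n : \forall z \near FF, `|zeta z - at_ (s' (rho (sval z).2)) erefl erefl| < e.
  apply: (near_sec_usc (z0 := z0) Eu) => //.
    by move=> S hS; exact: (@sub_nbhs_point _ P z0 S hS).
  by rewrite key -omfib_normE.
have nd := @near_descent G H Om (arr G) (@rng G) a0 w0
  (fun a w => `|act erefl erefl (s (src a)) - s' (rng a)| < e) (@rng_cts G a0) (esym w0g).
have {nd} : \forall a \near a0, exists2 w : pts Om, rho w = rng a &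
    `|act erefl erefl (s (src a)) - s' (rng a)| < e.
  apply: nd; have {}n : \forall p \near (a0, w0), forall pp : P p, _ := n.
  apply: filterS n => -[a w] n' aw; have := n' aw.
  by rewrite (key (exist P (a, w) aw)) -omfib_normE.
by apply: filterS => a [].
Qed.

(** Near [a0], [a s(src a)] is approximated by any section that is close to it at [a0]: density
    provides the section, [om_act_close] the neighbourhood. *)
Lemma om_gspace (E : gspace R H) : is_gspace E -> is_gspace (om_space Om E).
Proof.
move=> HE; split; first exact: om_usc.
move=> xi /sec_pullP sxi; apply/sec_pullP => a0; apply: near_sec_approx => d d0.
have d20 : 0 < d / 2 by rewrite divr_gt0.
have [s ss n] := sxi a0 (d / 2) d20.
have [s' ss' s'0] := om_dense HE lam (act erefl erefl (s (src a0))) d20.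
exists (fun a => s' (rng a)); first exact: near_sec_base.
have n' := om_act_close HE ss ss' s'0.
apply: filterS2 n n' => a n1 n2; rewrite [d]splitr.
apply: le_trans (ler_distD (act erefl erefl (s (src a))) _ _) _.
by rewrite lerD// ?(ltW n2)// -actB act_norm.
Qed.

Section Lifts.
Variables (E F K : gspace R H).

Lemma om_lift1_linear (f : forall x, E x -> F x) (feq : equivariant1 f) :
  is_gspace E -> cont_linear E F f ->
  cont_linear (om_space Om E) (om_space Om F) (om_lift1 (Om := Om) feq).
Proof.
move=> HE fc; split.
- move=> g a u v; apply: omfib_ext => w x wg wx /=.
  have fl : linear (f x) by case: fc.
  exact: fl.
- move=> g; have [w0 w0g] := rho_onto Om g; have [M MP] := cl_bounded fc (sig w0).
  exists M; have n : nbhs w0 (@sig _ _ Om @^-1` _) := @sig_cts _ _ Om w0 _ MP.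
  have := nbhs_rho_image n; rewrite w0g; apply: filterS => _ [w Pw <-] e.
  rewrite (omfib_normE e (erefl (rho w)) (erefl (sig w))).
  by rewrite (omfib_normE (om_lift1 feq e) (erefl (rho w)) (erefl (sig w))); exact: Pw.
- move=> s /om_secP ss; apply/om_secP => w /=.
  by apply: (near_sec_linear (nbhs_filter w) (@sig_cts _ _ Om w) fc).
Qed.

Lemma om_lift2_bilinear (m : forall x, E x -> F x -> K x) (meq : equivariant2 m) :
  is_gspace E -> is_gspace F -> cont_bilinear E F K m ->
  cont_bilinear (om_space Om E) (om_space Om F) (om_space Om K) (om_lift2 (Om := Om) meq).
Proof.
move=> [Eu _] [Fu _] mc; split.
- move=> g; split=> u a v v'; apply: omfib_ext => w x wg wx /=;
  have [mr ml] := cb_bilinear mc x; [exact: mr|exact: ml].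
- move=> g; have [w0 w0g] := rho_onto Om g; have [M MP] := cb_bounded mc (sig w0).
  exists M; have n : nbhs w0 (@sig _ _ Om @^-1` _) := @sig_cts _ _ Om w0 _ MP.
  have := nbhs_rho_image n; rewrite w0g; apply: filterS => _ [w Pw <-] e f.
  rewrite (omfib_normE e (erefl (rho w)) (erefl (sig w))).
  rewrite (omfib_normE f (erefl (rho w)) (erefl (sig w))).
  by rewrite (omfib_normE (om_lift2 meq e f) (erefl (rho w)) (erefl (sig w))); exact: Pw.
- move=> s t /om_secP ss /om_secP st; apply/om_secP => w /=.
  by apply: (near_sec_bilinear Eu Fu (nbhs_filter w) (@sig_cts _ _ Om w) mc).
Qed.

Lemma om_lift2_contractive (m : forall x, E x -> F x -> K x) (meq : equivariant2 m) :
  contractive E F K m ->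
  contractive (om_space Om E) (om_space Om F) (om_space Om K) (om_lift2 (Om := Om) meq).
Proof.
move=> mc g e f; have [w wg] := rho_onto Om g.
rewrite (omfib_normE e wg erefl) (omfib_normE f wg erefl) (omfib_normE (om_lift2 meq e f) wg erefl).
exact: mc.
Qed.

End Lifts.

Lemma om_is_galg (A : galg R H) : is_galg A -> is_galg (om_alg Om A).
Proof. by move=> [HA mA]; split; [exact: om_gspace|exact: om_lift2_bilinear]. Qed.

(** Axioms are checked on components. For non-degeneracy, a finite sum in the fibre at one [w] is
    lifted by surjectivity of the evaluation. *)
Lemma om_is_pair (A B : galg R H) (E : kkdata A B) (c : pts Om -> R) :
  is_galg A -> is_galg B -> is_pair E -> is_pair (om_cycle Om lam c E).
Proof.
move=> [HA _] [HB _] EP.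
have HL := cyc_lp EP; have HR := cyc_rp EP.
have norm1 (K : gspace R H) (f : forall x, K x -> K x) (feq : equivariant1 f) g (e : om_space Om K g) :
    (forall x v, `|f x v| = `|v|) -> `|om_lift1 feq e| = `|e|.
  move=> fn; have [w wg] := rho_onto Om g.
  by rewrite (omfib_normE e wg erefl) (omfib_normE (om_lift1 feq e) wg erefl) /= fn.
split.
- exact: om_gspace.
- exact: om_gspace.
- exact: om_lift2_bilinear (cyc_bl EP).
- exact: om_lift2_bilinear (cyc_rb EP).
- exact: om_lift2_bilinear (cyc_pr EP).
- exact: om_lift2_bilinear (cyc_la EP).
- exact: om_lift2_bilinear (cyc_ar EP).
- exact: om_lift2_contractive (cyc_bl_contr EP).
- exact: om_lift2_contractive (cyc_rb_contr EP).
- exact: om_lift2_contractive (cyc_pr_contr EP).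
- exact: om_lift2_contractive (cyc_la_contr EP).
- exact: om_lift2_contractive (cyc_ar_contr EP).
- by move=> g b b' f; apply: omfib_ext => w x wg wx; exact: cyc_blA EP _ _ _ _.
- by move=> g b b' f; apply: omfib_ext => w x wg wx; exact: cyc_rbA EP _ _ _ _.
- by move=> g b b' f; apply: omfib_ext => w x wg wx; exact: cyc_laA EP _ _ _ _.
- by move=> g b b' f; apply: omfib_ext => w x wg wx; exact: cyc_arA EP _ _ _ _.
- by move=> g b f e; apply: omfib_ext => w x wg wx; exact: cyc_prl EP _ _ _ _.
- by move=> g b f e; apply: omfib_ext => w x wg wx; exact: cyc_prr EP _ _ _ _.
- by move=> g b f e; apply: omfib_ext => w x wg wx; exact: cyc_pra EP _ _ _ _.
- by move=> g b f e; apply: omfib_ext => w x wg wx; exact: cyc_lab EP _ _ _ _.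
- by move=> g b f e; apply: omfib_ext => w x wg wx; exact: cyc_arb EP _ _ _ _.
- move=> g f eps eps0; have [w wg] := rho_onto Om g.
  have [n [b [f' H1]]] := cyc_nondeg_l EP (at_ f wg erefl) eps0.
  have bE i := om_at_onto wg (erefl (sig w)) (b i).
  have fE i := om_at_onto wg (erefl (sig w)) (f' i).
  exists n, (fun i => sval (cid (bE i))), (fun i => sval (cid (fE i))).
  rewrite (omfib_normE _ wg erefl) /=.
  have -> : at_ (\sum_(i < n) om_lift2 (@bl_eq _ _ _ _ E) (sval (cid (bE i))) (sval (cid (fE i))) : om_space Om (lp E) g) wg erefl =
      \sum_(i < n) bl (b i) (f' i).
    rewrite (big_morph (fun u : om_space Om (lp E) g => at_ u wg erefl) (id1 := 0) (op1 := +%R))//.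
    by apply: eq_bigr => i _ /=; rewrite (svalP (cid (bE i))) (svalP (cid (fE i))).
  exact: H1.
- move=> g f eps eps0; have [w wg] := rho_onto Om g.
  have [n [f' [b H1]]] := cyc_nondeg_r EP (at_ f wg erefl) eps0.
  have bE i := om_at_onto wg (erefl (sig w)) (b i).
  have fE i := om_at_onto wg (erefl (sig w)) (f' i).
  exists n, (fun i => sval (cid (fE i))), (fun i => sval (cid (bE i))).
  rewrite (omfib_normE _ wg erefl) /=.
  have -> : at_ (\sum_(i < n) om_lift2 (@rb_eq _ _ _ _ E) (sval (cid (fE i))) (sval (cid (bE i))) : om_space Om (rp E) g) wg erefl =
      \sum_(i < n) rb (f' i) (b i).
    rewrite (big_morph (fun u : om_space Om (rp E) g => at_ u wg erefl) (id1 := 0) (op1 := +%R))//.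
    by apply: eq_bigr => i _ /=; rewrite (svalP (cid (bE i))) (svalP (cid (fE i))).
  exact: H1.
- exact: om_lift1_linear (cyc_gl EP).
- exact: om_lift1_linear (cyc_gr EP).
- by move=> g e; apply: omfib_ext => w x wg wx; exact: cyc_glK EP _ _.
- by move=> g e; apply: omfib_ext => w x wg wx; exact: cyc_grK EP _ _.
- by move=> g f; apply: norm1; exact: cyc_gl_norm EP.
- by move=> g f; apply: norm1; exact: cyc_gr_norm EP.
- by move=> g b f; apply: omfib_ext => w x wg wx; exact: cyc_gl_bl EP _ _ _.
- by move=> g b f; apply: omfib_ext => w x wg wx; exact: cyc_gr_rb EP _ _ _.
- by move=> g b f; apply: omfib_ext => w x wg wx; exact: cyc_g_pr EP _ _ _.
- by move=> g b f; apply: omfib_ext => w x wg wx; exact: cyc_gl_la EP _ _ _.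
- by move=> g b f; apply: omfib_ext => w x wg wx; exact: cyc_gr_ar EP _ _ _.
Qed.

End OmStructure.

(** * Averaging operators *)

Section Conjugation.
Variables (R : realType) (H : groupoid).
Local Notation C := R[i].

(** Frees [conj_act] from the particular proofs of the end-point equations in its definition. *)
Lemma conj_actE (E : gspace R H) (T : forall x, E x -> E x) (h : arr H) x y
    (hr : rng h = x) (hs : src h = y) (hs' : src (ginv h) = x) (hr' : rng (ginv h) = y) e :
  conj_act T hr e = act hs hr (T y (act hs' hr' e)).
Proof.
rewrite /conj_act; subst y; congr (act _ _ (T _ _)).
by rewrite (Prop_irrelevance (etrans _ _) hs') (Prop_irrelevance (rng_inv h) hr').
Qed.

Lemma act_invK' (E : gspace R H) (h : arr H) x y (hs : src h = x) (hr : rng h = y)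
    (hs' : src (ginv h) = y) (hr' : rng (ginv h) = x) e :
  @act R H E h x y hs hr (act hs' hr' e) = e.
Proof.
have k1 : src (gmul h (ginv h)) = y by rewrite gmulVr src_id.
have k2 : rng (gmul h (ginv h)) = y by rewrite gmulVr rng_id.
rewrite -(act_mul hs hr hs' hr' k1 k2).
have i1 : src (gid y) = y by rewrite src_id.
have i2 : rng (gid y) = y by rewrite rng_id.
by rewrite (act_irr k1 k2 i1 i2) ?act_id// gmulVr hr.
Qed.

Section Maps.
Variables (E F K : gspace R H).
Variables (TE : forall x, E x -> E x) (TF : forall x, F x -> F x) (TK : forall x, K x -> K x).

Lemma conj_act_map2r (m : forall x, E x -> F x -> K x) (meq : equivariant2 m) :
  (forall x e f, TK (m x e f) = m x e (TF f)) ->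
  forall h x (hr : rng h = x) e f, conj_act TK hr (m x e f) = m x e (conj_act TF hr f).
Proof.
move=> TM h x hr e f; subst x.
have i1 := src_inv h; have i2 := rng_inv h.
rewrite !(conj_actE _ _ erefl i1 i2) meq TM meq act_invK' //.
Qed.

Lemma conj_act_map2l (m : forall x, E x -> F x -> K x) (meq : equivariant2 m) :
  (forall x e f, TK (m x e f) = m x (TE e) f) ->
  forall h x (hr : rng h = x) e f, conj_act TK hr (m x e f) = m x (conj_act TE hr e) f.
Proof.
move=> TM h x hr e f; subst x.
have i1 := src_inv h; have i2 := rng_inv h.
by rewrite !(conj_actE _ _ erefl i1 i2) meq TM meq act_invK'.
Qed.

Lemma conj_act_adjoint (m : forall x, E x -> F x -> K x) (meq : equivariant2 m) :
  (forall x e f, m x e (TF f) = m x (TE e) f) ->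
  forall h x (hr : rng h = x) e f, m x e (conj_act TF hr f) = m x (conj_act TE hr e) f.
Proof.
move=> TM h x hr e f; subst x.
have i1 := src_inv h; have i2 := rng_inv h.
rewrite !(conj_actE _ _ erefl i1 i2).
rewrite -[e in LHS](act_invK' (E := E) erefl erefl i1 i2 e).
rewrite -[f in RHS](act_invK' (E := F) erefl erefl i1 i2 f).
by rewrite -!meq TM.
Qed.

Lemma conj_act_map1 (u : forall x, E x -> F x) (ueq : equivariant1 u) :
  (forall x e, TF (u x e) = u x (TE e)) ->
  forall h x (hr : rng h = x) e, conj_act TF hr (u x e) = u x (conj_act TE hr e).
Proof.
move=> TM h x hr e; subst x.
have i1 := src_inv h; have i2 := rng_inv h.
by rewrite !(conj_actE _ _ erefl i1 i2) ueq TM ueq.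
Qed.

End Maps.

Lemma conj_act_linear (E : gspace R H) (T : forall x, E x -> E x) :
  (forall x, linear (@T x)) -> forall h x (hr : rng h = x), linear (conj_act T hr).
Proof.
move=> Tl h x hr a u v; rewrite /conj_act.
by rewrite (act_linear _ _) (Tl _) (act_linear _ _).
Qed.

Lemma conj_act_norm (E : gspace R H) (T : forall x, E x -> E x) (M : C) :
  (forall x e, `|T x e| <= M * `|e|) ->
  forall h x (hr : rng h = x) e, `|conj_act T hr e| <= M * `|e|.
Proof. by move=> TM h x hr e; rewrite /conj_act act_norm; apply: le_trans (TM _ _) _; rewrite act_norm. Qed.

Lemma conj_act_near (E : gspace R H) (T : forall x, E x -> E x) (Z : Type)
    (F : set_system Z) (hz : Z -> arr H) (h0 : arr H) (q : Z -> obj H)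
    (hr : forall z, rng (hz z) = q z) (zeta : forall z, E (q z)) :
  is_gspace E -> cont_linear E E T -> Filter F -> hz @ F --> h0 ->
  near_sec F zeta -> near_sec F (fun z => conj_act T (hr z) (zeta z)).
Proof.
move=> HE Tc FF hF zs; rewrite /conj_act.
have sF : (fun z => src (hz z)) @ F --> src h0.
  by apply: cvg_comp hF _; exact: src_cts.
apply: (near_sec_act (a := hz) (a0 := h0) (q := fun z => src (hz z))) => //.
apply: (near_sec_linear FF sF Tc).
apply: (near_sec_act (a := fun z => ginv (hz z)) (a0 := ginv h0)) => //.
by apply: cvg_comp hF _; exact: ginv_cts.
Qed.

End Conjugation.

Section Average.
Variables (R : realType) (G H : groupoid) (Om : equivalence G H) (lam : haar_system R H).
Variable c : pts Om -> R.
Hypothesis cP : is_cutoff Om lam c.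
Local Notation C := R[i].

Lemma cutoff_continuous : continuous (c : pts Om -> R^o). Proof. by case: cP. Qed.

(** For [w] in a compact neighbourhood [N] the points [w h] lie over the compact set [rho(N)], above
    which the support of [c] is compact. *)
Lemma cutoff_proper_support : proper_support c.
Proof.
have [cc c0 c1 cK] := cP => w1.
have := @pts_lc _ _ Om w1 I; rewrite withinET => -[N w1N [Nc _]].
have rNc : compact (@rho _ _ Om @` N).
  by apply: continuous_compact Nc; apply: continuous_subspaceT; exact: rho_cts.
have Lc := cK _ rNc.
exists [set h : arr H | exists2 w, N w & sig w = rng h /\
  (@rho _ _ Om @^-1` (@rho _ _ Om @` N) `&` closure [set w | c w != 0]) (rmv w h)].
  exact: fibre_translate_compact.
apply: filterS w1N => w Nw h hw nK; apply/eqP; apply: contrapT => /negP fh.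
apply: nK; exists w => //; split=> //; split; last exact: subset_closure.
by exists w => //; rewrite rho_rmv.
Qed.

Lemma cutoff_hint w x : sig w = x -> hint lam x (fun h => c (rmv w h)) = 1.
Proof. by case: cP => _ _ + _ => /(_ w) h wx; subst x. Qed.

Lemma cutoff_fibre w x (wx : sig w = x) :
  fibre_continuous x (fun h => c (rmv w h)) /\ fibre_support x (fun h => c (rmv w h)).
Proof.
split; first exact: translate_fibre_continuous cutoff_continuous.
exact: translate_fibre_support cutoff_proper_support.
Qed.

Section Operator.
Variables (E : gspace R H) (T : forall x, E x -> E x).
Hypotheses (HE : is_gspace E) (Tc : cont_linear E E T).

Lemma om_integrand_regular w x (wx : sig w = x) (e : E x) :
  fibre_regular x (om_integrand c T w e).
Proof.
have [Eu _] := HE; subst x; split; last first.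
  have [K Kc KP] := (cutoff_fibre (erefl (sig w))).2; exists K => // h hw nK.
  by rewrite /om_integrand; case: pselect => // hr; rewrite KP// scale0r.
move=> h0 h0w d d0.
pose P (h : arr H) := rng h = sig w.
pose F := sub_nbhs (P := P) h0.
have es : @near_sec R _ E _ F (fun=> sig w) (fun z => e).
  move=> d' d'0; have [xi sxi xe] := sec_dense Eu e d'0.
  by exists xi => //; apply: nearW => z; exact: ltW.
have hF : (fun z : {h | P h} => sval z) @ F --> h0.
  exact: (@sub_nbhs_cvg _ _ P idfun h0 (@cvg_id _ _)).
have qF : (fun z : {h | P h} => sig w) @ F --> sig w by exact: cvg_cst.
have tF : (fun z : {h | P h} => rmv w (sval z)) @ F --> rmv w h0.
  move=> U wU; have n := near_pair2 (rmv_near (esym h0w) wU).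
  suff : \forall h \near h0, forall pp : P h, U (rmv w h) by [].
  by apply: filterS n => h hU pp; exact/hU/esym.
have s1 := conj_act_near (fun z : {h | P h} => svalP z) HE Tc _ hF es.
have s2 := near_sec_real_scale Eu _ qF tF (@cutoff_continuous _) (s1 _).
have [xi sxi n] := s2 (sub_nbhs_filter _ _) (sub_nbhs_filter _ _) d d0; exists (xi (sig w)).
have {}n : \forall h \near h0, forall pp : P h, _ := n.
apply: filterS n => h n hw; move: (n hw) => /=; rewrite /om_integrand.
case: pselect => // hr; congr (`|_ *: _ - _| <= _).
by congr (conj_act _ _ _); exact: Prop_irrelevance.
Qed.

(** [T~_w] on the single fibre at [sig w], without reference to coherent families; [om_opP] relates
    it to [om_op]. *)
Definition avg w x (wx : sig w = x) (e : E x) : E x :=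
  sval (cid (weak_int_exists lam (om_integrand_regular wx e))).

Lemma avgP w x (wx : sig w = x) (e : E x) : weak_int lam x (om_integrand c T w e) (avg wx e).
Proof. exact: (svalP (cid (weak_int_exists lam (om_integrand_regular wx e)))). Qed.

Lemma avg_uniq w x (wx : sig w = x) (e : E x) v :
  weak_int lam x (om_integrand c T w e) v -> v = avg wx e.
Proof. move=> h; exact: weak_int_uniq h (avgP wx e). Qed.

Lemma om_integrandE w x (e : E x) h (hr : rng h = x) :
  om_integrand c T w e h = (c (rmv w h))%:C *: conj_act T hr e.
Proof.
rewrite /om_integrand; case: pselect => // hr'.
by rewrite (Prop_irrelevance hr hr').
Qed.

(** The integrals form a coherent family, so the set in [om_op] is inhabited and the default value 0
    does not occur. *)
Lemma om_opP g (e : om_space Om E g) w x (wg : rho w = g) (wx : sig w = x) :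
  at_ (om_op lam c T e) wg wx = avg wx (at_ e wg wx).
Proof.
apply: avg_uniq.
have ex : exists e' : om_space Om E g, forall w x (wg : rho w = g) (wx : sig w = x),
    weak_int lam x (om_integrand c T w (at_ e wg wx)) (at_ e' wg wx).
  apply: (@average_exists R G H Om E lam g (fun w x wg wx => om_integrand c T w (at_ e wg wx))).
    by move=> w' x' wg' wx'; exact: om_integrand_regular.
  move=> w' h x' y wg' wx' whg why hs hr k ky.
  have hk : src h = rng k by rewrite hs ky.
  have wh : sig w' = rng h by rewrite wx' hr.
  have r1 : rng (gmul h k) = x' by rewrite rng_mul.
  rewrite (om_integrandE _ _ r1) (om_integrandE _ _ ky) actZ rmvM//.
  congr (_ *: _); rewrite (at_coherent e wg' wx' whg why hs hr).
  have s1 : src (gmul h k) = src k by rewrite src_mul.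
  have s2 : src (ginv (gmul h k)) = x' by rewrite src_inv.
  have s3 : rng (ginv (gmul h k)) = src k by rewrite rng_inv.
  have t1 : src (ginv k) = y by rewrite src_inv.
  have t2 : rng (ginv k) = src k by rewrite rng_inv.
  rewrite (conj_actE _ r1 s1 s2 s3) (conj_actE _ ky erefl t1 t2).
  rewrite -(act_mul hs hr erefl ky s1 r1); congr (act _ _ (T _)).
  have u1 : src (gmul (ginv (gmul h k)) h) = y by rewrite src_mul// s2.
  have u2 : rng (gmul (ginv (gmul h k)) h) = src k by rewrite rng_mul// s2.
  rewrite -(act_mul s2 s3 hs hr u1 u2); apply: act_irr.
  by rewrite ginvM// -gmulA ?gmulVl ?src_inv ?rng_inv// hk -src_inv gmul1r.
have := @xgetPex _ (0 : om_space Om E g) [set e' | forall w x (wg : rho w = g) (wx : sig w = x),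
   is_weak_integral (lam x) [set h | rng h = x]
      (om_integrand c T w (at_ e wg wx)) (at_ e' wg wx)] ex.
by move=> /(_ w x wg wx).
Qed.

Lemma avg_linear w x (wx : sig w = x) : linear (avg wx).
Proof.
move=> a u v; apply/esym/avg_uniq.
have ru := om_integrand_regular wx u; have rv := om_integrand_regular wx v.
apply: weak_int_ext (weak_int_lin a ru rv (avgP wx u) (avgP wx v)) => h hx.
have Tl : forall x, linear (@T x) by case: Tc.
rewrite !(om_integrandE _ _ hx) (conj_act_linear Tl hx) scalerDr !scalerA.
by rewrite mulrC.
Qed.

(** Conjugation preserves the bound, and the cut-off is nonnegative with integral 1 over each
    fibre. *)
Lemma avg_norm (M : C) : (forall x e, `|@T x e| <= M * `|e|) ->
  forall w x (wx : sig w = x) e, `|avg wx e| <= M * `|e|.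
Proof.
move=> TM w x wx e.
have M0 : 0 <= M * `|e| by apply: le_trans (normr_ge0 _) (TM x e).
have [m mE] : exists m : R, M * `|e| = m%:C.
  by exists (complex.Re (M * `|e|)); rewrite RRe_real// realE M0.
have [fc fs] := cutoff_fibre wx.
have ci := fibre_integrable lam fc fs; have mD := @fibre_measurable H x.
have := weak_int_norm (g := fun h => m * c (rmv w h)) (om_integrand_regular wx e) (avgP wx e).
rewrite mE /hint RintegralZl// -/(hint _ _ _) (cutoff_hint wx) mulr1; apply.
  by have := integrableZl mD m ci; congr (_.-integrable _ _); apply/funext.
move=> h hx; rewrite (om_integrandE _ _ hx) normrZ rmorphM/= -mE mulrC.
have c0 : 0 <= c (rmv w h) by case: cP => _ + _ _; apply.
have -> : `|(c (rmv w h))%:C : C| = (c (rmv w h))%:C by rewrite ger0_norm// lecR.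
by rewrite ler_wpM2r ?lecR//; exact: conj_act_norm.
Qed.

Lemma avg_near (zeta : forall w, E (sig w)) (w0 : pts Om) :
  near_sec (nbhs w0) zeta -> near_sec (nbhs w0) (fun w => avg (erefl (sig w)) (zeta w)).
Proof.
move=> zs; have [Eu _] := HE.
apply: (@near_sec_integral R H lam (pts Om) (@sig _ _ Om) (@sig_cts _ _ Om) E
  (fun w => om_integrand c T w (zeta w)) w0 Eu).
- move=> h0 h0w; pose Z := {p | fibred (@sig _ _ Om) p}.
  pose F : set_system Z := sub_nbhs (w0, h0).
  have wF : (fun z : Z => (sval z).1) @ F --> w0.
    exact: (@sub_nbhs_cvg _ _ (fibred (@sig _ _ Om)) fst (w0, h0) (@fst_cts _ _ _)).
  have zF : near_sec F (fun z : Z => zeta (sval z).1).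
    move=> d d0; have [xi sxi n] := zs d d0; exists xi => //.
    by have n' : F (_ @^-1` _) := wF _ n; apply: filterS n'.
  have s1 := conj_act_near (fun z : Z => svalP z) HE Tc _ (@fibred_src_cvg _ _ Om w0 h0) zF.
  have s2 := near_sec_real_scale Eu _ (@fibred_sig_cvg _ _ Om w0 h0) (fibred_rmv_cvg h0w) (@cutoff_continuous _) (s1 _).
  move: (s2 (sub_nbhs_filter _ _) (sub_nbhs_filter _ _)); congr near_sec; apply: functional_extensionality_dep => -[[w h] /= hw].
  by rewrite (om_integrandE _ _ hw); congr (_ *: conj_act _ _ _); exact: Prop_irrelevance.
- have [K Kc n] := cutoff_proper_support w0; exists K => //; apply: filterS n => w wK h hw nK.
  by rewrite (om_integrandE _ _ hw) wK// scale0r.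
- by move=> w; exact: om_integrand_regular.
- by move=> w; exact: avgP.
Qed.

End Operator.
End Average.

Lemma subACA (V : zmodType) (a b c d : V) : a - b - (c - d) = a - c - (b - d).
Proof. by rewrite !opprB [d - c]addrC addrACA [- b + d]addrC. Qed.

Section Regular.
Variables (R : realType) (H : groupoid) (lam : haar_system R H) (x : obj H)
  (V : completeNormedModType R[i]).
Local Notation C := R[i].

Lemma fibre_regularB (F F' : arr H -> V) : fibre_regular x F -> fibre_regular x F' ->
  fibre_regular x (fun h => F h - F' h).
Proof.
move=> [Fc [K Kc FK]] [Fc' [K' Kc' FK']]; split; last first.
  exists (K `|` K'); first exact: compactU.
  by move=> h hx nK; rewrite FK ?FK' ?subrr// => ?; apply: nK; [right|left].
move=> h0 h0x d d0; have d20 : 0 < d / 2 by rewrite divr_gt0.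
have [u n] := Fc h0 h0x _ d20; have [u' n'] := Fc' h0 h0x _ d20.
exists (u - u'); apply: filterS2 n n' => h n n' hx.
rewrite subACA [d]splitr; apply: le_trans (ler_normB _ _) _.
by rewrite lerD ?n ?n'.
Qed.

Lemma weak_intB (F F' : arr H -> V) v v' : fibre_regular x F -> fibre_regular x F' ->
  weak_int lam x F v -> weak_int lam x F' v' -> weak_int lam x (fun h => F h - F' h) (v - v').
Proof.
move=> Fr Fr' h h'; have := weak_int_lin (-1) Fr' Fr h' h.
by rewrite scaleN1r addrC; apply: weak_int_ext => k _; rewrite scaleN1r addrC.
Qed.

End Regular.

(** * Conjugation of locally compact operators; cycle conditions along a filter *)

Section NearCompactMore.
Variables (R : realType) (H : groupoid) (A B : galg R H) (E : kkdata A B).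
Local Notation C := R[i].
Hypothesis EP : is_pair E.

(** The families carry the equation [r t = x] as an argument, so they can be restated on the fibre
    at [q z] without a transport. *)
Lemma near_compact_pull (T : topologicalType) (r : T -> obj H)
    (Sl : forall t x, r t = x -> lp E x -> lp E x) (Sr : forall t x, r t = x -> rp E x -> rp E x)
    (Z : Type) (F : set_system Z) (m : Z -> T) (t0 : T) (q : Z -> obj H)
    (pf : forall z, r (m z) = q z) : Filter F -> m @ F --> t0 ->
  near_compact (nbhs t0) (fun t => Sl t _ erefl) (fun t => Sr t _ erefl) ->
  near_compact F (fun z => Sl (m z) _ (pf z)) (fun z => Sr (m z) _ (pf z)).
Proof.
move=> FF mF h e e0; have [s sP n] := h e e0; exists s => //.
have {}n : F (m @^-1` _) := mF _ n; apply: filterS n => z /=.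
by case: _ / (pf z).
Qed.

(** [h |eta><xi| h^-1 = |h eta><h xi|]. *)
Lemma near_compact_conj (Z : Type) (F : set_system Z) (hz : Z -> arr H) (h0 : arr H)
    (q : Z -> obj H) (hr : forall z, rng (hz z) = q z)
    (Sl : forall z, lp E (src (hz z)) -> lp E (src (hz z)))
    (Sr : forall z, rp E (src (hz z)) -> rp E (src (hz z))) :
  Filter F -> hz @ F --> h0 -> near_compact F Sl Sr ->
  near_compact F
    (fun z f => act erefl (hr z) (Sl z (act (etrans (src_inv (hz z)) (hr z)) (rng_inv (hz z)) f)))
    (fun z v => act erefl (hr z) (Sr z (act (etrans (src_inv (hz z)) (hr z)) (rng_inv (hz z)) v))).
Proof.
move=> FF hF h.
have qF : q @ F --> rng h0.
  have -> : q = (fun z => rng (hz z)) by apply/funext => z.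
  by apply: cvg_comp hF _; exact: rng_cts.
have [HL HR] := (cyc_lp EP, cyc_rp EP).
apply: (@near_compact_approx _ _ _ _ _ _ _ _ _ _ _ 1) => // d d0 _; have [s sP n] := h d d0.
exists (fun z f => \sum_(p <- s) rankl (act erefl (hr z) (p.1 (src (hz z)))) (act erefl (hr z) (p.2 (src (hz z)))) f).
exists (fun z f => \sum_(p <- s) rankr (act erefl (hr z) (p.1 (src (hz z)))) (act erefl (hr z) (p.2 (src (hz z)))) f).
split.
  elim: s sP {n} => [|p s IH] sP.
    by apply: near_compact_ext (@near_compact0 _ _ _ _ E _ _ q FF) => *; rewrite big_nil.
  have [[s1 s2] sP'] := (List.Forall_cons_iff _ _ _).1 sP.
  apply: near_compact_ext (near_compactD _ _ (IH sP')) => [z f|z v|]; last first.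
  + apply: (near_compact_rank FF qF EP).
      exact: (near_sec_act (a := hz) (q := fun z => src (hz z)) (fun z => erefl) hr HR FF hF
        (near_sec_base (fun z => src (hz z)) FF s1)).
    exact: (near_sec_act (a := hz) (q := fun z => src (hz z)) (fun z => erefl) hr HL FF hF
      (near_sec_base (fun z => src (hz z)) FF s2)).
  + by rewrite big_cons.
  + by rewrite big_cons.
apply: filterS n => z [h1 h2]; rewrite mul1r; split=> v.
  have -> : \sum_(p <- s) rankr (act erefl (hr z) (p.1 (src (hz z)))) (act erefl (hr z) (p.2 (src (hz z)))) v
    = act erefl (hr z) (\sum_(p <- s) rankr (p.1 (src (hz z))) (p.2 (src (hz z))) (act (etrans (src_inv (hz z)) (hr z)) (rng_inv (hz z)) v)).
    rewrite act_sum; apply: eq_bigr => p _.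
    by rewrite /rankr rb_eq pr_eq act_invK'.
  rewrite -actB act_norm; apply: le_trans (h1 _) _.
  by rewrite act_norm.
have -> : \sum_(p <- s) rankl (act erefl (hr z) (p.1 (src (hz z)))) (act erefl (hr z) (p.2 (src (hz z)))) v
    = act erefl (hr z) (\sum_(p <- s) rankl (p.1 (src (hz z))) (p.2 (src (hz z))) (act (etrans (src_inv (hz z)) (hr z)) (rng_inv (hz z)) v)).
  rewrite act_sum; apply: eq_bigr => p _.
  by rewrite /rankl bl_eq pr_eq act_invK'.
rewrite -actB act_norm; apply: le_trans (h2 _) _.
by rewrite act_norm.
Qed.

Hypothesis OP : is_odd_operator E.

Lemma near_adjointable_op (Z : Type) (F : set_system Z) (q : Z -> obj H) (x0 : obj H) :
  Filter F -> q @ F --> x0 ->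
  near_adjointable F (fun z => @tl _ _ _ _ E (q z)) (fun z => @tr _ _ _ _ E (q z)).
Proof.
move=> FF qF; have [M MP] := cyc_t_bounded OP; split.
- by move=> z; have : forall x, linear (@tl _ _ _ _ E x) by case: (cyc_tl OP).
- by move=> z; have : forall x, linear (@tr _ _ _ _ E x) by case: (cyc_tr OP).
- exists `|M| => //; apply: nearW => z; have [h1 h2] := MP (q z).
  by split; exact: real_bound.
- by move=> xi; exact: near_sec_linear FF qF (cyc_tl OP).
- by move=> xi; exact: near_sec_linear FF qF (cyc_tr OP).
- by move=> z b f; exact: cyc_tl_bl.
- by move=> z b f; exact: cyc_tr_rb.
- by move=> z b f; exact: cyc_t_pr.
Qed.

Lemma near_adjointableB (Z : Type) (F : set_system Z) (q : Z -> obj H)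
    (Al Al' : forall z, lp E (q z) -> lp E (q z)) (Ar Ar' : forall z, rp E (q z) -> rp E (q z)) :
  Filter F -> near_adjointable F Al Ar -> near_adjointable F Al' Ar' ->
  near_adjointable F (fun z f => Al z f - Al' z f) (fun z v => Ar z v - Ar' z v).
Proof.
move=> FF [l1 l2 [M M0 MP] s1 s2 b1 b2 p1] [l1' l2' [M' M0' MP'] s1' s2' b1' b2' p1'].
have [Lu _] := cyc_lp EP; have [Ru _] := cyc_rp EP; split.
- by move=> z a u v; rewrite (l1 z) (l1' z) scalerBr opprD addrACA.
- by move=> z a u v; rewrite (l2 z) (l2' z) scalerBr opprD addrACA.
- exists (M + M'); first exact: addr_ge0.
  apply: filterS2 MP MP' => z [h1 h2] [h3 h4]; split=> v; rewrite mulrDl;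
    by apply: le_trans (ler_normB _ _) _; rewrite lerD.
- by move=> xi h; apply: near_secD => //; [exact: s1|apply: near_secN => //; exact: s1'].
- by move=> xi h; apply: near_secD => //; [exact: s2|apply: near_secN => //; exact: s2'].
- move=> z b f; have [blr _] := cb_bilinear (cyc_bl EP) (q z).
  by rewrite b1 b1' (linB (blr b)).
- move=> z v b; have [_ rbl] := cb_bilinear (cyc_rb EP) (q z).
  by rewrite b2 b2' (linB (rbl b)).
- move=> z f v; have [prr prl] := cb_bilinear (cyc_pr EP) (q z).
  by rewrite (linB (prr f)) (linB (prl v)) p1 p1'.
Qed.

End NearCompactMore.

Section CycleNear.
Variables (R : realType) (H : groupoid) (A B : galg R H) (E : kkdata A B).
Local Notation C := R[i].
Hypotheses (HA : is_galg A) (EC : is_cycle E).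

Let EP := cyc_pair EC.
Let OP := cyc_op EC.

Lemma ar_le x (a : A x) (e : rp E x) (d v : C) : `|a| <= d -> `|e| <= v -> `|ar a e| <= d * v.
Proof.
by move=> h h'; apply: le_trans (cyc_ar_contr EP _ _) _; rewrite ler_pM.
Qed.

Lemma la_le x (a : A x) (e : lp E x) (d v : C) : `|a| <= d -> `|e| <= v -> `|la e a| <= d * v.
Proof.
by move=> h h'; apply: le_trans (cyc_la_contr EP _ _) _; rewrite mulrC ler_pM.
Qed.

Lemma op_bound : exists2 M : C, 0 <= M & forall x,
  (forall f : lp E x, `|tl f| <= M * `|f|) /\ (forall e : rp E x, `|tr e| <= M * `|e|).
Proof.
have [M MP] := cyc_t_bounded OP; exists `|M| => // x; have [h1 h2] := MP x.
by split; exact: real_bound.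
Qed.

(** The cycle condition extends from sections [a] to selections along a convergent filter, because
    [[pi(a), T]] is bounded by [2 M |a|]. *)
Lemma near_commutator (Z : Type) (F : set_system Z) (q : Z -> obj H) (x0 : obj H)
    (a : forall z, A (q z)) : Filter F -> q @ F --> x0 -> near_sec F a ->
  near_compact F (fun z (f : lp E (q z)) => tl (la f (a z)) - la (tl f) (a z))
    (fun z (e : rp E (q z)) => ar (a z) (tr e) - tr (ar (a z) e)).
Proof.
move=> FF qF as_; have [M M0 MP] := op_bound.
have tll : forall x, linear (@tl _ _ _ _ E x) by case: (cyc_tl OP).
have trl : forall x, linear (@tr _ _ _ _ E x) by case: (cyc_tr OP).
apply: (@near_compact_approx _ _ _ _ _ _ _ _ _ _ _ (M + M)); first exact: addr_ge0.
move=> d d0 _; have [a0 sa0 n] := as_ d d0.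
exists (fun z (f : lp E (q z)) => tl (la f (a0 (q z))) - la (tl f) (a0 (q z))),
  (fun z (e : rp E (q z)) => ar (a0 (q z)) (tr e) - tr (ar (a0 (q z)) e)); split.
  have /(locally_compact_opP _ _ EP (fun x => @cvg_id _ _)) h := cyc_commutator EC sa0.
  exact: (near_compact_pull (r := idfun) (Sl := fun t x (p : t = x) f => tl (la f (a0 x)) - la (tl f) (a0 x))
    (Sr := fun t x (p : t = x) e => ar (a0 x) (tr e) - tr (ar (a0 x) e)) (fun z => erefl) FF qF (h x0)).
apply: filterS n => z n; have [h1 h2] := MP (q z); split=> v.
  have [arr_ arl] := cb_bilinear (cyc_ar EP) (q z).
  have -> : ar (a z) (tr v) - tr (ar (a z) v) - (ar (a0 (q z)) (tr v) - tr (ar (a0 (q z)) v)) =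
      ar (a z - a0 (q z)) (tr v) - tr (ar (a z - a0 (q z)) v).
    by rewrite (linB (arl _)) (linB (arl _)) (linB (trl _)) subACA.
  apply: le_trans (ler_normB _ _) _; rewrite !mulrDl lerD//.
    by rewrite [M * d]mulrC -mulrA; exact: ar_le.
  by apply: le_trans (h2 _) _; rewrite -mulrA ler_wpM2l//; exact: ar_le.
have [lar lal] := cb_bilinear (cyc_la EP) (q z).
have -> : tl (la v (a z)) - la (tl v) (a z) - (tl (la v (a0 (q z))) - la (tl v) (a0 (q z))) =
    tl (la v (a z - a0 (q z))) - la (tl v) (a z - a0 (q z)).
  by rewrite (linB (lar _)) (linB (lar _)) (linB (tll _)) subACA.
apply: le_trans (ler_normB _ _) _; rewrite !mulrDl lerD//.
  by apply: le_trans (h1 _) _; rewrite -mulrA ler_wpM2l//; exact: la_le.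
by rewrite [M * d]mulrC -mulrA; exact: la_le.
Qed.

Lemma near_square (Z : Type) (F : set_system Z) (q : Z -> obj H) (x0 : obj H)
    (a : forall z, A (q z)) : Filter F -> q @ F --> x0 -> near_sec F a ->
  near_compact F (fun z (f : lp E (q z)) => la f (a z) - tl (tl (la f (a z))))
    (fun z (e : rp E (q z)) => ar (a z) (e - tr (tr e))).
Proof.
move=> FF qF as_; have [M M0 MP] := op_bound.
have tll : forall x, linear (@tl _ _ _ _ E x) by case: (cyc_tl OP).
have trl : forall x, linear (@tr _ _ _ _ E x) by case: (cyc_tr OP).
apply: (@near_compact_approx _ _ _ _ _ _ _ _ _ _ _ (1 + M * M)).
  by rewrite addr_ge0// mulr_ge0.
move=> d d0 _; have [a0 sa0 n] := as_ d d0.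
exists (fun z (f : lp E (q z)) => la f (a0 (q z)) - tl (tl (la f (a0 (q z))))),
  (fun z (e : rp E (q z)) => ar (a0 (q z)) (e - tr (tr e))); split.
  have /(locally_compact_opP _ _ EP (fun x => @cvg_id _ _)) h := cyc_square EC sa0.
  exact: (near_compact_pull (r := idfun) (Sl := fun t x (p : t = x) f => la f (a0 x) - tl (tl (la f (a0 x))))
    (Sr := fun t x (p : t = x) e => ar (a0 x) (e - tr (tr e))) (fun z => erefl) FF qF (h x0)).
apply: filterS n => z n; have [h1 h2] := MP (q z); split=> v.
  have [arr_ arl] := cb_bilinear (cyc_ar EP) (q z).
  rewrite -(linB (arl _)) [(1 + _) * d]mulrC -mulrA.
  apply: ar_le n _; rewrite mulrDl mul1r.
  apply: le_trans (ler_normB _ _) _; rewrite lerD//.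
  by apply: le_trans (h2 _) _; rewrite -mulrA ler_wpM2l.
have [lar lal] := cb_bilinear (cyc_la EP) (q z).
have -> : la v (a z) - tl (tl (la v (a z))) - (la v (a0 (q z)) - tl (tl (la v (a0 (q z))))) =
    la v (a z - a0 (q z)) - tl (tl (la v (a z - a0 (q z)))).
  by rewrite (linB (lar _)) !(linB (tll _)) subACA.
rewrite -mulrA mulrDl mul1r; apply: le_trans (ler_normB _ _) _; rewrite lerD ?la_le//.
apply: le_trans (h1 _) _; rewrite -mulrA ler_wpM2l//.
by apply: le_trans (h1 _) _; rewrite ler_wpM2l// la_le.
Qed.

Lemma near_equivariance (Z : Type) (F : set_system Z) (q : Z -> obj H) (hz : Z -> arr H) (h0 : arr H)
    (hr : forall z, rng (hz z) = q z)
    (a : forall x, A x) : Filter F -> hz @ F --> h0 -> sec A a ->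
  near_compact F (fun z (f : lp E (q z)) =>
      conj_act (@tl _ _ _ _ E) (hr z) (la f (a (q z))) - tl (la f (a (q z))))
    (fun z (e : rp E (q z)) => ar (a (q z)) (conj_act (@tr _ _ _ _ E) (hr z) e - tr e)).
Proof.
move=> FF hF sa.
have sa' : sec (pull (@rng H) A) (fun h => a (rng h)).
  by apply/sec_pullP => h; exact: near_sec_base.
have /(locally_compact_opP _ _ EP (@rng_cts H)) h := cyc_equivariance EC sa'.
exact: (near_compact_pull (r := @rng H) (Sl := fun t x (p : rng t = x) f => conj_act (@tl _ _ _ _ E) p (la f (a x)) - tl (la f (a x)))
    (Sr := fun t x (p : rng t = x) e => ar (a x) (conj_act (@tr _ _ _ _ E) p e - tr e)) hr FF hF (h h0)).
Qed.

End CycleNear.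

(** * Algebraic properties of averaged operators *)

Section AverageMaps.
Variables (R : realType) (G H : groupoid) (Om : equivalence G H) (lam : haar_system R H).
Variable c : pts Om -> R.
Hypothesis cP : is_cutoff Om lam c.
Local Notation C := R[i].

Section Bilinear.
Variables (E F K : gspace R H).
Variables (TE : forall x, E x -> E x) (TF : forall x, F x -> F x) (TK : forall x, K x -> K x).
Hypotheses (HE : is_gspace E) (HF : is_gspace F) (HK : is_gspace K).
Hypotheses (TEc : cont_linear E E TE) (TFc : cont_linear F F TF) (TKc : cont_linear K K TK).
Variables (m : forall x, E x -> F x -> K x) (meq : equivariant2 m).
Hypotheses (mb : contractive E F K m) (ml : forall x, is_bilinear (@m x)).

Lemma contractive_l x (e : E x) f : `|m e f| <= `|f| * `|e|.
Proof. by rewrite mulrC; exact: mb. Qed.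

Lemma avg_map2r w x (wx : sig w = x) e f : (forall x e f, @TK x (m e f) = m e (TF f)) ->
  avg cP HK TKc wx (m e f) = m e (avg cP HF TFc wx f).
Proof.
move=> TM; apply/esym/avg_uniq; have [mr _] := ml x.
apply: weak_int_ext (weak_int_map (mr e) (mb e) (avgP cP HF TFc wx f)) => h hx.
by rewrite !(om_integrandE _ _ _ _ hx) (linZ (mr e)) (conj_act_map2r meq TM).
Qed.

Lemma avg_map2l w x (wx : sig w = x) e f : (forall x e f, @TK x (m e f) = m (TE e) f) ->
  avg cP HK TKc wx (m e f) = m (avg cP HE TEc wx e) f.
Proof.
move=> TM; apply/esym/avg_uniq; have [_ mr] := ml x.
apply: weak_int_ext (weak_int_map (mr f) (@contractive_l x ^~ f) (avgP cP HE TEc wx e)) => h hx.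
by rewrite !(om_integrandE _ _ _ _ hx) (linZ (mr f)) (conj_act_map2l meq TM).
Qed.

Lemma avg_adjoint w x (wx : sig w = x) e f : (forall x e f, @m x e (TF f) = m (TE e) f) ->
  m e (avg cP HF TFc wx f) = m (avg cP HE TEc wx e) f.
Proof.
move=> TM; have [mr1 mr2] := ml x.
have h1 := weak_int_map (mr1 e) (mb e) (avgP cP HF TFc wx f).
have h2 := weak_int_map (mr2 f) (@contractive_l x ^~ f) (avgP cP HE TEc wx e).
apply: weak_int_uniq h1 _; apply: weak_int_ext h2 => h hx.
by rewrite !(om_integrandE _ _ _ _ hx) (linZ (mr1 e)) (linZ (mr2 f)) (conj_act_adjoint meq TM).
Qed.

End Bilinear.

Section Linear.
Variables (E : gspace R H) (T : forall x, E x -> E x).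
Hypotheses (HE : is_gspace E) (Tc : cont_linear E E T).

Lemma avg_odd (u : forall x, E x -> E x) (ueq : equivariant1 u) w x (wx : sig w = x) e :
  (forall x, linear (@u x)) -> (forall x e, `|@u x e| = `|e|) ->
  (forall x e, @T x (u x e) = - u x (T e)) ->
  avg cP HE Tc wx (u x e) = - u x (avg cP HE Tc wx e).
Proof.
move=> ul un TM; apply/esym/avg_uniq.
have Ll : linear (fun v => - u x v) by move=> a v v'; rewrite (ul x) opprD scalerN.
have Lb v : `|- u x v| <= 1 * `|v| by rewrite normrN un mul1r.
apply: weak_int_ext (weak_int_map Ll Lb (avgP cP HE Tc wx e)) => h hx.
rewrite !(om_integrandE _ _ _ _ hx) (linZ (ul x)) -scalerN; congr (_ *: _).
have TM' : forall x e, @T x (u x e) = u x ((fun x e => - @T x e) x e).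
  by move=> y v; rewrite TM (linN (ul y)).
rewrite (conj_act_map1 ueq TM') -(linN (ul x)); congr (u x _).
by rewrite /conj_act actN.
Qed.

Lemma om_op_linear (M : C) : (forall x e, `|@T x e| <= M * `|e|) ->
  cont_linear (om_space Om E) (om_space Om E) (om_op lam c T).
Proof.
move=> TM; split.
- by move=> g a u v; apply: omfib_ext => w x wg wx;
    rewrite /= !(om_opP cP HE Tc) (avg_linear cP HE Tc wx).
- move=> g; exists M; apply: nearW => g' e; have [w wg] := rho_onto Om g'.
  rewrite (omfib_normE e wg erefl) (omfib_normE (om_op lam c T e) wg erefl).
  by rewrite (om_opP cP HE Tc); exact: avg_norm.
- move=> s /om_secP ss; apply/om_secP => w; move: (avg_near cP HE Tc (ss w)).
  congr near_sec; apply: functional_extensionality_dep => w'.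
  by rewrite (om_opP cP HE Tc).
Qed.

Lemma om_op_norm (M : C) : (forall x e, `|@T x e| <= M * `|e|) ->
  forall g (e : om_space Om E g), `|om_op lam c T e| <= M * `|e|.
Proof.
move=> TM g e; have [w wg] := rho_onto Om g.
rewrite (omfib_normE e wg erefl) (omfib_normE (om_op lam c T e) wg erefl).
by rewrite (om_opP cP HE Tc); exact: avg_norm.
Qed.

End Linear.
End AverageMaps.

(** * Cycle conditions for the averaged operator *)

Section OmCycle.
Variables (R : realType) (G H : groupoid) (Om : equivalence G H) (lam : haar_system R H).
Variable c : pts Om -> R.
Hypothesis cP : is_cutoff Om lam c.
Local Notation C := R[i].
Variables (A B : galg R H) (E : kkdata A B).
Hypotheses (HA : is_galg A) (HB : is_galg B) (EC : is_cycle E).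

Let EP := cyc_pair EC.
Let OP := cyc_op EC.
Let HL := cyc_lp EP.
Let HR := cyc_rp EP.
Local Notation avl := (avg cP (cyc_lp (cyc_pair EC)) (cyc_tl (cyc_op EC))).
Local Notation avr := (avg cP (cyc_rp (cyc_pair EC)) (cyc_tr (cyc_op EC))).

Lemma avl_norm : exists2 M : C, 0 <= M & [/\ forall w x (wx : sig w = x) (f : lp E x), `|avl wx f| <= M * `|f|,
  forall w x (wx : sig w = x) (e : rp E x), `|avr wx e| <= M * `|e|,
  forall x (f : lp E x), `|tl f| <= M * `|f| & forall x (e : rp E x), `|tr e| <= M * `|e|].
Proof.
have [M M0 MP] := op_bound EC; exists M => //; split.
- by apply: avg_norm => x; exact: (MP x).1.
- by apply: avg_norm => x; exact: (MP x).2.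
- by move=> x; exact: (MP x).1.
- by move=> x; exact: (MP x).2.
Qed.

Lemma avl_bl w x (wx : sig w = x) (b : B x) f : avl wx (bl b f) = bl b (avl wx f).
Proof.
exact: (avg_map2r cP HL HL _ _ (@bl_eq _ _ _ _ E) (cyc_bl_contr EP) (cb_bilinear (cyc_bl EP)) wx b f (@cyc_tl_bl _ _ _ _ _ OP)).
Qed.

Lemma avr_rb w x (wx : sig w = x) (b : B x) f : avr wx (rb f b) = rb (avr wx f) b.
Proof.
exact: (avg_map2l cP HR HR _ _ (@rb_eq _ _ _ _ E) (cyc_rb_contr EP) (cb_bilinear (cyc_rb EP)) wx f b (fun x e b => @cyc_tr_rb _ _ _ _ _ OP x b e)).
Qed.

Lemma avr_pr w x (wx : sig w = x) (f : lp E x) e : pr f (avr wx e) = pr (avl wx f) e.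
Proof.
exact: (avg_adjoint cP HL HR _ _ (@pr_eq _ _ _ _ E) (cyc_pr_contr EP) (cb_bilinear (cyc_pr EP)) wx f e (@cyc_t_pr _ _ _ _ _ OP)).
Qed.

Lemma om_odd_operator : is_odd_operator (om_cycle Om lam c E).
Proof.
have [M M0 [_ _ Ml Mr]] := avl_norm.
have gll : forall x, linear (@gl _ _ _ _ E x) by case: (cyc_gl EP).
have grl : forall x, linear (@gr _ _ _ _ E x) by case: (cyc_gr EP).
have opl := om_opP cP HL (cyc_tl OP); have opr := om_opP cP HR (cyc_tr OP).
split.
- exact: (om_op_linear cP HL (cyc_tl OP) Ml).
- exact: (om_op_linear cP HR (cyc_tr OP) Mr).
- exists M => g; split.
    exact: (om_op_norm cP HL (cyc_tl OP) Ml).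
  exact: (om_op_norm cP HR (cyc_tr OP) Mr).
- by move=> g b f; apply: omfib_ext => w x wg wx; rewrite /= !opl /= avl_bl.
- by move=> g b f; apply: omfib_ext => w x wg wx; rewrite /= !opr /= avr_rb.
- by move=> g f e; apply: omfib_ext => w x wg wx; rewrite /= opr opl avr_pr.
- move=> g f; apply: omfib_ext => w x wg wx; rewrite /= !opl /=.
  exact: (avg_odd _ _ _ (@gl_eq _ _ _ _ E) wx _ gll (@cyc_gl_norm _ _ _ _ _ EP) (@cyc_tl_odd _ _ _ _ _ OP)).
- move=> g f; apply: omfib_ext => w x wg wx; rewrite /= !opr /=.
  exact: (avg_odd _ _ _ (@gr_eq _ _ _ _ E) wx _ grl (@cyc_gr_norm _ _ _ _ _ EP) (@cyc_tr_odd _ _ _ _ _ OP)).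
Qed.

Let sc := @sig_cts _ _ Om.

Lemma near_cutoff (w0 : pts Om) h0 (e : C) : rng h0 = sig w0 -> 0 < e ->
  \forall z \near (sub_nbhs (w0, h0) : set_system {p | fibred (@sig _ _ Om) p}),
    `|(c (rmv (sval z).1 (sval z).2))%:C - (c (rmv w0 h0))%:C| <= e.
Proof.
move=> h0w e0.
have [r eE] : exists r : R, e = r%:C by exists (complex.Re e); rewrite RRe_real// gtr0_real.
rewrite eE ltcR in e0.
have /continuous_distP/(_ (rmv w0 h0) r e0) n := cutoff_continuous cP.
have {}n : sub_nbhs (w0, h0) _ := fibred_rmv_cvg h0w n.
apply: filterS n => z /= n.
by rewrite -rmorphB/= normc_def/= expr0n/= addr0 sqrtr_sqr eE lecR distrC ltW.
Qed.

Lemma near_compact_cutoff (w0 : pts Om) h0 Sl Sr : rng h0 = sig w0 ->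
  @near_compact R H A B E _ (sub_nbhs (w0, h0) : set_system {p | fibred (@sig _ _ Om) p})
    (fun z => sig (sval z).1) Sl Sr ->
  near_compact (sub_nbhs (w0, h0) : set_system {p | fibred (@sig _ _ Om) p})
    (fun z f => (c (rmv (sval z).1 (sval z).2))%:C *: Sl z f)
    (fun z v => (c (rmv (sval z).1 (sval z).2))%:C *: Sr z v).
Proof.
move=> h0w; apply: (near_compact_scale (a := (c (rmv w0 h0))%:C) _ (@fibred_sig_cvg _ _ Om w0 h0) EP).
by move=> e; exact: near_cutoff.
Qed.

Let cf w := cutoff_fibre cP (erefl (sig w)).

(** As [c] has integral 1, [a (T~ - T)] is the integral of [c(w h) a (h T h^-1 - T)], and
    [near_equivariance] makes the integrand locally compact. *)
Lemma near_diff_base (a : forall x, A x) (w0 : pts Om) : sec A a ->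
  near_compact (nbhs w0)
    (fun w f => avl (erefl (sig w)) (la f (a (sig w))) - tl (la f (a (sig w))))
    (fun w v => ar (a (sig w)) (avr (erefl (sig w)) v - tr v)).
Proof.
move=> sa.
have arl x (b : A x) : linear (@ar _ _ _ _ E x b) by have [+ _] := cb_bilinear (cyc_ar EP) x; apply.
have arb x (b : A x) (v : rp E x) : `|ar b v| <= `|b| * `|v| := cyc_ar_contr EP b v.
apply: (near_compact_integral (lam := lam) (q := @sig _ _ Om) sc EP
  (Fl := fun w h f => om_integrand c (@tl _ _ _ _ E) w (la f (a (sig w))) h - (c (rmv w h))%:C *: tl (la f (a (sig w))))
  (Fr := fun w h v => ar (a (sig w)) (om_integrand c (@tr _ _ _ _ E) w v h - (c (rmv w h))%:C *: tr v))).
- move=> h0 h0w.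
  have h := near_equivariance EC (fun z : {p | fibred (@sig _ _ Om) p} => svalP z) (sub_nbhs_filter _ _)
    (@fibred_src_cvg _ _ Om w0 h0) sa.
  apply: near_compact_ext (near_compact_cutoff h0w h) => z v /=.
    by rewrite (om_integrandE _ _ _ _ (svalP z)) scalerBr.
  by rewrite (om_integrandE _ _ _ _ (svalP z)) -scalerBr (linZ (arl _ _)).
- have [K Kc n] := cutoff_proper_support cP w0; exists K => //; apply: filterS n => w wK h hw nK.
  by split=> v; rewrite (om_integrandE _ _ _ _ hw) wK// !scale0r subrr// (lin0 (arl _ _)).
- by move=> w f; have [fc fs] := cf w; apply: fibre_regularB; [exact: (om_integrand_regular cP HL (cyc_tl OP))|exact: fibre_regular_scale].
- move=> w f; have [fc fs] := cf w; apply: (fibre_regular_map (arl _ _) (arb _ _)).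
  by apply: fibre_regularB; [exact: (om_integrand_regular cP HR (cyc_tr OP))|exact: fibre_regular_scale].
- move=> w f; have [fc fs] := cf w; apply: weak_intB.
  + exact: (om_integrand_regular cP HL (cyc_tl OP)).
  + exact: fibre_regular_scale.
  + exact: avgP.
  + by have := weak_int_scale lam (tl (la f (a (sig w)))) fc fs; rewrite (cutoff_hint cP) ?scale1r.
- move=> w f; have [fc fs] := cf w; apply: (weak_int_map (arl _ _) (arb _ _)); apply: weak_intB.
  + exact: (om_integrand_regular cP HR (cyc_tr OP)).
  + exact: fibre_regular_scale.
  + exact: avgP.
  + by have := weak_int_scale lam (tr f) fc fs; rewrite (cutoff_hint cP) ?scale1r.
Qed.

(** The map [m] into [Om] serves the equivariance condition, where [T~] occurs at [gamma^-1 w],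
    whose [sig] equals [sig w] only propositionally. *)
Lemma near_diff (Z : Type) (F : set_system Z) (m : Z -> pts Om) (w1 : pts Om) (q : Z -> obj H)
    (pf : forall z, sig (m z) = q z) (a : forall z, A (q z)) :
  Filter F -> m @ F --> w1 -> near_sec F a ->
  near_compact F (fun z f => avl (pf z) (la f (a z)) - tl (la f (a z)))
    (fun z v => ar (a z) (avr (pf z) v - tr v)).
Proof.
move=> FF mF as_; have [M M0 [ml mr tl_ tr_]] := avl_norm.
apply: (@near_compact_approx _ _ _ _ _ _ _ _ _ _ _ (M + M)); first exact: addr_ge0.
move=> d d0 _; have [a0 sa0 n] := as_ d d0.
exists (fun z f => avl (pf z) (la f (a0 (q z))) - tl (la f (a0 (q z)))),
  (fun z v => ar (a0 (q z)) (avr (pf z) v - tr v)); split.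
  exact: (near_compact_pull (r := @sig _ _ Om)
    (Sl := fun t x (p : sig t = x) f => avl p (la f (a0 x)) - tl (la f (a0 x)))
    (Sr := fun t x (p : sig t = x) v => ar (a0 x) (avr p v - tr v)) pf FF mF (near_diff_base w1 sa0)).
have tll : forall x, linear (@tl _ _ _ _ E x) by case: (cyc_tl OP).
apply: filterS n => z n; split=> v.
  have [arr_ arl] := cb_bilinear (cyc_ar EP) (q z).
  rewrite -(linB (arl _)) [(M + M) * d]mulrC -mulrA; apply: (ar_le EC) n _.
  by rewrite mulrDl; apply: le_trans (ler_normB _ _) _; rewrite lerD.
have [lar lal] := cb_bilinear (cyc_la EP) (q z).
rewrite subACA -(linB (tll _)) -(linB (avg_linear cP HL (cyc_tl OP) (pf z))) -(linB (lar v)).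
rewrite -mulrA mulrDl; apply: le_trans (ler_normB _ _) _; rewrite lerD//.
  by apply: le_trans (ml _ _ _ _) _; rewrite ler_wpM2l// (la_le EC).
by apply: le_trans (tl_ _ _) _; rewrite ler_wpM2l// (la_le EC).
Qed.

(** [[a, T~_w]] is the integral of [c(w h) h [h^-1 a, T] h^-1]. *)
Lemma near_avg_commutator (a : forall w, A (sig w)) (w0 : pts Om) : near_sec (nbhs w0) a ->
  near_compact (nbhs w0)
    (fun w f => avl (erefl (sig w)) (la f (a w)) - la (avl (erefl (sig w)) f) (a w))
    (fun w v => ar (a w) (avr (erefl (sig w)) v) - avr (erefl (sig w)) (ar (a w) v)).
Proof.
move=> sa; have [[Au _] _] := HA.
have arl x (b : A x) : linear (@ar _ _ _ _ E x b) by have [+ _] := cb_bilinear (cyc_ar EP) x; apply.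
have arb x (b : A x) (v : rp E x) : `|ar b v| <= `|b| * `|v| := cyc_ar_contr EP b v.
have lal x (b : A x) : linear (fun f : lp E x => la f b) by have [_ +] := cb_bilinear (cyc_la EP) x; apply.
have lab x (b : A x) (v : lp E x) : `|la v b| <= `|b| * `|v| by rewrite mulrC; exact: (cyc_la_contr EP).
apply: (near_compact_integral (lam := lam) (q := @sig _ _ Om) sc EP
  (Fl := fun w h f => om_integrand c (@tl _ _ _ _ E) w (la f (a w)) h - la (om_integrand c (@tl _ _ _ _ E) w f h) (a w))
  (Fr := fun w h v => ar (a w) (om_integrand c (@tr _ _ _ _ E) w v h) - om_integrand c (@tr _ _ _ _ E) w (ar (a w) v) h)).
- move=> h0 h0w; pose Z := {p | fibred (@sig _ _ Om) p}.
  pose F : set_system Z := sub_nbhs (w0, h0).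
  have FF : Filter F := sub_nbhs_filter _ _.
  have hF : (fun z : Z => (sval z).2) @ F --> h0 := @fibred_src_cvg _ _ Om w0 h0.
  have wF : (fun z : Z => (sval z).1) @ F --> w0.
    exact: (@sub_nbhs_cvg _ _ (fibred (@sig _ _ Om)) fst (w0, h0) (@fst_cts _ _ _)).
  have aF : near_sec F (fun z : Z => a (sval z).1).
    move=> d d0; have [xi sxi n] := sa d d0; exists xi => //.
    by have n' : F (_ @^-1` _) := wF _ n; apply: filterS n'.
  have sF : (fun z : Z => src (sval z).2) @ F --> src h0.
    by apply: cvg_comp hF _; exact: src_cts.
  have iF : (fun z : Z => ginv (sval z).2) @ F --> ginv h0.
    by apply: cvg_comp hF _; exact: ginv_cts.
  pose hr (z : Z) : rng (sval z).2 = sig (sval z).1 := svalP z.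
  have aF' := near_sec_act (fun z : Z => etrans (src_inv (sval z).2) (hr z)) (fun z => rng_inv (sval z).2) HA.1 FF iF aF.
  have h := near_compact_conj EP hr FF hF (near_commutator EC FF sF aF').
  apply: near_compact_ext (near_compact_cutoff h0w h) => z v /=.
    rewrite !(om_integrandE _ _ _ _ (svalP z)) (linZ (lal _ _)) -scalerBr actB.
    congr (_ *: (_ - _)); first by rewrite /conj_act la_eq.
    by rewrite la_eq act_invK'.
  rewrite !(om_integrandE _ _ _ _ (svalP z)) (linZ (arl _ _)) -scalerBr actB.
  congr (_ *: (_ - _)); last by rewrite /conj_act ar_eq.
  by rewrite ar_eq act_invK'.
- have [K Kc n] := cutoff_proper_support cP w0; exists K => //; apply: filterS n => w wK h hw nK.
  by split=> v; rewrite !(om_integrandE _ _ _ _ hw) wK// !scale0r ?(lin0 (arl _ _)) ?(lin0 (lal _ _)) subrr.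
- move=> w f; apply: fibre_regularB; first exact: (om_integrand_regular cP HL (cyc_tl OP)).
  by apply: (fibre_regular_map (lal _ _) (lab _ _)); exact: (om_integrand_regular cP HL (cyc_tl OP)).
- move=> w f; apply: fibre_regularB; last exact: (om_integrand_regular cP HR (cyc_tr OP)).
  by apply: (fibre_regular_map (arl _ _) (arb _ _)); exact: (om_integrand_regular cP HR (cyc_tr OP)).
- move=> w f; apply: weak_intB.
  + exact: (om_integrand_regular cP HL (cyc_tl OP)).
  + by apply: (fibre_regular_map (lal _ _) (lab _ _)); exact: (om_integrand_regular cP HL (cyc_tl OP)).
  + exact: avgP.
  + by apply: (weak_int_map (lal _ _) (lab _ _)); exact: avgP.
- move=> w f; apply: weak_intB.
  + by apply: (fibre_regular_map (arl _ _) (arb _ _)); exact: (om_integrand_regular cP HR (cyc_tr OP)).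
  + exact: (om_integrand_regular cP HR (cyc_tr OP)).
  + by apply: (weak_int_map (arl _ _) (arb _ _)); exact: avgP.
  + exact: avgP.
Qed.

Lemma near_adjointable_avg (w0 : pts Om) :
  near_adjointable (nbhs w0) (fun w => avl (erefl (sig w))) (fun w => avr (erefl (sig w))).
Proof.
have [M M0 [ml mr _ _]] := avl_norm; split.
- by move=> w; exact: avg_linear.
- by move=> w; exact: avg_linear.
- by exists M => //; apply: nearW => w; split.
- by move=> xi; exact: avg_near.
- by move=> xi; exact: avg_near.
- by move=> w b f; exact: avl_bl.
- by move=> w b f; exact: avr_rb.
- by move=> w b f; exact: avr_pr.
Qed.

(** With [D = T - T~]: [a (1 - T~^2) = a (1 - T^2) + a D T + T~ a D + [a, T~] D], and each of the
    four terms is locally compact. *)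
Lemma near_avg_square (a : forall w, A (sig w)) (w0 : pts Om) : near_sec (nbhs w0) a ->
  near_compact (nbhs w0)
    (fun w f => la f (a w) - avl (erefl (sig w)) (avl (erefl (sig w)) (la f (a w))))
    (fun w v => ar (a w) (v - avr (erefl (sig w)) (avr (erefl (sig w)) v))).
Proof.
move=> sa; have FF := nbhs_filter w0.
have ta := near_adjointable_op OP FF (@sig_cts _ _ Om w0).
have aa := near_adjointable_avg w0; have da := near_adjointableB EP FF ta aa.
have k1 := near_square EC FF (@sig_cts _ _ Om w0) sa.
have k2 := near_compactN FF (@sig_cts _ _ Om w0) EP (near_diff (m := idfun) (fun w => erefl (sig w)) FF (@cvg_id _ _) sa).
have k3 := near_compact_mulr FF (@sig_cts _ _ Om w0) EP ta k2.
have k4 := near_compact_mull FF (@sig_cts _ _ Om w0) EP aa k2.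
have k5 := near_compact_mulr FF (@sig_cts _ _ Om w0) EP da (near_avg_commutator sa).
have tll : forall x, linear (@tl _ _ _ _ E x) by case: (cyc_tl OP).
have avll w : linear (avl (erefl (sig w))) := avg_linear _ _ _ _.
have avrl w : linear (avr (erefl (sig w))) := avg_linear _ _ _ _.
apply: near_compact_ext (near_compactD FF (near_compactD FF (near_compactD FF k1 k3) k4) k5) => w v /=.
  rewrite !(linB (tll _)) !(linN (tll _)) !(linB (avll _)) !(linB (tll _)) opprB.
  set x1 := la v (a w); set x2 := tl (tl x1); set x3 := tl (avl _ x1).
  set y1 := tl (la (avl _ v) _); set y2 := avl _ (la (avl _ v) _).
  set x4 := avl _ (avl _ x1).
  by rewrite (addrA (x1 - x2)) subrK (opprB y2 y1) (subACA x3) addrACA subrr addr0 addrA subrK.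
have [arl _] := cb_bilinear (cyc_ar EP) (sig w).
pose u := tr v - avr (erefl (sig w)) v.
have -> : - ar (a w) (avr erefl v - tr v) = ar (a w) u by rewrite -(linN (arl _)) opprB.
set t := avr _ (ar (a w) u); rewrite -addrA [t + _]addrC subrK -(linB (arl _)) -(linD (arl _)).
by congr (ar _ _); rewrite (linB (avrl w)) subACA subrr subr0 addrA subrK.
Qed.

End OmCycle.

(** * Pulled-back cycles *)

Section Descent.
Variables (R : realType) (G H : groupoid) (Om : equivalence G H) (lam : haar_system R H).
Variable c : pts Om -> R.
Local Notation C := R[i].
Variables (A B : galg R H) (E : kkdata A B).
Hypotheses (HA : is_galg A) (HB : is_galg B) (EP : is_pair E).
Variables (Y : topologicalType) (p : Y -> obj G).
Hypothesis pc : continuous p.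

Local Notation D := (om_cycle Om lam c E).
Let DP : is_pair D := om_is_pair lam c HA HB EP.

Definition over_anchor (z : Y * pts Om) : Prop := rho z.2 = p z.1.

Local Notation Z := {z | over_anchor z}.

Lemma anchor_sig_cvg (y0 : Y) w0 :
  (fun z : Z => sig (sval z).2) @ (sub_nbhs (y0, w0) : set_system Z) --> sig w0.
Proof.
apply: (@sub_nbhs_cvg _ _ over_anchor (fun z => sig z.2) (y0, w0)).
by apply: continuous_comp; [exact: snd_cts|exact: sig_cts].
Qed.

Lemma anchor_pts_cvg (y0 : Y) w0 :
  (fun z : Z => (sval z).2) @ (sub_nbhs (y0, w0) : set_system Z) --> w0.
Proof. exact: (@sub_nbhs_cvg _ _ over_anchor snd (y0, w0) (@snd_cts _ _ _)). Qed.

(** Density gives a section of [Om^* K] with almost the prescribed component at [w0], and upper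
    semicontinuity of the difference spreads the estimate to nearby [w]. *)
Lemma om_section_through (K : gspace R H) (HK : is_gspace K) (xi : forall x, K x) (w0 : pts Om) (d : C) :
  0 < d -> sec K xi -> exists2 s, sec (om_space Om K) s &
    \forall w \near w0, `|at_ (s (rho w)) (erefl (rho w)) (erefl (sig w)) - xi (sig w)| <= d.
Proof.
move=> d0 sxi; have [Ku _] := HK.
have [e eE] := om_at_onto (erefl (rho w0)) (erefl (sig w0)) (xi (sig w0)).
have [s ss se] := om_dense HK lam e d0; exists s => //.
have /om_secP/(_ w0) s1 := ss.
have s2 : near_sec (nbhs w0) (fun w => at_ (s (rho w)) erefl erefl - xi (sig w)).
  by apply: near_secD => //; apply: near_secN => //; exact: near_sec_base.
have n : \forall w \near w0, `|at_ (s (rho w)) (erefl (rho w)) (erefl (sig w)) - xi (sig w)| < d.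
  apply: (near_sec_usc Ku _ (@nbhs_singleton _ w0) (@sig_cts _ _ Om w0) s2).
  by move: se; rewrite distrC (omfib_normE _ (erefl (rho w0)) (erefl (sig w0))) /= eE.
by apply: filterS n => w /ltW.
Qed.

(** Replaces sections of [E] by sections of the pulled-back pair, from which the approximating
    operators on [Om^* E] must be built. *)
Lemma om_base_pairs (y0 : Y) w0 (s : seq ((forall x, rp E x) * (forall x, lp E x))) (e : C) :
  0 < e -> base_pairs s -> exists2 t : seq ((forall g, rp D g) * (forall g, lp D g)),
    base_pairs t &
    near_op_le (sub_nbhs (y0, w0) : set_system Z) (q := fun z => sig (sval z).2) (E := E)
      (fun z f => \sum_(a <- s) rankl (a.1 (sig (sval z).2)) (a.2 (sig (sval z).2)) f -
         \sum_(a <- t) rankl (E := E) (at_ (a.1 (p (sval z).1)) (svalP z) erefl) (at_ (a.2 (p (sval z).1)) (svalP z) erefl) f)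
      (fun z f => \sum_(a <- s) rankr (a.1 (sig (sval z).2)) (a.2 (sig (sval z).2)) f -
         \sum_(a <- t) rankr (E := E) (at_ (a.1 (p (sval z).1)) (svalP z) erefl) (at_ (a.2 (p (sval z).1)) (svalP z) erefl) f) e.
Proof.
have FF : Filter (sub_nbhs (y0, w0) : set_system Z) := sub_nbhs_filter _ _.
have [HL HR] := (cyc_lp EP, cyc_rp EP).
have [Lu Ru] := (proj1 HL, proj1 HR).
elim: s e => [|[eta xi] s IH] e e0 sP.
  exists [::]; first exact: List.Forall_nil.
  by apply: nearW => z; split=> v; rewrite !big_nil subrr normr0 mulr_ge0// ltW.
have [[/= s1 s2] sP'] := (List.Forall_cons_iff _ _ _).1 sP.
have e20 : 0 < e / 2 by rewrite divr_gt0.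
have [t tP tn] := IH _ e20 sP'.
have qF := @anchor_sig_cvg y0 w0; have mF := @anchor_pts_cvg y0 w0.
have [M1 M10 n1] := near_sec_bounded FF qF Ru (near_sec_base (fun z : Z => sig (sval z).2) FF s1).
have [M2 M20 n2] := near_sec_bounded FF qF Lu (near_sec_base (fun z : Z => sig (sval z).2) FF s2).
have [d [d0 d1 Md]] := scaled_eps (addr_ge0 M10 (addr_ge0 M20 ler01)) e20.
have [eta' se1 ne1] := om_section_through HR w0 d0 s1.
have [xi' se2 ne2] := om_section_through HL w0 d0 s2.
exists ((eta', xi') :: t); first exact: List.Forall_cons.
have {}ne1 : sub_nbhs (y0, w0) (_ @^-1` _) := mF _ ne1.
have {}ne2 : sub_nbhs (y0, w0) (_ @^-1` _) := mF _ ne2.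
apply: filterS2 tn (filterI (filterI n1 n2) (filterI ne1 ne2)) => z [t1 t2] [[h1 h2] /= [h3 h4]].
rewrite -(at_section_irr eta' (svalP z) erefl erefl) in h3.
rewrite -(at_section_irr xi' (svalP z) erefl erefl) in h4.
have h5 : `|at_ (xi' (p (sval z).1)) (svalP z) erefl| <= M2 + 1.
  rewrite -[X in `|X|](subrK (xi (sig (sval z).2))) addrC.
  by apply: le_trans (ler_normD _ _) _; rewrite lerD// (le_trans h4).
have Md' : (M1 + (M2 + 1)) * d <= e / 2 by [].
split=> v; rewrite !big_cons /= [e]splitr mulrDl opprD addrACA;
  apply: le_trans (ler_normD _ _) _; rewrite lerD//; rewrite distrC.
  apply: le_trans (ler_wpM2r (normr_ge0 v) Md').
  apply: (rank_dist (m := fun a b => rankr a b v)) => //; rewrite ?addr_ge0 ?(ltW d0)//.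
    exact: rankr_bilinear.
  by move=> *; exact: rankr_le.
apply: le_trans (ler_wpM2r (normr_ge0 v) Md').
apply: (rank_dist (m := fun a b => rankl a b v)) => //; rewrite ?addr_ge0 ?(ltW d0)//.
  exact: rankl_bilinear.
by move=> *; exact: rankl_le.
Qed.

(** Local compactness on [Om^* E] may be tested on components: an estimate at [(y, w)] concerns a
    fibre isometric to the one at [p y], and [near_descent] removes [w]. *)
Lemma om_locally_compact (Tl : forall y, lp D (p y) -> lp D (p y))
    (Tr : forall y, rp D (p y) -> rp D (p y))
    (Sl : forall z : Z, lp E (sig (sval z).2) -> lp E (sig (sval z).2))
    (Sr : forall z : Z, rp E (sig (sval z).2) -> rp E (sig (sval z).2)) :
  (forall (z : Z) f, at_ (Tl (sval z).1 f) (svalP z) erefl = Sl z (at_ f (svalP z) erefl)) ->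
  (forall (z : Z) f, at_ (Tr (sval z).1 f) (svalP z) erefl = Sr z (at_ f (svalP z) erefl)) ->
  (forall y0 w0, rho w0 = p y0 -> near_compact (sub_nbhs (y0, w0) : set_system Z) Sl Sr) ->
  locally_compact_op (E := D) (p := p) Tl Tr.
Proof.
move=> TSl TSr Sc; apply/(locally_compact_opP _ _ DP pc) => y0 e e0.
have e20 : 0 < e / 2 by rewrite divr_gt0.
have [w0 w0y] := rho_onto Om (p y0).
have [s sP sn] := Sc y0 w0 w0y _ e20.
have [t tP tn] := om_base_pairs y0 w0 e20 sP; exists t => //.
pose P y := (forall v, `|Tr y v - \sum_(a <- t) rankr (a.1 (p y)) (a.2 (p y)) v| <= e * `|v|) /\
  (forall f, `|Tl y f - \sum_(a <- t) rankl (a.1 (p y)) (a.2 (p y)) f| <= e * `|f|).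
have nd := @near_descent G H Om Y p y0 w0 (fun y _ => P y) (@pc y0) (esym w0y).
have {nd} : \forall y \near y0, exists2 w : pts Om, rho w = p y & P y.
  apply: nd; have n : nbhs (y0, w0) (fun z : Y * pts Om => forall pf : over_anchor z, _) := @filterI _ _ (sub_nbhs_filter _ _) _ _ sn tn.
  apply: filterS n => -[y w] n yw; have wy : rho w = p y by rewrite yw.
  have [[h1 h2] [h3 h4]] := n wy.
  pose z : Z := exist over_anchor (y, w) wy.
  split=> v.
    rewrite (omfib_normE v wy erefl) (omfib_normE _ wy erefl) [e]splitr mulrDl.
    have -> : at_ (Tr y v - \sum_(a <- t) rankr (a.1 (p y)) (a.2 (p y)) v) wy erefl =
        Sr z (at_ v wy erefl) - \sum_(a <- t) rankr (E := E) (at_ (a.1 (p y)) wy erefl) (at_ (a.2 (p y)) wy erefl) (at_ v wy erefl).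
      have := TSr z v; rewrite (Prop_irrelevance (svalP z) wy) /= => <-; congr (_ - _).
      by rewrite (big_morph (fun u : om_space Om (rp E) (p y) => at_ u wy erefl) (id1 := 0) (op1 := +%R)).
    apply: le_trans (ler_distD (\sum_(a <- s) rankr (a.1 (sig w)) (a.2 (sig w)) (at_ v wy erefl)) _ _) _.
    apply: lerD; first exact: h1.
    by have := h3 (at_ v wy erefl); rewrite (Prop_irrelevance (svalP z) wy).
  rewrite (omfib_normE v wy erefl) (omfib_normE _ wy erefl) [e]splitr mulrDl.
  have -> : at_ (Tl y v - \sum_(a <- t) rankl (a.1 (p y)) (a.2 (p y)) v) wy erefl =
      Sl z (at_ v wy erefl) - \sum_(a <- t) rankl (E := E) (at_ (a.1 (p y)) wy erefl) (at_ (a.2 (p y)) wy erefl) (at_ v wy erefl).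
    have := TSl z v; rewrite (Prop_irrelevance (svalP z) wy) /= => <-; congr (_ - _).
    by rewrite (big_morph (fun u : om_space Om (lp E) (p y) => at_ u wy erefl) (id1 := 0) (op1 := +%R)).
  apply: le_trans (ler_distD (\sum_(a <- s) rankl (a.1 (sig w)) (a.2 (sig w)) (at_ v wy erefl)) _ _) _.
  apply: lerD; first exact: h2.
  by have := h4 (at_ v wy erefl); rewrite (Prop_irrelevance (svalP z) wy).
by apply: filterS => y [].
Qed.

End Descent.

Section OmIsCycle.
Variables (R : realType) (G H : groupoid) (Om : equivalence G H) (lam : haar_system R H).
Variable c : pts Om -> R.
Hypothesis cP : is_cutoff Om lam c.
Local Notation C := R[i].
Variables (A B : galg R H) (E : kkdata A B).
Hypotheses (HA : is_galg A) (HB : is_galg B) (EC : is_cycle E).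

Let EP := cyc_pair EC.
Let OP := cyc_op EC.
Let HL := cyc_lp EP.
Let HR := cyc_rp EP.
Local Notation avl := (avg cP (cyc_lp (cyc_pair EC)) (cyc_tl (cyc_op EC))).
Local Notation avr := (avg cP (cyc_rp (cyc_pair EC)) (cyc_tr (cyc_op EC))).

Lemma om_is_cycle : is_cycle (om_cycle Om lam c E).
Proof.
have opl := om_opP cP HL (cyc_tl OP); have opr := om_opP cP HR (cyc_tr OP).
split.
- exact: om_is_pair.
- exact: om_odd_operator.
- move=> a /om_secP sa.
  pose aa (z : {z | over_anchor (Om := Om) (@idfun (obj G)) z}) : A (sig (sval z).2) := at_ (a (sval z).1) (svalP z) erefl.
  apply: (om_locally_compact (lam := lam) (c := c) HA HB EP (fun x => @cvg_id _ _)
    (Sl := fun z f => avl erefl (la f (aa z)) - la (avl erefl f) (aa z))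
    (Sr := fun z v => ar (aa z) (avr erefl v) - avr erefl (ar (aa z) v))).
  + by move=> z f; rewrite /= !opl.
  + by move=> z f; rewrite /= !opr.
  move=> y0 w0 w0y.
  have h := near_compact_pull (r := @sig _ _ Om) (m := fun z : {z | over_anchor (Om := Om) (@idfun (obj G)) z} => (sval z).2)
    (Sl := fun w x (p : sig w = x) f => avl p (la f (at_ (a (rho w)) erefl p)) - la (avl p f) (at_ (a (rho w)) erefl p))
    (Sr := fun w x (p : sig w = x) v => ar (at_ (a (rho w)) erefl p) (avr p v) - avr p (ar (at_ (a (rho w)) erefl p) v))
    (fun z => erefl) (sub_nbhs_filter _ _) (@anchor_pts_cvg G H Om _ idfun y0 w0) (near_avg_commutator cP HA EC (sa w0)).
  by apply: near_compact_ext h => z v; rewrite /aa (at_section_irr a (svalP z) erefl erefl).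
- move=> a /om_secP sa.
  pose aa (z : {z | over_anchor (Om := Om) (@idfun (obj G)) z}) : A (sig (sval z).2) := at_ (a (sval z).1) (svalP z) erefl.
  apply: (om_locally_compact (lam := lam) (c := c) HA HB EP (fun x => @cvg_id _ _)
    (Sl := fun z f => la f (aa z) - avl erefl (avl erefl (la f (aa z))))
    (Sr := fun z v => ar (aa z) (v - avr erefl (avr erefl v)))).
  + by move=> z f; rewrite /= !opl.
  + by move=> z f; rewrite /= !opr.
  move=> y0 w0 w0y.
  have h := near_compact_pull (r := @sig _ _ Om) (m := fun z : {z | over_anchor (Om := Om) (@idfun (obj G)) z} => (sval z).2)
    (Sl := fun w x (p : sig w = x) f => la f (at_ (a (rho w)) erefl p) - avl p (avl p (la f (at_ (a (rho w)) erefl p))))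
    (Sr := fun w x (p : sig w = x) v => ar (at_ (a (rho w)) erefl p) (v - avr p (avr p v)))
    (fun z => erefl) (sub_nbhs_filter _ _) (@anchor_pts_cvg G H Om _ idfun y0 w0) (near_avg_square cP HA EC (sa w0)).
  by apply: near_compact_ext h => z v; rewrite /aa (at_section_irr a (svalP z) erefl erefl).
move=> a /sec_pullP sa.
pose Z := {z | over_anchor (Om := Om) (@rng G) z}.
pose aa (z : Z) : A (sig (sval z).2) := at_ (a (sval z).1) (svalP z) erefl.
(* The component of [gamma T~ gamma^-1] at [w] is [T~] at [gamma^-1 w], a point with the same [sig].
   So the condition is the difference of two instances of [near_diff]. *)
pose m (z : Z) := lmv (ginv (sval z).1) (sval z).2.
have ms (z : Z) : src (ginv (sval z).1) = rho (sval z).2 by rewrite src_inv (svalP z).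
have pm (z : Z) : sig (m z) = sig (sval z).2 by rewrite sig_lmv.
have back (K : gspace R H) (z : Z) (f : om_space Om K (rng (sval z).1)) p q :
    @at_ _ _ _ _ _ _ f (lmv (ginv (ginv (sval z).1)) (m z)) (sig (sval z).2) p q =
    at_ f (svalP z) erefl.
  by apply: at_eq; rewrite -lmvM ?ginvK ?gmulVr ?rng_inv//;
    rewrite -?(svalP z) ?lmv1// ?src_inv -?(svalP z).
apply: (om_locally_compact (lam := lam) (c := c) HA HB EP (@rng_cts G)
  (Sl := fun z f => avl (pm z) (la f (aa z)) - avl erefl (la f (aa z)))
  (Sr := fun z v => ar (aa z) (avr (pm z) v - avr erefl v))).
- move=> z f; rewrite /= !opl /=; congr (_ - _).
  have -> (q : sig (m z) = sig (sval z).2) v : avl q v = avl (pm z) v by rewrite (Prop_irrelevance q (pm z)).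
  by rewrite !back.
- move=> z f; rewrite /= !opr /=; congr (ar _ (_ - _)).
  have -> (q : sig (m z) = sig (sval z).2) v : avr q v = avr (pm z) v by rewrite (Prop_irrelevance q (pm z)).
  by rewrite back.
move=> y0 w0 w0y.
have FF : Filter (sub_nbhs (y0, w0) : set_system Z) := sub_nbhs_filter _ _.
have mF : m @ (sub_nbhs (y0, w0) : set_system Z) --> lmv (ginv y0) w0.
  move=> U mU; have e1 : src (ginv y0) = rho w0 by rewrite src_inv w0y.
  have [[S1 S2] /= [n1 n2] SU] := lmv_near e1 mU.
  suff : \forall z \near (y0, w0), forall pp : over_anchor (@rng G) z, U (m (exist _ z pp)) by [].
  exists (@ginv G @^-1` S1, S2) => /=; first by split=> //; exact: ginv_cts n1.
  move=> [g w] /= [Sg Sw] pp; apply: (SU (ginv g, w)) => //=.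
  by rewrite src_inv.
have as_ : near_sec (sub_nbhs (y0, w0) : set_system Z) aa.
  apply: near_sec_approx => d d0; have [s ss n] := sa y0 d d0.
  exists (fun z => at_ (s (rho (sval z).2)) erefl erefl).
    have /om_secP/(_ w0) s0 := ss; move=> d' d'0; have [xi sxi n'] := s0 d' d'0.
    by exists xi => //; exact: (@anchor_pts_cvg _ _ _ _ _ y0 w0 _ n').
  have gF : (fun z : Z => (sval z).1) @ (sub_nbhs (y0, w0) : set_system Z) --> y0.
    exact: (@sub_nbhs_cvg _ _ (over_anchor (@rng G)) fst (y0, w0) (@fst_cts _ _ _)).
  have {}n : sub_nbhs (y0, w0) (_ @^-1` _) := gF _ n; apply: filterS n => z /=.
  rewrite (omfib_normE _ (svalP z) erefl) /=; congr (`|_ - _| <= _).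
  exact: at_section_irr.
have k1 := near_diff cP EC pm FF mF as_.
have k2 := near_diff cP EC (fun z => erefl) FF (@anchor_pts_cvg _ _ _ _ _ y0 w0) as_.
apply: near_compact_ext (near_compactB FF (@anchor_sig_cvg _ _ _ _ _ y0 w0) EP k1 k2) => z v.
  by rewrite subACA subrr subr0.
have [arl _] := cb_bilinear (cyc_ar EP) (sig (sval z).2).
by rewrite -(linB (arl _)) subACA subrr subr0.
Qed.

End OmIsCycle.

(** * Cut-off functions *)

Section RealContinuity.
Variables (R : realType) (T : topologicalType).

Lemma near_approx_continuous (f : T -> R) (t : T) :
  (forall e : R, 0 < e -> exists2 g : T -> R, {for t, continuous (g : T -> R^o)} &
     \forall s \near t, `|f s - g s| <= e) -> {for t, continuous (f : T -> R^o)}.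
Proof.
move=> H; apply/cvgrPdist_lt => e e0; have e40 : 0 < e / 4 by rewrite divr_gt0.
have [g gc n] := H _ e40; have /cvgr_dist_lt/(_ _ e40) n' := gc.
have nt := nbhs_singleton n; apply: filterS2 n n' => s fs gs /=.
have -> : f t - f s = (f t - g t) + (g t - g s) - (f s - g s).
  by ring.
apply: le_lt_trans (ler_normB _ _) _; apply: le_lt_trans (lerD (ler_normD _ _) (lexx _)) _.
by lra.
Qed.

Lemma sum_continuous_at I (r : seq I) (f : I -> T -> R) (t : T) :
  (forall i, {for t, continuous (f i : T -> R^o)}) ->
  {for t, continuous ((fun x => \sum_(i <- r) f i x) : T -> R^o)}.
Proof.
move=> fc; elim: r => [|i r IH].
  have -> : (fun x => \sum_(i <- [::]) f i x) = fun=> 0 by apply/funext => x; rewrite big_nil.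
  exact: cst_continuous.
have -> : (fun x => \sum_(j <- i :: r) f j x) = (fun x => f i x + \sum_(j <- r) f j x).
  by apply/funext => x; rewrite big_cons.
exact: (@continuousD _ _ _ (f i : T -> R^o)).
Qed.

End RealContinuity.

(** * Exhaustions of sigma-compact spaces *)

Section Exhaustion.
Variables (R : realType) (X : topologicalType).
Hypotheses (Xlc : locally_compact [set: X]) (Xhaus : hausdorff_space X).

Lemma compact_cutoff (K : set X) : compact K ->
  exists psi : X -> R, [/\ Cc psi, forall x, 0 <= psi x & forall x, K x -> 1 <= psi x].
Proof.
move=> Kc; have [psi [psiC psi0 part]] := partition_cutoff R Xlc Xhaus Kc.
exists psi; split=> // x Kx.
have [|n [_ [chi [_ _ cp cK _]]]] := part unit unit (globally setT) (fun _ _ _ => True) _.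
  by move=> h _; exists tt; exists (setT, setT) => //=; split; [exact: filterT|].
by rewrite -(cK x Kx); exact: cp.
Qed.

(** [L n.+1] is the support of a function that is at least 1 on [L n] and on [K n]. So [L n] lies in
    the interior of [L n.+1] and every [K n] is eventually absorbed. *)
Lemma exhaustion : sigma_compact X -> exists (L : nat -> set X) (psi : nat -> X -> R),
  [/\ forall n, compact (L n) & L 0%N = set0] /\
  [/\ forall n, continuous (psi n : X -> R^o), forall n x, 0 <= psi n x,
      forall n x, L n x -> 1 <= psi n x, forall n x, psi n x != 0 -> L n.+1 x &
      forall x, exists n, L n x].
Proof.
move=> [K [Kc KX]].
(* A choice for every set [M], compact or not, so that the recursion for [L] can be written before
   compactness of [L n] is known. *)
have ex M : exists psi : X -> R, compact M ->
    [/\ Cc psi, forall x, 0 <= psi x & forall x, M x -> 1 <= psi x].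
  have [Mc|Mc] := pselect (compact M); last by exists (fun=> 0).
  by have [psi psiP] := compact_cutoff Mc; exists psi.
have [pick pickP] := choice ex.
pose L := fix L n := if n is m.+1 then closure [set x | pick (L m `|` K m) x != 0] else set0.
have Lc n : compact (L n).
  elim: n => [|n IH] /=; first exact: compact0.
  by have [[_ ?] _ _] := pickP _ (compactU IH (Kc n)).
have LKc n := compactU (Lc n) (Kc n).
exists L, (fun n => pick (L n `|` K n)); split; first by split.
split=> [n|n x|n x Lx|n x nx|x].
- by have [[? _] _ _] := pickP _ (LKc n).
- by have [_ + _] := pickP _ (LKc n); apply.
- by have [_ _] := pickP _ (LKc n); apply; left.
- exact: subset_closure.
- have : [set: X] x by []. rewrite -KX => -[n _ Kx]; exists n.+1.
  apply: subset_closure => /=; have [_ _ p1] := pickP _ (LKc n).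
  by rewrite gt_eqF// (lt_le_trans ltr01)// p1//; right.
Qed.

End Exhaustion.

Section CutoffExistence.
Variables (R : realType) (G H : groupoid) (Om : equivalence G H) (lam : haar_system R H).

Lemma hint_estimate x (f : arr H -> R) n (chi : 'I_n -> arr H -> R) (r : 'I_n -> R)
    (psi : arr H -> R) (e : R) :
  fibre_continuous x f -> fibre_support x f -> (forall k, Cc (chi k)) -> Cc psi ->
  (forall h, rng h = x -> `|f h - \sum_k chi k h * r k| <= e * psi h) ->
  `|hint lam x f - \sum_k hint lam x (chi k) * r k| <= e * hint lam x psi.
Proof.
move=> fc fs chiC psiC fe; have mD := @fibre_measurable H x.
have intf := fibre_integrable lam fc fs.
have ints : (lam x).-integrable [set h | rng h = x] (EFin \o (fun h => \sum_k chi k h * r k)).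
  apply: Cc_integrable; apply: Cc_sum => k.
  by apply: Cc_mul => // h; exact: cst_continuous.
have intB := integrableB mD intf ints.
rewrite -RintegralS// /hint -RintegralB// -RintegralZl//; last exact: Cc_integrable.
apply: le_trans (le_normr_Rintegral mD intB) _.
apply: le_Rintegral => //.
- by have := integrable_abse intB; congr (_.-integrable _ _); apply/funext => h.
- by apply: Cc_integrable; under eq_fun do rewrite mulrC; apply: Cc_mul => // h; exact: cst_continuous.
Qed.

(** The scalar counterpart of [near_sec_integral]: one partition approximates [h |-> F (w h)] for
    all [w] near [w1]. *)
Lemma translate_hint_continuous (F : pts Om -> R) : continuous (F : pts Om -> R^o) ->
  proper_support F -> continuous ((fun w => hint lam (sig w) (fun h => F (rmv w h))) : pts Om -> R^o).
Proof.
move=> Fc Fs w1; have [K Kc FK] := Fs w1; have sc := @sig_cts _ _ Om.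
have [psi [psiC psi0 part]] := partition_cutoff R (@arr_lc H) (@arr_haus H) Kc.
pose M := hint lam (sig w1) psi + 1.
have M0 : 0 < M by rewrite ltr_wpDl// hint_ge0.
apply: near_approx_continuous => e e0; pose d := e / M.
have d0 : 0 < d by rewrite divr_gt0.
have [|n [r [chi [cC c0 cp cK cQ]]]] := part R _ (nbhs w1)
    (fun r w h => rng h = sig w -> `|F (rmv w h) - r| <= d) _.
  move=> h0 _; have [h0x|h0x] := pselect (rng h0 = sig w1).
    exists (F (rmv w1 h0)).
    have /cvgr_dist_lt/(_ _ d0) nF := Fc (rmv w1 h0).
    have n := rmv_near (esym h0x) nF.
    have {}n : \forall p \near (w1, h0), rng p.2 = sig p.1 -> `|F (rmv p.1 p.2) - F (rmv w1 h0)| <= d.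
      by apply: filterS n => -[w h] /= n hw; rewrite distrC; exact/ltW/n/esym.
    exact: (@near_pair_swap _ _ w1 h0 (fun w h => rng h = sig w -> `|F (rmv w h) - F (rmv w1 h0)| <= d) n).
  exists 0; have := near_not_fibred sc h0x.
  by apply: filterS => p np /np.
exists (fun w => \sum_k hint lam (sig w) (chi k) * r k).
  apply: sum_continuous_at => k.
  apply: (@continuousM _ _ (fun w => hint lam (sig w) (chi k) : R^o)); last exact: cst_continuous.
  exact: (@continuous_comp _ _ _ (@sig _ _ Om) ((fun x => hint lam x (chi k)) : obj H -> R^o) w1 (@sc w1)
    (@hint_continuous _ _ lam _ (cC k) _)).
apply: filterS3 FK cQ (hint_near lam sc w1 psiC ltr01) => w FKw cQw psiw.
apply: le_trans (_ : d * hint lam (sig w) psi <= _); last first.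
  rewrite /d mulrAC ler_pdivrMr// ler_wpM2l ?(ltW e0)// /M -lerBlDl.
  by apply: le_trans (ler_norm _) (ltW _).
apply: hint_estimate => //.
- exact: translate_fibre_continuous.
- exact: translate_fibre_support.
move=> h hw.
have := @partition_close _ H (sig w) _ (fun h => (F (rmv w h))%:C : R[i]^o) K n chi psi (fun k => (r k)%:C) d _ (ltW d0) c0 cp cK _ h hw.
have -> : \sum_k (chi k h)%:C *: ((r k)%:C : R[i]^o) = (\sum_k chi k h * r k)%:C :> R[i].
  by rewrite rmorph_sum; apply: eq_bigr => k _; rewrite rmorphM.
have nC (a : R) : `|a%:C : R[i]| = `|a|%:C by rewrite normc_def/= expr0n/= addr0 sqrtr_sqr.
rewrite -rmorphB nC lecR; apply.
  by move=> k kw nK; rewrite FKw.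
by move=> k k' ck kw; rewrite -rmorphB nC lecR; exact: cQw ck kw.
Qed.

(** A sum of bump functions; since [rho] is open, the images of their positivity sets are
    neighbourhoods, and finitely many of them cover [L]. *)
Lemma rho_positive (L : set (obj G)) : compact L -> exists f : pts Om -> R,
  [/\ Cc f, forall w, 0 <= f w & forall x, L x -> exists2 w, rho w = x & 0 < f w].
Proof.
move=> Lc.
have bump (w : pts Om) : {b : pts Om -> R | [/\ Cc b, forall y, 0 <= b y <= 1 & 0 < b w]}.
  apply: cid; have [b [bC b01 bw _]] := lc_bump R (@pts_lc _ _ Om) (@pts_haus _ _ Om) (@filterT _ (nbhs w) _).
  by exists b; split=> //; rewrite bw.
have [|n [w wP]] := @compact_finite_cover _ (pts Om) L
    (fun w x => exists2 w', rho w' = x & 0 < sval (bump w) w') Lc.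
  move=> x _; have [w wx] := rho_onto Om x; exists w.
  have [bC _ bw] := svalP (bump w).
  have n : \forall w' \near w, 0 < sval (bump w) w'.
    have /cvgr_dist_lt/(_ _ bw) := (proj1 bC) w; apply: filterS => w' /= h.
    by move: (le_lt_trans (ler_norm _) h); rewrite ltrBlDl ltrDr.
  have := nbhs_rho_image n; rewrite wx; apply: filterS => _ [w' ? <-]; by exists w'.
have b0 k y : 0 <= sval (bump (w k)) y by have [_ /(_ y)/andP[]] := svalP (bump (w k)).
exists (fun y => \sum_(k < n) sval (bump (w k)) y); split.
- by apply: Cc_sum => k; have [] := svalP (bump (w k)).
- by move=> y; apply: sumr_ge0.
- move=> x /wP[k [w' w'x w'0]]; exists w' => //.
  by rewrite (bigD1 k)//= ltr_pwDl// sumr_ge0.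
Qed.

(** A sum of functions [f n] positive over [L n.+1], damped by the positive part of [1 - psi]. The
    term of index [n] vanishes over [L k] for [k < n], so the sum is finite over a neighbourhood of
    each point of the unit space. *)
Lemma proper_function_exists : sigma_compact (obj G) -> exists F : pts Om -> R,
  [/\ continuous (F : pts Om -> R^o), forall w, 0 <= F w,
    forall x, exists2 w, rho w = x & 0 < F w &
    forall x0 : obj G, exists S : pts Om -> R, [/\ Cc S, forall w, 0 <= S w &
      \forall x \near x0, forall w : pts Om, rho w = x -> F w = S w]].
Proof.
move=> /(exhaustion R (@obj_locally_compact G) (@obj_hausdorff G))[L [psi [[Lc L0] [psic psi0 psi1 psiL cov]]]].
have Lmono n m : (n <= m)%N -> L n `<=` L m.
  move=> /subnK <-; elim: (m - n)%N => [//|k IH] x /IH Lx; apply: psiL.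
  by rewrite gt_eqF// (lt_le_trans ltr01)// psi1.
have [f fP] := choice (fun n => rho_positive (Lc n.+1)).
pose g n (w : pts Om) := Num.max 0 (1 - psi n (rho w)).
have gc n : continuous (g n : pts Om -> R^o).
  move=> w; have : {for w, continuous ((fun=> 0 : R^o) \max (fun w : pts Om => 1 - psi n (rho w) : R^o))}; last by [].
  apply: continuous_max; first exact: cst_continuous.
  apply: (@continuousB _ _ _ (fun=> 1 : R^o)); first exact: cst_continuous.
  by apply: continuous_comp; [exact: rho_cts|exact: psic].
have g0 n w : 0 <= g n w by rewrite le_max lexx.
pose phi n (w : pts Om) := if n is m.+1 then f n w * g m w else f 0%N w.
have phiC n : Cc (phi n).
  by case: n => [|n]; [have [] := fP 0%N|apply: Cc_mul => //; have [] := fP n.+1].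
have phi0 n w : 0 <= phi n w.
  by case: n => [|n]; [have [_ + _] := fP 0%N; exact|rewrite mulr_ge0//; have [_ + _] := fP n.+1; exact].
have phiL k n w : L k (rho w) -> (k < n)%N -> phi n w = 0.
  case: n => // n Lw; rewrite ltnS => kn; rewrite /= /g.
  have := psi1 _ _ (Lmono _ _ kn _ Lw); rewrite -subr_le0 => h.
  by rewrite (max_idPl _) ?mulr0.
pose S n (w : pts Om) := \sum_(i < n) phi i w.
have SC n : Cc (S n) by exact: Cc_sum.
have S0 n w : 0 <= S n w by exact: sumr_ge0.
have Sst k n w : L k (rho w) -> (k < n)%N -> S n w = S k.+1 w.
  move=> Lw /subnK <-; elim: (n - _)%N => [//|j IH].
  by rewrite /S addSn big_ord_recr /= -/(S _ _) IH (phiL k)// ?addr0// ltn_addl.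
have cov' (w : pts Om) := cid (cov (rho w)).
pose F w := S (sval (cov' w)).+1 w.
have FS k w : L k (rho w) -> F w = S k.+1 w.
  move=> Lw; have Lw' := svalP (cov' w); rewrite /F; set n := sval _ in Lw' *.
  by rewrite -(Sst n (maxn n k).+1) ?ltnS ?leq_maxl// (Sst k)// ltnS leq_maxr.
have loc (x0 : obj G) : exists k, \forall x \near x0, L k x.
  have [k Lk] := cov x0; exists k.+1.
  have p0 : 0 < psi k x0 by rewrite (lt_le_trans ltr01)// psi1.
  have /cvgr_dist_lt/(_ _ p0) := psic k x0; apply: filterS => x /= h; apply: psiL.
  by rewrite gt_eqF//; move: (le_lt_trans (ler_norm _) h); rewrite ltrBlDl ltrDr.
exists F; split.
- move=> w; have [k Lk] := loc (rho w); apply: near_approx_continuous => e e0.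
  exists (S k.+1); first by case: (SC k.+1) => + _; exact.
  have {}Lk : nbhs w (@rho _ _ Om @^-1` _) := @rho_cts _ _ Om w _ Lk.
  by apply: filterS Lk => w' /= /FS ->; rewrite subrr normr0 ltW.
- by move=> w; exact: S0.
- move=> x; have exn : exists n, `[< L n x >] by have [n Ln] := cov x; exists n; exact/asboolP.
  have [n /asboolP Ln nmin] := ex_minnP exn.
  (* [L 0] is empty, so the least index is some [n.+1]; the summand of index [n] is positive at [w],
     because minimality forces the damping factor to be 1 there. *)
  case: n Ln nmin => [|n] Ln nmin; first by rewrite L0 in Ln.
  have [_ f0 /(_ x Ln)[w wx fw]] := fP n; exists w => //.
  rewrite (FS n.+1) ?wx// /S (bigD1 (Ordinal (leqnSn n.+1 : (n < n.+2)%N)))//=.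
  rewrite ltr_pwDl ?sumr_ge0//; case: n Ln nmin f0 fw => [//|n] Ln nmin f0 fw /=.
  rewrite mulr_gt0// /g wx.
  have -> : psi n x = 0; last by rewrite subr0 lt_max ltr01 orbT.
  apply/eqP; apply: contraT => /psiL Lnx.
  by have := nmin n.+1; rewrite ltnn => ->//; exact/asboolP.
- move=> x0; have [k Lk] := loc x0; exists (S k.+1); split=> //.
  by apply: filterS Lk => x Lx w wx; apply: FS; rewrite wx.
Qed.

(** [F] is divided by its integral [N] over orbits. Left invariance makes [N] constant on orbits,
    and positivity of [F] somewhere over each point makes [N] positive. The compactness condition
    comes from the local description of [F] by functions in [Cc]. *)
Lemma cutoff_exists : sigma_compact (obj G) -> exists c, is_cutoff Om lam c.
Proof.
move=> /proper_function_exists[F [Fc F0 Fpos Floc]].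
have Fs : proper_support F.
  move=> w1; have [S [SC S0 FS]] := Floc (rho w1).
  have [K Kc n] := Cc_proper_support SC w1; exists K => //.
  have {}FS : nbhs w1 (@rho _ _ Om @^-1` _) := @rho_cts _ _ Om w1 _ FS.
  apply: filterS2 FS n => w FS n h hw nK; rewrite FS ?rho_rmv//; exact: n.
pose N w := hint lam (sig w) (fun h => F (rmv w h)).
have Nc : continuous (N : pts Om -> R^o) by exact: translate_hint_continuous.
have fc w := translate_fibre_continuous (erefl (sig w)) Fc.
have fs w := translate_fibre_support (erefl (sig w)) Fs.
have Ninv w h : sig w = rng h -> N (rmv w h) = N w.
  move=> wh; rewrite /N wh (haar_inv_fibre lam) -?wh// sig_rmv//.
  apply: eq_Rintegral => k; rewrite inE /= => kh; rewrite rmvM//.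
have Npos w : 0 < N w.
  have [w' w'x Fw'] := Fpos (rho w).
  have [h wh hw'] := rho_orbit (esym w'x).
  rewrite -(Ninv w h wh) hw' /N; apply: hint_gt0 => //.
  by rewrite rmv1.
exists (fun w => F w / N w); split.
- move=> w; apply: (@continuousM _ _ (F : pts Om -> R^o)); first exact: Fc.
  by apply: (@continuousV _ _ (N : pts Om -> R^o)); [rewrite gt_eqF|exact: Nc].
- by move=> w; rewrite divr_ge0// ltW.
- move=> w; transitivity (hint lam (sig w) (fun h => F (rmv w h) * (N w)^-1)).
    by apply: eq_Rintegral => h; rewrite inE /= => hw; rewrite Ninv.
  have -> : hint lam (sig w) (fun h => F (rmv w h) * (N w)^-1) = N w * (N w)^-1.
    by rewrite /N /hint RintegralZr//; [exact: fibre_measurable|exact: fibre_integrable].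
  by rewrite mulfV// gt_eqF.
- have -> : [set w | F w / N w != 0] = [set w | F w != 0].
    by apply/seteqP; split=> w /=; rewrite mulf_eq0 invr_eq0 negb_or (gt_eqF (Npos w)) andbT.
  move=> K Kc.
  pose I := {S : pts Om -> R | Cc S /\ forall w, 0 <= S w}.
  have [|n [S SP]] := @compact_finite_cover _ I K
      (fun S x0 => \forall x \near x0, forall w, rho w = x -> F w = sval S w) Kc.
    move=> x _; have [S [SC S0 n]] := Floc x; exists (exist _ S (conj SC S0)).
    exact: nbhs_interior n.
  pose T w := \sum_(k < n) sval (S k) w.
  have [_ Tc] : Cc T by apply: Cc_sum => k; exact: (svalP (S k)).1.
  apply: subclosed_compact Tc _.
    apply: closedI; last exact: closed_closure.
    apply: preimage_closed => [w _|]; first exact: rho_cts.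
    by apply: compact_closed => //; exact: obj_hausdorff.
  move=> w [/SP[k kn] Fw]; move: Fw.
  have {}kn : nbhs w (@rho _ _ Om @^-1` _) := @rho_cts _ _ Om w _ kn.
  move=> Fw U wU; have [w' [/= Fw' [w'U w'k]]] := Fw _ (filterI wU kn).
  exists w'; split=> //=; rewrite /T (bigD1 k)//= gt_eqF// ltr_pwDl//.
    by rewrite -(w'k w' erefl) lt_neqAle eq_sym Fw' F0.
  by apply: sumr_ge0 => j _; exact: (svalP (S j)).2.
Qed.

End CutoffExistence.

(** * Pairs of paths *)

Section PathValues.
Variable R : realType.
Local Notation C := R[i].
Local Notation I := (unitI R).

Definition tval (t : I) : R := sval t.

Lemma tval_continuous : continuous (tval : I -> R^o).
Proof. exact: initial_continuous. Qed.

Lemma tval_itv t : 0 <= tval t <= 1.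
Proof. by case: t => r /= h; have := h; rewrite inE/= in_itv. Qed.

Lemma unitI_hausdorff : hausdorff_space I.
Proof.
move=> s t st; apply: val_inj; apply: (@Rhausdorff R) => A B nA nB.
have [x [Ax Bx]] := st _ _ (@tval_continuous s _ nA) (@tval_continuous t _ nB).
by exists (tval x).
Qed.

Lemma unitI_locally_compact : locally_compact [set: I].
Proof.
move=> t _; exists setT; first exact: filterT.
split=> //; exact: unitI_compact.
Qed.

(** The tube lemma, for an arbitrary filter in place of neighbourhoods. *)
Lemma unitI_tube (Z : Type) (F : set_system Z) (Q : Z -> I -> Prop) : Filter F ->
  (forall t : I, \forall p \near filter_prod F (nbhs t), Q p.1 p.2) ->
  \forall z \near F, forall t, Q z t.
Proof.
move=> FF H; have /compact_near_coveringP/(_ Z F Q FF) := @unitI_compact R.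
move=> h; have {h} : \forall z \near F, [set: I] `<=` Q z.
  apply: h => t _; have [[A B] /= [FA tB] AB] := H t.
  by exists (B, A) => // -[s z] /= [Bs Az]; exact: (AB (z, s)).
by apply: filterS => z h t; exact: h.
Qed.

Section Values.
Variable V : normedModType C.

Lemma cpath_le (f : cpath V) (M : C) : (forall t, `|pval f t| <= M) -> `|f| <= M.
Proof.
move=> fM; have M0 : 0 <= M by exact: le_trans (normr_ge0 _) (fM (i0 R)).
have er : M = (complex.Re M)%:C by rewrite RRe_real// realE M0.
by rewrite cpath_normE er; apply: path_norm_le => t; rewrite -er.
Qed.

Lemma pval_le (f : cpath V) t : `|pval f t| <= `|f|.
Proof. exact: path_norm_ub. Qed.

Definition cpath_const (v : V) : cpath V := mkpath (@cst_continuous I V v).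

Lemma cpath_const_norm v : `|cpath_const v| = `|v|.
Proof.
apply/eqP; rewrite eq_le; apply/andP; split; first exact: cpath_le.
exact: (pval_le (cpath_const v) (i0 R)).
Qed.

Lemma real_complex_cts (chi : I -> R) : continuous (chi : I -> R^o) ->
  continuous ((fun t => (chi t)%:C) : I -> C^o).
Proof.
move=> cc; apply/(@continuous_distP _ _ C^o) => t e e0.
have [e' e'E] : exists r : R, e = r%:C by exists (complex.Re e); rewrite RRe_real// gtr0_real.
rewrite e'E ltcR in e0; have /continuous_distP/(_ t _ e0) := cc; apply: filterS => s.
by rewrite -rmorphB e'E normc_def/= expr0n/= addr0 sqrtr_sqr ltcR.
Qed.

Lemma scale_cts (chi : I -> R) (f : I -> V) : continuous (chi : I -> R^o) -> continuous f ->
  continuous (fun t => (chi t)%:C *: f t).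
Proof.
move=> cc fc t; apply: (@continuousZ C V I (fun t => (chi t)%:C) f t); last exact: fc.
exact: real_complex_cts.
Qed.

Lemma tensor_cts (chi : I -> R) (v : V) : continuous (chi : I -> R^o) ->
  continuous (fun t => (chi t)%:C *: v).
Proof. by move=> cc; apply: scale_cts => //; exact: cst_continuous. Qed.

Definition cpath_tensor (chi : I -> R) (cc : continuous (chi : I -> R^o)) (v : V) : cpath V :=
  mkpath (@tensor_cts chi v cc).

Definition cpath_scale (chi : I -> R) (cc : continuous (chi : I -> R^o)) (f : cpath V) : cpath V :=
  mkpath (scale_cts cc (@pvalP _ _ f)).

Lemma pval_sum J (r : seq J) (f : J -> cpath V) t :
  pval (\sum_(j <- r) f j) t = \sum_(j <- r) pval (f j) t.
Proof. by rewrite (big_morph (fun g : cpath V => pval g t) (id1 := 0) (op1 := +%R)). Qed.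

(** Paths are uniform limits of finite sums of [chi u]; density statements for [V] thereby pass to
    [C([0,1], V)]. *)
Lemma cpath_partition (f : cpath V) (e : C) : 0 < e ->
  exists n (chi : 'I_n -> {chi : I -> R | continuous (chi : I -> R^o)}) (u : 'I_n -> V),
    [/\ forall k t, 0 <= sval (chi k) t, forall t, \sum_k sval (chi k) t = 1,
      forall k t, sval (chi k) t != 0 -> `|pval f t - u k| <= e &
      forall t, `|pval f t - \sum_k (sval (chi k) t)%:C *: u k| <= e].
Proof.
move=> e0.
have [|n [u [chi [chiC chi0 chi1 chiK chiQ]]]] := @partition_of_unity R I unitI_locally_compact
  unitI_hausdorff V unit (globally setT) setT (fun u _ t => `|pval f t - u| <= e) _ (@unitI_compact R).
  move=> t _; exists (pval f t); have /continuous_distP/(_ t _ e0) n := @pvalP _ _ f.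
  exists ([set s | `|pval f t - pval f s| < e], setT) => /=; first by split=> //; exact: filterT.
  by move=> [s z] /= [h _]; rewrite distrC ltW.
have chic k : continuous (chi k : I -> R^o) by case: (chiC k).
have close k t : chi k t != 0 -> `|pval f t - u k| <= e by exact: (chiQ tt).
have one t : \sum_k chi k t = 1 by exact: chiK.
exists n, (fun k => exist _ (chi k) (chic k)), u; split=> // t /=.
have -> : pval f t = \sum_k (chi k t)%:C *: pval f t.
  by rewrite -scaler_suml -(rmorph_sum (real_complex R)) one scale1r.
rewrite -sumrB; under eq_bigr do rewrite -scalerBr.
apply: le_trans (ler_norm_sum _ _ _) _.
apply: (@le_trans _ _ (\sum_k (chi k t)%:C * e)).
  apply: ler_sum => k _; rewrite normrZ.
  have -> : `|(chi k t)%:C| = (chi k t)%:C by rewrite ger0_norm// lecR.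
  have [->|ck] := eqVneq (chi k t) 0; first by rewrite !mul0r.
  by rewrite ler_wpM2l ?lecR// close.
by rewrite -mulr_suml -(rmorph_sum (real_complex R)) one mul1r.
Qed.

End Values.
End PathValues.

Section PathSections.
Variables (R : realType) (G : groupoid) (E : galg R G).
Local Notation C := R[i].
Local Notation I := (unitI R).
Local Notation P := (path_space E).

Lemma path_secP (xi : forall x, P x) : sec P xi <-> forall (x : obj G) (t : I),
  @near_sec R (obj G) E (obj G * I) (nbhs (x, t)) fst (fun p => pval (xi p.1) p.2).
Proof.
split; first by move/(@sec_pullP R (obj G) (obj G * I)%type fst E) => h x t; exact: h.
by move=> h; apply/(@sec_pullP R (obj G) (obj G * I)%type fst E) => -[x t]; exact: h.
Qed.

Hypothesis HE : is_gspace E.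
Let Eu := HE.1.

Lemma fst_filter_cvg (Z : Type) (F : set_system Z) (q : Z -> obj G) (x0 : obj G) (t : I) :
  Filter F -> q @ F --> x0 -> (fun p : Z * I => q p.1) @ filter_prod F (nbhs t) --> x0.
Proof. by move=> FF qF; apply: cvg_comp qF; exact: cvg_fst. Qed.

Lemma near_path_values (Z : Type) (F : set_system Z) (q : Z -> obj G) (x0 : obj G)
    (zeta : forall z, P (q z)) (t : I) : Filter F -> q @ F --> x0 -> near_sec F zeta ->
  near_sec (E := E) (filter_prod F (nbhs t)) (q := fun p => q p.1) (fun p => pval (zeta p.1) p.2).
Proof.
move=> FF qF zs; apply: near_sec_approx => d d0; have [xi /path_secP sxi n] := zs d d0.
exists (fun p => pval (xi (q p.1)) p.2).
  move=> d' d'0; have [xi' sxi' [[N1 N2] /= [n1 n2] N]] := sxi x0 t d' d'0; exists xi' => //.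
  exists (q @^-1` N1, N2) => /=; first by split=> //; exact: qF n1.
  by move=> [z s] /= [? ?]; exact: (N (q z, s)).
exists ([set z | `|zeta z - xi (q z)| <= d], setT) => /=; first by split=> //; exact: filterT.
by move=> [z s] /= [h _]; apply: le_trans h; exact: (pval_le (zeta z - xi (q z)) s).
Qed.

Lemma path_sec_tensor (chi : I -> R) (cc : continuous (chi : I -> R^o)) (eta : forall x, E x) :
  sec E eta -> sec P (fun x => cpath_tensor cc (eta x)).
Proof.
move=> se; apply/path_secP => x t.
apply: (@near_sec_real_scale _ G _ (nbhs (x, t)) I snd t fst x chi E (fun p => eta p.1)) => //.
- exact: cvg_fst.
- exact: cvg_snd.
- exact: cc.
- exact: near_sec_base.
Qed.

Lemma path_sec_sum n (xi : 'I_n -> forall x, P x) : (forall k, sec P (xi k)) ->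
  sec P (fun x => \sum_k xi k x).
Proof.
move=> sxi; apply/path_secP => x t.
have h := near_sec_sum (nbhs_filter (x, t)) Eu (index_enum _)
  (fun k => (path_secP _).1 (sxi k) x t).
move: h; congr near_sec; apply: functional_extensionality_dep => p.
by rewrite pval_sum.
Qed.

Lemma path_dense (x : obj G) (f : P x) (e : C) : 0 < e -> exists2 xi, sec P xi & `|f - xi x| < e.
Proof.
move=> e0; have e40 : 0 < e / 4 by rewrite divr_gt0.
have [n [chi [u [chi0 chi1 _ fu]]]] := cpath_partition f e40.
have ex k : exists eta, sec E eta /\ `|u k - eta x| <= e / 4.
  by have [eta ? ?] := sec_dense Eu (u k) e40; exists eta; split=> //; exact: ltW.
have [eta etaP] := choice ex.
exists (fun x => \sum_k cpath_tensor (svalP (chi k)) (eta k x)).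
  by apply: path_sec_sum => k; apply: path_sec_tensor; case: (etaP k).
apply: (@le_lt_trans _ _ (e / 4 + e / 4)); last first.
  rewrite -mulrDl ltr_pdivrMr// (_ : 4 = 2 + 2 :> C) ?mulrDr; last by rewrite -natrD.
  by rewrite !mulr1 ltrDl addr_gt0.
apply: cpath_le => t.
have -> : pval (f - \sum_k cpath_tensor (svalP (chi k)) (eta k x)) t =
    pval f t - \sum_k (sval (chi k) t)%:C *: eta k x.
  by congr (_ - _); rewrite pval_sum.
apply: le_trans (ler_distD (\sum_k (sval (chi k) t)%:C *: u k) _ _) _.
rewrite lerD// -sumrB; under eq_bigr do rewrite -scalerBr.
apply: le_trans (ler_norm_sum _ _ _) _.
apply: (@le_trans _ _ (\sum_k (sval (chi k) t)%:C * (e / 4))).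
  apply: ler_sum => k _; rewrite normrZ.
  have -> : `|(sval (chi k) t)%:C| = (sval (chi k) t)%:C by rewrite ger0_norm// lecR.
  by rewrite ler_wpM2l ?lecR//; case: (etaP k).
by rewrite -mulr_suml -(rmorph_sum (real_complex R)) chi1 mul1r.
Qed.

Lemma path_usc_near (Z : Type) (F : set_system Z) (q : Z -> obj G) (z0 : Z)
    (zeta : forall z, P (q z)) (r : C) : Filter F -> (forall S, F S -> S z0) -> q @ F --> q z0 ->
  (forall t : I, near_sec (E := E) (filter_prod F (nbhs t)) (q := fun p => q p.1) (fun p => pval (zeta p.1) p.2)) ->
  `|zeta z0| < r -> \forall z \near F, `|zeta z| < r.
Proof.
move=> FF F0 qF zs zr; pose r' := (`|zeta z0| + r) / 2.
have [h1 h2] := midf_lt zr.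
have n : \forall z \near F, forall t, `|pval (zeta z) t| < r'.
  apply: unitI_tube => t.
  apply: (@near_sec_usc R (obj G) (Z * I)%type (filter_prod F (nbhs t)) (z0, t) (fun p => q p.1) E
    (fun p => pval (zeta p.1) p.2) r' Eu).
  - by move=> S [[A B] /= [FA tB] AB]; apply: (AB (z0, t)); split; [exact: F0|exact: nbhs_singleton].
  - exact: fst_filter_cvg.
  - exact: zs.
  - by apply: le_lt_trans (pval_le _ _) h1.
apply: filterS n => z h; apply: le_lt_trans h2.
by apply: cpath_le => t; exact: ltW.
Qed.

(** Converse of [near_path_values]: a section of the path field that is close at [z0] stays close
    nearby, by upper semicontinuity uniformly in [t]. *)
Lemma near_path_sec (Z : Type) (F : set_system Z) (q : Z -> obj G) (z0 : Z)
    (zeta : forall z, P (q z)) : Filter F -> (forall S, F S -> S z0) -> q @ F --> q z0 ->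
  (forall t : I, near_sec (E := E) (filter_prod F (nbhs t)) (q := fun p => q p.1) (fun p => pval (zeta p.1) p.2)) ->
  near_sec F zeta.
Proof.
move=> FF F0 qF zs e e0; have [xi sxi zx] := path_dense (zeta z0) e0.
exists xi => //.
have n : \forall z \near F, `|zeta z - xi (q z)| < e.
  apply: (path_usc_near (zeta := fun z => zeta z - xi (q z)) FF F0 qF) => // t.
  apply: near_secD => //; apply: near_secN => //.
  exact: (near_path_values t FF qF (near_sec_base q FF sxi)).
by apply: filterS n => z /ltW.
Qed.

Lemma path_gspace : is_gspace P.
Proof.
split; first split.
- by apply/path_secP => x t; exact: near_sec0.
- move=> a xi zeta /path_secP h1 /path_secP h2; apply/path_secP => x t.
  exact: (near_sec_lin _ _ a (h1 x t) (h2 x t)).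
- exact: path_dense.
- move=> xi sxi x r xr.
  apply: (path_usc_near (q := idfun) (nbhs_filter x) (@nbhs_singleton _ x) (@cvg_id _ _) _ xr) => t.
  by move/path_secP: sxi; apply.
- move=> xi sxi; apply/path_secP => x t; apply: near_sec_approx => d d0.
  have [zeta /path_secP sz n] := sxi x d d0.
  exists (fun p => pval (zeta p.1) p.2); first exact: sz.
  have {}n : \forall p \near (x, t), `|xi p.1 - zeta p.1| <= d by exact: (@cvg_fst _ _ _ _ _ _ n).
  by apply: filterS n => p h; apply: le_trans h; exact: (pval_le (xi p.1 - zeta p.1) p.2).
move=> xi /sec_pullP sxi; apply/sec_pullP => g.
apply: (near_path_sec (nbhs_filter g) (@nbhs_singleton _ g) (@rng_cts G g)) => t.
have h := near_path_values t (nbhs_filter g) (@src_cts G g) (sxi g).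
apply: (near_sec_act (a := fun p : arr G * I => p.1) (q := fun p => src p.1) (q' := fun p => rng p.1) _ _ HE _ (@cvg_fst _ _ _ _ _) h).
Qed.

End PathSections.

(** * Density of spans, and non-degeneracy of pairs of paths *)

Section SpanDense.
Variables (R : realType).
Local Notation C := R[i].
Variables (D1 D2 : Type) (V : normedModType C) (m : D1 -> D2 -> V).

Definition span_dense (v : V) : Prop := forall e : C, 0 < e ->
  exists n (a : 'I_n -> D1) (b : 'I_n -> D2), `|v - \sum_(i < n) m (a i) (b i)| < e.

Lemma span_dense_elem a b : span_dense (m a b).
Proof.
move=> e e0; exists 1%N, (fun=> a), (fun=> b).
by rewrite big_ord_recl big_ord0 addr0 subrr normr0.
Qed.

Lemma span_dense_approx v : (forall e : C, 0 < e -> exists2 v', span_dense v' & `|v - v'| <= e) ->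
  span_dense v.
Proof.
move=> H e e0; have e20 : 0 < e / 2 by rewrite divr_gt0.
have [v' v's vv'] := H _ e20; have [n [a [b h]]] := v's _ e20.
exists n, a, b; rewrite [e]splitr; apply: le_lt_trans (ler_distD v' _ _) _.
exact: ler_ltD.
Qed.

Lemma span_dense0 : span_dense 0.
Proof.
move=> e e0; have ex : forall T : Type, 'I_0 -> T by move=> T [].
by exists 0%N, (ex _), (ex _); rewrite big_ord0 subrr normr0.
Qed.

Lemma span_denseD v v' : span_dense v -> span_dense v' -> span_dense (v + v').
Proof.
move=> h h' e e0; have e20 : 0 < e / 2 by rewrite divr_gt0.
have [n [a [b k]]] := h _ e20; have [n' [a' [b' k']]] := h' _ e20.
exists (n + n')%N, (fun i => match fintype.split i with inl j => a j | inr j => a' j end),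
  (fun i => match fintype.split i with inl j => b j | inr j => b' j end).
rewrite big_split_ord /= opprD addrACA [e]splitr.
apply: le_lt_trans (ler_normD _ _) _; rewrite ltrD//.
  apply: le_lt_trans k; rewrite (eq_bigr (fun i => m (a i) (b i)))// => i _.
  by case: fintype.splitP => j /= ij; [congr (m (a _) (b _)); exact: val_inj|
    have := ltn_ord i; rewrite ij ltnNge leq_addr].
apply: le_lt_trans k'; rewrite (eq_bigr (fun i => m (a' i) (b' i)))// => i _.
case: fintype.splitP => j /= ij; first by have := ltn_ord j; rewrite -ij ltnNge leq_addr.
by congr (m (a' _) (b' _)); apply: val_inj; exact/(addnI (esym ij)).
Qed.

Lemma span_dense_sum J (r : seq J) (v : J -> V) : (forall j, span_dense (v j)) ->
  span_dense (\sum_(j <- r) v j).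
Proof.
move=> h; elim: r => [|j r IH]; first by rewrite big_nil; exact: span_dense0.
by rewrite big_cons; exact: span_denseD.
Qed.

End SpanDense.

(** It suffices to treat [chi u]; if [u] is close to a sum of [a b], then [chi u] is close to the
    sum of the constant path [a] times [chi b]. *)
Lemma path_span_dense (R : realType) (V W : normedModType R[i]) (m : W -> V -> V)
    (pm : cpath W -> cpath V -> cpath V) :
  (forall b f t, pval (pm b f) t = m (pval b t) (pval f t)) -> (forall b, linear (m b)) ->
  (forall v, span_dense m v) -> forall f, span_dense pm f.
Proof.
move=> pmE ml mv f; apply: span_dense_approx => e e0.
have [n [chi [u [chi0 chi1 _ fu]]]] := cpath_partition f e0.
exists (\sum_k cpath_tensor (svalP (chi k)) (u k)); last first.
  apply: cpath_le => t.
  have -> // : pval (f - \sum_k cpath_tensor (svalP (chi k)) (u k)) t =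
    pval f t - \sum_k (sval (chi k) t)%:C *: u k.
  by congr (_ - _); rewrite pval_sum.
have chi_le k t : sval (chi k) t <= 1.
  by rewrite -(chi1 t) (bigD1 k)//= lerDl sumr_ge0.
apply: span_dense_sum => k; apply: span_dense_approx => d d0.
have [n' [a [b h]]] := mv (u k) d d0.
exists (\sum_i pm (cpath_const (a i)) (cpath_tensor (svalP (chi k)) (b i))).
  by apply: span_dense_sum => i; exact: span_dense_elem.
apply: cpath_le => t.
have -> : pval (cpath_tensor (svalP (chi k)) (u k) -
     \sum_i pm (cpath_const (a i)) (cpath_tensor (svalP (chi k)) (b i))) t =
   (sval (chi k) t)%:C *: (u k - \sum_i m (a i) (b i)).
  rewrite scalerBr scaler_sumr; congr (_ - _); rewrite pval_sum; apply: eq_bigr => i _.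
  by rewrite pmE /= (linZ (ml _)).
rewrite normrZ -[leRHS]mul1r ler_pM//; last exact: ltW.
by rewrite ger0_norm ?lecR.
Qed.

Section PathLifts.
Variables (R : realType) (G : groupoid).
Local Notation C := R[i].
Local Notation I := (unitI R).

Section Lift2.
Variables (E F K : galg R G) (m : forall x, E x -> F x -> K x).
Hypotheses (mb : contractive E F K m) (ml : forall x, is_bilinear (@m x)).

Fact path_lift2_cts x (f : cpath (E x)) (g : cpath (F x)) :
  continuous (fun t => m (pval f t) (pval g t)).
Proof.
have [mr mlx] := ml x; apply/continuous_distP => t e e0.
pose M := `|f| + `|g| + 1; have M0 : 0 < M by rewrite ltr_wpDl ?addr_ge0.
have fM s : `|pval f s| <= M by apply: le_trans (pval_le _ _) _; rewrite /M -addrA lerDl addr_ge0.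
have gM s : `|pval g s| <= M by apply: le_trans (pval_le _ _) _; rewrite /M addrAC lerDr addr_ge0.
have eM : 0 < e / 2 / M by rewrite !divr_gt0.
have /continuous_distP/(_ t _ eM) nf := @pvalP _ _ f.
have /continuous_distP/(_ t _ eM) ng := @pvalP _ _ g.
apply: filterS2 nf ng => s nf ng.
have -> : m (pval f t) (pval g t) - m (pval f s) (pval g s) =
    m (pval f t - pval f s) (pval g t) + m (pval f s) (pval g t - pval g s).
  by rewrite (linB (mlx _)) (linB (mr _)) addrA subrK.
apply: le_lt_trans (ler_normD _ _) _; rewrite [e]splitr ltrD//.
  apply: le_lt_trans (mb _ _) _; apply: le_lt_trans (ler_wpM2l (normr_ge0 _) (gM t)) _.
  by rewrite -ltr_pdivlMr.
apply: le_lt_trans (mb _ _) _; apply: le_lt_trans (ler_wpM2r (normr_ge0 _) (fM s)) _.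
by rewrite mulrC -ltr_pdivlMr.
Qed.

Definition path_lift2 x (f : path_space E x) (g : path_space F x) : path_space K x :=
  mkpath (@path_lift2_cts x f g).

Lemma path_lift2_equivariant : equivariant2 m ->
  @equivariant2 R G (path_space E) (path_space F) (path_space K) path_lift2.
Proof. by move=> meq g x y hs hr e f; apply: cpath_ext => t; exact: meq. Qed.

Lemma path_lift2_contractive :
  contractive (path_space E) (path_space F) (path_space K) path_lift2.
Proof.
move=> x f g; apply: cpath_le => t; apply: le_trans (mb _ _) _.
by rewrite ler_pM// pval_le.
Qed.

Lemma path_lift2_bilinear x : is_bilinear (@path_lift2 x).
Proof.
have [mr mlx] := ml x.
by split=> f a u v; apply: cpath_ext => t; [exact: mr|exact: mlx].
Qed.

Lemma path_lift2_cont : is_gspace E -> is_gspace F -> cont_bilinear E F K m ->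
  cont_bilinear (path_space E) (path_space F) (path_space K) path_lift2.
Proof.
move=> [Eu _] [Fu _] mc; split.
- exact: path_lift2_bilinear.
- by move=> x; exists 1; apply: nearW => y e f; rewrite mul1r; exact: path_lift2_contractive.
- move=> xi zeta /path_secP s1 /path_secP s2; apply/path_secP => x t.
  exact: (near_sec_bilinear Eu Fu (nbhs_filter (x, t)) (@cvg_fst _ _ _ _ _) mc (s1 x t) (s2 x t)).
Qed.

End Lift2.

Lemma path_is_galg (B : galg R G) : is_galg B -> is_galg (path_alg B).
Proof.
move=> [HB mB]; split; first exact: path_gspace.
have := path_lift2_cont (@amul_contractive _ _ B) (@amul_bilinear _ _ B) HB HB mB.
congr cont_bilinear; apply: functional_extensionality_dep => x.
by apply/funext => f; apply/funext => g; apply: cpath_ext.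
Qed.

Lemma path_sec_const (E : galg R G) (xi : forall x, E x) : is_gspace E -> sec E xi ->
  sec (path_space E) (fun x => cpath_const (xi x)).
Proof.
move=> HE sxi; apply/path_secP => x t; exact: near_sec_base.
Qed.

Section Lift1.
Variables (E F : galg R G) (S : forall x, E x -> F x).
Hypotheses (Sl : forall x, linear (@S x)) (Sb : exists2 M : C, 0 <= M & forall x e, `|@S x e| <= M * `|e|).

Fact path_lift1_cts x (f : cpath (E x)) : continuous (fun t => S (pval f t)).
Proof.
have [M MS0 MS] := Sb; apply/continuous_distP => t e e0.
have Slx : linear (@S x) := @Sl x.
have M0 : 0 < `|M| + 1 by rewrite ltr_wpDl.
have eM : 0 < e / (`|M| + 1) by rewrite divr_gt0.
have /continuous_distP/(_ t _ eM) := @pvalP _ _ f; apply: filterS => s.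
rewrite ltr_pdivlMr// -(linB Slx); apply: le_lt_trans.
by apply: le_trans (real_bound (MS x) _) _; rewrite mulrC ler_wpM2l// lerDl.
Qed.

Definition path_lift1 x (f : path_space E x) : path_space F x := mkpath (@path_lift1_cts x f).

Lemma path_lift1_equivariant : equivariant1 S ->
  @equivariant1 R G (path_space E) (path_space F) path_lift1.
Proof. by move=> Seq g x y hs hr e; apply: cpath_ext => t; exact: Seq. Qed.

Lemma path_lift1_cont : cont_linear E F S -> cont_linear (path_space E) (path_space F) path_lift1.
Proof.
move=> Sc; split.
- by move=> x a u v; apply: cpath_ext => t; exact: Sl.
- move=> x; have [M M0 MS] := Sb; exists M; apply: nearW => y e.
  by apply: cpath_le => t; apply: le_trans (MS _ _) _; rewrite ler_wpM2l// pval_le.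
- move=> xi /path_secP s1; apply/path_secP => x t.
  exact: (near_sec_linear (nbhs_filter (x, t)) (@cvg_fst _ _ _ _ _) Sc (s1 x t)).
Qed.

End Lift1.
End PathLifts.

Section ZeroAlgebra.
Variables (R : realType) (G : groupoid) (E : gspace R G).

Definition zero_mul x (u v : E x) : E x := 0.

Fact zero_mul_bilinear x : is_bilinear (@zero_mul x).
Proof. by split=> u a v w; rewrite scaler0 addr0. Qed.
Fact zero_mulA x : associative (@zero_mul x). Proof. by []. Qed.
Fact zero_mul_contractive : contractive E E E zero_mul.
Proof. by move=> x u v; rewrite normr0 mulr_ge0. Qed.
Fact zero_mul_equivariant : equivariant2 zero_mul.
Proof. by move=> g x y hs hr u v; rewrite act0. Qed.

(* [E] with zero multiplication: this makes [path_space] available for [E]. *)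
Definition zero_alg : galg R G :=
  GAlg zero_mul_bilinear zero_mulA zero_mul_contractive zero_mul_equivariant.

End ZeroAlgebra.

(** * The straight line between two operators *)

Section PathLine.
Variables (R : realType) (G : groupoid) (E : galg R G) (S0 S1 : forall x, E x -> E x).
Local Notation C := R[i].
Hypotheses (S0l : forall x, linear (@S0 x)) (S1l : forall x, linear (@S1 x)).
Hypotheses (S0b : exists2 M : C, 0 <= M & forall x e, `|@S0 x e| <= M * `|e|)
  (S1b : exists2 M : C, 0 <= M & forall x e, `|@S1 x e| <= M * `|e|).

Definition path_line x (f : path_space E x) : path_space E x :=
  path_lift1 S0l S0b f + cpath_scale (@tval_continuous R) (path_lift1 S1l S1b f - path_lift1 S0l S0b f).

Lemma path_lineE x (f : path_space E x) t :
  pval (path_line f) t = S0 (pval f t) + (tval t)%:C *: (S1 (pval f t) - S0 (pval f t)).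
Proof. by []. Qed.

Lemma path_line_linear x : linear (@path_line x).
Proof.
move=> a u v; apply: cpath_ext => t.
have h : pval (a *: path_line u + path_line v) t = a *: pval (path_line u) t + pval (path_line v) t by [].
rewrite h !path_lineE.
have -> : pval (a *: u + v) t = a *: pval u t + pval v t by [].
rewrite (S0l a) (S1l a) !scalerDr !scalerN !scalerDr !scalerA !opprD ![a * _]mulrC.
set p := a *: S0 _; set p' := S0 _; set q := _ *: S1 _; set q' := _ *: S1 _.
by rewrite [q + q' + _]addrACA (addrACA p).
Qed.

Lemma path_line_bounded : exists2 M : C, 0 <= M & forall x f, `|@path_line x f| <= M * `|f|.
Proof.
have [M0 M00 b0] := S0b; have [M1 M10 b1] := S1b.
exists (M0 + (M1 + M0)); first by rewrite !addr_ge0.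
move=> x f; apply: cpath_le => t; rewrite path_lineE.
have ft := pval_le f t; have h0 := le_trans (b0 x _) (ler_wpM2l M00 ft).
have h1 := le_trans (b1 x _) (ler_wpM2l M10 ft).
apply: le_trans (ler_normD _ _) _; rewrite mulrDl lerD//.
have /andP[t0 t1] := tval_itv t.
rewrite normrZ -[leRHS]mul1r ler_pM//; first by rewrite ger0_norm lecR.
by rewrite mulrDl; apply: le_trans (ler_normB _ _) _; rewrite lerD.
Qed.

Lemma path_line_cont : is_gspace E -> cont_linear E E S0 -> cont_linear E E S1 ->
  cont_linear (path_space E) (path_space E) path_line.
Proof.
move=> HE c0 c1; have [Eu _] := HE; split; first exact: path_line_linear.
- by move=> x; have [M M0 MP] := path_line_bounded; exists M; apply: nearW => y f; exact: MP.
move=> xi /path_secP s; apply/path_secP => x t.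
have qF : fst @ nbhs (x, t) --> x by exact: cvg_fst.
have k0 := near_sec_linear (nbhs_filter (x, t)) qF c0 (s x t).
have k1 := near_sec_linear (nbhs_filter (x, t)) qF c1 (s x t).
have k2 := near_secD (nbhs_filter (x, t)) Eu k1 (near_secN (nbhs_filter (x, t)) Eu k0).
have sF : snd @ nbhs (x, t) --> t by exact: cvg_snd.
have k3 := near_sec_real_scale Eu (nbhs_filter (x, t)) qF sF (@tval_continuous R t) k2.
have k4 := near_secD (nbhs_filter (x, t)) Eu k0 k3; exact: k4.
Qed.

End PathLine.

Section WithOperator.
Variables (R : realType) (G : groupoid) (A B : galg R G) (E : kkdata A B).

Definition with_op (l : forall x, lp E x -> lp E x) (r : forall x, rp E x -> rp E x) : kkdata A B :=
  KKData l r (@bl_eq _ _ _ _ E) (@rb_eq _ _ _ _ E) (@pr_eq _ _ _ _ E) (@la_eq _ _ _ _ E)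
    (@ar_eq _ _ _ _ E) (@gl_eq _ _ _ _ E) (@gr_eq _ _ _ _ E).

Lemma with_op_pair l r : is_pair E -> is_pair (with_op l r).
Proof. by case=> *; split. Qed.

Lemma with_op_id : with_op (@tl _ _ _ _ E) (@tr _ _ _ _ E) = E.
Proof. by rewrite /with_op; case: E. Qed.

End WithOperator.

Section PathKK.
Variables (R : realType) (G : groupoid) (A B : galg R G) (E : kkdata A B).
Local Notation C := R[i].
Local Notation I := (unitI R).
Variables (l0 l1 : forall x, lp E x -> lp E x) (r0 r1 : forall x, rp E x -> rp E x).
Hypotheses (EP : is_pair E) (O0 : is_odd_operator (with_op l0 r0))
  (O1 : is_odd_operator (with_op l1 r1)).

Lemma odd_bound (F : kkdata A B) : is_odd_operator F ->
  (exists2 M : C, 0 <= M & forall x (f : lp F x), `|tl f| <= M * `|f|) /\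
  (exists2 M : C, 0 <= M & forall x (f : rp F x), `|tr f| <= M * `|f|).
Proof.
move=> /cyc_t_bounded[M MP].
by split; exists `|M| => // x; apply: real_bound; [exact: (MP x).1|exact: (MP x).2].
Qed.

Lemma odd_linl (F : kkdata A B) x : is_odd_operator F -> linear (@tl _ _ _ _ F x).
Proof. by move=> /cyc_tl/cl_linear. Qed.
Lemma odd_linr (F : kkdata A B) x : is_odd_operator F -> linear (@tr _ _ _ _ F x).
Proof. by move=> /cyc_tr/cl_linear. Qed.

Let L := zero_alg (lp E).
Let S := zero_alg (rp E).

Definition pk_bl := @path_lift2 R G B L L _ (cyc_bl_contr EP) (cb_bilinear (cyc_bl EP)).
Definition pk_rb := @path_lift2 R G S B S _ (cyc_rb_contr EP) (cb_bilinear (cyc_rb EP)).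
Definition pk_pr := @path_lift2 R G L S B _ (cyc_pr_contr EP) (cb_bilinear (cyc_pr EP)).
Definition pk_la x (f : path_space L x) (a : A x) : path_space L x :=
  @path_lift2 R G L A L _ (cyc_la_contr EP) (cb_bilinear (cyc_la EP)) x f (cpath_const a).
Definition pk_ar x (a : A x) (e : path_space S x) : path_space S x :=
  @path_lift2 R G A S S _ (cyc_ar_contr EP) (cb_bilinear (cyc_ar EP)) x (cpath_const a) e.

Fact isometry_bounded (K : gspace R G) (u : forall x, K x -> K x) :
  (forall x e, `|u x e| = `|e|) -> exists2 M : C, 0 <= M & forall x e, `|u x e| <= M * `|e|.
Proof. by move=> un; exists 1 => // x e; rewrite un mul1r. Qed.

Fact gl_lin x : linear (@gl _ _ _ _ E x). Proof. exact: cl_linear (cyc_gl EP) x. Qed.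
Fact gr_lin x : linear (@gr _ _ _ _ E x). Proof. exact: cl_linear (cyc_gr EP) x. Qed.

Definition pk_gl := @path_lift1 R G L L _ gl_lin (isometry_bounded (@cyc_gl_norm _ _ _ _ _ EP)).
Definition pk_gr := @path_lift1 R G S S _ gr_lin (isometry_bounded (@cyc_gr_norm _ _ _ _ _ EP)).
Definition pk_tl := @path_line R G L l0 l1 (fun x => odd_linl (x := x) O0) (fun x => odd_linl (x := x) O1)
  (odd_bound O0).1 (odd_bound O1).1.
Definition pk_tr := @path_line R G S r0 r1 (fun x => odd_linr (x := x) O0) (fun x => odd_linr (x := x) O1)
  (odd_bound O0).2 (odd_bound O1).2.

Fact pk_la_eq : @equivariant2 R G (path_space L) A (path_space L) pk_la.
Proof. by move=> g x y hs hr f a; apply: cpath_ext => t; exact: la_eq. Qed.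
Fact pk_ar_eq : @equivariant2 R G A (path_space S) (path_space S) pk_ar.
Proof. by move=> g x y hs hr a f; apply: cpath_ext => t; exact: ar_eq. Qed.

(** The pair [E[0,1]] with [A] acting through constant paths and, at time [t], the operator
    [T_0 + t (T_1 - T_0)]. *)
Definition path_kk : kkdata A (path_alg B) :=
  @KKData R G A (path_alg B) (path_space L) (path_space S) pk_bl pk_rb pk_pr pk_la pk_ar
    pk_gl pk_gr pk_tl pk_tr
    (@path_lift2_equivariant R G B L L _ _ _ (@bl_eq _ _ _ _ E)) (@path_lift2_equivariant R G S B S _ _ _ (@rb_eq _ _ _ _ E))
    (@path_lift2_equivariant R G L S B _ _ _ (@pr_eq _ _ _ _ E)) pk_la_eq pk_ar_eq
    (@path_lift1_equivariant R G L L _ _ _ (@gl_eq _ _ _ _ E)) (@path_lift1_equivariant R G S S _ _ _ (@gr_eq _ _ _ _ E)).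

Hypotheses (HA : is_galg A) (HB : is_galg B).
Let HL := cyc_lp EP.
Let HS := cyc_rp EP.

Lemma path_kk_pair : is_pair path_kk.
Proof.
have [GA _] := HA; have [GB _] := HB.
have const_sec (K : galg R G) := @path_sec_const R G K.
split.
- exact: path_gspace.
- exact: path_gspace.
- exact: (@path_lift2_cont R G B L L _ (cyc_bl_contr EP) (cb_bilinear (cyc_bl EP)) GB HL (cyc_bl EP)).
- exact: (@path_lift2_cont R G S B S _ (cyc_rb_contr EP) (cb_bilinear (cyc_rb EP)) HS GB (cyc_rb EP)).
- exact: (@path_lift2_cont R G L S B _ (cyc_pr_contr EP) (cb_bilinear (cyc_pr EP)) HL HS (cyc_pr EP)).
- split.
  + move=> x; have [h1 h2] := path_lift2_bilinear (E := L) (F := A) (K := L) (cyc_la_contr EP) (cb_bilinear (cyc_la EP)) x.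
    split=> [f a u v|a]; last exact: h2.
    by apply: cpath_ext => t; exact: (cb_bilinear (cyc_la EP) x).1.
  + move=> x; exists 1; apply: nearW => y f a; rewrite mul1r -(cpath_const_norm a).
    exact: (path_lift2_contractive (E := L) (F := A) (K := L)).
  + move=> xi a sxi sa.
    exact: (cb_sec (path_lift2_cont (E := L) (F := A) (K := L) (cyc_la_contr EP) (cb_bilinear (cyc_la EP)) HL GA (cyc_la EP)) sxi (const_sec A a GA sa)).
- split.
  + move=> x; have [h1 h2] := path_lift2_bilinear (E := A) (F := S) (K := S) (cyc_ar_contr EP) (cb_bilinear (cyc_ar EP)) x.
    split=> [a|f a u v]; first exact: h1.
    by apply: cpath_ext => t; exact: (cb_bilinear (cyc_ar EP) x).2.
  + move=> x; exists 1; apply: nearW => y a f; rewrite mul1r -(cpath_const_norm a).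
    exact: (path_lift2_contractive (E := A) (F := S) (K := S)).
  + move=> a xi sa sxi.
    exact: (cb_sec (path_lift2_cont (E := A) (F := S) (K := S) (cyc_ar_contr EP) (cb_bilinear (cyc_ar EP)) GA HS (cyc_ar EP)) (const_sec A a GA sa) sxi).
- exact: (@path_lift2_contractive R G B L L).
- exact: (@path_lift2_contractive R G S B S).
- exact: (@path_lift2_contractive R G L S B).
- by move=> x f a; rewrite -(cpath_const_norm a); exact: (path_lift2_contractive (E := L) (F := A) (K := L)).
- by move=> x a f; rewrite -(cpath_const_norm a); exact: (path_lift2_contractive (E := A) (F := S) (K := S)).
- by move=> x b b' f; apply: cpath_ext => t; exact: cyc_blA EP _ _ _ _.
- by move=> x b b' f; apply: cpath_ext => t; exact: cyc_rbA EP _ _ _ _.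
- by move=> x b b' f; apply: cpath_ext => t; exact: cyc_laA EP _ _ _ _.
- by move=> x b b' f; apply: cpath_ext => t; exact: cyc_arA EP _ _ _ _.
- by move=> x b b' f; apply: cpath_ext => t; exact: cyc_prl EP _ _ _ _.
- by move=> x b b' f; apply: cpath_ext => t; exact: cyc_prr EP _ _ _ _.
- by move=> x b b' f; apply: cpath_ext => t; exact: cyc_pra EP _ _ _ _.
- by move=> x b b' f; apply: cpath_ext => t; exact: cyc_lab EP _ _ _ _.
- by move=> x b b' f; apply: cpath_ext => t; exact: cyc_arb EP _ _ _ _.
- move=> x f eps eps0.
  exact: (path_span_dense (pm := @pk_bl x) (m := @bl _ _ _ _ E x) (fun _ _ _ => erefl) (cb_bilinear (cyc_bl EP) x).1 (cyc_nondeg_l EP (x := x)) f eps0).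
- move=> x f eps eps0.
  have nd v : span_dense (fun b e => @rb _ _ _ _ E x e b) v.
    by move=> e e0; have [n [a [b h]]] := cyc_nondeg_r EP v e0; exists n, b, a.
  have [n [b [f' h]]] := path_span_dense (pm := fun b e => @pk_rb x e b) (fun _ _ _ => erefl) (cb_bilinear (cyc_rb EP) x).2 nd f eps0.
  by exists n, f', b.
- exact: (@path_lift1_cont R G L L _ _ _ (cyc_gl EP)).
- exact: (@path_lift1_cont R G S S _ _ _ (cyc_gr EP)).
- by move=> x f; apply: cpath_ext => t; exact: cyc_glK EP _ _.
- by move=> x f; apply: cpath_ext => t; exact: cyc_grK EP _ _.
- move=> x f; rewrite !cpath_normE /path_norm /path_norms; congr ((sup _)%:C).
  by apply: eq_imagel => t _ /=; rewrite (cyc_gl_norm EP).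
- move=> x f; rewrite !cpath_normE /path_norm /path_norms; congr ((sup _)%:C).
  by apply: eq_imagel => t _ /=; rewrite (cyc_gr_norm EP).
- by move=> x b f; apply: cpath_ext => t; exact: cyc_gl_bl EP _ _ _.
- by move=> x b f; apply: cpath_ext => t; exact: cyc_gr_rb EP _ _ _.
- by move=> x b f; apply: cpath_ext => t; exact: cyc_g_pr EP _ _ _.
- by move=> x b f; apply: cpath_ext => t; exact: cyc_gl_la EP _ _ _.
- by move=> x b f; apply: cpath_ext => t; exact: cyc_gr_ar EP _ _ _.
Qed.

Lemma path_kk_odd : is_odd_operator path_kk.
Proof.
have lE x (f : path_space L x) t : pval (pk_tl f) t = l0 (pval f t) + (tval t)%:C *: (l1 (pval f t) - l0 (pval f t)) by [].
have rE x (f : path_space S x) t : pval (pk_tr f) t = r0 (pval f t) + (tval t)%:C *: (r1 (pval f t) - r0 (pval f t)) by [].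
have bl0 x b f : l0 (@bl _ _ _ _ E x b f) = bl b (l0 f) := cyc_tl_bl O0 b f.
have bl1 x b f : l1 (@bl _ _ _ _ E x b f) = bl b (l1 f) := cyc_tl_bl O1 b f.
have rb0 x b f : r0 (@rb _ _ _ _ E x f b) = rb (r0 f) b := cyc_tr_rb O0 b f.
have rb1 x b f : r1 (@rb _ _ _ _ E x f b) = rb (r1 f) b := cyc_tr_rb O1 b f.
have pr0 x f e : @pr _ _ _ _ E x f (r0 e) = pr (l0 f) e := cyc_t_pr O0 f e.
have pr1 x f e : @pr _ _ _ _ E x f (r1 e) = pr (l1 f) e := cyc_t_pr O1 f e.
have gl0 x f : l0 (@gl _ _ _ _ E x f) = - gl (l0 f) := cyc_tl_odd O0 f.
have gl1 x f : l1 (@gl _ _ _ _ E x f) = - gl (l1 f) := cyc_tl_odd O1 f.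
have gr0 x f : r0 (@gr _ _ _ _ E x f) = - gr (r0 f) := cyc_tr_odd O0 f.
have gr1 x f : r1 (@gr _ _ _ _ E x f) = - gr (r1 f) := cyc_tr_odd O1 f.
split.
- exact: (@path_line_cont R G L _ _ _ _ _ _ HL (cyc_tl O0) (cyc_tl O1)).
- exact: (@path_line_cont R G S _ _ _ _ _ _ HS (cyc_tr O0) (cyc_tr O1)).
- have [M M0 MP] := path_line_bounded (E := L) (fun x => odd_linl (x := x) O0) (fun x => odd_linl (x := x) O1) (odd_bound O0).1 (odd_bound O1).1.
  have [M' M0' MP'] := path_line_bounded (E := S) (fun x => odd_linr (x := x) O0) (fun x => odd_linr (x := x) O1) (odd_bound O0).2 (odd_bound O1).2.
  exists (M + M') => x; split=> f; rewrite mulrDl.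
    by apply: le_trans (MP x f) _; rewrite lerDl mulr_ge0.
  by apply: le_trans (MP' x f) _; rewrite lerDr mulr_ge0.
- move=> x b f; apply: cpath_ext => t; have [blr _] := cb_bilinear (cyc_bl EP) x.
  have h g : pval (pk_bl b g) t = bl (pval b t) (pval g t) by [].
  rewrite lE !h lE bl0 bl1.
  by rewrite (linD (blr _)) (linZ (blr _)) (linB (blr _)).
- move=> x b f; apply: cpath_ext => t; have [_ rbl] := cb_bilinear (cyc_rb EP) x.
  have h g : pval (pk_rb g b) t = rb (pval g t) (pval b t) by [].
  rewrite rE !h rE rb0 rb1.
  by rewrite (linD (rbl _)) (linZ (rbl _)) (linB (rbl _)).
- move=> x f e; apply: cpath_ext => t; have [prr prl] := cb_bilinear (cyc_pr EP) x.
  have h f' e' : pval (pk_pr f' e') t = pr (pval f' t) (pval e' t) by [].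
  rewrite !h lE rE (linD (prl _)) (linZ (prl _)) (linB (prl _)) (linD (prr _)) (linZ (prr _)) (linB (prr _)).
  by rewrite pr0 pr1.
- move=> x f; apply: cpath_ext => t.
  have h g : pval (pk_gl g) t = gl (pval g t) by [].
  have h' : pval (- pk_gl (pk_tl f)) t = - gl (pval (pk_tl f) t) by [].
  rewrite h' !lE h gl0 gl1 (linD (@gl_lin x)) (linZ (@gl_lin x)) (linB (@gl_lin x)).
  by rewrite opprD -scalerN opprD.
- move=> x f; apply: cpath_ext => t.
  have h g : pval (pk_gr g) t = gr (pval g t) by [].
  have h' : pval (- pk_gr (pk_tr f)) t = - gr (pval (pk_tr f) t) by [].
  rewrite h' !rE h gr0 gr1 (linD (@gr_lin x)) (linZ (@gr_lin x)) (linB (@gr_lin x)).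
  by rewrite opprD -scalerN opprD.
Qed.

End PathKK.

(** * Local compactness on pairs of paths *)

Section PathCompact.
Variables (R : realType) (G : groupoid) (A B : galg R G) (E : kkdata A B).
Local Notation C := R[i].
Local Notation I := (unitI R).
Variables (l0 l1 : forall x, lp E x -> lp E x) (r0 r1 : forall x, rp E x -> rp E x).
Hypotheses (EP : is_pair E) (O0 : is_odd_operator (with_op l0 r0))
  (O1 : is_odd_operator (with_op l1 r1)).
Local Notation P := (path_kk EP O0 O1).

Section Near.
Variables (Z : Type) (F : set_system Z) (q : Z -> obj G).
Hypothesis FF : Filter F.

(** Local compactness of operators on [E] depending on [t], uniformly in [t] and with coefficients
    that are sections of the path fields. This is what local compactness on [E[0,1]] asks of an
    operator acting pointwise in [t]. *)
Definition near_compact_family (phil : forall z, I -> lp E (q z) -> lp E (q z))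
    (phir : forall z, I -> rp E (q z) -> rp E (q z)) : Prop :=
  forall e : C, 0 < e -> exists2 s : seq ((forall x, rp P x) * (forall x, lp P x)), base_pairs s &
    \forall z \near F, forall t,
      (forall v, `|phir z t v - \sum_(p <- s) rankr (E := E) (pval (p.1 (q z)) t) (pval (p.2 (q z)) t) v|
         <= e * `|v|) /\
      (forall f, `|phil z t f - \sum_(p <- s) rankl (E := E) (pval (p.1 (q z)) t) (pval (p.2 (q z)) t) f|
         <= e * `|f|).

Lemma near_compact_familyD phil phir phil' phir' :
  near_compact_family phil phir -> near_compact_family phil' phir' ->
  near_compact_family (fun z t f => phil z t f + phil' z t f) (fun z t v => phir z t v + phir' z t v).
Proof.
move=> h h' e e0; have e20 : 0 < e / 2 by rewrite divr_gt0.
have [s sP sn] := h _ e20; have [s' sP' sn'] := h' _ e20.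
exists (s ++ s'); first exact/List.Forall_app.
apply: filterS2 sn sn' => z n n' t; have [h1 h2] := n t; have [h3 h4] := n' t.
by split=> v; rewrite [e]splitr mulrDl big_cat/= opprD addrACA;
  apply: le_trans (ler_normD _ _) _; rewrite lerD.
Qed.

(** [chi |eta><xi|] is the rank-one operator of the path [chi eta] and the constant path [xi]. *)
Lemma near_compact_family_scale (chi : I -> R) Sl Sr : is_gspace (lp E) -> is_gspace (rp E) ->
  continuous (chi : I -> R^o) -> (forall t, `|chi t| <= 1) ->
  near_compact F (E := E) (q := q) Sl Sr ->
  near_compact_family (fun z t f => (chi t)%:C *: Sl z f) (fun z t v => (chi t)%:C *: Sr z v).
Proof.
move=> HL HR cc chi1 h e e0; have [s sP sn] := h e e0.
have chiC t : `|(chi t)%:C : C| <= 1.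
  have -> : `|(chi t)%:C : C| = `|chi t|%:C by rewrite normc_def/= expr0n/= addr0 sqrtr_sqr.
  by rewrite lecR.
exists [seq ((fun x => cpath_tensor cc (p.1 x)) : forall x, rp P x, (fun x => cpath_const (p.2 x)) : forall x, lp P x) | p <- s].
  apply/List.Forall_map; apply: List.Forall_impl sP => p [s1 s2]; split.
    exact: (@path_sec_tensor R G (zero_alg (rp E)) HR).
  exact: (@path_sec_const R G (zero_alg (lp E))).
apply: filterS sn => z [h1 h2] t; split=> v; rewrite big_map.
  have -> : (chi t)%:C *: Sr z v - \sum_(p <- s) rankr (E := E) ((chi t)%:C *: p.1 (q z)) (p.2 (q z)) v =
      (chi t)%:C *: (Sr z v - \sum_(p <- s) rankr (p.1 (q z)) (p.2 (q z)) v).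
    rewrite scalerBr scaler_sumr; congr (_ - _); apply: eq_bigr => p _.
    by rewrite (linZ ((rankr_bilinear EP v).2 _)).
  by rewrite normrZ -[leRHS]mul1r ler_pM.
have -> : (chi t)%:C *: Sl z v - \sum_(p <- s) rankl (E := E) ((chi t)%:C *: p.1 (q z)) (p.2 (q z)) v =
    (chi t)%:C *: (Sl z v - \sum_(p <- s) rankl (p.1 (q z)) (p.2 (q z)) v).
  rewrite scalerBr scaler_sumr; congr (_ - _); apply: eq_bigr => p _.
  by rewrite (linZ ((rankl_bilinear EP v).2 _)).
by rewrite normrZ -[leRHS]mul1r ler_pM.
Qed.

Lemma near_compact_path phil phir (Pl : forall z, lp P (q z) -> lp P (q z))
    (Pr : forall z, rp P (q z) -> rp P (q z)) : near_compact_family phil phir ->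
  (forall z f t, pval (Pl z f) t = phil z t (pval f t)) ->
  (forall z v t, pval (Pr z v) t = phir z t (pval v t)) ->
  near_compact F (E := P) Pl Pr.
Proof.
move=> h PlE PrE e e0; have [s sP sn] := h e e0; exists s => //.
have e0' := ltW e0.
apply: filterS sn => z n; split=> v; apply: cpath_le => t; have [h1 h2] := n t.
  apply: le_trans (ler_wpM2l e0' (pval_le v t)).
  have -> : pval (Pr z v - \sum_(p <- s) rankr (p.1 (q z)) (p.2 (q z)) v) t =
      phir z t (pval v t) - \sum_(p <- s) rankr (E := E) (pval (p.1 (q z)) t) (pval (p.2 (q z)) t) (pval v t).
    by rewrite -PrE; congr (_ - _); rewrite pval_sum.
  exact: h1.
apply: le_trans (ler_wpM2l e0' (pval_le v t)).
have -> : pval (Pl z v - \sum_(p <- s) rankl (p.1 (q z)) (p.2 (q z)) v) t =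
    phil z t (pval v t) - \sum_(p <- s) rankl (E := E) (pval (p.1 (q z)) t) (pval (p.2 (q z)) t) (pval v t).
  by rewrite -PlE; congr (_ - _); rewrite pval_sum.
exact: h2.
Qed.

End Near.
End PathCompact.

Lemma line_square (R : realType) (V : lmodType R[i]) (T D : V -> V) (t : R[i]) (v : V) :
  linear T -> linear D ->
  T (T v + t *: D v) + t *: D (T v + t *: D v) =
  T (T v) + t *: (T (D v) + D (T v)) + (t * t) *: D (D v).
Proof.
move=> Tl Dl; rewrite (linD Tl) (linD Dl) (linZ Tl) (linZ Dl) !scalerDr scalerA.
by rewrite !addrA.
Qed.

Lemma line_diff (R : realType) (V : lmodType R[i]) (x0 x1 y0 y1 : V) (t : R[i]) :
  x0 + t *: (x1 - x0) - (y0 + t *: (y1 - y0)) = x0 - y0 + t *: (x1 - y1 - (x0 - y0)).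
Proof. by rewrite opprD addrACA -scalerBr subACA. Qed.

Section PathCycle.
Variables (R : realType) (G : groupoid) (A B : galg R G) (E : kkdata A B).
Local Notation C := R[i].
Local Notation I := (unitI R).
Variables (l0 l1 : forall x, lp E x -> lp E x) (r0 r1 : forall x, rp E x -> rp E x).
Hypotheses (HA : is_galg A) (HB : is_galg B) (EP : is_pair E).
Hypotheses (C0 : is_cycle (with_op l0 r0)) (C1 : is_cycle (with_op l1 r1)).
Hypothesis DC : forall a, sec A a -> locally_compact_op (E := E) (p := idfun)
  (fun x f => l1 (la f (a x)) - l0 (la f (a x))) (fun x e => ar (a x) (r1 e - r0 e)).

Local Notation P := (path_kk EP (cyc_op C0) (cyc_op C1)).

Lemma unit_bound (t : I) : `|1 : R| <= 1. Proof. by rewrite normr1. Qed.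
Lemma tval_bound (t : I) : `|tval t| <= 1.
Proof. by have /andP[h1 h2] := tval_itv t; rewrite ger0_norm. Qed.
Lemma tval2_bound (t : I) : `|tval t * tval t| <= 1.
Proof. by rewrite normrM -[leRHS]mulr1 ler_pM// tval_bound. Qed.
Lemma tval2_cts : continuous ((fun t : I => tval t * tval t) : I -> R^o).
Proof.
by move=> t; apply: (@continuousM _ _ (@tval R : I -> R^o)); exact: tval_continuous.
Qed.

Lemma path_cycle : is_cycle P.
Proof.
have PP := path_kk_pair EP (cyc_op C0) (cyc_op C1) HA HB.
have PO := path_kk_odd EP (cyc_op C0) (cyc_op C1).
have [HL HR] := (cyc_lp EP, cyc_rp EP).
have l0l x : linear (@l0 x) := odd_linl (F := with_op l0 r0) (x := x) (cyc_op C0).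
have l1l x : linear (@l1 x) := odd_linl (F := with_op l1 r1) (x := x) (cyc_op C1).
have r0l x : linear (@r0 x) := odd_linr (F := with_op l0 r0) (x := x) (cyc_op C0).
have r1l x : linear (@r1 x) := odd_linr (F := with_op l1 r1) (x := x) (cyc_op C1).
have idc : continuous (@idfun (obj G)) by move=> x; exact: cvg_id.
have fam1 Z (F : set_system Z) q Sl Sr : Filter F -> near_compact F (E := E) (q := q) Sl Sr ->
  near_compact_family EP (cyc_op C0) (cyc_op C1) F (q := q)
   (fun z t f => (1 : R)%:C *: Sl z f) (fun z t v => (1 : R)%:C *: Sr z v).
  move=> FF h.
  exact: (near_compact_family_scale EP (cyc_op C0) (cyc_op C1) FF HL HR (@cst_continuous I R^o 1) unit_bound h).
have famt Z (F : set_system Z) q Sl Sr : Filter F -> near_compact F (E := E) (q := q) Sl Sr ->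
  near_compact_family EP (cyc_op C0) (cyc_op C1) F (q := q)
   (fun z t f => (tval t)%:C *: Sl z f) (fun z t v => (tval t)%:C *: Sr z v).
  move=> FF h.
  exact: (near_compact_family_scale EP (cyc_op C0) (cyc_op C1) FF HL HR (@tval_continuous R) tval_bound h).
have famt2 Z (F : set_system Z) q Sl Sr : Filter F -> near_compact F (E := E) (q := q) Sl Sr ->
  near_compact_family EP (cyc_op C0) (cyc_op C1) F (q := q)
   (fun z t f => (tval t * tval t)%:C *: Sl z f) (fun z t v => (tval t * tval t)%:C *: Sr z v).
  move=> FF h.
  exact: (near_compact_family_scale EP (cyc_op C0) (cyc_op C1) FF HL HR tval2_cts tval2_bound h).
split=> //.
- move=> a sa; apply/(locally_compact_opP _ _ PP idc) => x.
  have FF := nbhs_filter x.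
  have qF : idfun @ nbhs x --> x by exact: cvg_id.
  have k0 : near_compact (nbhs x) (E := E) (q := idfun) (fun x f => l0 (la f (a x)) - la (l0 f) (a x))
    (fun x v => ar (a x) (r0 v) - r0 (ar (a x) v)) := near_commutator C0 FF qF (near_sec_base idfun FF sa).
  have k1 : near_compact (nbhs x) (E := E) (q := idfun) (fun x f => l1 (la f (a x)) - la (l1 f) (a x))
    (fun x v => ar (a x) (r1 v) - r1 (ar (a x) v)) := near_commutator C1 FF qF (near_sec_base idfun FF sa).
  have k2 := near_compactB FF qF EP k1 k0.
  apply: near_compact_path (near_compact_familyD _ (fam1 _ _ _ _ _ FF k0) (famt _ _ _ _ _ FF k2)) _ _ => z f t.
    have [_ lal] := cb_bilinear (cyc_la EP) z.
    have -> : pval (tl (la f (a z)) - la (tl f) (a z)) t =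
      (l0 (la (pval f t) (a z)) + (tval t)%:C *: (l1 (la (pval f t) (a z)) - l0 (la (pval f t) (a z)))) -
      la (l0 (pval f t) + (tval t)%:C *: (l1 (pval f t) - l0 (pval f t))) (a z) by [].
    by rewrite rmorph1 scale1r (linD (lal _)) (linZ (lal _)) (linB (lal _)) line_diff.
  have [arl _] := cb_bilinear (cyc_ar EP) z.
  have -> : pval (ar (a z) (tr f) - tr (ar (a z) f)) t =
    ar (a z) (r0 (pval f t) + (tval t)%:C *: (r1 (pval f t) - r0 (pval f t))) -
    (r0 (ar (a z) (pval f t)) + (tval t)%:C *: (r1 (ar (a z) (pval f t)) - r0 (ar (a z) (pval f t)))) by [].
  by rewrite rmorph1 scale1r (linD (arl _)) (linZ (arl _)) (linB (arl _)) line_diff.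
- move=> a sa; apply/(locally_compact_opP _ _ PP idc) => x.
  have FF := nbhs_filter x; have qF : idfun @ nbhs x --> x by exact: cvg_id.
  have k0 : near_compact (nbhs x) (E := E) (q := idfun) (fun x f => la f (a x) - l0 (l0 (la f (a x))))
    (fun x v => ar (a x) (v - r0 (r0 v))) := near_square C0 FF qF (near_sec_base idfun FF sa).
  have kD : near_compact (nbhs x) (E := E) (q := idfun) (fun x f => l1 (la f (a x)) - l0 (la f (a x)))
      (fun x e => ar (a x) (r1 e - r0 e)).
    by move: x {FF qF k0}; exact: (locally_compact_opP _ _ EP idc).1 (DC sa).
  have A0 : near_adjointable (nbhs x) (E := E) (q := idfun) (fun x => @l0 x) (fun x => @r0 x).
    by case: (near_adjointable_op (E := with_op l0 r0) (cyc_op C0) FF qF).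
  have A1 : near_adjointable (nbhs x) (E := E) (q := idfun) (fun x => @l1 x) (fun x => @r1 x).
    by case: (near_adjointable_op (E := with_op l1 r1) (cyc_op C1) FF qF).
  have AD := near_adjointableB EP FF A1 A0.
  have kc : near_compact (nbhs x) (E := E) (q := idfun) (fun x f => l0 (la f (a x)) - la (l0 f) (a x))
    (fun x v => ar (a x) (r0 v) - r0 (ar (a x) v)) := near_commutator C0 FF qF (near_sec_base idfun FF sa).
  (* With [D = T_1 - T_0]: [a (1 - T_t^2) = a (1 - T_0^2) - t a (T_0 D + D T_0) - t^2 a D^2], where
     [a T_0 D = T_0 a D + [a, T_0] D]. *)
  have k1 := near_compact_mulr FF qF EP A0 kD.
  have k2 := near_compact_mulr FF qF EP AD kD.
  have k3 := near_compactD FF (near_compact_mull FF qF EP A0 kD) (near_compact_mulr FF qF EP AD kc).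
  have k4 := near_compactN FF qF EP (near_compactD FF k3 k1).
  have k5 := near_compactN FF qF EP k2.
  apply: near_compact_path (near_compact_familyD _ (near_compact_familyD _ (fam1 _ _ _ _ _ FF k0) (famt _ _ _ _ _ FF k4)) (famt2 _ _ _ _ _ FF k5)) _ _ => z f t.
    have [_ lal] := cb_bilinear (cyc_la EP) z.
    have Dl : linear (fun v => @l1 z v - @l0 z v).
      by move=> b u v; rewrite (l0l z) (l1l z) scalerBr opprD addrACA.
    pose g := la (pval f t) (a z); pose c := (tval t)%:C.
    have -> : pval (la f (a z) - tl (tl (la f (a z)))) t =
       g - (l0 (l0 g + c *: (l1 g - l0 g)) + c *: (l1 (l0 g + c *: (l1 g - l0 g)) - l0 (l0 g + c *: (l1 g - l0 g)))) by [].
    have e1 u v : @l1 z v - l0 v + (l1 (u - v) - l0 (u - v)) = l1 u - l0 u.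
      by rewrite (linB (l1l z)) (linB (l0l z)) subACA addrC subrK.
    rewrite (line_square c g (l0l z) Dl) rmorph1 scale1r rmorphM /= -/g -/c e1.
    set p := l0 (l1 g - l0 g); set p' := l1 (l0 g) - l0 (l0 g); set p'' := _ *: (_ - l0 _).
    by rewrite [p' + p]addrC !scalerN -/p'' !opprD !addrA.
  have [arl _] := cb_bilinear (cyc_ar EP) z.
  have Dl : linear (fun v => @r1 z v - @r0 z v).
    by move=> b u v; rewrite (r0l z) (r1l z) scalerBr opprD addrACA.
  pose g := pval f t; pose c := (tval t)%:C.
  have -> : pval (ar (a z) (f - tr (tr f))) t = ar (a z)
     (g - (r0 (r0 g + c *: (r1 g - r0 g)) + c *: (r1 (r0 g + c *: (r1 g - r0 g)) - r0 (r0 g + c *: (r1 g - r0 g))))) by [].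
  rewrite (line_square c g (r0l z) Dl) rmorph1 scale1r rmorphM /= -/g -/c.
  rewrite [r0 (ar _ _) + _]addrC subrK -(linD (arl _)) !scalerN -!(linZ (arl _)).
  by rewrite -(linB (arl _)) -(linB (arl _)) !opprD !addrA.
- move=> a sa; apply/(locally_compact_opP _ _ PP (@rng_cts G)) => g.
  have FF := nbhs_filter g; have qF := @rng_cts G g.
  have k0 : near_compact (nbhs g) (E := E) (q := @rng G) (fun g f => conj_act l0 erefl (la f (a g)) - l0 (la f (a g)))
    (fun g v => ar (a g) (conj_act r0 erefl v - r0 v)) := (locally_compact_opP _ _ (with_op_pair l0 r0 EP) (@rng_cts G)).1 (cyc_equivariance C0 sa) g.
  have k1 : near_compact (nbhs g) (E := E) (q := @rng G) (fun g f => conj_act l1 erefl (la f (a g)) - l1 (la f (a g)))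
    (fun g v => ar (a g) (conj_act r1 erefl v - r1 v)) := (locally_compact_opP _ _ (with_op_pair l1 r1 EP) (@rng_cts G)).1 (cyc_equivariance C1 sa) g.
  have k2 := near_compactB FF qF EP k1 k0.
  apply: near_compact_path (near_compact_familyD _ (fam1 _ _ _ _ _ FF k0) (famt _ _ _ _ _ FF k2)) _ _ => z f t.
    pose u := la (pval f t) (a z); pose c := (tval t)%:C.
    pose w := act (etrans (src_inv z) erefl) (rng_inv z) u.
    have -> : pval (conj_act (@tl _ _ _ _ P) erefl (la f (a z)) - tl (la f (a z))) t =
      act erefl erefl (l0 w + c *: (l1 w - l0 w)) - (l0 u + c *: (l1 u - l0 u)) by [].
    have al : linear (@act R G (lp E) z _ _ erefl erefl) := act_linear erefl erefl.
    by rewrite (linD al) (linZ al) (linB al) line_diff rmorph1 scale1r.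
  have [arl _] := cb_bilinear (cyc_ar EP) (rng z).
  pose u := pval f t; pose c := (tval t)%:C.
  pose w := act (etrans (src_inv z) erefl) (rng_inv z) u.
  have -> : pval (ar (a z) (conj_act (@tr _ _ _ _ P) erefl f - tr f)) t =
    ar (a z) (act erefl erefl (r0 w + c *: (r1 w - r0 w)) - (r0 u + c *: (r1 u - r0 u))) by [].
  have al : linear (@act R G (rp E) z _ _ erefl erefl) := act_linear erefl erefl.
  rewrite (linD al) (linZ al) (linB al) line_diff rmorph1 scale1r.
  by rewrite -(linB (arl _)) -(linZ (arl _)) -(linD (arl _)).
Qed.

End PathCycle.

(** * Straight-line homotopies *)

Section TensorFlip.
Variable R : realType.
Local Notation C := R[i].

Lemma bounded_balanced_flip (D : Type) (U V : normedModType C) (ru : U -> D -> U) (lv : D -> V -> V)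
    (M : C) (W : normedModType C) (m : U -> V -> W) :
  bounded_balanced ru lv M m ->
  bounded_balanced (fun v d => lv d v) (fun d u => ru u d) M (fun v u => m u v).
Proof.
move=> [[h1 h2] h3 h4]; split=> [|v u|v d u].
- by split=> u; [exact: h2|exact: h1].
- by rewrite mulrAC.
- by rewrite h4.
Qed.

(** Lets statements about the left-hand modules be deduced from those about the right-hand ones. *)
Lemma tensor_flip (D : Type) (U V : normedModType C) (ru : U -> D -> U) (lv : D -> V -> V)
    (X : completeNormedModType C) (t : U -> V -> X) :
  is_projective_tensor (fun v d => lv d v) (fun d u => ru u d) (fun v u => t u v) ->
  is_projective_tensor ru lv t.
Proof.
move=> [h1 h2]; split; first exact: (bounded_balanced_flip h1).
move=> W m M M0 /bounded_balanced_flip mb.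
have [l [[l1 l2 l3] lu]] := h2 W _ M M0 mb; exists l; split; first by split=> // u v; exact: l3.
by move=> l' [k1 k2 k3]; apply: lu; split=> // v u; exact: k3.
Qed.

End TensorFlip.

Lemma norm_small (R : realType) (V : normedModType R[i]) (v : V) :
  (forall d : R[i], 0 < d -> `|v| <= d) -> v = 0.
Proof.
move=> h; apply/eqP; apply: contraT => v0.
have n0 : 0 < `|v| by rewrite normr_gt0.
have := h (`|v| / 2); rewrite divr_gt0// => /(_ isT).
by rewrite ler_pdivlMr// mulr_natr mulr2n gerDl normr_le0 (negbTE v0).
Qed.

Section EvalTensor.
Variable R : realType.
Local Notation C := R[i].
Local Notation I := (unitI R).
Variables (Bf V : completeNormedModType C) (mul : Bf -> Bf -> Bf) (r : V -> Bf -> V)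
  (pr : cpath V -> cpath Bf -> cpath V) (t0 : I).
Hypotheses (mulbil : is_bilinear mul) (rbil : is_bilinear r) (rcontr : forall v b, `|r v b| <= `|v| * `|b|)
  (rA : forall v b b', r (r v b) b' = r v (mul b b')) (rnd : forall v, span_dense r v)
  (prE : forall e b t, pval (pr e b) t = r (pval e t) (pval b t)).

(** [umul] for an arbitrary bilinear multiplication, so that [eval_tensor] also covers left modules,
    through the opposite multiplication. *)
Definition unit_mul (d c : l1sum Bf C^o) : l1sum Bf C^o :=
  (mul d.1 c.1 + c.2 *: d.1 + d.2 *: c.1, d.2 * c.2).

(** The push-forward of [E[0,1]] along evaluation at [t0] is [E]: for balanced [m], the value
    [m e one] depends only on [e] at [t0], so [m] is determined by its values on constant paths and
    [one]. *)
Lemma eval_tensor :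
  @is_projective_tensor R (l1sum (cpath Bf) C^o) (cpath V) (l1sum Bf C^o)
    (fun e d => pr e d.1 + d.2 *: e) (fun d c => unit_mul (pval d.1 t0, d.2) c) V
    (fun e c => r (pval e t0) c.1 + c.2 *: pval e t0).
Proof.
have [rr rl] := rbil; split; first split.
- split=> [e a c c'|c a e e'].
    have -> : (a *: c + c').1 = a *: c.1 + c'.1 by [].
    have -> : (a *: c + c').2 = a * c.2 + c'.2 by [].
    by rewrite (rr _ a) scalerDl scalerDr scalerA addrACA.
  have -> : pval (a *: e + e') t0 = a *: pval e t0 + pval e' t0 by [].
  by rewrite (rl _ a) !scalerDr !scalerA [c.2 * a]mulrC addrACA.
- move=> e c; rewrite mul1r l1sum_normE mulrDr; apply: le_trans (ler_normD _ _) _.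
  rewrite lerD//; first by apply: le_trans (rcontr _ _) _; rewrite ler_wpM2r// pval_le.
  by rewrite normrZ mulrC ler_wpM2r// pval_le.
- move=> e d c.
  have -> : pval (pr e d.1 + d.2 *: e) t0 = r (pval e t0) (pval d.1 t0) + d.2 *: pval e t0.
    by rewrite -prE.
  rewrite /unit_mul /= (linD (rl _)) (linZ (rl _)) rA (linD (rr _)) (linD (rr _)) (linZ (rr _)) (linZ (rr _)).
  by rewrite scalerDr scalerA [d.2 * c.2]mulrC addrACA -!addrA; congr (_ + _); rewrite addrCA.
move=> W m M M0 [[mr ml] mM mbal].
pose one : l1sum Bf C^o := (0, 1).
have one1 : `|one| = 1 by rewrite l1sum_normE /= normr0 add0r normr1.
have mzero e : m e 0 = 0 by exact: lin0 (mr e).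
have m1b e : `|m e one| <= M * `|e| by have := mM e one; rewrite one1 mulr1.
(* Where [e] is small it is cut off by [f]; what remains is, by non-degeneracy,
   close to a sum of [e' b] with [b t0 = 0], on which [m _ one] vanishes by
   balancedness. *)
have vanish e : pval e t0 = 0 -> m e one = 0.
  move=> et0; apply: norm_small => d' d'0.
  have [d [d0 _ Md]] := scaled_eps (addr_ge0 M0 M0) d'0.
  have [|f [[fc _] f01 ft0 fU]] := @lc_bump R I (@unitI_locally_compact R) (@unitI_hausdorff R) t0 [set s | `|pval e s| <= d].
    have /continuous_distP/(_ t0 _ d0) := @pvalP _ _ e; apply: filterS => s.
    by rewrite et0 sub0r normrN => /ltW.
  pose phi s := 1 - f s.
  have phic : continuous (phi : I -> R^o).
    move=> s; apply: (@continuousB _ _ _ (fun=> 1 : R^o)); [exact: cst_continuous|exact: fc].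
  have phi0 s : 0 <= phi s by rewrite subr_ge0; case/andP: (f01 s).
  have phi1 s : phi s <= 1 by rewrite lerBlDr lerDl; case/andP: (f01 s).
  have phit0 : phi t0 = 0 by rewrite /phi ft0 subrr.
  have [n [b [e' h]]] := path_span_dense (pm := fun b e => pr e b) (m := fun b v => r v b)
    (fun b f t => prE f b t) rl (fun v e e0 => let: ex_intro n (ex_intro a (ex_intro b h)) := rnd v e0 in
      ex_intro _ n (ex_intro _ b (ex_intro _ a h))) e d0.
  pose pe := cpath_scale phic e; pose pb i := cpath_scale phic (b i).
  have z1 i : m (pr (e' i) (pb i)) one = 0.
    have := mbal (e' i) (pb i, 0) one; rewrite scale0r addr0 /= => ->.
    rewrite -(mzero (e' i)); congr (m _ _); rewrite /unit_mul /= phit0 mul0r scale0r.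
    have [_ mull] := mulbil.
    by rewrite (lin0 (mull _)) scaler0 scale0r !addr0.
  have -> : m e one = m (e - pe) one + m (pe - \sum_i pr (e' i) (pb i)) one.
    have s0 : m (\sum_i pr (e' i) (pb i)) one = 0 by rewrite (lin_sum _ _ _ (ml _)) big1.
    by rewrite !(linB (ml _)) s0 subr0 subrK.
  apply: le_trans Md; apply: le_trans (ler_normD _ _) _; rewrite mulrDl lerD//.
    apply: le_trans (m1b _) _; rewrite ler_wpM2l//; apply: cpath_le => s.
    have -> : pval (e - pe) s = (f s)%:C *: pval e s.
      have -> : pval (e - pe) s = pval e s - (phi s)%:C *: pval e s by [].
      by rewrite /phi rmorphB rmorph1 scalerBl scale1r opprB addrC subrK.
    have [->|fs] := eqVneq (f s) 0; first by rewrite scale0r normr0 ltW.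
    rewrite normrZ -[leRHS]mul1r ler_pM//; last exact: (fU s).
    by have /andP[? ?] := f01 s; rewrite ger0_norm lecR.
  apply: le_trans (m1b _) _; rewrite ler_wpM2l//; apply: cpath_le => s.
  have -> : pval (pe - \sum_i pr (e' i) (pb i)) s = (phi s)%:C *: pval (e - \sum_i pr (e' i) (b i)) s.
    have -> : pval (e - \sum_i pr (e' i) (b i)) s = pval e s - \sum_i r (pval (e' i) s) (pval (b i) s).
      by congr (_ - _); rewrite pval_sum; apply: eq_bigr => i _; rewrite prE.
    rewrite scalerBr scaler_sumr; congr (_ - _); rewrite pval_sum; apply: eq_bigr => i _.
    by rewrite prE /= (linZ (rr _)).
  rewrite normrZ -[leRHS]mul1r ler_pM//; first by rewrite ger0_norm lecR.
  exact: le_trans (pval_le _ _) (ltW h).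
(* Balancedness moves [c] to the left factor and leaves [one] on the right; the two left factors
   then agree at [t0]. *)
have constE e c : m (cpath_const (r (pval e t0) c.1 + c.2 *: pval e t0)) one = m e c.
  have := mbal e (cpath_const c.1, c.2) one.
  have -> : unit_mul (pval (cpath_const c.1, c.2).1 t0, (cpath_const c.1, c.2).2) one = c.
    have [mulr _] := mulbil.
    rewrite /unit_mul /= (lin0 (mulr _)) add0r scale1r scaler0 addr0 mulr1.
    by case: c.
  move=> <-; apply/eqP; rewrite -subr_eq0 -(linB (ml _)); apply/eqP; apply: vanish.
  have -> : pval (cpath_const (r (pval e t0) c.1 + c.2 *: pval e t0) -
      (pr e (cpath_const c.1, c.2).1 + (cpath_const c.1, c.2).2 *: e)) t0 =
    r (pval e t0) c.1 + c.2 *: pval e t0 - (pval (pr e (cpath_const c.1)) t0 + c.2 *: pval e t0) by [].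
  by rewrite prE subrr.
exists (fun v => m (cpath_const v) one); split; first split.
- move=> a u v; rewrite -(ml one); congr (m _ _); exact: cpath_ext.
- by move=> v; apply: le_trans (m1b _) _; rewrite cpath_const_norm.
- exact: constE.
move=> l [l1 l2 l3]; apply/funext => v; rewrite -l3.
by congr (l _); rewrite /= (lin0 (rr _)) add0r scale1r.
Qed.

End EvalTensor.

Section Sections.
Variables (R : realType) (X : topologicalType) (K : bfield R X).
Local Notation C := R[i].
Hypothesis Ku : is_usc_field K.

Lemma sec_sum J (r : seq J) (xi : J -> forall x, K x) : (forall j, sec K (xi j)) ->
  sec K (fun x => \sum_(j <- r) xi j x).
Proof.
move=> h; apply/(sec_nearP _ Ku) => x; apply: near_sec_sum => // j.
exact: near_sec_base.
Qed.

Lemma sec_scale (f : X -> C) (xi : forall x, K x) : continuous (f : X -> C^o) -> sec K xi ->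
  sec K (fun x => f x *: xi x).
Proof.
move=> fc sxi; apply/(sec_nearP _ Ku) => x.
apply: (near_sec_scale (a := f x) (nbhs_filter x) (@cvg_id _ _) Ku); last exact: near_sec_base.
move=> e e0; have /(@continuous_distP _ _ C^o)/(_ x e e0) := fc; apply: filterS => y.
by rewrite distrC => /ltW.
Qed.

Lemma secD (xi zeta : forall x, K x) : sec K xi -> sec K zeta -> sec K (fun x => xi x + zeta x).
Proof.
move=> h h'; apply/(sec_nearP _ Ku) => x.
by apply: near_secD => //; exact: near_sec_base.
Qed.

Lemma approx_sub (S : set (forall x, K x)) : S `<=` sec K -> Defs.approx S `<=` sec K.
Proof.
move=> SK xi xa; apply: (sec_approx Ku) => x e e0.
by have [zeta /SK sz n] := xa x e e0; exists zeta.
Qed.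

Lemma sub_approx (S : set (forall x, K x)) : S `<=` Defs.approx S.
Proof. by move=> xi Sxi x e e0; exists xi => //; apply: nearW => y; rewrite subrr normr0 ltW. Qed.

End Sections.

(** * Push-forward along evaluation at a point of the interval *)

Section PathPush.
Variables (R : realType) (G : groupoid).
Local Notation C := R[i].
Local Notation I := (unitI R).
Variable t0 : I.

Lemma path_sec_eval (K : galg R G) (xi : forall x, path_space K x) : is_gspace K ->
  sec (path_space K) xi -> sec K (fun x => pval (xi x) t0).
Proof.
move=> [Ku _] /path_secP s; apply/(sec_nearP _ Ku) => x e e0.
have [zeta sz n] := s x t0 e e0; exists zeta => //.
have := near_pair_swap (P := fun x t => `|pval (xi x) t - zeta x| <= e) n.
by move/near_pair2.
Qed.

(** Every section is the image of its constant path, tensored with the unit [(0, 1)]; conversely the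
    terms are sections because [r] is continuous. *)
Lemma path_sec_image (K B : galg R G) (r : forall x, K x -> B x -> K x) :
  is_gspace K -> is_gspace B -> cont_bilinear K B K r ->
  sec K = Defs.approx [set zeta | exists n,
    exists2 xi : 'I_n -> forall x, path_space K x, (forall i, sec (path_space K) (xi i)) &
    exists2 beta : 'I_n -> forall x, unitization B x, (forall i, @usec _ _ B (beta i)) &
    zeta = fun x => \sum_(i < n) (r x (pval (xi i x) t0) (beta i x).1 + (beta i x).2 *: pval (xi i x) t0)].
Proof.
move=> HK HB rc; have [Ku _] := HK; have [Bu _] := HB; apply/seteqP; split.
  move=> xi sxi; apply: sub_approx; exists 1%N, (fun=> fun x => cpath_const (xi x)).
    by move=> _; exact: path_sec_const.
  exists (fun=> fun x => (0, 1)).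
    by move=> _; split; [exact: sec_zero Bu|exact: cst_continuous].
  apply: functional_extensionality_dep => x; rewrite big_ord_recl big_ord0 addr0 /=.
  have [rr _] := cb_bilinear rc x.
  by rewrite (lin0 (rr _)) add0r scale1r.
apply: approx_sub => // _ [n [xi sxi [beta sbeta ->]]].
apply: sec_sum => // i; have [b1 b2] := sbeta i.
by apply: secD => //; [apply: cb_sec rc _ _ _ b1|apply: sec_scale => //]; exact: path_sec_eval.
Qed.

Variables (A B : galg R G) (E : kkdata A B).
Variables (l0 l1 : forall x, lp E x -> lp E x) (r0 r1 : forall x, rp E x -> rp E x).
Hypotheses (HA : is_galg A) (HB : is_galg B) (EP : is_pair E) (O0 : is_odd_operator (with_op l0 r0))
  (O1 : is_odd_operator (with_op l1 r1)).
Local Notation P := (path_kk EP O0 O1).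
Variables (lt : forall x, lp E x -> lp E x) (rt : forall x, rp E x -> rp E x).
Hypotheses (ltE : forall x (f : lp P x), pval (tl f) t0 = lt (pval f t0))
  (rtE : forall x (f : rp P x), pval (tr f) t0 = rt (pval f t0)).
Hypotheses (ltl : forall x, linear (@lt x)) (rtl : forall x, linear (@rt x)).
Hypotheses (lt_bl : forall x (b : B x) (f : lp E x), lt (bl b f) = bl b (lt f))
  (rt_rb : forall x (b : B x) (f : rp E x), rt (rb f b) = rb (rt f) b).

Definition evR x (e : rp P x) (c : unitization B x) : rp (with_op lt rt) x :=
  @rb _ _ _ _ E x (pval e t0) c.1 + c.2 *: pval e t0.
Definition evL x (c : unitization B x) (f : lp P x) : lp (with_op lt rt) x :=
  @bl _ _ _ _ E x c.1 (pval f t0) + c.2 *: pval f t0.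

Lemma path_push : @pushes_to R G A (path_alg B) B (@path_ev R G B t0) P (with_op lt rt) evR evL.
Proof.
have [HL HR] := (cyc_lp EP, cyc_rp EP); have [GB _] := HB.
have blb x := cb_bilinear (cyc_bl EP) x; have rbb x := cb_bilinear (cyc_rb EP) x.
have prb x := cb_bilinear (cyc_pr EP) x; have lab x := cb_bilinear (cyc_la EP) x.
have arb x := cb_bilinear (cyc_ar EP) x.
have gll x : linear (@gl _ _ _ _ E x) := gl_lin EP (x := x).
have grl x : linear (@gr _ _ _ _ E x) := gr_lin EP (x := x).
split.
- move=> x; exact: (@eval_tensor R (B x) (rp E x) (@amul _ _ B x) (@rb _ _ _ _ E x) (@rb _ _ _ _ P x) t0
    (amul_bilinear B x) (rbb x) (@cyc_rb_contr _ _ _ _ _ EP x) (fun v b b' => esym (cyc_rbA EP b b' v))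
    (cyc_nondeg_r EP (x := x)) (fun _ _ _ => erefl)).
- move=> x; apply: tensor_flip.
  have nd v : span_dense (fun v b => @bl _ _ _ _ E x b v) v.
    by move=> e e0; have [n [b [v' h]]] := cyc_nondeg_l EP v e0; exists n, v', b.
  have bc v b : `|@bl _ _ _ _ E x b v| <= `|v| * `|b| by rewrite mulrC; exact: (cyc_bl_contr EP).
  have swapb (U V W : lmodType C) (m : U -> V -> W) : is_bilinear m -> is_bilinear (fun v u => m u v) by case.
  have h := @eval_tensor R (B x) (lp E x) (fun b b' => @amul _ _ B x b' b) (fun v b => @bl _ _ _ _ E x b v)
    (fun f b => @bl _ _ _ _ P x b f) t0 (swapb _ _ _ _ (amul_bilinear B x)) (swapb _ _ _ _ (blb x)) bc
    (fun v b b' => esym (cyc_blA EP b' b v)) nd (fun _ _ _ => erefl).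
  have E1 : (fun (d : unitization (path_alg B) x) (u : unitization B x) => umul u (upsi (@path_ev R G B t0) d)) =
     (fun d c => unit_mul (fun b b' => @amul _ _ B x b' b) (pval d.1 t0, d.2) c).
    by apply/funext => d; apply/funext => c; rewrite /umul /unit_mul /= mulrC; congr pair; rewrite addrAC.
  by rewrite E1; exact: h.
- exact: (@path_sec_image (zero_alg (rp E)) B (@rb _ _ _ _ E) HR GB (cyc_rb EP)).
- have h : cont_bilinear (lp E) B (lp E) (fun x f b => @bl _ _ _ _ E x b f).
    split.
    + by move=> x; have [? ?] := blb x; split.
    + by move=> x; have [M MP] := cb_bounded (cyc_bl EP) x; exists M; apply: filterS MP => y h e f; rewrite mulrAC.
    + by move=> xi b sxi sb; exact: (cb_sec (cyc_bl EP)).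
  exact: (@path_sec_image (zero_alg (lp E)) B (fun x f b => @bl _ _ _ _ E x b f) HL GB h).
- move=> g x y hs hr e c; have al : linear (@act R G (rp E) g x y hs hr) := act_linear hs hr.
  by rewrite /evR (linD al) (linZ al) rb_eq.
- move=> g x y hs hr c e; have al : linear (@act R G (lp E) g x y hs hr) := act_linear hs hr.
  by rewrite /evL (linD al) (linZ al) bl_eq.
- move=> x e c b; have [rr rl] := rbb x.
  rewrite /evR /= (linD (rl _)) (linZ (rl _)) (linD (rr _)) (linD (rr _)) !(linZ (rr _)) -(cyc_rbA EP).
  by rewrite mulr0 !scale0r !addr0.
- move=> x c f b; have [rr rl] := blb x.
  rewrite /evL /= (linD (rr _)) (linZ (rr _)) -(cyc_blA EP) mul0r scale0r !addr0 scale0r addr0.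
  by rewrite (linD (rl _)) (linZ (rl _)).
- move=> x c f e c'; have [rr rl] := prb x; have [mr ml] := amul_bilinear B x.
  rewrite /evR /evL /umul /uincl /path_ev /=; congr pair; last by rewrite !(mulr0, mul0r).
  rewrite (linD (rl _)) (linZ (rl _)) !(linD (rr _)) !(linZ (rr _)) !(cyc_prl EP) !(cyc_prr EP).
  rewrite mulr0 !scale0r !addr0 (linD (ml _)) (linZ (ml _)) amulA.
  by rewrite !scalerDr !scalerA addrACA [c'.2 * c.2]mulrC.
- move=> x a e c; have [rr rl] := arb x.
  by rewrite /evR /= (linD (rr _)) (linZ (rr _)) (cyc_arb EP).
- move=> x a c f; have [rr rl] := lab x.
  by rewrite /evL /= (linD (rl _)) (linZ (rl _)) (cyc_lab EP).
- by move=> x e c; rewrite /evR /= (linD (grl x)) (linZ (grl x)) (cyc_gr_rb EP).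
- by move=> x c f; rewrite /evL /= (linD (gll x)) (linZ (gll x)) (cyc_gl_bl EP).
- by move=> x e c; rewrite /evR rtE /= (linD (@rtl x)) (linZ (@rtl x)) rt_rb.
- by move=> x c f; rewrite /evL ltE /= (linD (@ltl x)) (linZ (@ltl x)) lt_bl.
Qed.

End PathPush.

Section Perturbation.
Variables (R : realType) (G : groupoid) (A B : galg R G) (E : kkdata A B).
Local Notation C := R[i].
Variables (l0 l1 : forall x, lp E x -> lp E x) (r0 r1 : forall x, rp E x -> rp E x).
Hypotheses (HA : is_galg A) (HB : is_galg B).
Hypotheses (C0 : is_cycle (with_op l0 r0)) (C1 : is_cycle (with_op l1 r1)).
Hypothesis DC : forall a, sec A a -> locally_compact_op (E := E) (p := idfun)
  (fun x f => l1 (la f (a x)) - l0 (la f (a x))) (fun x e => ar (a x) (r1 e - r0 e)).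

Lemma perturbation_homotopic : homotopic (with_op l0 r0) (with_op l1 r1).
Proof.
have EP : is_pair E by case: (cyc_pair C0) => *; split.
split=> //; exists (path_kk EP (cyc_op C0) (cyc_op C1)); split.
- exact: path_cycle.
- eexists; eexists; apply: path_push => //.
  + move=> x f; transitivity (l0 (pval f (i0 R)) + (0 : R)%:C *: (l1 (pval f (i0 R)) - l0 (pval f (i0 R)))) => //.
    by rewrite rmorph0 scale0r addr0.
  + move=> x f; transitivity (r0 (pval f (i0 R)) + (0 : R)%:C *: (r1 (pval f (i0 R)) - r0 (pval f (i0 R)))) => //.
    by rewrite rmorph0 scale0r addr0.
  + by move=> x; exact: (odd_linl (F := with_op l0 r0) (cyc_op C0)).
  + by move=> x; exact: (odd_linr (F := with_op l0 r0) (cyc_op C0)).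
  + by move=> x; exact: (cyc_tl_bl (cyc_op C0)).
  + by move=> x; exact: (cyc_tr_rb (cyc_op C0)).
- eexists; eexists; apply: path_push => //.
  + move=> x f; transitivity (l0 (pval f (i1 R)) + (1 : R)%:C *: (l1 (pval f (i1 R)) - l0 (pval f (i1 R)))) => //.
    by rewrite rmorph1 scale1r addrC subrK.
  + move=> x f; transitivity (r0 (pval f (i1 R)) + (1 : R)%:C *: (r1 (pval f (i1 R)) - r0 (pval f (i1 R)))) => //.
    by rewrite rmorph1 scale1r addrC subrK.
  + by move=> x; exact: (odd_linl (F := with_op l1 r1) (cyc_op C1)).
  + by move=> x; exact: (odd_linr (F := with_op l1 r1) (cyc_op C1)).
  + by move=> x; exact: (cyc_tl_bl (cyc_op C1)).
  + by move=> x; exact: (cyc_tr_rb (cyc_op C1)).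
Qed.

End Perturbation.

(** * Isomorphisms *)

Section SpaceIso.
Variables (R : realType) (G : groupoid).
Local Notation C := R[i].

Record space_iso (E F : gspace R G) (u : forall x, E x -> F x) : Prop := {
  si_linear : forall x, linear (u x);
  si_norm : forall x e, `|u x e| = `|e|;
  si_onto : forall x f, exists e, u x e = f;
  si_sec : forall xi, sec F (fun x => u x (xi x)) <-> sec E xi;
  si_act : equivariant1 u }.
Arguments si_linear {E F u} _ x.
Arguments si_norm {E F u} _ x e.

Lemma space_iso_inj (E F : gspace R G) u x : @space_iso E F u -> injective (u x).
Proof.
move=> ui e f uef; apply/eqP; rewrite -subr_eq0 -normr_eq0 -(si_norm ui).
by rewrite (linB (si_linear ui x)) uef subrr normr0.
Qed.

Lemma space_iso_inv (E F : gspace R G) u : @space_iso E F u ->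
  exists v, [/\ @space_iso F E v, forall x, cancel (u x) (v x) & forall x, cancel (v x) (u x)].
Proof.
move=> ui; pose v x f := sval (cid (si_onto ui (x := x) f)).
have vK x : cancel (v x) (u x) by move=> f; rewrite /v; case: cid.
have uK x : cancel (u x) (v x) by move=> e; apply: (space_iso_inj ui); rewrite vK.
exists v; split=> //; split.
- by move=> x a f g; apply: (space_iso_inj ui); rewrite (si_linear ui x) !vK.
- by move=> x f; rewrite -(si_norm ui) vK.
- by move=> x e; exists (u x e); rewrite uK.
- move=> xi; rewrite -(si_sec ui).
  by have -> : (fun x => u x (v x (xi x))) = xi by apply: functional_extensionality_dep => x; rewrite vK.
- by move=> g x y hs hr f; apply: (space_iso_inj ui); rewrite -(si_act ui) !vK.
Qed.

Lemma space_iso_id (E : gspace R G) : @space_iso E E (fun=> id).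
Proof. by split=> // x f; exists f. Qed.

Lemma space_iso_comp (E F K : gspace R G) u v : @space_iso E F u -> @space_iso F K v ->
  @space_iso E K (fun x e => v x (u x e)).
Proof.
move=> ui vi; split.
- by move=> x a e f; rewrite (si_linear ui x) (si_linear vi x).
- by move=> x e; rewrite (si_norm vi) (si_norm ui).
- by move=> x k; have [f <-] := si_onto vi k; have [e <-] := si_onto ui f; exists e.
- by move=> xi; rewrite (si_sec vi (fun x => u x (xi x))) (si_sec ui).
- by move=> g x y hs hr e; rewrite (si_act vi) (si_act ui).
Qed.

Lemma space_iso_near (E F : gspace R G) u Z (S : set_system Z) (q : Z -> obj G) (zeta : forall z, E (q z)) :
  @space_iso E F u -> Filter S ->
  near_sec (E := F) S (q := q) (fun z => u (q z) (zeta z)) <-> near_sec (E := E) S (q := q) zeta.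
Proof.
move=> ui SF; have [v [vi uK vK]] := space_iso_inv ui; split=> h e e0.
  have [xi sxi n] := h e e0; exists (fun x => v x (xi x)).
    exact: (si_sec vi _).2 sxi.
  apply: filterS n => z; rewrite -(si_norm vi) (linB (si_linear vi _)) uK; exact.
have [xi sxi n] := h e e0; exists (fun x => u x (xi x)).
  exact: (si_sec ui _).2 sxi.
by apply: filterS n => z; rewrite -(si_norm ui) (linB (si_linear ui _)).
Qed.

Lemma space_iso_gspace (E F : gspace R G) u : @space_iso E F u -> is_gspace F -> is_gspace E.
Proof.
move=> ui [Fu Fa]; have [v [vi uK vK]] := space_iso_inv ui; split.
  split.
  - apply: (si_sec ui _).1; have -> : (fun x => u x 0) = fun=> 0 by
      apply: functional_extensionality_dep => x; rewrite (lin0 (si_linear ui x)).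
    exact: sec_zero Fu.
  - move=> a xi zeta /(si_sec ui) s /(si_sec ui) s'; apply: (si_sec ui _).1.
    have -> : (fun x => u x (a *: xi x + zeta x)) = fun x => a *: u x (xi x) + u x (zeta x)
      by apply: functional_extensionality_dep => x; rewrite (si_linear ui x).
    exact: sec_lin Fu _ _ _ s s'.
  - move=> x e d d0; have [xi sxi n] := sec_dense Fu (u x e) d0.
    exists (fun x => v x (xi x)); first exact: (si_sec vi _).2 sxi.
    by move: n; rewrite -(si_norm vi) (linB (si_linear vi _)) uK.
  - move=> xi /(si_sec ui) s x r xr.
    have := sec_usc Fu s (x := x) (r := r); rewrite (si_norm ui) => /(_ xr).
    by apply: filterS => y; rewrite (si_norm ui).
  - move=> xi h; apply: (si_sec ui _).1; apply/(sec_nearP _ Fu) => x.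
    exact: (space_iso_near (q := idfun) xi ui (nbhs_filter x)).2 (h x).
move=> xi /sec_pullP h; apply/sec_pullP => g; apply/(space_iso_near _ ui (nbhs_filter g)).
have k : sec (pull (@src G) F) (fun g => u (src g) (xi g)).
  by apply/sec_pullP => g'; apply/(space_iso_near _ ui (nbhs_filter g')).
have /sec_pullP/(_ g) := Fa _ k.
have -> // : (fun g => act erefl erefl (u (src g) (xi g))) = (fun g => u (rng g) (act erefl erefl (xi g)))
  by apply: functional_extensionality_dep => g'; rewrite (si_act ui).
Qed.

Lemma space_iso_bilinear (E F K E' F' K' : gspace R G) u v w m m' :
  @space_iso E E' u -> @space_iso F F' v -> @space_iso K K' w ->
  (forall x e f, w x (m x e f) = m' x (u x e) (v x f)) ->
  cont_bilinear E' F' K' m' -> cont_bilinear E F K m.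
Proof.
move=> ui vi wi wm mc; split.
- move=> x; have [mr ml] := cb_bilinear mc x.
  by split=> e a f f'; apply: (space_iso_inj wi);
    rewrite (si_linear wi x) !wm ?(si_linear ui x) ?(si_linear vi x) (mr, ml).
- move=> x; have [M n] := cb_bounded mc x; exists M; apply: filterS n => y h e f.
  by rewrite -(si_norm wi) wm -(si_norm ui) -(si_norm vi).
- move=> xi zeta /(si_sec ui) s /(si_sec vi) s'; apply: (si_sec wi _).1.
  have -> : (fun x => w x (m x (xi x) (zeta x))) = (fun x => m' x (u x (xi x)) (v x (zeta x))).
    by apply: functional_extensionality_dep => x.
  exact: (cb_sec mc s s').
Qed.

Lemma space_iso_contractive (E F K E' F' K' : gspace R G) u v w m m' :
  @space_iso E E' u -> @space_iso F F' v -> @space_iso K K' w ->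
  (forall x e f, w x (m x e f) = m' x (u x e) (v x f)) ->
  contractive E' F' K' m' -> contractive E F K m.
Proof.
move=> ui vi wi wm mc x e f.
by rewrite -(si_norm wi) wm -(si_norm ui) -(si_norm vi).
Qed.

Lemma space_iso_cont_linear (E F E' F' : gspace R G) u v m m' :
  @space_iso E E' u -> @space_iso F F' v ->
  (forall x e, v x (m x e) = m' x (u x e)) ->
  cont_linear E' F' m' -> cont_linear E F m.
Proof.
move=> ui vi vm mc; split.
- move=> x a e f; apply: (space_iso_inj vi).
  by rewrite (si_linear vi x) !vm (si_linear ui x) (cl_linear mc).
- move=> x; have [M n] := cl_bounded mc x; exists M; apply: filterS n => y h e.
  by rewrite -(si_norm vi) vm -(si_norm ui).
- move=> xi /(si_sec ui) s; apply: (si_sec vi _).1.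
  have -> : (fun x => v x (m x (xi x))) = (fun x => m' x (u x (xi x))).
    by apply: functional_extensionality_dep => x.
  exact: (cl_sec mc s).
Qed.

End SpaceIso.

Arguments si_linear {R G E F u} _ x.
Arguments si_norm {R G E F u} _ x e.

Section AlgIso.
Variables (R : realType) (G : groupoid).
Local Notation C := R[i].

Record alg_iso (A A' : galg R G) (i : forall x, A x -> A' x) : Prop := {
  ai_space : @space_iso R G A A' i;
  ai_mul : forall x a b, i x (amul a b) = amul (i x a) (i x b) }.

Lemma alg_iso_id (A : galg R G) : @alg_iso A A (fun=> id).
Proof. by split=> //; exact: space_iso_id. Qed.

Lemma alg_iso_inv (A A' : galg R G) i : @alg_iso A A' i ->
  exists j, [/\ @alg_iso A' A j, forall x, cancel (i x) (j x) & forall x, cancel (j x) (i x)].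
Proof.
move=> [h m]; have [j [ji iK jK]] := space_iso_inv h; exists j; split=> //.
by split=> // x a b; rewrite -[in LHS](jK x a) -[in LHS](jK x b) -m iK.
Qed.

Lemma alg_iso_galg (A A' : galg R G) i : @alg_iso A A' i -> is_galg A' -> is_galg A.
Proof.
move=> [h m] [HA' mc]; split; first exact: (space_iso_gspace h HA').
exact: (space_iso_bilinear (u := i) (v := i) (w := i)) m mc.
Qed.

Variables (A A' B B' : galg R G) (iA : forall x, A x -> A' x) (iB : forall x, B x -> B' x).

Section Over.
Variables (E : kkdata A B) (F : kkdata A' B') (ul : forall x, lp E x -> lp F x)
  (ur : forall x, rp E x -> rp F x).
Hypothesis uo : iso_over iA iB ul ur.

Lemma iso_over_spaces : space_iso ul /\ space_iso ur.
Proof. by case: uo => *; split; split. Qed.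

Hypotheses (hA : alg_iso iA) (hB : alg_iso iB).

Lemma iso_pair : is_pair F -> is_pair E.
Proof.
move=> FP; have [Ul Ur] := iso_over_spaces; have [HA mA] := hA; have [HB mB] := hB.
have ub := iso_bl uo; have uu := iso_rb uo; have up := iso_pr uo; have ua := iso_la uo; have uc := iso_ar uo; have ug := iso_gl uo; have ug' := iso_gr uo.
split.
- exact: (space_iso_gspace Ul (cyc_lp FP)).
- exact: (space_iso_gspace Ur (cyc_rp FP)).
- exact: (space_iso_bilinear HB Ul Ul (iso_bl uo) (cyc_bl FP)).
- exact: (space_iso_bilinear Ur HB Ur (iso_rb uo) (cyc_rb FP)).
- exact: (space_iso_bilinear Ul Ur HB (iso_pr uo) (cyc_pr FP)).
- exact: (space_iso_bilinear Ul HA Ul (iso_la uo) (cyc_la FP)).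
- exact: (space_iso_bilinear HA Ur Ur (iso_ar uo) (cyc_ar FP)).
- exact: (space_iso_contractive HB Ul Ul (iso_bl uo) (cyc_bl_contr FP)).
- exact: (space_iso_contractive Ur HB Ur (iso_rb uo) (cyc_rb_contr FP)).
- exact: (space_iso_contractive Ul Ur HB (iso_pr uo) (cyc_pr_contr FP)).
- exact: (space_iso_contractive Ul HA Ul (iso_la uo) (cyc_la_contr FP)).
- exact: (space_iso_contractive HA Ur Ur (iso_ar uo) (cyc_ar_contr FP)).
- by move=> *; apply: (space_iso_inj Ul); rewrite !ub mB (cyc_blA FP).
- by move=> *; apply: (space_iso_inj Ur); rewrite !uu mB (cyc_rbA FP).
- by move=> *; apply: (space_iso_inj Ul); rewrite !ua mA (cyc_laA FP).
- by move=> *; apply: (space_iso_inj Ur); rewrite !uc mA (cyc_arA FP).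
- by move=> *; apply: (space_iso_inj HB); rewrite mB !up ub (cyc_prl FP).
- by move=> *; apply: (space_iso_inj HB); rewrite mB !up uu (cyc_prr FP).
- by move=> *; apply: (space_iso_inj HB); rewrite !up ua uc (cyc_pra FP).
- by move=> *; apply: (space_iso_inj Ul); rewrite !(ua, ub) (cyc_lab FP).
- by move=> *; apply: (space_iso_inj Ur); rewrite !(uc, uu) (cyc_arb FP).
- move=> x f e e0; have [n [b [f' h]]] := cyc_nondeg_l FP (ul f) e0.
  pose b' i := sval (cid (si_onto HB (b i))); pose f'' i := sval (cid (si_onto Ul (f' i))).
  exists n, b', f''; rewrite -(si_norm Ul) (linB (si_linear Ul x)) (lin_sum _ _ _ (si_linear Ul x)).
  have -> // : \sum_(i < n) ul (bl (b' i) (f'' i)) = \sum_(i < n) bl (b i) (f' i).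
  by apply: eq_bigr => i _; rewrite ub /b' /f''; case: cid => ? /= ->; case: cid => ? /= ->.
- move=> x f e e0; have [n [f' [b h]]] := cyc_nondeg_r FP (ur f) e0.
  pose b' i := sval (cid (si_onto HB (b i))); pose f'' i := sval (cid (si_onto Ur (f' i))).
  exists n, f'', b'; rewrite -(si_norm Ur) (linB (si_linear Ur x)) (lin_sum _ _ _ (si_linear Ur x)).
  have -> // : \sum_(i < n) ur (rb (f'' i) (b' i)) = \sum_(i < n) rb (f' i) (b i).
  by apply: eq_bigr => i _; rewrite uu /b' /f''; case: cid => ? /= ->; case: cid => ? /= ->.
- exact: (space_iso_cont_linear Ul Ul ug (cyc_gl FP)).
- exact: (space_iso_cont_linear Ur Ur ug' (cyc_gr FP)).
- by move=> x f; apply: (space_iso_inj Ul); rewrite !ug (cyc_glK FP).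
- by move=> x f; apply: (space_iso_inj Ur); rewrite !ug' (cyc_grK FP).
- by move=> x f; rewrite -(si_norm Ul) ug (cyc_gl_norm FP) (si_norm Ul).
- by move=> x f; rewrite -(si_norm Ur) ug' (cyc_gr_norm FP) (si_norm Ur).
- by move=> *; apply: (space_iso_inj Ul); rewrite !(ug, ub) (cyc_gl_bl FP).
- by move=> *; apply: (space_iso_inj Ur); rewrite !(ug', uu) (cyc_gr_rb FP).
- by move=> *; apply: (space_iso_inj HB); rewrite !up ug ug' (cyc_g_pr FP).
- by move=> *; apply: (space_iso_inj Ul); rewrite !(ug, ua) (cyc_gl_la FP).
- by move=> *; apply: (space_iso_inj Ur); rewrite !(ug', uc) (cyc_gr_ar FP).
Qed.

Lemma iso_odd : is_odd_operator F -> is_odd_operator E.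
Proof.
move=> FO; have [Ul Ur] := iso_over_spaces; have [HA mA] := hA; have [HB mB] := hB.
have ub := iso_bl uo; have uu := iso_rb uo; have up := iso_pr uo; have ug := iso_gl uo; have ug' := iso_gr uo; have ut := iso_tl uo; have ut' := iso_tr uo.
split.
- exact: (space_iso_cont_linear Ul Ul ut (cyc_tl FO)).
- exact: (space_iso_cont_linear Ur Ur ut' (cyc_tr FO)).
- have [M MP] := cyc_t_bounded FO; exists M => x; split=> f.
    by rewrite -(si_norm Ul) -(si_norm Ul _ f) ut; exact: (MP x).1.
  by rewrite -(si_norm Ur) -(si_norm Ur _ f) ut'; exact: (MP x).2.
- by move=> *; apply: (space_iso_inj Ul); rewrite !(ut, ub) (cyc_tl_bl FO).
- by move=> *; apply: (space_iso_inj Ur); rewrite !(ut', uu) (cyc_tr_rb FO).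
- by move=> *; apply: (space_iso_inj HB); rewrite !up ut ut' (cyc_t_pr FO).
- by move=> x f; apply: (space_iso_inj Ul); rewrite (linN (si_linear Ul x)) !(ug, ut) (cyc_tl_odd FO).
- by move=> x f; apply: (space_iso_inj Ur); rewrite (linN (si_linear Ur x)) !(ug', ut') (cyc_tr_odd FO).
Qed.

Lemma iso_near_compact Z (S : set_system Z) (q : Z -> obj G)
    (Sl : forall z, lp E (q z) -> lp E (q z)) (Sr : forall z, rp E (q z) -> rp E (q z))
    (Sl' : forall z, lp F (q z) -> lp F (q z)) (Sr' : forall z, rp F (q z) -> rp F (q z)) :
  Filter S -> (forall z f, ul (Sl z f) = Sl' z (ul f)) -> (forall z f, ur (Sr z f) = Sr' z (ur f)) ->
  near_compact S (E := F) Sl' Sr' -> near_compact S (E := E) Sl Sr.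
Proof.
move=> SF Eul Eur h e e0; have [Ul Ur] := iso_over_spaces.
have [vl [Vl ulK vlK]] := space_iso_inv Ul; have [vr [Vr urK vrK]] := space_iso_inv Ur.
have [s sP n] := h e e0.
exists [seq ((fun x => vr x (p.1 x)), (fun x => vl x (p.2 x))) | p <- s].
  apply/List.Forall_map; apply: List.Forall_impl sP => p [s1 s2].
  by split; [exact: (si_sec Vr _).2 s1|exact: (si_sec Vl _).2 s2].
apply: filterS n => z [h1 h2]; split=> v; rewrite big_map.
  rewrite -(si_norm Ur) (linB (si_linear Ur _)) (lin_sum _ _ _ (si_linear Ur _)) Eur -(si_norm Ur _ v).
  have -> // : \sum_(p <- s) ur (rankr (vr (q z) (p.1 (q z))) (vl (q z) (p.2 (q z))) v) =
    \sum_(p <- s) rankr (p.1 (q z)) (p.2 (q z)) (ur v).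
  by apply: eq_bigr => p _; rewrite /rankr (iso_rb uo) (iso_pr uo) vrK vlK.
rewrite -(si_norm Ul) (linB (si_linear Ul _)) (lin_sum _ _ _ (si_linear Ul _)) Eul -(si_norm Ul _ v).
have -> // : \sum_(p <- s) ul (rankl (vr (q z) (p.1 (q z))) (vl (q z) (p.2 (q z))) v) =
  \sum_(p <- s) rankl (p.1 (q z)) (p.2 (q z)) (ul v).
by apply: eq_bigr => p _; rewrite /rankl (iso_bl uo) (iso_pr uo) vrK vlK.
Qed.

Lemma iso_cycle : is_cycle F -> is_cycle E.
Proof.
move=> FC; have FP := cyc_pair FC; have EP := iso_pair FP.
have [Ul Ur] := iso_over_spaces; have [HA mA] := hA.
have ua := iso_la uo; have uc := iso_ar uo; have ut := iso_tl uo; have ut' := iso_tr uo.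
have idc : continuous (@idfun (obj G)) by move=> x; exact: cvg_id.
split=> //.
- exact: iso_odd (cyc_op FC).
- move=> a sa; apply/(locally_compact_opP _ _ EP idc) => x.
  have h := (locally_compact_opP _ _ FP idc).1 (cyc_commutator FC ((si_sec HA a).2 sa)) x.
  apply: (iso_near_compact (nbhs_filter x) _ _ h) => z f /=.
    by rewrite (linB (si_linear Ul _)) !(ut, ua).
  by rewrite (linB (si_linear Ur _)) !(ut', uc).
- move=> a sa; apply/(locally_compact_opP _ _ EP idc) => x.
  have h := (locally_compact_opP _ _ FP idc).1 (cyc_square FC ((si_sec HA a).2 sa)) x.
  apply: (iso_near_compact (nbhs_filter x) _ _ h) => z f /=.
    by rewrite (linB (si_linear Ul _)) !(ut, ua).
  by rewrite uc (linB (si_linear Ur _)) !(ut', uc).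
- move=> a sa; apply/(locally_compact_opP _ _ EP (@rng_cts G)) => x.
  have sa' : sec (pull (@rng G) A') (fun g => iA (a g)).
    by move/sec_pullP : sa => sa; apply/sec_pullP => g; apply/(space_iso_near _ HA (nbhs_filter g)).
  have h := (locally_compact_opP _ _ FP (@rng_cts G)).1 (cyc_equivariance FC sa') x.
  apply: (iso_near_compact (nbhs_filter x) _ _ h) => z f /=.
    by rewrite (linB (si_linear Ul _)) /conj_act -(si_act Ul) !ut -(si_act Ul) !ua.
  by rewrite uc (linB (si_linear Ur _)) /conj_act -(si_act Ur) !ut' -(si_act Ur).
Qed.

End Over.
End AlgIso.

(** * Projective tensor products and push-forwards under isomorphism *)

Section TensorIso.
Variable R : realType.
Local Notation C := R[i].

Record isometry (U V : normedModType C) (f : U -> V) : Prop := {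
  im_linear : linear f;
  im_norm : forall u, `|f u| = `|u|;
  im_onto : forall v, exists u, f u = v }.

Lemma isometry_inv (U V : normedModType C) (f : U -> V) : isometry f ->
  exists g, [/\ isometry g, cancel f g & cancel g f].
Proof.
move=> [fl fn fo]; pose g v := sval (cid (fo v)).
have gK : cancel g f by move=> v; rewrite /g; case: cid.
have fi : injective f.
  by move=> u u' uu; apply/eqP; rewrite -subr_eq0 -normr_eq0 -fn (linB fl) uu subrr normr0.
have fK : cancel f g by move=> u; apply: fi; rewrite gK.
exists g; split=> //; split.
- by move=> a u v; apply: fi; rewrite fl !gK.
- by move=> v; rewrite -fn gK.
- by move=> u; exists (f u); rewrite fK.
Qed.

(** Of [d] only surjectivity is asked: the scalars enter through balancedness alone. *)
Lemma tensor_iso (D D' : Type) (U V U' V' : normedModType C) (ru : U -> D -> U) (lv : D -> V -> V)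
    (ru' : U' -> D' -> U') (lv' : D' -> V' -> V') (X X' : completeNormedModType C)
    (t : U -> V -> X) (t' : U' -> V' -> X') (a : U -> U') (b : V -> V') (c : X -> X') (d : D -> D') :
  isometry a -> isometry b -> isometry c -> (forall z, exists y, d y = z) ->
  (forall u z, a (ru u z) = ru' (a u) (d z)) -> (forall z v, b (lv z v) = lv' (d z) (b v)) ->
  (forall u v, c (t u v) = t' (a u) (b v)) ->
  is_projective_tensor ru' lv' t' -> is_projective_tensor ru lv t.
Proof.
move=> ai bi ci donto ar bl ct [[[tr tl] tM tbal] univ].
have [a' [a'i aK a'K]] := isometry_inv ai; have [b' [b'i bK b'K]] := isometry_inv bi.
have [c' [c'i cK c'K]] := isometry_inv ci.
have tE u v : t u v = c' (t' (a u) (b v)) by rewrite -ct cK.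
split.
  split.
  - by split=> u e v w; rewrite !tE ((im_linear ai) , (im_linear bi)) (tr, tl) (im_linear c'i).
  - by move=> u v; rewrite tE (im_norm c'i) -(im_norm ai u) -(im_norm bi v).
  - by move=> u z v; rewrite !tE ar bl tbal.
move=> W m M M0 [[mr ml] mM mbal].
have mb : bounded_balanced ru' lv' M (fun u v => m (a' u) (b' v)).
  split.
  - by split=> u e v w; rewrite ((im_linear a'i) , (im_linear b'i)) (mr, ml).
  - by move=> u v; rewrite -(im_norm a'i u) -(im_norm b'i v).
  - move=> u z v; have [z' <-] := donto z.
    by rewrite -{1}(a'K u) -ar aK mbal -{2}(b'K v) -bl bK.
have [l [[l1 l2 l3] lu]] := univ W _ M M0 mb.
exists (fun x => l (c x)); split; first split.
- by move=> e u v; rewrite (im_linear ci) l1.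
- by move=> z; rewrite -(im_norm ci).
- by move=> u v; rewrite ct l3 aK bK.
move=> l' [k1 k2 k3]; have /(congr1 (fun h => h \o c)) : l = fun x => l' (c' x).
  apply: lu; split.
  - by move=> e u v; rewrite (im_linear c'i) k1.
  - by move=> z; rewrite -(im_norm c'i).
  - by move=> u v; rewrite -{1}(a'K u) -{1}(b'K v) -ct cK k3.
by move=> /= lE; apply/funext => x; move: (congr1 (fun h => h x) lE) => /= ->; rewrite cK.
Qed.

End TensorIso.

Section PushIso.
Variables (R : realType) (G : groupoid).
Local Notation C := R[i].

Lemma space_iso_isometry (E F : gspace R G) u x : @space_iso R G E F u -> isometry (u x).
Proof. by move=> ui; split; [exact: (si_linear ui)|exact: (si_norm ui)|exact: (si_onto ui)]. Qed.

(** The generators in [push_secR] and, with the factors exchanged, in [push_secL]. *)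
Definition tensor_sections (E F : gspace R G) (B : galg R G)
    (t : forall x, E x -> unitization B x -> F x) : set (forall x, F x) :=
  [set zeta | exists n,
    exists2 xi : 'I_n -> forall x, E x, (forall i, sec E (xi i)) &
    exists2 beta : 'I_n -> forall x, unitization B x, (forall i, @usec _ _ B (beta i)) &
    zeta = fun x => \sum_(i < n) t x (xi i x) (beta i x)].

Definition umap (B B1 : galg R G) (j : forall x, B x -> B1 x) x (c : unitization B x) :
  unitization B1 x := (j x c.1, c.2).

Lemma umap_isometry (B B1 : galg R G) (j : forall x, B x -> B1 x) x : space_iso j -> isometry (@umap B B1 j x).
Proof.
move=> ji; split.
- by move=> a [b z] [b' z']; congr pair; exact: (si_linear ji).
- by move=> [b z]; rewrite !l1sum_normE /= (si_norm ji).
- by move=> [b z]; have [b' <-] := si_onto ji b; exists (b', z).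
Qed.

Lemma tensor_sections_iso (E E1 F F1 : gspace R G) (B B1 : galg R G) u v j
    (t : forall x, E x -> unitization B x -> F x) (t1 : forall x, E1 x -> unitization B1 x -> F1 x) :
  @space_iso R G E E1 u -> @space_iso R G F F1 v -> @space_iso R G B B1 j ->
  (forall x e c, v x (t x e c) = t1 x (u x e) (@umap B B1 j x c)) ->
  sec F1 = Defs.approx (tensor_sections t1) -> sec F = Defs.approx (tensor_sections t).
Proof.
move=> ui vi ji vt F1E; have [u' [u'i uK u'K]] := space_iso_inv ui.
have [j' [j'i jK j'K]] := space_iso_inv ji.
have ts zeta : tensor_sections t zeta -> tensor_sections t1 (fun x => v x (zeta x)).
  move=> [n [xi sxi [beta sb ->]]]; exists n, (fun i x => u x (xi i x)).
    by move=> i; exact: (si_sec ui _).2 (sxi i).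
  exists (fun i x => umap j (beta i x)).
    by move=> i; have [s1 s2] := sb i; split=> //; exact: (si_sec ji _).2 s1.
  apply: functional_extensionality_dep => x; rewrite (lin_sum _ _ _ (si_linear vi x)).
  by apply: eq_bigr => i _; rewrite vt.
have ts' zeta : tensor_sections t1 zeta -> exists2 zeta', tensor_sections t zeta' &
    forall x, v x (zeta' x) = zeta x.
  move=> [n [xi sxi [beta sb ->]]].
  exists (fun x => \sum_(i < n) t x (u' x (xi i x)) (umap j' (beta i x))).
    exists n, (fun i x => u' x (xi i x)).
      by move=> i; exact: (si_sec u'i _).2 (sxi i).
    exists (fun i x => umap j' (beta i x)) => //.
    by move=> i; have [s1 s2] := sb i; split=> //; exact: (si_sec j'i _).2 s1.
  move=> x; rewrite (lin_sum _ _ _ (si_linear vi x)); apply: eq_bigr => i _.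
  by rewrite vt u'K /umap /= j'K; case: (beta i x).
apply/seteqP; split=> xi.
  move=> /(si_sec vi); rewrite F1E => h x e e0.
  have [zeta /ts'[zeta' sz zE] n] := h x e e0; exists zeta' => //.
  by apply: filterS n => y; rewrite -(si_norm vi) (linB (si_linear vi y)) zE.
move=> h; apply: (si_sec vi _).1; rewrite F1E => x e e0.
have [zeta /ts sz n] := h x e e0; exists (fun x => v x (zeta x)) => //.
by apply: filterS n => y; rewrite -(si_norm vi) (linB (si_linear vi y)).
Qed.

Variables (A A1 B B1 B' B1' : galg R G) (iA : forall x, A x -> A1 x) (iB : forall x, B x -> B1 x)
  (jB : forall x, B' x -> B1' x) (psi : forall x, B x -> B' x) (psi1 : forall x, B1 x -> B1' x).
Hypotheses (hA : alg_iso iA) (hB : alg_iso iB) (hj : alg_iso jB).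
Hypothesis psiE : forall x b, psi1 (iB b) = jB (psi b) :> B1' x.
Variables (P : kkdata A B) (P1 : kkdata A1 B1) (F : kkdata A B') (F1 : kkdata A1 B1').
Variables (ul : forall x, lp P x -> lp P1 x) (ur : forall x, rp P x -> rp P1 x)
  (vl : forall x, lp F x -> lp F1 x) (vr : forall x, rp F x -> rp F1 x).
Hypotheses (uo : iso_over iA iB ul ur) (vo : iso_over iA jB vl vr).

Lemma push_iso : is_pushforward psi1 P1 F1 -> is_pushforward psi P F.
Proof.
move=> [t1R [t1L p]]; have [Ul Ur] := iso_over_spaces uo; have [Vl Vr] := iso_over_spaces vo.
have [HA mA] := hA; have [HB mB] := hB; have [Hj mj] := hj.
have [wl [Wl vlK wlK]] := space_iso_inv Vl; have [wr [Wr vrK wrK]] := space_iso_inv Vr.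
pose tR x (e : rp P x) (c : unitization B' x) : rp F x := wr x (t1R x (ur e) (umap jB c)).
pose tL x (c : unitization B' x) (f : lp P x) : lp F x := wl x (t1L x (umap jB c) (ul f)).
have tRE x e c : vr (tR x e c) = t1R x (ur e) (umap jB c) by rewrite /tR wrK.
have tLE x c f : vl (tL x c f) = t1L x (umap jB c) (ul f) by rewrite /tL wlK.
have onto_u x (d1 : unitization B1 x) : exists d, umap iB d = d1 by exact: im_onto (umap_isometry x HB) d1.
have um x c d : umap jB (umul c d) = @umul _ _ _ x (umap jB c) (umap jB d).
  by congr pair; rewrite /= !(linD (si_linear Hj x)) !(linZ (si_linear Hj x)) mj.
have up x b : umap jB (upsi psi b) = @upsi _ _ _ _ psi1 x (umap iB b) by rewrite /umap /upsi /= psiE.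
have ui x b : umap jB (uincl b) = @uincl _ _ _ x (jB b) by [].
have uj x : injective (@umap _ _ jB x).
  by move=> [b z] [b' z'] [] /(space_iso_inj Hj) -> ->.
exists tR, tL; split.
- move=> x; apply: (tensor_iso (space_iso_isometry x Ur) (umap_isometry x Hj) (space_iso_isometry x Vr)
    (onto_u x) _ _ _ (push_tR p x)) => [e b|d c|]; last exact: tRE.
    by rewrite /urb (linD (si_linear Ur x)) (linZ (si_linear Ur x)) (iso_rb uo).
  by rewrite um up.
- move=> x; apply: (tensor_iso (umap_isometry x Hj) (space_iso_isometry x Ul) (space_iso_isometry x Vl)
    (onto_u x) _ _ _ (push_tL p x)) => [d c|b f|]; last exact: tLE.
    by rewrite um up.
  by rewrite /ubl (linD (si_linear Ul x)) (linZ (si_linear Ul x)) (iso_bl uo).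
- exact: (tensor_sections_iso Ur Vr Hj tRE (push_secR p)).
- exact: (tensor_sections_iso (t := fun x f c => tL x c f) (t1 := fun x f c => t1L x c f) Ul Vl Hj
    (fun x f c => tLE x c f) (push_secL p)).
- move=> g x y hs hr e c; apply: (space_iso_inj Vr).
  by rewrite -(si_act Vr) !tRE (push_actR p) -(si_act Ur) /umap /uact /= (si_act Hj).
- move=> g x y hs hr c f; apply: (space_iso_inj Vl).
  by rewrite -(si_act Vl) !tLE (push_actL p) -(si_act Ul) /umap /uact /= (si_act Hj).
- by move=> x e c b; apply: (space_iso_inj Vr); rewrite (iso_rb vo) !tRE (push_rb p) um ui.
- by move=> x c f b; apply: (space_iso_inj Vl); rewrite (iso_bl vo) !tLE (push_bl p) um ui.
- move=> x c f e c'; apply: uj.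
  by rewrite !um ui (iso_pr vo) tRE tLE (push_pr p) ui -(iso_pr uo) psiE.
- by move=> x a e c; apply: (space_iso_inj Vr); rewrite (iso_ar vo) !tRE (push_ar p) (iso_ar uo).
- by move=> x a c f; apply: (space_iso_inj Vl); rewrite (iso_la vo) !tLE (push_la p) (iso_la uo).
- by move=> x e c; apply: (space_iso_inj Vr); rewrite (iso_gr vo) !tRE (push_gr p) (iso_gr uo).
- by move=> x c f; apply: (space_iso_inj Vl); rewrite (iso_gl vo) !tLE (push_gl p) (iso_gl uo).
- by move=> x e c; apply: (space_iso_inj Vr); rewrite (iso_tr vo) !tRE (push_tr p) (iso_tr uo).
- by move=> x c f; apply: (space_iso_inj Vl); rewrite (iso_tl vo) !tLE (push_tl p) (iso_tl uo).
Qed.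

End PushIso.

Section IsoCategory.
Variables (R : realType) (G : groupoid).
Local Notation C := R[i].

Lemma iso_over_id (A B : galg R G) (E : kkdata A B) :
  @iso_over _ _ _ _ _ _ (fun=> id) (fun=> id) E E (fun=> id) (fun=> id).
Proof. by split=> // x f; exists f. Qed.

Lemma iso_over_comp (A A' A'' B B' B'' : galg R G) (iA : forall x, A x -> A' x) (iB : forall x, B x -> B' x)
    (iA' : forall x, A' x -> A'' x) (iB' : forall x, B' x -> B'' x)
    (E : kkdata A B) (F : kkdata A' B') (K : kkdata A'' B'') ul ur vl vr :
  @iso_over _ _ _ _ _ _ iA iB E F ul ur -> @iso_over _ _ _ _ _ _ iA' iB' F K vl vr ->
  @iso_over _ _ _ _ _ _ (fun x a => iA' x (iA x a)) (fun x b => iB' x (iB x b)) E K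
    (fun x f => vl x (ul x f)) (fun x e => vr x (ur x e)).
Proof.
move=> uo vo; have [Ul Ur] := iso_over_spaces uo; have [Vl Vr] := iso_over_spaces vo.
have [Wl Wr] := (space_iso_comp Ul Vl, space_iso_comp Ur Vr).
split; [exact: (si_linear Wl)|exact: (si_linear Wr)|exact: (si_norm Wl)|exact: (si_norm Wr)|exact: (si_onto Wl)
  |exact: (si_onto Wr)|exact: (si_sec Wl)|exact: (si_sec Wr)|exact: (si_act Wl)|exact: (si_act Wr)| | | | | | | | |].
- by move=> *; rewrite (iso_bl uo) (iso_bl vo).
- by move=> *; rewrite (iso_rb uo) (iso_rb vo).
- by move=> *; rewrite (iso_pr uo) (iso_pr vo).
- by move=> *; rewrite (iso_la uo) (iso_la vo).
- by move=> *; rewrite (iso_ar uo) (iso_ar vo).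
- by move=> *; rewrite (iso_gl uo) (iso_gl vo).
- by move=> *; rewrite (iso_gr uo) (iso_gr vo).
- by move=> *; rewrite (iso_tl uo) (iso_tl vo).
- by move=> *; rewrite (iso_tr uo) (iso_tr vo).
Qed.

Variables (A A' B B' : galg R G) (iA : forall x, A x -> A' x) (iB : forall x, B x -> B' x)
  (jA : forall x, A' x -> A x) (jB : forall x, B' x -> B x).
Hypotheses (hA : alg_iso iA) (hB : alg_iso iB).

Lemma iso_over_inv (E : kkdata A B) (F : kkdata A' B') ul ur :
  (forall x, cancel (@jA x) (@iA x)) -> (forall x, cancel (@jB x) (@iB x)) ->
  @iso_over _ _ _ _ _ _ iA iB E F ul ur ->
  exists vl vr, @iso_over _ _ _ _ _ _ jA jB F E vl vr.
Proof.
move=> jAK jBK uo; have [Ul Ur] := iso_over_spaces uo; have [HB mB] := hB.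
have [vl [Vl ulK vlK]] := space_iso_inv Ul; have [vr [Vr urK vrK]] := space_iso_inv Ur.
exists vl, vr.
split; [exact: (si_linear Vl)|exact: (si_linear Vr)|exact: (si_norm Vl)|exact: (si_norm Vr)|exact: (si_onto Vl)
  |exact: (si_onto Vr)|exact: (si_sec Vl)|exact: (si_sec Vr)|exact: (si_act Vl)|exact: (si_act Vr)| | | | | | | | |].
- by move=> *; apply: (space_iso_inj Ul); rewrite (iso_bl uo) !vlK jBK.
- by move=> *; apply: (space_iso_inj Ur); rewrite (iso_rb uo) !vrK jBK.
- by move=> *; apply: (space_iso_inj HB); rewrite (iso_pr uo) vlK vrK jBK.
- by move=> *; apply: (space_iso_inj Ul); rewrite (iso_la uo) !vlK jAK.
- by move=> *; apply: (space_iso_inj Ur); rewrite (iso_ar uo) !vrK jAK.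
- by move=> *; apply: (space_iso_inj Ul); rewrite (iso_gl uo) !vlK.
- by move=> *; apply: (space_iso_inj Ur); rewrite (iso_gr uo) !vrK.
- by move=> *; apply: (space_iso_inj Ul); rewrite (iso_tl uo) !vlK.
- by move=> *; apply: (space_iso_inj Ur); rewrite (iso_tr uo) !vrK.
Qed.

(** Restriction of scalars: spaces, gradings and operator of [F] are kept, the actions are composed
    with [iA] and [iB], and the pairing with the inverse of [iB]. *)
Lemma iso_over_restr (F : kkdata A' B') : exists (E : kkdata A B) ul ur,
  @iso_over _ _ _ _ _ _ iA iB E F ul ur.
Proof.
have [HA _] := hA; have [HB _] := hB; have [kB [KB iBK kBK]] := space_iso_inv HB.
pose bl' x (b : B x) (f : lp F x) := bl (iB b) f.
pose rb' x (e : rp F x) (b : B x) := rb e (iB b).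
pose pr' x (f : lp F x) (e : rp F x) := kB x (pr f e).
pose la' x (f : lp F x) (a : A x) := la f (iA a).
pose ar' x (a : A x) (e : rp F x) := ar (iA a) e.
have e1 : @equivariant2 R G B (lp F) (lp F) bl'.
  by move=> g x y hs hr b f; rewrite /bl' bl_eq (si_act HB).
have e2 : @equivariant2 R G (rp F) B (rp F) rb'.
  by move=> g x y hs hr e b; rewrite /rb' rb_eq (si_act HB).
have e3 : @equivariant2 R G (lp F) (rp F) B pr'.
  by move=> g x y hs hr f e; rewrite /pr' (si_act KB) pr_eq.
have e4 : @equivariant2 R G (lp F) A (lp F) la'.
  by move=> g x y hs hr b f; rewrite /la' la_eq (si_act HA).
have e5 : @equivariant2 R G A (rp F) (rp F) ar'.
  by move=> g x y hs hr e b; rewrite /ar' ar_eq (si_act HA).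
exists (KKData (@tl _ _ _ _ F) (@tr _ _ _ _ F) e1 e2 e3 e4 e5 (@gl_eq _ _ _ _ F) (@gr_eq _ _ _ _ F)).
exists (fun=> id), (fun=> id); split=> //=.
- by move=> x f; exists f.
- by move=> x f; exists f.
- by move=> x f e; rewrite /pr' kBK.
Qed.

End IsoCategory.

Section PathIso.
Variables (R : realType) (G : groupoid) (B B1 : galg R G) (i : forall x, B x -> B1 x).
Local Notation C := R[i].
Hypothesis (hi : alg_iso i).

Fact path_map_cts x (f : path_alg B x) : continuous (fun t => i (pval f t)).
Proof.
have [hs _] := hi; apply/continuous_distP => t e e0.
have /continuous_distP/(_ t _ e0) := @pvalP _ _ f; apply: filterS => s.
by rewrite -(linB (si_linear hs x)) (si_norm hs).
Qed.

Definition path_map x (f : path_alg B x) : path_alg B1 x := mkpath (@path_map_cts x f).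

Lemma path_map_iso : alg_iso path_map.
Proof.
have [hs hm] := hi; have [j [hj iK jK]] := space_iso_inv hs; split.
  split.
  - by move=> x a f f'; apply: cpath_ext => t; exact: (si_linear hs).
  - move=> x f; rewrite !cpath_normE /path_norm /path_norms; congr ((sup _)%:C).
    by apply: eq_imagel => t _ /=; rewrite (si_norm hs).
  - move=> x f.
    have fc : continuous (fun t => j x (pval f t)).
      apply/continuous_distP => t e e0.
      have /continuous_distP/(_ t _ e0) := @pvalP _ _ f; apply: filterS => s.
      by rewrite -(linB (si_linear hj x)) (si_norm hj).
    by exists (mkpath fc); apply: cpath_ext => t; exact: jK.
  - move=> xi; rewrite !path_secP; split=> h x t.
      exact: (space_iso_near _ hs (nbhs_filter (x, t))).1 (h x t).
    exact: (space_iso_near _ hs (nbhs_filter (x, t))).2 (h x t).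
  - by move=> g x y hs' hr f; apply: cpath_ext => t; exact: (si_act hs).
by move=> x f f'; apply: cpath_ext => t; exact: hm.
Qed.

End PathIso.

Section Transport.
Variables (R : realType) (G : groupoid) (A A1 B B1 : galg R G).
Variables (iA : forall x, A x -> A1 x) (iB : forall x, B x -> B1 x).
Hypotheses (hA : alg_iso iA) (hB : alg_iso iB).

Definition iso_pair_over (E : kkdata A B) (F : kkdata A1 B1) : Prop :=
  exists ul ur, @iso_over _ _ _ _ _ _ iA iB E F ul ur.

(** The connecting cycle over [B1[0,1]] is restricted along the isomorphism [B[0,1] -> B1[0,1]]
    induced by [iB]; its push-forwards correspond by [push_iso]. *)
Lemma homotopic_transport (D0 D1 : kkdata A B) (E0 E1 : kkdata A1 B1) :
  iso_pair_over D0 E0 -> iso_pair_over D1 E1 -> homotopic E0 E1 -> homotopic D0 D1.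
Proof.
move=> [ul [ur uo]] [vl [vr vo]] [C0 C1 [P1 [P1C p0 p1]]]; split.
- exact: iso_cycle uo hA hB C0.
- exact: iso_cycle vo hA hB C1.
have [P [wl [wr wo]]] := iso_over_restr hA (path_map_iso hB) P1.
exists P; split; first exact: iso_cycle wo hA (path_map_iso hB) P1C.
  exact: (push_iso hA (path_map_iso hB) hB _ wo uo p0).
exact: (push_iso hA (path_map_iso hB) hB _ wo vo p1).
Qed.

End Transport.

(** * Isomorphic cycles and homotopy classes *)

Section IsoHomotopic.
Variables (R : realType) (G : groupoid) (A B : galg R G).
Hypotheses (HA : is_galg A) (HB : is_galg B).

(** [F] is isomorphic to [E] only after a perturbation of the operator; the straight line is
    followed by the isomorphism. In this form [E] is compared with [(Om^-1)^* Om^* E]. *)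
Lemma near_iso_homotopic (E F : kkdata A B) l r ul ur : is_cycle E -> is_cycle F ->
  @iso_over _ _ _ _ _ _ (fun=> id) (fun=> id) (@with_op _ _ _ _ E l r) F ul ur ->
  (forall a, sec A a -> locally_compact_op (E := E) (p := idfun)
    (fun x f => l x (la f (a x)) - tl (la f (a x))) (fun x e => ar (a x) (r x e - tr e))) ->
  homotopic E F.
Proof.
move=> CE CF uo DC; have hA := alg_iso_id A; have hB := alg_iso_id B.
have C1 : is_cycle (with_op l r) := iso_cycle uo hA hB CF.
have C0 : is_cycle (with_op (@tl _ _ _ _ E) (@tr _ _ _ _ E)) by rewrite with_op_id.
have := perturbation_homotopic HA HB C0 C1 DC; rewrite with_op_id.
have [vl [vr vo]] := iso_over_inv hB (fun=> frefl _) (fun=> frefl _) uo.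
apply: (homotopic_transport hA hB); last by exists vl, vr.
by exists (fun=> id), (fun=> id); exact: iso_over_id.
Qed.

(** Push-forwards are determined up to isomorphism only, so the constant homotopy on [E] also ends
    at [F]. *)
Lemma iso_homotopic (E F : kkdata A B) ul ur : is_cycle F ->
  @iso_over _ _ _ _ _ _ (fun=> id) (fun=> id) E F ul ur -> homotopic E F.
Proof.
move=> CF uo; have CE : is_cycle E := iso_cycle uo (alg_iso_id A) (alg_iso_id B) CF.
have EP := cyc_pair CE.
apply: (@near_iso_homotopic E F (@tl _ _ _ _ E) (@tr _ _ _ _ E) ul ur) => //; first by case: uo => *; split.
move=> a sa; have idc : continuous (@idfun (obj G)) by move=> x; exact: cvg_id.
apply/(locally_compact_opP _ _ EP idc) => x.
apply: (near_compact_ext _ _ (near_compact0 E idfun (nbhs_filter x))) => z f /=.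
  by rewrite subrr.
have [arl _] := cb_bilinear (cyc_ar EP) z.
by rewrite subrr (lin0 (arl _)).
Qed.

Lemma homotopic_refl (E : kkdata A B) : is_cycle E -> homotopic E E.
Proof. by move=> CE; exact: iso_homotopic CE (iso_over_id E). Qed.

End IsoHomotopic.

Section KKClass.
Variables (R : realType) (G : groupoid).

Local Notation kk_eq := (Relation_Operators.clos_refl_sym_trans _ (@homotopic R G _ _)).

(** [homotopic] includes that both ends are cycles, but a reflexive step does not; the closure
    preserves only the equivalence. *)
Lemma kk_eq_cycle (A B : galg R G) (E F : kkdata A B) : kk_eq E F -> is_cycle E <-> is_cycle F.
Proof. by elim=> {E F} [E F []|E|E F _ h|E F K _ h _ h'] //; split; tauto. Qed.

Lemma kk_class_refl (A B : galg R G) (E : kkdata A B) : is_cycle E -> kk_class E E.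
Proof. by move=> CE; split=> //; exact: Relation_Operators.rst_refl. Qed.

Lemma kk_class_sym (A B : galg R G) (E F : kkdata A B) : is_cycle E -> kk_class E F -> kk_class F E.
Proof. by move=> CE [_ h]; split=> //; exact: Relation_Operators.rst_sym. Qed.

Lemma kk_class_trans (A B : galg R G) (E F K : kkdata A B) : kk_class E F -> kk_class F K -> kk_class E K.
Proof. by move=> [_ h] [CK k]; split=> //; exact: Relation_Operators.rst_trans h k. Qed.

Lemma homotopic_class (A B : galg R G) (E F : kkdata A B) : homotopic E F -> kk_class E F.
Proof. by move=> h; split; [case: h|exact: Relation_Operators.rst_step]. Qed.

Lemma kk_class_eq (A B : galg R G) (E F : kkdata A B) : is_cycle E -> kk_class E F -> kk_class E = kk_class F.
Proof.
move=> CE h; apply/funext => K; apply/propext; split; first by apply: kk_class_trans; exact: kk_class_sym.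
exact: kk_class_trans.
Qed.

Variables (A A1 B B1 : galg R G).
Variables (iA : forall x, A x -> A1 x) (iB : forall x, B x -> B1 x).
Hypotheses (hA : alg_iso iA) (hB : alg_iso iB) (HA : is_galg A1) (HB : is_galg B1).

(** A chain of homotopies over the new algebras is lifted step by step, intermediate members being
    lifted by restriction of scalars. *)
Lemma kk_class_transport (D0 D1 : kkdata A B) (E0 E1 : kkdata A1 B1) :
  iso_pair_over iA iB D0 E0 -> iso_pair_over iA iB D1 E1 ->
  is_cycle E0 -> kk_class E0 E1 -> kk_class D0 D1.
Proof.
move=> i0 i1 C0 [C1 h]; have [ul [ur uo]] := i1.
split; first exact: iso_cycle uo hA hB C1.
move: i0 C0 {C1 uo ul ur} i1; move: D0 D1; elim: h => {E0 E1} [E F h|E|E F EF IH|E F K EF IH FK IH'] D0 D1 i0 C0 i1.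
- exact: Relation_Operators.rst_step (homotopic_transport hA hB i0 i1 h).
(* [D0] and [D1] are isomorphic to the same [E], hence homotopic, but may differ. *)
- apply: Relation_Operators.rst_step.
  exact: (homotopic_transport hA hB i0 i1 (homotopic_refl HA HB C0)).
- apply: Relation_Operators.rst_sym; apply: IH i1 _ i0.
  exact: (kk_eq_cycle EF).2 C0.
- have CF : is_cycle F by exact: (kk_eq_cycle EF).1 C0.
  have [D [ul [ur uo]]] := iso_over_restr hA hB F.
  by apply: (Relation_Operators.rst_trans _ _ _ D); [apply: IH i0 _ _|apply: IH' _ _ i1] => //; exists ul, ur.
Qed.

End KKClass.

(** * Functoriality *)

Section OmTensor.
Variables (R : realType) (G H : groupoid) (Om : equivalence G H) (lam : haar_system R H).
Local Notation C := R[i].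
Variables (K L : gspace R H) (B : galg R H) (t : forall x, K x -> unitization B x -> L x).
Hypotheses (HK : is_gspace K) (HL : is_gspace L) (HB : is_gspace B).
Hypotheses (tb : forall x, is_bilinear (@t x)) (tn : forall x e c, `|@t x e c| <= `|e| * `|c|).
Hypothesis teq : forall (g : arr H) x y (hs : src g = x) (hr : rng g = y) e c,
  act hs hr (@t x e c) = @t y (act hs hr e) (uact hs hr c).

Local Notation U g := (unitization (om_alg Om B) g).

Definition at_u g (c : U g) w x (wg : rho w = g) (wx : sig w = x) : unitization B x :=
  (at_ c.1 wg wx, c.2).

Fact om_t_coherent g (e : om_space Om K g) (c : U g) :
  coherent (fun w x (wg : rho w = g) (wx : sig w = x) => t (at_ e wg wx) (at_u c wg wx)).
Proof.
move=> w h x y wg wx whg why hs hr.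
by rewrite teq /uact /at_u /= -!(at_coherent _ wg wx whg why hs hr).
Qed.

Definition om_t g (e : om_space Om K g) (c : U g) : om_space Om L g := mkom (om_t_coherent e c).

Lemma om_t_act a g g' (hs : src a = g) (hr : rng a = g') e c :
  act hs hr (@om_t g e c) = @om_t g' (act hs hr e) (uact hs hr c).
Proof. exact: omfib_ext. Qed.

Lemma at_isometry (E : gspace R H) g w x (wg : rho w = g) (wx : sig w = x) :
  isometry (fun e : om_space Om E g => at_ e wg wx).
Proof.
split=> // [e|v]; first by rewrite -omfib_normE.
exact: om_at_onto.
Qed.

Lemma at_u_isometry g w x (wg : rho w = g) (wx : sig w = x) :
  isometry (fun c : U g => at_u c wg wx).
Proof.
have i := at_isometry B wg wx; split.
- by move=> a [b z] [b' z'].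
- by move=> [b z]; rewrite !l1sum_normE /= (im_norm i).
- by move=> [b z]; have [b' bE] := im_onto i b; exists (b', z); rewrite /at_u /= bE.
Qed.

(** Evaluation at one point [w] over [g] is isometric and onto in each factor, so the universal
    property can be read off in the fibre at [sig w]. *)
Lemma om_tensorP g (D D' : Type) (ru : om_space Om K g -> D -> om_space Om K g) (lv : D -> U g -> U g)
    w (wg : rho w = g) (ru' : K (sig w) -> D' -> K (sig w)) lv' (d : D -> D') :
  (forall z, exists y, d y = z) ->
  (forall e z, at_ (ru e z) wg erefl = ru' (at_ e wg erefl) (d z)) ->
  (forall z c, at_u (lv z c) wg erefl = lv' (d z) (at_u c wg erefl)) ->
  is_projective_tensor ru' lv' (@t (sig w)) -> is_projective_tensor ru lv (@om_t g).
Proof.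
move=> donto ruE lvE.
exact: (tensor_iso (at_isometry K wg erefl) (at_u_isometry wg erefl) (at_isometry L wg erefl) donto ruE lvE).
Qed.

(** The restrictions of [t] to [B] and to the unit. Unlike the unitisation, the spaces involved are
    [gspace]s, so [om_lift2] and [om_lift1] apply. *)
Let m x (e : K x) (b : B x) : L x := t e (b, 0).
Let n x (e : K x) : L x := t e (0, 1).

Lemma t_split x (e : K x) (c : unitization B x) : t e c = t e (c.1, 0) + c.2 *: t e (0, 1).
Proof.
have [tr _] := tb x; rewrite -(linZ (tr e)) -(linD (tr e)); congr (t e _).
case: c => b z; congr pair; first by rewrite /= scaler0 addr0.
by rewrite add0r /=; exact/esym/mulr1.
Qed.

Fact m_equivariant : equivariant2 m.
Proof. by move=> g x y hs hr e b; rewrite /m teq. Qed.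
Fact n_equivariant : equivariant1 n.
Proof. by move=> g x y hs hr e; rewrite /n teq /uact /= act0. Qed.

Lemma om_t_split g (e : om_space Om K g) (c : U g) :
  om_t e c = om_lift2 m_equivariant e c.1 + c.2 *: om_lift1 n_equivariant e.
Proof. by apply: omfib_ext => w x wg wx; rewrite /= t_split. Qed.

Hypothesis tsec : sec L = Defs.approx (tensor_sections t).

Fact m_bilinear : cont_bilinear K B L m.
Proof.
split.
- move=> x; have [tr tl] := tb x; split=> [e a b b'|b a e e']; last exact: tl.
  rewrite /m -(tr e); congr (t e _); congr pair.
  by transitivity (a * 0 + 0 : C) => //; rewrite mulr0 addr0.
- move=> x; exists 1; apply: nearW => y e b; rewrite mul1r; apply: le_trans (tn _ _) _.
  by rewrite l1sum_normE /= normr0 addr0.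
- move=> xi b sxi sb; rewrite tsec; apply: sub_approx.
  exists 1%N, (fun=> xi) => //; exists (fun=> fun x => (b x, 0)).
    by move=> _; split=> //; exact: cst_continuous.
  by apply: functional_extensionality_dep => x; rewrite big_ord_recl big_ord0 addr0.
Qed.

Fact n_linear : cont_linear K L n.
Proof.
have [Bu _] := HB; split.
- by move=> x; have [tr tl] := tb x; exact: tl.
- move=> x; exists 1; apply: nearW => y e; rewrite mul1r; apply: le_trans (tn _ _) _.
  by rewrite l1sum_normE /= normr0 add0r normr1 mulr1.
- move=> xi sxi; rewrite tsec; apply: sub_approx.
  exists 1%N, (fun=> xi) => //; exists (fun=> fun x => (0, 1)).
    by move=> _; split; [exact: sec_zero Bu|exact: cst_continuous].
  by apply: functional_extensionality_dep => x; rewrite big_ord_recl big_ord0 addr0.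
Qed.

Lemma om_tensor_sections_sub : tensor_sections om_t `<=` sec (om_space Om L).
Proof.
move=> _ [k [xi sxi [beta sbeta ->]]].
have Lu := om_usc Om lam HL.
apply: (sec_sum Lu) => i; have [s1 s2] := sbeta i.
have -> : (fun g => om_t (xi i g) (beta i g)) =
  (fun g => om_lift2 m_equivariant (xi i g) (beta i g).1 + (beta i g).2 *: om_lift1 n_equivariant (xi i g)).
  by apply: functional_extensionality_dep => g; rewrite om_t_split.
apply: (secD Lu); first exact: (cb_sec (om_lift2_bilinear Om m_equivariant HK HB m_bilinear)).
by apply: (sec_scale Lu) => //; exact: (cl_sec (om_lift1_linear Om n_equivariant HK n_linear)).
Qed.

(** Both factors are approximated within [r] by sections; as [t] is bilinear and contractive, the
    total error is at most [(|c| + |e| + 1) r]. *)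
Lemma om_tensor_term w (e : K (sig w)) (c : unitization B (sig w)) (d : C) : 0 < d ->
  exists2 xi, sec (om_space Om K) xi & exists2 beta, @usec _ _ (om_alg Om B) beta &
  `|t e c - at_ (om_t (xi (rho w)) (beta (rho w))) erefl erefl| <= d.
Proof.
move=> d0; have M0 : 0 <= `|c| + `|e| + 1 by rewrite !addr_ge0.
have [r [r0 r1 Mr]] := scaled_eps M0 d0.
have [e' e'E] := om_at_onto (Om := Om) (erefl (rho w)) (erefl (sig w)) e.
have [b' b'E] := om_at_onto (Om := Om) (E := B) (erefl (rho w)) (erefl (sig w)) c.1.
have [xi sxi h] := om_dense HK lam e' r0; have [b sb h'] := om_dense HB lam b' r0.
exists xi => //; exists (fun g => (b g, c.2)); first by split=> //; exact: cst_continuous.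
have [tr tl] := tb (sig w); apply: le_trans Mr.
set e1 := at_ (xi (rho w)) erefl erefl; set c1 : unitization B (sig w) := (at_ (b (rho w)) erefl erefl, c.2).
have -> : at_ (om_t (xi (rho w)) (b (rho w), c.2)) erefl erefl = t e1 c1 by [].
have he : `|e - e1| <= r by rewrite -e'E -at_norm_le ltW.
have hc : `|c - c1| <= r.
  rewrite l1sum_normE /= subrr normr0 addr0 -b'E.
  by have := at_norm_le b' (b (rho w)) (erefl (rho w)) (erefl (sig w)) => <-; rewrite ltW.
have -> : t e c - t e1 c1 = t (e - e1) c + t e1 (c - c1).
  by rewrite (linB (tl c)) (linB (tr e1)) addrA subrK.
apply: le_trans (ler_normD _ _) _; rewrite -addrA mulrDl; apply: lerD.
  by apply: le_trans (tn _ _) _; rewrite mulrC ler_wpM2l.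
apply: le_trans (tn _ _) _; apply: ler_pM => //.
rewrite -[e1](subrK e); apply: le_trans (ler_normD _ _) _.
by rewrite addrC; apply: lerD => //; rewrite distrC; exact: le_trans he r1.
Qed.

Lemma om_tensor_dense g (v : om_space Om L g) (e : C) : 0 < e ->
  exists2 zeta, tensor_sections om_t zeta & `|v - zeta g| < e.
Proof.
move=> e0; have [w wg] := rho_onto Om g; subst g; have [Lu _] := HL.
have e20 : 0 < e / 2 by rewrite divr_gt0.
have e40 : 0 < e / 2 / 2 by rewrite divr_gt0.
have [z sz vz] := sec_dense Lu (at_ v erefl erefl) e20.
move: sz; rewrite tsec => /(_ (sig w) _ e40)[_ [k [xi sxi [beta sbeta ->]]] /nbhs_singleton zn].
(* [k.+1] instead of [k], since the sum may be empty. *)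
have ek0 : 0 < e / 2 / 2 / k.+1%:R by rewrite divr_gt0// ltr0n.
have [X XP] : exists X : 'I_k -> (forall g, om_space Om K g) * (forall g, U g),
    forall i, [/\ sec (om_space Om K) (X i).1, @usec _ _ (om_alg Om B) (X i).2 &
    `|t (xi i (sig w)) (beta i (sig w)) - at_ (om_t ((X i).1 (rho w)) ((X i).2 (rho w))) erefl erefl|
       <= e / 2 / 2 / k.+1%:R].
  have h (i : 'I_k) : exists X : (forall g, om_space Om K g) * (forall g, U g),
     [/\ sec (om_space Om K) X.1, @usec _ _ (om_alg Om B) X.2 &
      `|t (xi i (sig w)) (beta i (sig w)) - at_ (om_t (X.1 (rho w)) (X.2 (rho w))) erefl erefl|
       <= e / 2 / 2 / k.+1%:R].
    by have [x sx [b sb h]] := om_tensor_term (xi i (sig w)) (beta i (sig w)) ek0; exists (x, b).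
  by exists (fun i => sval (cid (h i))) => i; exact: (svalP (cid (h i))).
exists (fun g => \sum_(i < k) om_t ((X i).1 g) ((X i).2 g)).
  by exists k, (fun i => (X i).1); [move=> i; case: (XP i)|exists (fun i => (X i).2) => // i; case: (XP i)].
rewrite (at_norm_le _ _ (erefl (rho w)) (erefl (sig w))).
have -> : at_ (\sum_(i < k) om_t ((X i).1 (rho w)) ((X i).2 (rho w))) (erefl (rho w)) (erefl (sig w)) =
  \sum_(i < k) at_ (om_t ((X i).1 (rho w)) ((X i).2 (rho w))) (erefl (rho w)) (erefl (sig w)).
  exact: (lin_sum _ _ _ (im_linear (at_isometry L (erefl (rho w)) (erefl (sig w))))).
rewrite [e]splitr; apply: le_lt_trans (ler_distD (z (sig w)) _ _) _; apply: ltr_leD => //.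
apply: le_trans (ler_distD (\sum_(i < k) t (xi i (sig w)) (beta i (sig w))) _ _) _.
rewrite [leRHS]splitr; apply: lerD => //.
rewrite -sumrB; apply: le_trans (ler_norm_sum _ _ _) _.
apply: (@le_trans _ _ (\sum_(i < k) (e / 2 / 2 / k.+1%:R))).
  by apply: ler_sum => i _; case: (XP i).
rewrite sumr_const card_ord -[leLHS]mulr_natr -mulrA -[leRHS]mulr1 ler_wpM2l//; first exact: ltW.
by rewrite mulrC ler_pdivrMr ?ltr0n// mul1r ler_nat.
Qed.

(** Density yields a sum of tensors close to a given section at [g], and upper semicontinuity of the
    difference keeps it close near [g]. *)
Lemma om_tensor_sec : sec (om_space Om L) = Defs.approx (tensor_sections om_t).
Proof.
have Lu := om_usc Om lam HL; have sub := om_tensor_sections_sub.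
apply/seteqP; split; last exact: (approx_sub Lu).
move=> s ss g e e0; have [zeta tz n0] := om_tensor_dense (s g) e0; exists zeta => //.
have sd : sec (om_space Om L) (fun g => s g - zeta g).
  have := sec_lin Lu (-1) (sub _ tz) ss; congr sec; apply: functional_extensionality_dep => g'.
  by rewrite scaleN1r addrC.
by have := sec_usc Lu sd n0; apply: filterS => g' /ltW.
Qed.

Variables (TK : forall x, K x -> K x) (TL : forall x, L x -> L x).
Hypotheses (TKc : cont_linear K K TK) (TLc : cont_linear L L TL).
Hypothesis TE : forall x e c, @TL x (t e c) = t (TK e) c.
Variable c : pts Om -> R.
Hypothesis cP : is_cutoff Om lam c.

(** For fixed [b] the map [t _ b] is bounded and linear, so it passes through the integral.
    Conjugation by [h] commutes with it, because [h] acts on both factors and the operator on the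
    first alone. *)
Lemma om_op_tensor g (e : om_space Om K g) (b : U g) :
  om_op lam c TL (om_t e b) = om_t (om_op lam c TK e) b.
Proof.
apply: omfib_ext => w x wg wx; rewrite /= !(om_opP cP HK TKc) !(om_opP cP HL TLc) /=.
have [_ tl] := tb x; apply/esym/avg_uniq.
have bn v : `|t v (at_u b wg wx)| <= `|at_u b wg wx| * `|v| by rewrite mulrC; exact: tn.
apply: weak_int_ext (weak_int_map (tl _) bn (avgP cP HK TKc wx (at_ e wg wx))) => h hx.
rewrite (om_integrandE c TK w (at_ e wg wx) hx) (om_integrandE c TL w _ hx).
rewrite (linZ (tl _)); congr (_ *: _).
move: (at_ e wg wx) (at_u b wg wx) => v u {wx bn}; subst x.
have i1 := src_inv h; have i2 := rng_inv h.
rewrite !(conj_actE _ _ erefl i1 i2) teq TE teq /uact /=; congr t.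
by case: u => u z; rewrite /= act_invK'.
Qed.

End OmTensor.

Lemma isometry_inj (R : realType) (U V : normedModType R[i]) (f : U -> V) : isometry f -> injective f.
Proof. by move=> /isometry_inv[g [_ fK _]]; exact: can_inj fK. Qed.

(** * Push-forwards, paths and homotopies under the pull-back *)

Section OmPush.
Variables (R : realType) (G H : groupoid) (Om : equivalence G H) (lam : haar_system R H).
Local Notation C := R[i].
Variable c : pts Om -> R.
Hypothesis cP : is_cutoff Om lam c.
Variables (A B B' : galg R H) (psi : forall x, B x -> B' x).
Hypothesis peq : @equivariant1 R H B B' psi.
Variables (P : kkdata A B) (F : kkdata A B').
Hypotheses (HB' : is_galg B') (PC : is_cycle P) (FC : is_cycle F).

Lemma om_push : is_pushforward psi P F ->
  @is_pushforward R G (om_alg Om A) (om_alg Om B) (om_alg Om B') (om_lift1 (Om := Om) peq)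
    (om_cycle Om lam c P) (om_cycle Om lam c F).
Proof.
move=> [tR [tL p]]; have [HB _] := HB'.
have [PP PO] := (cyc_pair PC, cyc_op PC); have [FP FO] := (cyc_pair FC, cyc_op FC).
pose sL x (f : lp P x) (b : unitization B' x) := tL x b f.
have bR x : is_bilinear (@tR x) by case: (push_tR p x) => -[].
have nR x e b : `|@tR x e b| <= `|e| * `|b|.
  by case: (push_tR p x) => -[_ h _] _; have := h e b; rewrite mul1r.
have bL x : is_bilinear (@sL x).
  by case: (push_tL p x) => -[[h1 h2] _ _] _; split=> u; [exact: h2|exact: h1].
have nL x f b : `|@sL x f b| <= `|f| * `|b|.
  by case: (push_tL p x) => -[_ h _] _; have := h b f; rewrite mul1r mulrC.
have eL g x y (hs : src g = x) (hr : rng g = y) f b :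
  act hs hr (@sL x f b) = @sL y (act hs hr f) (uact hs hr b) by exact: push_actL p _ _ _ _ _ _ _.
have onto_u g w (wg : rho w = g) (z : unitization B (sig w)) : exists y, at_u (Om := Om) y wg erefl = z.
  exact: im_onto (at_u_isometry B wg erefl) z.
exists (om_t (push_actR p)), (fun g b f => om_t eL f b); split.
- move=> g; have [w wg] := rho_onto Om g.
  apply: (om_tensorP (push_actR p) (onto_u g w wg) _ _ (push_tR p (sig w))) => //.
- move=> g; have [w wg] := rho_onto Om g; apply: tensor_flip.
  apply: (om_tensorP (ru' := fun f d => ubl d f) (lv' := fun d b => umul b (upsi psi d))
    eL (onto_u g w wg) _ _ (tensor_flip (push_tL p (sig w)))) => //.
- exact: (om_tensor_sec Om lam (cyc_rp PP) (cyc_rp FP) HB bR nR (push_actR p) (push_secR p)).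
- exact: (om_tensor_sec Om lam (cyc_lp PP) (cyc_lp FP) HB bL nL eL (push_secL p)).
- by move=> g x y hs hr e b; exact: om_t_act.
- by move=> g x y hs hr b f; exact: om_t_act.
- by move=> g e b b'; apply: omfib_ext => w x wg wx; exact: push_rb p _ _ _ _.
- by move=> g b f b'; apply: omfib_ext => w x wg wx; exact: push_bl p _ _ _ _.
- move=> g b f e b'; have [w wg] := rho_onto Om g.
  apply: (isometry_inj (at_u_isometry B' wg erefl)); exact: push_pr p _ _ _ _ _.
- by move=> g a e b; apply: omfib_ext => w x wg wx; exact: push_ar p _ _ _ _.
- by move=> g a b f; apply: omfib_ext => w x wg wx; exact: push_la p _ _ _ _.
- by move=> g e b; apply: omfib_ext => w x wg wx; exact: push_gr p _ _ _.
- by move=> g b f; apply: omfib_ext => w x wg wx; exact: push_gl p _ _ _.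
- move=> g e b.
  exact: (om_op_tensor (cyc_rp PP) (cyc_rp FP) bR nR (push_actR p) (cyc_tr PO) (cyc_tr FO) (push_tr p) cP).
- move=> g b f.
  exact: (om_op_tensor (cyc_lp PP) (cyc_lp FP) bL nL eL (cyc_tl PO) (cyc_tl FO) (fun x f b => push_tl p b f) cP).
Qed.

End OmPush.

Section OmPath.
Variables (R : realType) (G H : groupoid) (Om : equivalence G H) (lam : haar_system R H).
Local Notation C := R[i].
Local Notation I := (unitI R).
Variable B : galg R H.
Hypothesis HB : is_galg B.

Section Fibre.
Variable g : obj G.

Fact om_path_coherent (e : om_space Om (path_alg B) g) (t : I) :
  coherent (E := B) (fun w x (wg : rho w = g) (wx : sig w = x) => pval (at_ e wg wx) t).
Proof.
by move=> w h x y wg wx whg why hs hr; rewrite (at_coherent e wg wx whg why hs hr).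
Qed.

Fact om_path_cts (e : om_space Om (path_alg B) g) :
  continuous (fun t : I => mkom (om_path_coherent e t) : om_space Om B g).
Proof.
have [w wg] := rho_onto Om g; apply/continuous_distP => t d d0.
have /continuous_distP/(_ t _ d0) := @pvalP _ _ (at_ e wg erefl); apply: filterS => s.
by rewrite (at_norm_le _ _ wg erefl).
Qed.

Definition om_path (e : om_alg Om (path_alg B) g) : path_alg (om_alg Om B) g := mkpath (@om_path_cts e).

End Fibre.

Lemma om_path_onto g (f : path_alg (om_alg Om B) g) : exists e, om_path e = f.
Proof.
have fc w x (wg : rho w = g) (wx : sig w = x) : continuous (fun t => at_ (pval f t) wg wx).
  apply/continuous_distP => t d d0.
  have /continuous_distP/(_ t _ d0) := @pvalP _ _ f; apply: filterS => s.
  by rewrite (at_norm_le _ _ wg wx).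
have ec : coherent (E := path_alg B) (fun w x (wg : rho w = g) (wx : sig w = x) => mkpath (fc w x wg wx)).
  by move=> w h x y wg wx whg why hs hr; apply: cpath_ext => t; exact: (at_coherent (pval f t)).
exists (mkom ec : om_alg Om (path_alg B) g); apply: cpath_ext => t; exact: omfib_ext.
Qed.

(** Both conditions amount to local approximability over the product of [Om] with the interval.
    Passing from [Om] to the unit space uses upper semicontinuity of the difference from a section,
    and openness of [rho]. *)
Lemma om_path_sec (xi : forall g, om_alg Om (path_alg B) g) :
  sec (path_alg (om_alg Om B)) (fun g => om_path (xi g)) <-> sec (om_alg Om (path_alg B)) xi.
Proof.
have [GB _] := HB; have [Bu _] := GB; rewrite path_secP om_secP; split.
  move=> h w.
  apply: (near_path_sec (E := B) GB (nbhs_filter w) (@nbhs_singleton _ w) (@sig_cts _ _ Om w)) => t.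
  apply: near_sec_approx => d d0; have [s /om_secP ss [[S1 S2] /= [n1 n2] n]] := h (rho w) t d d0.
  exists (fun p => at_ (s (rho p.1)) erefl erefl).
    move=> e e0; have [b sb nb] := ss w e e0; exists b => //.
    by exists ([set w' | `|at_ (s (rho w')) erefl erefl - b (sig w')| <= e], setT) => [|[w' t'] /= []//];
      split=> //; exact: filterT.
  exists (@rho _ _ Om @^-1` S1, S2) => /=; first by split=> //; exact: (@rho_cts _ _ Om w).
  move=> [w' t'] /= [k1 k2]; have := n (rho w', t') (conj k1 k2).
  by rewrite /= (at_norm_le _ _ (erefl (rho w')) (erefl (sig w'))).
move=> h g t e e0; have [w wg] := rho_onto Om g; subst g.
have [s ss sv] := om_dense GB lam (pval (om_path (xi (rho w))) t) e0; exists s => //.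
have k1 := near_path_values (E := B) t (nbhs_filter w) (@sig_cts _ _ Om w) (h w).
have k2 : near_sec (E := B) (filter_prod (nbhs w) (nbhs t)) (q := fun p => sig p.1)
    (fun p => at_ (s (rho p.1)) (erefl (rho p.1)) (erefl (sig p.1))).
  move/om_secP: ss => ss d d0; have [b sb nb] := ss w d d0; exists b => //.
  by exists ([set w' | `|at_ (s (rho w')) erefl erefl - b (sig w')| <= d], setT) => [|[w' t'] /= []//];
    split=> //; exact: filterT.
have FF : Filter (filter_prod (nbhs w) (nbhs t)) by exact: (nbhs_filter (w, t)).
have qF : (fun p : pts Om * I => sig p.1) @ filter_prod (nbhs w) (nbhs t) --> sig w.
  exact: fst_filter_cvg (nbhs_filter w) (@sig_cts _ _ Om w).
have k := near_secD FF Bu k1 (near_secN FF Bu k2).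
have := near_sec_usc (z0 := (w, t)) Bu FF (@nbhs_singleton _ (w, t)) qF k.
move=> /(_ e); rewrite (at_norm_le _ _ (erefl (rho w)) (erefl (sig w))) in sv.
move=> /(_ sv)[[S1 S2] /= [n1 n2] n].
exists (@rho _ _ Om @` S1, S2) => /=; first by split=> //; exact: nbhs_rho_image.
move=> [g t'] /= [[w' k1' <-] k2'].
rewrite (at_norm_le _ _ (erefl (rho w')) (erefl (sig w'))); apply: ltW.
exact: (n (w', t') (conj k1' k2')).
Qed.

Lemma om_path_iso : @alg_iso R G (om_alg Om (path_alg B)) (path_alg (om_alg Om B)) om_path.
Proof.
split; last by move=> g e f; apply: cpath_ext => t; exact: omfib_ext.
split.
- by move=> g a e f; apply: cpath_ext => t; exact: omfib_ext.
- move=> g e; have [w wg] := rho_onto Om g; rewrite (omfib_normE e wg erefl).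
  rewrite !cpath_normE /path_norm /path_norms; congr ((sup _)%:C).
  by apply: eq_imagel => t _; rewrite (omfib_normE _ wg erefl).
- exact: om_path_onto.
- exact: om_path_sec.
- by move=> a g g' hs hr e; apply: cpath_ext => t; exact: omfib_ext.
Qed.

End OmPath.

Section OmFunctor.
Variables (R : realType) (G H : groupoid) (Om : equivalence G H) (lam : haar_system R H).
Variable c : pts Om -> R.
Hypothesis cP : is_cutoff Om lam c.
Variables (A B : galg R H).
Hypotheses (HA : is_galg A) (HB : is_galg B).

Fact path_ev_equivariant t : @equivariant1 R H (path_alg B) B (@path_ev R H B t).
Proof. by []. Qed.

Lemma om_homotopic (E0 E1 : kkdata A B) : homotopic E0 E1 ->
  homotopic (om_cycle Om lam c E0) (om_cycle Om lam c E1).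
Proof.
move=> [C0 C1 [P [PC p0 p1]]].
have HA' := om_is_galg Om lam HA; have HB' := om_is_galg Om lam HB.
have D0 := om_is_cycle cP HA HB C0; have D1 := om_is_cycle cP HA HB C1.
have DP := om_is_cycle cP HA (path_is_galg HB) PC; split=> //.
have ki := om_path_iso Om lam HB; have [k [ki' iK kK]] := alg_iso_inv ki.
(* [Q] is [Om^* P], viewed over [(Om^* B)[0,1]] in place of [Om^*(B[0,1])]. *)
have [Q [ul [ur uo]]] := iso_over_restr (alg_iso_id (om_alg Om A)) ki' (om_cycle Om lam c P).
have push t E : is_cycle E -> is_pushforward (@path_ev R H B t) P E ->
    is_pushforward (@path_ev R G (om_alg Om B) t) Q (om_cycle Om lam c E).
  move=> EC p; have q := om_push cP (@path_ev_equivariant t) HB PC EC p.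
  apply: (push_iso (alg_iso_id (om_alg Om A)) ki' (alg_iso_id (om_alg Om B)) _ uo (iso_over_id _) q).
  by move=> g b; rewrite -[in RHS](kK g b); exact: omfib_ext.
exists Q; split; [exact: iso_cycle uo (alg_iso_id _) ki' DP|exact: push|exact: push].
Qed.

(** Each average differs from [T] by a locally compact operator after multiplication by [a]; the two
    differences are subtracted. *)
Lemma om_cutoff_homotopic (c' : pts Om -> R) (E : kkdata A B) : is_cutoff Om lam c' -> is_cycle E ->
  homotopic (om_cycle Om lam c E) (om_cycle Om lam c' E).
Proof.
move=> cP' EC; have HA' := om_is_galg Om lam HA; have HB' := om_is_galg Om lam HB.
have D := om_is_cycle cP HA HB EC; have D' := om_is_cycle cP' HA HB EC.
pose EP := cyc_pair EC; pose EO := cyc_op EC.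
apply: (perturbation_homotopic (E := om_cycle Om lam c E) HA' HB' D D') => a /om_secP sa.
pose HL := cyc_lp EP; pose HR := cyc_rp EP.
pose avl := avg cP HL (cyc_tl EO); pose avl' := avg cP' HL (cyc_tl EO).
pose avr := avg cP HR (cyc_tr EO); pose avr' := avg cP' HR (cyc_tr EO).
pose Z := {z | over_anchor (Om := Om) (@idfun (obj G)) z}.
pose aa (z : Z) : A (sig (sval z).2) := at_ (a (sval z).1) (svalP z) erefl.
apply: (om_locally_compact (lam := lam) (c := c) HA HB EP (fun x => @cvg_id _ _)
  (Sl := fun z f => avl' _ _ erefl (la f (aa z)) - avl _ _ erefl (la f (aa z)))
  (Sr := fun z v => ar (aa z) (avr' _ _ erefl v - avr _ _ erefl v))).
- by move=> z f; rewrite /= (om_opP cP HL (cyc_tl EO)) (om_opP cP' HL (cyc_tl EO)).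
- by move=> z f; rewrite /= (om_opP cP HR (cyc_tr EO)) (om_opP cP' HR (cyc_tr EO)).
move=> y0 w0 w0y; have FF : Filter (sub_nbhs (y0, w0) : set_system Z) := sub_nbhs_filter _ _.
have as_ : near_sec (sub_nbhs (y0, w0) : set_system Z) aa.
  move=> d d0; have [b sb n] := sa w0 d d0; exists b => //.
  have {}n : sub_nbhs (y0, w0) (_ @^-1` _) := @anchor_pts_cvg _ _ Om _ idfun y0 w0 _ n.
  apply: filterS n => z; rewrite /= /aa.
  by rewrite (at_section_irr a (svalP z) erefl erefl).
have k1 := near_diff cP EC (fun z => erefl) FF (@anchor_pts_cvg _ _ _ _ _ y0 w0) as_.
have k2 := near_diff cP' EC (fun z => erefl) FF (@anchor_pts_cvg _ _ _ _ _ y0 w0) as_.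
apply: near_compact_ext (near_compactB FF (@anchor_sig_cvg _ _ _ _ _ y0 w0) EP k2 k1) => z v.
  by rewrite subACA subrr subr0.
have [arl _] := cb_bilinear (cyc_ar EP) (sig (sval z).2).
by rewrite -(linB (arl _)) subACA subrr subr0.
Qed.

Lemma om_kk_class (c' : pts Om -> R) (E0 E1 : kkdata A B) : is_cutoff Om lam c' -> is_cycle E0 -> kk_class E0 E1 ->
  kk_class (om_cycle Om lam c E0) (om_cycle Om lam c' E1).
Proof.
move=> cP' C0 [C1 h].
apply: (kk_class_trans _ (homotopic_class (om_cutoff_homotopic cP' C1))).
split; first exact: om_is_cycle.
elim: h C0 {C1} => {E0 E1} [E F h|E|E F EF IH|E F K EF IH FK IH'] C0.
- exact: Relation_Operators.rst_step (om_homotopic h).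
- exact: Relation_Operators.rst_refl.
- apply: Relation_Operators.rst_sym; apply: IH; exact: (kk_eq_cycle EF).2 C0.
- have CF : is_cycle F by exact: (kk_eq_cycle EF).1 C0.
  exact: Relation_Operators.rst_trans (IH C0) (IH' CF).
Qed.

End OmFunctor.

Lemma contractive_bounded (R : realType) (X : topologicalType) (E F K : bfield R X) m :
  contractive E F K m -> forall x : X, exists M : R[i],
    \forall y \near x, forall e f, `|m y e f| <= M * `|e| * `|f|.
Proof. by move=> h x; exists 1; apply: nearW => y e f; rewrite mul1r. Qed.

(** * Sums *)

Section L1Sums.
Variable R : realType.
Local Notation C := R[i].

Lemma l1_inl_linear (U V : normedModType C) : linear (fun u : U => (u, 0) : l1sum U V).
Proof. by move=> a u v; congr pair; rewrite /= scaler0 addr0. Qed.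

Lemma l1_inr_linear (U V : normedModType C) : linear (fun v : V => (0, v) : l1sum U V).
Proof. by move=> a u v; congr pair; rewrite /= scaler0 addr0. Qed.

Lemma l1_split (U V : normedModType C) (u : U) (v : V) : ((u, v) : l1sum U V) = (u, 0) + (0, v).
Proof. by congr pair; rewrite /= (addr0, add0r). Qed.

Lemma l1_cross (U V U' V' : normedModType C) (u : U) (v : V) (u' : U') (v' : V') (M M' : C) :
  0 <= M -> 0 <= M' -> `|u'| <= M * `|u| -> `|v'| <= M' * `|v| ->
  `|u'| + `|v'| <= (M + M') * (`|u| + `|v|).
Proof.
move=> M0 M0' h h'; rewrite mulrDr !mulrDl -addrA; apply: lerD => //.
by rewrite addrA addrC; apply: ler_wpDr => //; rewrite addr_ge0// mulr_ge0.
Qed.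

Lemma sum_split n n' (X Y : Type) (V : nmodType) (g : 'I_n -> X * Y) (g' : 'I_n' -> X * Y) (h : X * Y -> V) :
  \sum_(i < n + n') h (match fintype.split i with inl j => (g j).1 | inr k => (g' k).1 end,
    match fintype.split i with inl j => (g j).2 | inr k => (g' k).2 end) =
  \sum_(j < n) h (g j) + \sum_(k < n') h (g' k).
Proof.
rewrite big_split_ord; congr (_ + _); apply: eq_bigr => i _.
  by rewrite (unsplitK (inl i)) -surjective_pairing.
by rewrite (unsplitK (inr i)) -surjective_pairing.
Qed.

End L1Sums.

Section DirectSums.
Variables (R : realType) (G : groupoid).
Local Notation C := R[i].

Lemma dsum_near (E F : gspace R G) Z (S : set_system Z) (q : Z -> obj G) (zeta : forall z, dsum E F (q z)) :
  is_gspace E -> is_gspace F -> Filter S ->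
  near_sec (E := dsum E F) S (q := q) zeta <->
  near_sec (E := E) S (q := q) (fun z => (zeta z).1) /\ near_sec (E := F) S (q := q) (fun z => (zeta z).2).
Proof.
move=> [Eu _] [Fu _] SF; split.
  move=> h; split=> e e0; have [xi [s1 s2] n] := h e e0.
    exists (fun x => (xi x).1) => //; apply: filterS n => z; apply: le_trans.
    by rewrite l1sum_normE lerDl.
  exists (fun x => (xi x).2) => //; apply: filterS n => z; apply: le_trans.
  by rewrite l1sum_normE lerDr.
move=> [h1 h2] e e0; have e20 : 0 < e / 2 by rewrite divr_gt0.
have [xi1 s1 n1] := h1 _ e20; have [xi2 s2 n2] := h2 _ e20.
exists (fun x => (xi1 x, xi2 x)) => //; apply: filterS2 n1 n2 => z k1 k2.
by rewrite l1sum_normE [e]splitr lerD.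
Qed.

Lemma dsum_gspace (E F : gspace R G) : is_gspace E -> is_gspace F -> is_gspace (dsum E F).
Proof.
move=> HE HF; have [[Eu Ea] [Fu Fa]] := (HE, HF); split; first split.
- by split; [exact: sec_zero Eu|exact: sec_zero Fu].
- by move=> a xi zeta [s1 s2] [s3 s4]; split; [exact: (sec_lin Eu)|exact: (sec_lin Fu)].
- move=> x v e e0; have e20 : 0 < e / 2 by rewrite divr_gt0.
  have [xi1 s1 n1] := sec_dense Eu v.1 e20; have [xi2 s2 n2] := sec_dense Fu v.2 e20.
  by exists (fun x => (xi1 x, xi2 x)) => //; rewrite l1sum_normE [e]splitr ltrD.
- move=> xi [s1 s2] x r; rewrite l1sum_normE -subr_gt0 => r0.
  have d0 : 0 < (r - (`|(xi x).1| + `|(xi x).2|)) / 2 by rewrite divr_gt0.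
  have n1 := sec_usc Eu s1 (x := x) (r := `|(xi x).1| + (r - (`|(xi x).1| + `|(xi x).2|)) / 2).
  have n2 := sec_usc Fu s2 (x := x) (r := `|(xi x).2| + (r - (`|(xi x).1| + `|(xi x).2|)) / 2).
  rewrite !ltrDl in n1 n2; apply: filterS2 (n1 d0) (n2 d0) => y k1 k2.
  rewrite l1sum_normE; apply: lt_le_trans (ltrD k1 k2) _.
  by rewrite addrACA -splitr addrC subrK.
- move=> xi h; have k (x : obj G) := (dsum_near (q := idfun) xi HE HF (nbhs_filter x)).1 (h x).
  by split; [apply/(sec_nearP _ Eu)|apply/(sec_nearP _ Fu)] => x; have [? ?] := k x.
move=> xi /sec_pullP h; have k g := (dsum_near (q := @src G) xi HE HF (nbhs_filter g)).1 (h g).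
apply/sec_pullP => g; apply/(dsum_near _ HE HF (nbhs_filter g)); split.
  have s : sec (pull (@src G) E) (fun g => (xi g).1) by apply/sec_pullP => g'; case: (k g').
  by have /sec_pullP/(_ g) := Ea _ s.
have s : sec (pull (@src G) F) (fun g => (xi g).2) by apply/sec_pullP => g'; case: (k g').
by have /sec_pullP/(_ g) := Fa _ s.
Qed.

Lemma dsum_contractive (A E F E' F' : gspace R G) m m' :
  contractive A E E' m -> contractive A F F' m' ->
  contractive A (dsum E F) (dsum E' F') (fun x a f => (m x a f.1, m' x a f.2)).
Proof.
by move=> h h' x a f; rewrite !l1sum_normE mulrDr; apply: lerD; [exact: h|exact: h'].
Qed.

Lemma dsum_bilinear (A E F E' F' : gspace R G) m m' :
  contractive A E E' m -> contractive A F F' m' ->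
  cont_bilinear A E E' m -> cont_bilinear A F F' m' ->
  cont_bilinear A (dsum E F) (dsum E' F') (fun x a f => (m x a f.1, m' x a f.2)).
Proof.
move=> h h' b b'; split.
- move=> x; have [[r l] [r' l']] := (cb_bilinear b x, cb_bilinear b' x).
  by split=> u z v w; congr pair; [exact: r|exact: r'|exact: l|exact: l'].
- exact: (contractive_bounded (dsum_contractive h h')).
- by move=> a xi sa [s1 s2]; split; [exact: (cb_sec b sa s1)|exact: (cb_sec b' sa s2)].
Qed.

Lemma contractive_swap (E F K : gspace R G) m :
  contractive E F K m -> contractive F E K (fun x f e => m x e f).
Proof. by move=> h x f e; rewrite mulrC. Qed.

Lemma cont_bilinear_swap (E F K : gspace R G) m :
  cont_bilinear E F K m -> cont_bilinear F E K (fun x f e => m x e f).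
Proof.
move=> h; split.
- by move=> x; have [r l] := cb_bilinear h x.
- by move=> x; have [M n] := cb_bounded h x; exists M; apply: filterS n => y n f e; rewrite mulrAC.
- by move=> f e sf se; exact: (cb_sec h se sf).
Qed.

Lemma dsum_linear (E F E' F' : gspace R G) t t' (M M' : C) : 0 <= M -> 0 <= M' ->
  (forall x e, `|t x e| <= M * `|e|) -> (forall x e, `|t' x e| <= M' * `|e|) ->
  cont_linear E E' t -> cont_linear F F' t' ->
  cont_linear (dsum E F) (dsum E' F') (fun x e => (t x e.1, t' x e.2)).
Proof.
move=> M0 M0' tM tM' h h'; split.
- move=> x a u v; have l : linear (t x) by case: h.
  by have l' : linear (t' x) by [case: h']; congr pair; [exact: l|exact: l'].
- move=> x; exists (M + M'); apply: nearW => y e; rewrite !l1sum_normE.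
  exact: (l1_cross M0 M0' (tM _ _) (tM' _ _)).
- by move=> xi [s1 s2]; split; [exact: (cl_sec h s1)|exact: (cl_sec h' s2)].
Qed.

End DirectSums.

Section SumCycle.
Variables (R : realType) (G : groupoid) (A B : galg R G) (E F : kkdata A B).
Local Notation C := R[i].
Local Notation S := (kksum E F).

Lemma kksum_pair : is_galg B -> is_pair E -> is_pair F -> is_pair S.
Proof.
move=> [[Bu _] _] EP FP.
have prc : contractive (lp S) (rp S) B (@pr _ _ _ _ S).
  move=> x f e; rewrite !l1sum_normE; apply: le_trans (ler_normD _ _) _.
  apply: (@le_trans _ _ (`|f.1| * `|e.1| + `|f.2| * `|e.2|)).
    by apply: lerD; [exact: (cyc_pr_contr EP)|exact: (cyc_pr_contr FP)].
  by rewrite mulrDl !mulrDr; apply: lerD; [rewrite lerDl|rewrite lerDr]; rewrite mulr_ge0.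
have iso1 x (f : lp E x) : `|gl f| <= 1 * `|f| by rewrite mul1r (cyc_gl_norm EP).
have iso2 x (f : lp F x) : `|gl f| <= 1 * `|f| by rewrite mul1r (cyc_gl_norm FP).
have iso3 x (f : rp E x) : `|gr f| <= 1 * `|f| by rewrite mul1r (cyc_gr_norm EP).
have iso4 x (f : rp F x) : `|gr f| <= 1 * `|f| by rewrite mul1r (cyc_gr_norm FP).
have z1 x (b : B x) : linear (@bl _ _ _ _ E x b) by case: (cb_bilinear (cyc_bl EP) x) => h _; exact: h.
have z2 x (b : B x) : linear (@bl _ _ _ _ F x b) by case: (cb_bilinear (cyc_bl FP) x) => h _; exact: h.
have z3 x (b : B x) : linear ((@rb _ _ _ _ E x)^~ b) by case: (cb_bilinear (cyc_rb EP) x) => _ h; exact: h.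
have z4 x (b : B x) : linear ((@rb _ _ _ _ F x)^~ b) by case: (cb_bilinear (cyc_rb FP) x) => _ h; exact: h.
split.
- exact: dsum_gspace (cyc_lp EP) (cyc_lp FP).
- exact: dsum_gspace (cyc_rp EP) (cyc_rp FP).
- exact: (dsum_bilinear (cyc_bl_contr EP) (cyc_bl_contr FP) (cyc_bl EP) (cyc_bl FP)).
- exact: (cont_bilinear_swap (dsum_bilinear (contractive_swap (cyc_rb_contr EP))
    (contractive_swap (cyc_rb_contr FP)) (cont_bilinear_swap (cyc_rb EP)) (cont_bilinear_swap (cyc_rb FP)))).
- split.
  + move=> x; have [[r l] [r' l']] := (cb_bilinear (cyc_pr EP) x, cb_bilinear (cyc_pr FP) x).
    by split=> u z v w; rewrite /= /sum_pr; [rewrite (r _ z) (r' _ z)|rewrite (l _ z) (l' _ z)];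
      rewrite addrACA -scalerDr.
  + exact: contractive_bounded.
  + move=> f e [s1 s2] [s3 s4]; apply: (secD Bu); [exact: (cb_sec (cyc_pr EP) s1 s3)|exact: (cb_sec (cyc_pr FP) s2 s4)].
- exact: (cont_bilinear_swap (dsum_bilinear (contractive_swap (cyc_la_contr EP))
    (contractive_swap (cyc_la_contr FP)) (cont_bilinear_swap (cyc_la EP)) (cont_bilinear_swap (cyc_la FP)))).
- exact: (dsum_bilinear (cyc_ar_contr EP) (cyc_ar_contr FP) (cyc_ar EP) (cyc_ar FP)).
- exact: (dsum_contractive (cyc_bl_contr EP) (cyc_bl_contr FP)).
- exact: (contractive_swap (dsum_contractive (contractive_swap (cyc_rb_contr EP)) (contractive_swap (cyc_rb_contr FP)))).
- exact: prc.
- exact: (contractive_swap (dsum_contractive (contractive_swap (cyc_la_contr EP)) (contractive_swap (cyc_la_contr FP)))).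
- exact: (dsum_contractive (cyc_ar_contr EP) (cyc_ar_contr FP)).
- by move=> x b b' f; rewrite /= /sum_bl /sum_rb /sum_la /sum_ar /sum_gl /sum_gr /sum_tl /sum_tr /= (cyc_blA EP) (cyc_blA FP).
- by move=> x b b' f; rewrite /= /sum_bl /sum_rb /sum_la /sum_ar /sum_gl /sum_gr /sum_tl /sum_tr /= (cyc_rbA EP) (cyc_rbA FP).
- by move=> x b b' f; rewrite /= /sum_bl /sum_rb /sum_la /sum_ar /sum_gl /sum_gr /sum_tl /sum_tr /= (cyc_laA EP) (cyc_laA FP).
- by move=> x b b' f; rewrite /= /sum_bl /sum_rb /sum_la /sum_ar /sum_gl /sum_gr /sum_tl /sum_tr /= (cyc_arA EP) (cyc_arA FP).
- by move=> x b f e; have [mr _] := amul_bilinear B x;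
    rewrite /= /sum_pr /= (cyc_prl EP) (cyc_prl FP) (linD (mr b)).
- by move=> x b f e; have [_ ml] := amul_bilinear B x;
    rewrite /= /sum_pr /= (cyc_prr EP) (cyc_prr FP) (linD (ml b)).
- by move=> x a f e; rewrite /= /sum_pr /= (cyc_pra EP) (cyc_pra FP).
- by move=> x a b f; rewrite /= /sum_bl /sum_rb /sum_la /sum_ar /sum_gl /sum_gr /sum_tl /sum_tr /= (cyc_lab EP) (cyc_lab FP).
- by move=> x a b f; rewrite /= /sum_bl /sum_rb /sum_la /sum_ar /sum_gl /sum_gr /sum_tl /sum_tr /= (cyc_arb EP) (cyc_arb FP).
- move=> x f e e0; have e20 : 0 < e / 2 by rewrite divr_gt0.
  have [n [b [u h]]] := cyc_nondeg_l EP f.1 e20; have [n' [b' [u' h']]] := cyc_nondeg_l FP f.2 e20.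
  exists (n + n')%N, (fun i => match fintype.split i with inl j => b j | inr k => b' k end),
    (fun i => match fintype.split i with inl j => (u j, 0) | inr k => (0, u' k) end).
  rewrite (sum_split (fun j => (b j, (u j, 0) : lp S x)) (fun k => (b' k, (0, u' k) : lp S x))
    (fun p => @bl _ _ _ _ S x p.1 p.2)) /= /sum_bl /=.
  have -> : \sum_(i < n) ((bl (b i) (u i), bl (b i) 0) : lp S x) = (\sum_(i < n) bl (b i) (u i), 0).
    by rewrite (lin_sum _ _ _ (@l1_inl_linear R _ _)); apply: eq_bigr => i _; rewrite (lin0 (z2 _ _)).
  have -> : \sum_(i < n') ((bl (b' i) 0, bl (b' i) (u' i)) : lp S x) = (0, \sum_(i < n') bl (b' i) (u' i)).
    by rewrite (lin_sum _ _ _ (@l1_inr_linear R _ _)); apply: eq_bigr => i _; rewrite (lin0 (z1 _ _)).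
  by rewrite -l1_split l1sum_normE [e]splitr ltrD.
- move=> x f e e0; have e20 : 0 < e / 2 by rewrite divr_gt0.
  have [n [u [b h]]] := cyc_nondeg_r EP f.1 e20; have [n' [u' [b' h']]] := cyc_nondeg_r FP f.2 e20.
  exists (n + n')%N, (fun i => match fintype.split i with inl j => (u j, 0) | inr k => (0, u' k) end),
    (fun i => match fintype.split i with inl j => b j | inr k => b' k end).
  rewrite (sum_split (fun j => (b j, (u j, 0) : rp S x)) (fun k => (b' k, (0, u' k) : rp S x))
    (fun p => @rb _ _ _ _ S x p.2 p.1)) /= /sum_rb /=.
  have -> : \sum_(i < n) ((rb (u i) (b i), rb 0 (b i)) : rp S x) = (\sum_(i < n) rb (u i) (b i), 0).
    by rewrite (lin_sum _ _ _ (@l1_inl_linear R _ _)); apply: eq_bigr => i _; rewrite (lin0 (z4 _ _)).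
  have -> : \sum_(i < n') ((rb 0 (b' i), rb (u' i) (b' i)) : rp S x) = (0, \sum_(i < n') rb (u' i) (b' i)).
    by rewrite (lin_sum _ _ _ (@l1_inr_linear R _ _)); apply: eq_bigr => i _; rewrite (lin0 (z3 _ _)).
  by rewrite -l1_split l1sum_normE [e]splitr ltrD.
- exact: (dsum_linear ler01 ler01 iso1 iso2 (cyc_gl EP) (cyc_gl FP)).
- exact: (dsum_linear ler01 ler01 iso3 iso4 (cyc_gr EP) (cyc_gr FP)).
- by move=> x [f f']; rewrite /= /sum_bl /sum_rb /sum_la /sum_ar /sum_gl /sum_gr /sum_tl /sum_tr /= (cyc_glK EP) (cyc_glK FP).
- by move=> x [f f']; rewrite /= /sum_bl /sum_rb /sum_la /sum_ar /sum_gl /sum_gr /sum_tl /sum_tr /= (cyc_grK EP) (cyc_grK FP).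
- by move=> x f; rewrite !l1sum_normE /= (cyc_gl_norm EP) (cyc_gl_norm FP).
- by move=> x f; rewrite !l1sum_normE /= (cyc_gr_norm EP) (cyc_gr_norm FP).
- by move=> x b f; rewrite /= /sum_bl /sum_rb /sum_la /sum_ar /sum_gl /sum_gr /sum_tl /sum_tr /= (cyc_gl_bl EP) (cyc_gl_bl FP).
- by move=> x b f; rewrite /= /sum_bl /sum_rb /sum_la /sum_ar /sum_gl /sum_gr /sum_tl /sum_tr /= (cyc_gr_rb EP) (cyc_gr_rb FP).
- by move=> x f e; rewrite /= /sum_pr /= (cyc_g_pr EP) (cyc_g_pr FP).
- by move=> x b f; rewrite /= /sum_bl /sum_rb /sum_la /sum_ar /sum_gl /sum_gr /sum_tl /sum_tr /= (cyc_gl_la EP) (cyc_gl_la FP).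
- by move=> x b f; rewrite /= /sum_bl /sum_rb /sum_la /sum_ar /sum_gl /sum_gr /sum_tl /sum_tr /= (cyc_gr_ar EP) (cyc_gr_ar FP).
Qed.

Lemma kksum_odd : is_odd_operator E -> is_odd_operator F -> is_odd_operator S.
Proof.
move=> EO FO; have [[M1 p1 b1] [M2 p2 b2]] := odd_bound EO; have [[M3 p3 b3] [M4 p4 b4]] := odd_bound FO.
split.
- exact: (dsum_linear p1 p3 b1 b3 (cyc_tl EO) (cyc_tl FO)).
- exact: (dsum_linear p2 p4 b2 b4 (cyc_tr EO) (cyc_tr FO)).
- exists ((M1 + M3) + (M2 + M4)) => x; split=> f; rewrite !l1sum_normE.
    apply: le_trans (l1_cross p1 p3 (b1 _ _) (b3 _ _)) _.
    by rewrite ler_wpM2r ?addr_ge0// lerDl addr_ge0.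
  apply: le_trans (l1_cross p2 p4 (b2 _ _) (b4 _ _)) _.
  by rewrite ler_wpM2r ?addr_ge0// lerDr addr_ge0.
- by move=> x b f; rewrite /= /sum_bl /sum_rb /sum_la /sum_ar /sum_gl /sum_gr /sum_tl /sum_tr /= (cyc_tl_bl EO) (cyc_tl_bl FO).
- by move=> x b f; rewrite /= /sum_bl /sum_rb /sum_la /sum_ar /sum_gl /sum_gr /sum_tl /sum_tr /= (cyc_tr_rb EO) (cyc_tr_rb FO).
- by move=> x f e; rewrite /= /sum_pr /= (cyc_t_pr EO) (cyc_t_pr FO).
- by move=> x f; rewrite /= /sum_bl /sum_rb /sum_la /sum_ar /sum_gl /sum_gr /sum_tl /sum_tr /= (cyc_tl_odd EO) (cyc_tl_odd FO).
- by move=> x f; rewrite /= /sum_bl /sum_rb /sum_la /sum_ar /sum_gl /sum_gr /sum_tl /sum_tr /= (cyc_tr_odd EO) (cyc_tr_odd FO).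
Qed.

Hypotheses (HB : is_galg B) (EP : is_pair E) (FP : is_pair F).

Lemma near_compact_dsum Z (S0 : set_system Z) (q : Z -> obj G) Sl Sr Tl Tr : Filter S0 ->
  near_compact S0 (E := E) (q := q) Sl Sr -> near_compact S0 (E := F) (q := q) Tl Tr ->
  near_compact S0 (E := S) (q := q) (fun z f => (Sl z f.1, Tl z f.2)) (fun z e => (Sr z e.1, Tr z e.2)).
Proof.
move=> SF h h' e e0; have [s sP n] := h e e0; have [s' sP' n'] := h' e e0.
have [[Eu _] [Fu _] [Eu' _] [Fu' _]] := And4 (cyc_lp EP) (cyc_lp FP) (cyc_rp EP) (cyc_rp FP).
exists ([seq ((fun x => (p.1 x, 0)) : forall x, rp S x, (fun x => (p.2 x, 0)) : forall x, lp S x) | p <- s] ++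
  [seq ((fun x => (0, p.1 x)) : forall x, rp S x, (fun x => (0, p.2 x)) : forall x, lp S x) | p <- s']).
  apply/List.Forall_app; split; apply/List.Forall_map.
    by apply: List.Forall_impl sP => p [s1 s2]; do 2!split=> //; exact: sec_zero.
  by apply: List.Forall_impl sP' => p [s1 s2]; do 2!split=> //; exact: sec_zero.
have prl0 x (f : lp E x) : pr f 0 = 0 by case: (cb_bilinear (cyc_pr EP) x) => r _; exact: lin0 (r f).
have prl1 x (f : lp F x) : pr f 0 = 0 by case: (cb_bilinear (cyc_pr FP) x) => r _; exact: lin0 (r f).
have prr0 x (f : rp E x) : pr 0 f = 0 by case: (cb_bilinear (cyc_pr EP) x) => _ r; exact: lin0 (r f).
have prr1 x (f : rp F x) : pr 0 f = 0 by case: (cb_bilinear (cyc_pr FP) x) => _ r; exact: lin0 (r f).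
have z1 x (b : B x) : @bl _ _ _ _ E x b 0 = 0 by case: (cb_bilinear (cyc_bl EP) x) => r _; exact: lin0 (r b).
have z2 x (b : B x) : @bl _ _ _ _ F x b 0 = 0 by case: (cb_bilinear (cyc_bl FP) x) => r _; exact: lin0 (r b).
have z3 x (b : B x) : @rb _ _ _ _ E x 0 b = 0 by case: (cb_bilinear (cyc_rb EP) x) => _ r; exact: lin0 (r b).
have z4 x (b : B x) : @rb _ _ _ _ F x 0 b = 0 by case: (cb_bilinear (cyc_rb FP) x) => _ r; exact: lin0 (r b).
apply: filterS2 n n' => z [k1 k2] [k3 k4]; split=> v; rewrite big_cat !big_map.
  have -> : \sum_(j <- s) @rankr _ _ _ _ S _ (j.1 (q z), 0) (j.2 (q z), 0) v =
      ((\sum_(j <- s) rankr (j.1 (q z)) (j.2 (q z)) v.1, 0) : rp S (q z)).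
    rewrite (lin_sum _ _ _ (@l1_inl_linear R _ _)); apply: eq_bigr => j _.
    by rewrite /rankr /= /sum_rb /sum_pr /= prr1 addr0 z4.
  have -> : \sum_(j <- s') @rankr _ _ _ _ S _ (0, j.1 (q z)) (0, j.2 (q z)) v =
      ((0, \sum_(j <- s') rankr (j.1 (q z)) (j.2 (q z)) v.2) : rp S (q z)).
    rewrite (lin_sum _ _ _ (@l1_inr_linear R _ _)); apply: eq_bigr => j _.
    by rewrite /rankr /= /sum_rb /sum_pr /= prr0 add0r z3.
  by rewrite /= -l1_split !l1sum_normE mulrDr; apply: lerD; [exact: k1|exact: k3].
have -> : \sum_(j <- s) @rankl _ _ _ _ S _ (j.1 (q z), 0) (j.2 (q z), 0) v =
    ((\sum_(j <- s) rankl (j.1 (q z)) (j.2 (q z)) v.1, 0) : lp S (q z)).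
  rewrite (lin_sum _ _ _ (@l1_inl_linear R _ _)); apply: eq_bigr => j _.
  by rewrite /rankl /= /sum_bl /sum_pr /= prl1 addr0 z2.
have -> : \sum_(j <- s') @rankl _ _ _ _ S _ (0, j.1 (q z)) (0, j.2 (q z)) v =
    ((0, \sum_(j <- s') rankl (j.1 (q z)) (j.2 (q z)) v.2) : lp S (q z)).
  rewrite (lin_sum _ _ _ (@l1_inr_linear R _ _)); apply: eq_bigr => j _.
  by rewrite /rankl /= /sum_bl /sum_pr /= prl0 add0r z1.
by rewrite /= -l1_split !l1sum_normE mulrDr; apply: lerD; [exact: k2|exact: k4].
Qed.

Lemma kksum_cycle : is_cycle E -> is_cycle F -> is_cycle S.
Proof.
move=> EC FC; have SP := kksum_pair HB EP FP.
have idc : continuous (@idfun (obj G)) by move=> x; exact: cvg_id.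
split=> //; first exact: kksum_odd (cyc_op EC) (cyc_op FC).
- move=> a sa; apply/(locally_compact_opP _ _ SP idc) => x.
  exact: (near_compact_dsum (nbhs_filter x) ((locally_compact_opP _ _ EP idc).1 (cyc_commutator EC sa) x)
    ((locally_compact_opP _ _ FP idc).1 (cyc_commutator FC sa) x)).
- move=> a sa; apply/(locally_compact_opP _ _ SP idc) => x.
  exact: (near_compact_dsum (nbhs_filter x) ((locally_compact_opP _ _ EP idc).1 (cyc_square EC sa) x)
    ((locally_compact_opP _ _ FP idc).1 (cyc_square FC sa) x)).
- move=> a sa; apply/(locally_compact_opP _ _ SP (@rng_cts G)) => x.
  exact: (near_compact_dsum (nbhs_filter x) ((locally_compact_opP _ _ EP (@rng_cts G)).1 (cyc_equivariance EC sa) x)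
    ((locally_compact_opP _ _ FP (@rng_cts G)).1 (cyc_equivariance FC sa) x)).
Qed.

End SumCycle.

(** * Push-forwards of direct sums, and addition of classes *)

Section SumTensor.
Variable R : realType.
Local Notation C := R[i].
Variables (D : Type) (U1 U2 V : normedModType C) (lv : D -> V -> V) (ru1 : U1 -> D -> U1) (ru2 : U2 -> D -> U2)
  (X1 X2 : completeNormedModType C) (t1 : U1 -> V -> X1) (t2 : U2 -> V -> X2).
Hypotheses (z1 : forall d, ru1 0 d = 0) (z2 : forall d, ru2 0 d = 0).

(** A balanced map on the sum is the sum of its restrictions to the summands, which are balanced by
    [z1] and [z2]. The bound is preserved because the norms of the two components are added. *)
Lemma sum_tensor : is_projective_tensor ru1 lv t1 -> is_projective_tensor ru2 lv t2 ->
  @is_projective_tensor R D (l1sum U1 U2) V (fun e d => (ru1 e.1 d, ru2 e.2 d)) lv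
    (l1sum X1 X2) (fun e c => (t1 e.1 c, t2 e.2 c)).
Proof.
move=> [[[r1 l1] n1 b1] u1] [[[r2 l2] n2 b2] u2]; split.
  split=> [|e c|e d c]; last by rewrite /= b1 b2.
    by split=> u a v w; congr pair; [exact: r1|exact: r2|exact: l1|exact: l2].
  rewrite !l1sum_normE mul1r mulrDl; apply: lerD.
    by have := n1 e.1 c; rewrite mul1r.
  by have := n2 e.2 c; rewrite mul1r.
move=> W m M M0 [[mr ml] mM mb].
have i1 := @l1_inl_linear R U1 U2; have i2 := @l1_inr_linear R U1 U2.
have j1 := @l1_inl_linear R X1 X2; have j2 := @l1_inr_linear R X1 X2.
have B1 : bounded_balanced ru1 lv M (fun u v => m (u, 0) v).
  split=> [|u v|u d v].
  - by split=> u a v w; [exact: mr|rewrite -ml -i1].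
  - by have := mM (u, 0) v; rewrite l1sum_normE /= normr0 addr0.
  - by rewrite -mb /= z2.
have B2 : bounded_balanced ru2 lv M (fun u v => m (0, u) v).
  split=> [|u v|u d v].
  - by split=> u a v w; [exact: mr|rewrite -ml -i2].
  - by have := mM (0, u) v; rewrite l1sum_normE /= normr0 add0r.
  - by rewrite -mb /= z1.
have [k1 [[k1l k1M k1t] k1u]] := u1 W _ M M0 B1; have [k2 [[k2l k2M k2t] k2u]] := u2 W _ M M0 B2.
exists (fun x => k1 x.1 + k2 x.2); split; first split.
- by move=> a u v; rewrite k1l k2l scalerDr addrACA.
- by move=> x; rewrite l1sum_normE mulrDr; apply: le_trans (ler_normD _ _) _;
  apply: lerD; [exact: k1M|exact: k2M].
- by move=> u v; rewrite /= k1t k2t -(linD (ml v)) -l1_split; case: u.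
move=> k [kl kM kt]; apply/funext => -[x1 x2] /=; rewrite l1_split (linD kl).
have -> : k1 = fun x => k (x, 0).
  apply: k1u; split.
  - by move=> a u v; rewrite -kl -j1.
  - by move=> x; apply: le_trans (kM _) _; rewrite l1sum_normE /= normr0 addr0.
  - by move=> u v; rewrite -kt /= (lin0 (l2 v)).
have -> // : k2 = fun x => k (0, x).
apply: k2u; split.
- by move=> a u v; rewrite -kl -j2.
- by move=> x; apply: le_trans (kM _) _; rewrite l1sum_normE /= normr0 add0r.
- by move=> u v; rewrite -kt /= (lin0 (l1 v)).
Qed.

End SumTensor.

Lemma sum_tensor_sections (R : realType) (G : groupoid) (E1 E2 F1 F2 : gspace R G) (B : galg R G)
    (t1 : forall x, E1 x -> unitization B x -> F1 x) (t2 : forall x, E2 x -> unitization B x -> F2 x) :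
  is_gspace E1 -> is_gspace E2 -> (forall x, is_bilinear (@t1 x)) -> (forall x, is_bilinear (@t2 x)) ->
  sec F1 = Defs.approx (tensor_sections t1) -> sec F2 = Defs.approx (tensor_sections t2) ->
  sec (dsum F1 F2) = Defs.approx (@tensor_sections R G (dsum E1 E2) (dsum F1 F2) B
    (fun x e c => (t1 x e.1 c, t2 x e.2 c))).
Proof.
move=> [E1u _] [E2u _] b1 b2 s1 s2; apply/seteqP; split=> xi.
  move=> [/=]; rewrite s1 s2 => h1 h2 x e e0; have e20 : 0 < e / 2 by rewrite divr_gt0.
  have [_ [n [u su [b sb ->]]] n1] := h1 x _ e20; have [_ [n' [u' su' [b' sb' ->]]] n2] := h2 x _ e20.
  exists (fun x => (\sum_(i < n) t1 x (u i x) (b i x), \sum_(i < n') t2 x (u' i x) (b' i x))); last first.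
    by apply: filterS2 n1 n2 => y k1 k2; rewrite l1sum_normE [e]splitr lerD.
  exists (n + n')%N, (fun i => match fintype.split i with inl j => (fun x => (u j x, 0)) | inr k => (fun x => (0, u' k x)) end).
    move=> i; case: fintype.splitP => k _; first by split; [exact: su|exact: sec_zero E2u].
    by split; [exact: sec_zero E1u|exact: su'].
  exists (fun i => match fintype.split i with inl j => b j | inr k => b' k end).
    by move=> i; case: fintype.splitP.
  apply: functional_extensionality_dep => y.
  rewrite (sum_split (fun j => ((fun x => (u j x, 0)) : forall x, dsum E1 E2 x, b j))
    (fun k => ((fun x => (0, u' k x)) : forall x, dsum E1 E2 x, b' k))
    (fun p => (t1 y (p.1 y).1 (p.2 y), t2 y (p.1 y).2 (p.2 y)) : dsum F1 F2 y)) /=.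
  have [_ l1] := b1 y; have [_ l2] := b2 y.
  have -> : \sum_(j < n) ((t1 y (u j y) (b j y), t2 y 0 (b j y)) : dsum F1 F2 y) = (\sum_(j < n) t1 y (u j y) (b j y), 0).
    by rewrite (lin_sum _ _ _ (@l1_inl_linear R _ _)); apply: eq_bigr => i _; rewrite (lin0 (l2 _)).
  have -> : \sum_(j < n') ((t1 y 0 (b' j y), t2 y (u' j y) (b' j y)) : dsum F1 F2 y) = (0, \sum_(j < n') t2 y (u' j y) (b' j y)).
    by rewrite (lin_sum _ _ _ (@l1_inr_linear R _ _)); apply: eq_bigr => i _; rewrite (lin0 (l1 _)).
  by rewrite -l1_split.
move=> h; split; rewrite (s1, s2) => x e e0; have [zeta [n [u su [b sb ->]]] n1] := h x e e0.
  exists (fun x => \sum_(i < n) t1 x (u i x).1 (b i x)).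
    by exists n, (fun i x => (u i x).1); [move=> i; case: (su i)|exists b].
  apply: filterS n1 => y; apply: le_trans; rewrite l1sum_normE /=.
  have l : linear (fun p : l1sum (F1 y) (F2 y) => p.1) by [].
  by rewrite (lin_sum _ _ _ l) /= lerDl.
exists (fun x => \sum_(i < n) t2 x (u i x).2 (b i x)).
  by exists n, (fun i x => (u i x).2); [move=> i; case: (su i)|exists b].
apply: filterS n1 => y; apply: le_trans; rewrite l1sum_normE /=.
have l : linear (fun p : l1sum (F1 y) (F2 y) => p.2) by [].
by rewrite (lin_sum _ _ _ l) /= lerDr.
Qed.

Lemma umul_linear_r (R : realType) (G : groupoid) (B : galg R G) x (c : unitization B x) :
  linear (fun b : unitization B x => umul c b).
Proof.
have [r l] := amul_bilinear B x; move=> a b b'; congr pair => /=.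
  rewrite (r _ a) scalerDl !scalerDr !scalerA [c.2 * a]mulrC -!scalerA.
  by rewrite -[RHS]addrACA; congr (_ + _); rewrite addrACA.
by rewrite mulrDr; congr (_ + _); rewrite mulrCA.
Qed.

Lemma umul_linear_l (R : realType) (G : groupoid) (B : galg R G) x (c : unitization B x) :
  linear (fun b : unitization B x => umul b c).
Proof.
have [r l] := amul_bilinear B x; move=> a b b'; congr pair => /=.
  rewrite (l _ a) scalerDl !scalerDr !scalerA [c.2 * a]mulrC -!scalerA.
  by rewrite -[RHS]addrACA; congr (_ + _); rewrite addrACA.
by rewrite mulrDl -scalerAl.
Qed.

Section SumPush.
Variables (R : realType) (G : groupoid) (A B B' : galg R G) (psi : forall x, B x -> B' x).
Local Notation C := R[i].
Variables (P P' : kkdata A B) (F F' : kkdata A B').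
Hypotheses (PP : is_pair P) (PP' : is_pair P').
Hypothesis (psiD : forall x (b b' : B x), psi (b + b') = psi b + psi b' :> B' x).

Lemma sum_push : is_pushforward psi P F -> is_pushforward psi P' F' ->
  is_pushforward psi (kksum P P') (kksum F F').
Proof.
move=> [tR [tL p]] [tR' [tL' p']].
have bR x : is_bilinear (@tR x) by case: (push_tR p x) => -[].
have bR' x : is_bilinear (@tR' x) by case: (push_tR p' x) => -[].
have bL x : is_bilinear (fun f b => @tL x b f) by case: (push_tL p x) => -[[h1 h2] _ _] _; split=> u; [exact: h2|exact: h1].
have bL' x : is_bilinear (fun f b => @tL' x b f) by case: (push_tL p' x) => -[[h1 h2] _ _] _; split=> u; [exact: h2|exact: h1].
have zl (Q : kkdata A B) (QP : is_pair Q) x (d : unitization B x) : ubl d (0 : lp Q x) = 0.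
  by have [r _] := cb_bilinear (cyc_bl QP) x; rewrite /ubl (lin0 (r _)) scaler0 addr0.
have zr (Q : kkdata A B) (QP : is_pair Q) x (d : unitization B x) : urb (0 : rp Q x) d = 0.
  by have [_ r] := cb_bilinear (cyc_rb QP) x; rewrite /urb (lin0 (r _)) scaler0 addr0.
exists (fun x (e : rp (kksum P P') x) c => (tR x e.1 c, tR' x e.2 c) : rp (kksum F F') x),
  (fun x c (f : lp (kksum P P') x) => (tL x c f.1, tL' x c f.2) : lp (kksum F F') x); split.
- move=> x; exact: (sum_tensor (zr P PP x) (zr P' PP' x) (push_tR p x) (push_tR p' x)).
- move=> x; apply: tensor_flip.
  exact: (sum_tensor (ru1 := fun f d => ubl d f) (ru2 := fun f d => ubl d f) (lv := fun d c => umul c (upsi psi d))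
    (zl P PP x) (zl P' PP' x) (tensor_flip (push_tL p x)) (tensor_flip (push_tL p' x))).
- exact: (sum_tensor_sections (cyc_rp PP) (cyc_rp PP') bR bR' (push_secR p) (push_secR p')).
- exact: (sum_tensor_sections (cyc_lp PP) (cyc_lp PP') bL bL' (push_secL p) (push_secL p')).
- by move=> g x y hs hr e b; rewrite /= /dsum_act /= (push_actR p) (push_actR p').
- by move=> g x y hs hr b f; rewrite /= /dsum_act /= (push_actL p) (push_actL p').
- by move=> x e c b; rewrite /= /sum_rb /= (push_rb p) (push_rb p').
- by move=> x c f b; rewrite /= /sum_bl /= (push_bl p) (push_bl p').
- move=> x c f e c'; have h := push_pr p c f.1 e.1 c'; have h' := push_pr p' c f.2 e.2 c'.
  have D : linear (fun b : unitization B' x => umul (umul c b) c').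
    by move=> a b b'; rewrite umul_linear_r umul_linear_l.
  have -> : uincl (psi (pr f e)) = uincl (psi (pr f.1 e.1)) + uincl (psi (pr f.2 e.2)) :> unitization B' x.
    by rewrite /= /sum_pr psiD /uincl; congr pair; rewrite addr0.
  rewrite (linD D) -h -h'; by congr pair; rewrite addr0.
- by move=> x a e c; rewrite /= /sum_ar /= (push_ar p) (push_ar p').
- by move=> x a c f; rewrite /= /sum_la /= (push_la p) (push_la p').
- by move=> x e c; rewrite /= /sum_gr /= (push_gr p) (push_gr p').
- by move=> x c f; rewrite /= /sum_gl /= (push_gl p) (push_gl p').
- by move=> x e c; rewrite /= /sum_tr /= (push_tr p) (push_tr p').
- by move=> x c f; rewrite /= /sum_tl /= (push_tl p) (push_tl p').
Qed.

End SumPush.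

Section Add.
Variables (R : realType) (G : groupoid) (A B : galg R G).
Hypotheses (HA : is_galg A) (HB : is_galg B).

Lemma kksum_homotopic (E E' F F' : kkdata A B) : homotopic E E' -> homotopic F F' ->
  homotopic (kksum E F) (kksum E' F').
Proof.
move=> [C C' [P [PC p0 p1]]] [K K' [Q [QC q0 q1]]].
have [cE cF cE' cF'] := And4 (cyc_pair C) (cyc_pair K) (cyc_pair C') (cyc_pair K').
split; [exact: kksum_cycle|exact: kksum_cycle|].
exists (kksum P Q); split; first exact: (kksum_cycle (path_is_galg HB) (cyc_pair PC) (cyc_pair QC)).
  exact: (sum_push (cyc_pair PC) (cyc_pair QC) _ p0 q0).
exact: (sum_push (cyc_pair PC) (cyc_pair QC) _ p1 q1).
Qed.

(** One summand is changed at a time, the other being joined to itself by [homotopic_refl]. *)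
Lemma kksum_class (E E' F F' : kkdata A B) : is_cycle E -> is_cycle F -> kk_class E E' -> kk_class F F' ->
  kk_class (kksum E F) (kksum E' F').
Proof.
move=> EC FC [EC' h] [FC' h']; split; first by apply: kksum_cycle => //; exact: cyc_pair.
apply: (Relation_Operators.rst_trans _ _ _ (kksum E' F)).
  elim: h EC {EC' h' FC'} => {E E'} [E E' k|E|E E' k IH|E K E' k IH k' IH'] EC.
  - exact: Relation_Operators.rst_step (kksum_homotopic k (homotopic_refl HA HB FC)).
  - exact: Relation_Operators.rst_refl.
  - apply: Relation_Operators.rst_sym; apply: IH; exact: (kk_eq_cycle k).2 EC.
  - have CK : is_cycle K by exact: (kk_eq_cycle k).1 EC.
    exact: Relation_Operators.rst_trans (IH EC) (IH' CK).
elim: h' FC {FC' h EC} => {F F'} [F F' k|F|F F' k IH|F K F' k IH k' IH'] FC.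
- exact: Relation_Operators.rst_step (kksum_homotopic (homotopic_refl HA HB EC') k).
- exact: Relation_Operators.rst_refl.
- apply: Relation_Operators.rst_sym; apply: IH; exact: (kk_eq_cycle k).2 FC.
- have CK : is_cycle K by exact: (kk_eq_cycle k).1 FC.
  exact: Relation_Operators.rst_trans (IH FC) (IH' CK).
Qed.

Lemma kk_add_class (E F : kkdata A B) : is_cycle E -> is_cycle F ->
  kk_add (kk_class E) (kk_class F) = kk_class (kksum E F).
Proof.
move=> EC FC; apply/funext => Z; apply/propext; split.
  by move=> [E' [F' [h h' k]]]; exact: kk_class_trans (kksum_class EC FC h h') k.
by move=> k; exists E, F; split=> //; exact: kk_class_refl.
Qed.

End Add.

Section OmSum.
Variables (R : realType) (G H : groupoid) (Om : equivalence G H) (lam : haar_system R H).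
Variable c : pts Om -> R.
Hypothesis cP : is_cutoff Om lam c.
Local Notation C := R[i].

Section Space.
Variables (E F : gspace R H).
Hypotheses (HE : is_gspace E) (HF : is_gspace F).

Definition om_dsum g (e : om_space Om (dsum E F) g) : dsum (om_space Om E) (om_space Om F) g :=
  (om_lift1 (Om := Om) (f := fun x (p : dsum E F x) => p.1) (fun _ _ _ _ _ _ => erefl) e,
   om_lift1 (Om := Om) (f := fun x (p : dsum E F x) => p.2) (fun _ _ _ _ _ _ => erefl) e).

Lemma om_dsum_iso : space_iso om_dsum.
Proof.
split.
- by move=> g a u v; congr pair; exact: omfib_ext.
- move=> g e; have [w wg] := rho_onto Om g.
  by rewrite (omfib_normE e wg erefl) !l1sum_normE !(omfib_normE _ wg erefl).
- move=> g [u v].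
  have ec : coherent (E := dsum E F) (fun w x (wg : rho w = g) (wx : sig w = x) => (at_ u wg wx, at_ v wg wx)).
    move=> w h x y wg wx whg why hs hr.
    by rewrite (at_coherent u wg wx whg why hs hr) (at_coherent v wg wx whg why hs hr).
  by exists (mkom ec); congr pair; exact: omfib_ext.
- move=> xi; split.
    move=> [/om_secP s1 /om_secP s2]; apply/om_secP => w.
    by apply/(dsum_near _ HE HF (nbhs_filter w)); split; [exact: s1|exact: s2].
  move=> /om_secP h; have k w := (dsum_near (q := @sig _ _ Om) _ HE HF (nbhs_filter w)).1 (h w).
  by split; apply/om_secP => w; case: (k w).
- by move=> a g g' hs hr e; congr pair; exact: omfib_ext.
Qed.

Variables (TE : forall x, E x -> E x) (TF : forall x, F x -> F x) (T : forall x, dsum E F x -> dsum E F x).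
Hypotheses (TEc : cont_linear E E TE) (TFc : cont_linear F F TF) (Tc : cont_linear (dsum E F) (dsum E F) T).
Hypothesis (TTE : forall x e, @T x e = (TE e.1, TF e.2)).

Lemma om_dsum_op g (e : om_space Om (dsum E F) g) :
  om_dsum (om_op lam c T e) = (om_op lam c TE (om_dsum e).1, om_op lam c TF (om_dsum e).2).
Proof.
have HS := dsum_gspace HE HF.
congr pair; apply: omfib_ext => w x wg wx; rewrite /= (om_opP cP HS Tc).
  rewrite (om_opP cP HE TEc) /=; apply: avg_uniq.
  have Ll : linear (fun p : dsum E F x => p.1) by [].
  have Lb (p : dsum E F x) : `|p.1| <= 1 * `|p| by rewrite mul1r l1sum_normE lerDl.
  apply: weak_int_ext (weak_int_map Ll Lb (avgP cP HS Tc wx _)) => h hx.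
  rewrite (om_integrandE c T w _ hx) (om_integrandE c TE w _ hx).
  by rewrite /conj_act TTE.
rewrite (om_opP cP HF TFc) /=; apply: avg_uniq.
have Ll : linear (fun p : dsum E F x => p.2) by [].
have Lb (p : dsum E F x) : `|p.2| <= 1 * `|p| by rewrite mul1r l1sum_normE lerDr.
apply: weak_int_ext (weak_int_map Ll Lb (avgP cP HS Tc wx _)) => h hx.
rewrite (om_integrandE c T w _ hx) (om_integrandE c TF w _ hx).
by rewrite /conj_act TTE.
Qed.

End Space.

Variables (A B : galg R H).
Hypotheses (HA : is_galg A) (HB : is_galg B).

Lemma om_kksum (E F : kkdata A B) : is_cycle E -> is_cycle F ->
  homotopic (om_cycle Om lam c (kksum E F)) (kksum (om_cycle Om lam c E) (om_cycle Om lam c F)).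
Proof.
move=> EC FC; have [EP FP] := (cyc_pair EC, cyc_pair FC); have [EO FO] := (cyc_op EC, cyc_op FC).
have [GA GB] := (om_is_galg Om lam HA, om_is_galg Om lam HB).
have [DE DF] := (om_is_cycle cP HA HB EC, om_is_cycle cP HA HB FC).
have SO := kksum_odd EO FO.
apply: (iso_homotopic GA GB (kksum_cycle GB (cyc_pair DE) (cyc_pair DF) DE DF)).
have Ul := om_dsum_iso (cyc_lp EP) (cyc_lp FP); have Ur := om_dsum_iso (cyc_rp EP) (cyc_rp FP).
split; [exact: (si_linear Ul)|exact: (si_linear Ur)|exact: (si_norm Ul)|exact: (si_norm Ur)|exact: (si_onto Ul)
  |exact: (si_onto Ur)|exact: (si_sec Ul)|exact: (si_sec Ur)|exact: (si_act Ul)|exact: (si_act Ur)| | | | | | | | |].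
- by move=> g b f; congr pair; exact: omfib_ext.
- by move=> g b f; congr pair; exact: omfib_ext.
- by move=> g b f; exact: omfib_ext.
- by move=> g b f; congr pair; exact: omfib_ext.
- by move=> g b f; congr pair; exact: omfib_ext.
- by move=> g f; congr pair; exact: omfib_ext.
- by move=> g f; congr pair; exact: omfib_ext.
- by move=> g f; exact: (om_dsum_op (cyc_lp EP) (cyc_lp FP) (cyc_tl EO) (cyc_tl FO) (cyc_tl SO)).
- by move=> g f; exact: (om_dsum_op (cyc_rp EP) (cyc_rp FP) (cyc_tr EO) (cyc_tr FO) (cyc_tr SO)).
Qed.

End OmSum.

(** * The inverse equivalence *)

Section InverseIso.
Variables (R : realType) (G H : groupoid) (Om : equivalence G H) (lam : haar_system R H).
Local Notation C := R[i].
Local Notation Om' := (inv_equiv Om).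

Section Space.
Variable E : gspace R H.
Local Notation X := (om_space Om' (om_space Om E)).

Lemma om_inv_omE y (e : X y) (w : pts Om) g (wy : sig w = y) (wg : rho w = g) :
  om_inv_om e = at_ (at_ e wy wg) wg wy.
Proof.
subst g; rewrite /om_inv_om; move: (sval (base Om' y)) (svalP (base Om' y)) => w0 w0y.
have [a aw0 aw] := sig_orbit (etrans w0y (esym wy)).
have hs : src (ginv a) = rho w by rewrite src_inv -aw rho_lmv.
have hr : rng (ginv a) = @rho _ _ Om w0 by rewrite rng_inv.
have w1 : @irmv G H Om w0 (ginv a) = w by rewrite /irmv ginvK.
have p1 : @sig _ _ Om (@irmv G H Om w0 (ginv a)) = y by rewrite w1.
have p2 : @rho _ _ Om (@irmv G H Om w0 (ginv a)) = rho w by rewrite w1.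
rewrite (@at_coherent R H G Om' (om_space Om E) y e w0 (ginv a) _ _ w0y erefl p1 p2 hs hr) /=.
rewrite (@at_eq _ _ _ _ _ _ e _ _ _ p1 p2 wy erefl w1).
by apply: at_eq; rewrite ginvK.
Qed.

Hypothesis HE : is_gspace E.

(** Sections of [Om^* E] have components approximable by sections of [E]; conversely
    [om_section_through] realises a section of [E] near [w0] by components of a section of
    [Om^* E]. *)
Lemma om_inv_om_near (xi : forall y, X y) (w0 : pts Om) :
  near_sec (E := om_space Om E) (nbhs w0) (q := @rho _ _ Om) (fun w => at_ (xi (sig w)) erefl erefl) <->
  near_sec (E := E) (nbhs w0) (q := @sig _ _ Om) (fun w => om_inv_om (xi (sig w))).
Proof.
split=> h.
  apply: near_sec_approx => d d0; have [s /om_secP ss n] := h d d0.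
  exists (fun w => at_ (s (rho w)) erefl erefl); first exact: ss.
  apply: filterS n => w; rewrite (at_norm_le _ _ (erefl (rho w)) (erefl (sig w))).
  by rewrite (om_inv_omE (xi (sig w)) (erefl (sig w)) (erefl (rho w))).
apply: near_sec_approx => d d0; have d20 : 0 < d / 2 by rewrite divr_gt0.
have [b sb n] := h _ d20; have [s ss n'] := om_section_through lam HE w0 d20 sb.
exists (fun w => s (rho w)); first exact: near_sec_base.
apply: filterS2 n n' => w k k'; rewrite (at_norm_le _ _ (erefl (rho w)) (erefl (sig w))).
rewrite -(om_inv_omE (xi (sig w)) (erefl (sig w)) (erefl (rho w))).
by apply: le_trans (ler_distD (b (sig w)) _ _) _; rewrite [d]splitr lerD// distrC.
Qed.

Lemma om_inv_om_space : @space_iso R H X E (@om_inv_om R G H Om E).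
Proof.
have [Eu _] := HE; split.
- by move=> y a u v.
- move=> y e; have [w wy] := sig_onto Om y.
  rewrite (om_inv_omE e wy erefl) -(omfib_normE _ (erefl (rho w)) wy).
  by rewrite (omfib_normE (Om := Om') e wy (erefl (rho w))).
- move=> y v; have [w wy] := sig_onto Om y.
  have [f fE] := om_at_onto (erefl (rho w)) wy v.
  have [e eE] := om_at_onto (Om := Om') (E := om_space Om E) wy (erefl (rho w)) f.
  by exists e; rewrite (om_inv_omE e wy erefl) eE.
- move=> xi; rewrite (om_secP (Om := Om')); split.
    move=> s w0; apply/om_inv_om_near.
    exact: (near_sec_base (E := E) (@sig _ _ Om) (nbhs_filter w0) s).
  move=> h; apply/(sec_nearP _ Eu) => y; have [w0 w0y] := sig_onto Om y; subst y.
  move=> e e0; have [b sb n] := (om_inv_om_near xi w0).1 (h w0) e e0; exists b => //.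
  by have := nbhs_rho_image (Om := Om') n; apply: filterS => _ [w k <-].
(* Equivariance: [h] acts on the outer family by moving [w] to [w h], and inner coherence relates
   the components at [w] and at [w h] by the action of [h] on [E]. *)
- move=> h x y hs hr e; have [w wy] := sig_onto Om y.
  have wh : sig w = rng h by rewrite wy hr.
  have e1 : rmv w (ginv (ginv h)) = rmv w h by rewrite ginvK.
  have p1 : sig (rmv w h) = x by rewrite sig_rmv.
  have p2 : rho (rmv w h) = rho w by rewrite rho_rmv.
  rewrite (om_inv_omE e p1 p2) (om_inv_omE (act hs hr e) wy erefl).
  rewrite (at_coherent (at_ (act hs hr e) wy erefl) erefl wy p2 p1 hs hr).
  congr (act hs hr _); rewrite /= (@at_eq _ _ _ _ _ _ e _ _ _ _ _ p1 p2 e1).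
  move: p1 p2; move: (rmv w h) => w' p1 p2; exact: erefl.
Qed.

End Space.

Lemma om_inv_om_alg (A : galg R H) : is_galg A -> @alg_iso R H (om_alg Om' (om_alg Om A)) A (@om_inv_om R G H Om A).
Proof. by move=> [HA _]; split=> //; exact: om_inv_om_space. Qed.

Section Evaluation.
Variables (A B : galg R H) (E : kkdata A B) (c : pts Om -> R).
Hypothesis EP : is_pair E.
Local Notation D := (om_cycle Om lam c E).

(** Opposite in direction to [om_locally_compact]: an operator that is locally compact on [Om^* E]
    along [rho] has locally compact components on [E] along [sig]. *)
Lemma near_compact_at (w0 : pts Om) (Sl : forall w, lp D (rho w) -> lp D (rho w)) (Sr : forall w, rp D (rho w) -> rp D (rho w))
    (Tl : forall w, lp E (sig w) -> lp E (sig w)) (Tr : forall w, rp E (sig w) -> rp E (sig w)) :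
  (forall w f, at_ (Sl w f) erefl erefl = Tl w (at_ f erefl erefl)) ->
  (forall w f, at_ (Sr w f) erefl erefl = Tr w (at_ f erefl erefl)) ->
  near_compact (nbhs w0) (E := D) (q := @rho _ _ Om) Sl Sr ->
  near_compact (nbhs w0) (E := E) (q := @sig _ _ Om) Tl Tr.
Proof.
move=> STl STr h; apply: (@near_compact_approx _ _ _ _ _ _ _ _ _ _ _ 1) => // d d0 _.
have [s sP n] := h d d0.
exists (fun w f => \sum_(p <- s) rankl (at_ (p.1 (rho w)) erefl erefl) (at_ (p.2 (rho w)) erefl erefl) f),
  (fun w v => \sum_(p <- s) rankr (at_ (p.1 (rho w)) erefl erefl) (at_ (p.2 (rho w)) erefl erefl) v).
split.
  elim: s sP {n} => [|p s IH] sP.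
    by apply: near_compact_ext (near_compact0 E (@sig _ _ Om) (nbhs_filter w0)) => *; rewrite big_nil.
  have [[/om_secP s1 /om_secP s2] sP'] := (List.Forall_cons_iff _ _ _).1 sP.
  have k := near_compactD (nbhs_filter w0) (near_compact_rank (nbhs_filter w0) (@sig_cts _ _ Om w0) EP (s1 w0) (s2 w0)) (IH sP').
  by apply: near_compact_ext k => *; rewrite big_cons.
apply: filterS n => w [h1 h2]; rewrite mul1r; split=> v.
  have [f fE] := om_at_onto (Om := Om) (erefl (rho w)) (erefl (sig w)) v.
  rewrite -fE -STr; have := h1 f.
  rewrite (omfib_normE f (erefl (rho w)) (erefl (sig w))) (at_norm_le _ _ (erefl (rho w)) (erefl (sig w))).
  apply: le_trans; rewrite (lin_sum _ _ _ (im_linear (at_isometry (rp E) (erefl (rho w)) (erefl (sig w))))).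
  exact: lexx.
have [f fE] := om_at_onto (Om := Om) (erefl (rho w)) (erefl (sig w)) v.
rewrite -fE -STl; have := h2 f.
rewrite (omfib_normE f (erefl (rho w)) (erefl (sig w))) (at_norm_le _ _ (erefl (rho w)) (erefl (sig w))).
apply: le_trans; rewrite (lin_sum _ _ _ (im_linear (at_isometry (lp E) (erefl (rho w)) (erefl (sig w))))).
exact: lexx.
Qed.

(** [sig] is the map [rho] of the inverse equivalence, hence open. *)
Lemma near_compact_sig (w0 : pts Om) (Tl : forall y, lp E y -> lp E y) (Tr : forall y, rp E y -> rp E y) :
  near_compact (nbhs w0) (E := E) (q := @sig _ _ Om) (fun w => Tl (sig w)) (fun w => Tr (sig w)) ->
  near_compact (nbhs (sig w0)) (E := E) (q := idfun) Tl Tr.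
Proof.
move=> h e e0; have [s sP n] := h e e0; exists s => //.
by have := nbhs_rho_image (Om := Om') n; apply: filterS => _ [w k <-].
Qed.

End Evaluation.

Variables (lam' : haar_system R G) (A B : galg R H) (E : kkdata A B) (c c' : pts Om -> R).
Hypotheses (cP : is_cutoff Om lam c) (cP' : is_cutoff Om' lam' c').
Hypotheses (HA : is_galg A) (HB : is_galg B) (EC : is_cycle E).
Local Notation D := (om_cycle Om lam c E).
Local Notation DD := (om_cycle Om' lam' c' D).
Local Notation jA := (@om_inv_om R G H Om A).
Local Notation jB := (@om_inv_om R G H Om B).

(** On the pair [E] itself, the operator of [(Om^-1)^* Om^* E] becomes [(l, r)]. Over [Om] its
    difference from [T] splits as [(T~~ - T~) + (T~ - T)]: the first part is [near_diff] for [Om^-1]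
    and [Om^* E], read on components, the second is [near_diff] for [Om] and [E]. *)
Lemma om_inv_om_homotopic (F : kkdata A B) : @iso_pair_over R H (om_alg Om' (om_alg Om A)) A (om_alg Om' (om_alg Om B)) B jA jB DD F -> homotopic E F.
Proof.
move=> [ul [ur uo]].
have [GA GB] := (om_is_galg Om lam HA, om_is_galg Om lam HB).
have DC := om_is_cycle cP HA HB EC; have DDC := om_is_cycle cP' GA GB DC.
have [hA hB] := (om_inv_om_alg HA, om_inv_om_alg HB).
have [iA [kA jAK iAK]] := alg_iso_inv hA; have [iB [kB jBK iBK]] := alg_iso_inv hB.
have [EP EO] := (cyc_pair EC, cyc_op EC); have [HL HR] := (cyc_lp EP, cyc_rp EP).
have [Jl Jr] := (om_inv_om_space HL, om_inv_om_space HR).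
have [vl [Vl JlK vlK]] := space_iso_inv Jl; have [vr [Vr JrK vrK]] := space_iso_inv Jr.
pose l y (f : lp E y) : lp E y := @om_inv_om R G H Om (lp E) y (@tl _ _ _ _ DD y (vl y f)).
pose r y (f : rp E y) : rp E y := @om_inv_om R G H Om (rp E) y (@tr _ _ _ _ DD y (vr y f)).
have jo : @iso_over R H (om_alg Om' (om_alg Om A)) A (om_alg Om' (om_alg Om B)) B jA jB DD (with_op l r) (@om_inv_om R G H Om (lp E)) (@om_inv_om R G H Om (rp E)).
  split; [exact: (si_linear Jl)|exact: (si_linear Jr)|exact: (si_norm Jl)|exact: (si_norm Jr)|exact: (si_onto Jl)
    |exact: (si_onto Jr)|exact: (si_sec Jl)|exact: (si_sec Jr)|exact: (si_act Jl)|exact: (si_act Jr)| | | | | | | | |].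
  - by move=> y b f.
  - by move=> y b f.
  - by move=> y b f.
  - by move=> y b f.
  - by move=> y b f.
  - by move=> y f.
  - by move=> y f.
  - by move=> y f; rewrite /= /l JlK.
  - by move=> y f; rewrite /= /r JrK.
have [wl [wr wo]] := iso_over_inv hB iAK iBK jo.
have FC : is_cycle F.
  have [xl [xr xo]] := iso_over_inv hB iAK iBK uo; exact: iso_cycle xo kA kB DDC.
(* [with_op l r] and [F] are both isomorphic to [DD] over the same algebra isomorphisms, so the
   composite lies over the identities. *)
have zo := iso_over_comp wo uo.
have eA : (fun x (a : A x) => om_inv_om (iA x a)) = (fun x a => a).
  by apply: functional_extensionality_dep => x; apply/funext => a; rewrite iAK.
have eB : (fun x (a : B x) => om_inv_om (iB x a)) = (fun x a => a).
  by apply: functional_extensionality_dep => x; apply/funext => a; rewrite iBK.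
rewrite eA eB in zo.
apply: (near_iso_homotopic HA HB EC FC zo) => a sa.
have idc : continuous (@idfun (obj H)) by move=> x; exact: cvg_id.
apply/(locally_compact_opP _ _ EP idc) => y0; have [w0 w0y] := sig_onto Om y0; subst y0.
pose DP := cyc_pair DC; pose DO := cyc_op DC.
(* The section [a], seen along [Om] as a selection of [Om^* A]: the component at [w] of the
   corresponding element of [(Om^-1)^* Om^* A]. *)
pose al (w : pts Om) : om_alg Om A (rho w) := at_ (iA (sig w) (a (sig w))) (erefl (sig w)) (erefl (rho w)).
have alE w : at_ (al w) erefl erefl = a (sig w).
  by rewrite -[RHS]iAK (om_inv_omE _ (erefl (sig w)) (erefl (rho w))).
have als : near_sec (E := om_alg Om A) (nbhs w0) (q := @rho _ _ Om) al.
  have s : sec (om_alg Om' (om_alg Om A)) (fun y => iA y (a y)) by have [h _] := kA; exact: (si_sec h a).2 sa.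
  exact: (om_secP (Om := Om') _).1 s w0.
have lE w (u : lp D (rho w)) : l (sig w) (at_ u (erefl (rho w)) (erefl (sig w))) =
    at_ (avg cP' (cyc_lp DP) (cyc_tl DO) (erefl (rho w)) u) (erefl (rho w)) (erefl (sig w)).
  rewrite /l (om_inv_omE _ (erefl (sig w)) (erefl (rho w))) /= (om_opP cP' (cyc_lp DP) (cyc_tl DO)).
  have ue : at_ (vl (sig w) (at_ u (erefl (rho w)) (erefl (sig w)))) (erefl (sig w)) (erefl (rho w)) = u.
    apply: (om_at_inj (wg := erefl (rho w)) (wx := erefl (sig w))).
    by rewrite -(om_inv_omE _ (erefl (sig w)) (erefl (rho w))) vlK.
  by rewrite ue.
have rE w (u : rp D (rho w)) : r (sig w) (at_ u (erefl (rho w)) (erefl (sig w))) =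
    at_ (avg cP' (cyc_rp DP) (cyc_tr DO) (erefl (rho w)) u) (erefl (rho w)) (erefl (sig w)).
  rewrite /r (om_inv_omE _ (erefl (sig w)) (erefl (rho w))) /= (om_opP cP' (cyc_rp DP) (cyc_tr DO)).
  have ue : at_ (vr (sig w) (at_ u (erefl (rho w)) (erefl (sig w)))) (erefl (sig w)) (erefl (rho w)) = u.
    apply: (om_at_inj (wg := erefl (rho w)) (wx := erefl (sig w))).
    by rewrite -(om_inv_omE _ (erefl (sig w)) (erefl (rho w))) vrK.
  by rewrite ue.
have idw : idfun @ nbhs w0 --> w0 by exact: cvg_id.
have k1 := near_diff (m := idfun) cP' DC (fun w => erefl) (nbhs_filter w0) idw als.
have k2 := near_compact_at EP (Tl := fun w f => l (sig w) (la f (a (sig w))) - avg cP (cyc_lp (cyc_pair EC)) (cyc_tl (cyc_op EC)) (erefl (sig w)) (la f (a (sig w))))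
  (Tr := fun w v => ar (a (sig w)) (r (sig w) v - avg cP (cyc_rp (cyc_pair EC)) (cyc_tr (cyc_op EC)) (erefl (sig w)) v)) _ _ k1.
have k3 := near_diff (m := idfun) cP EC (fun w => erefl) (nbhs_filter w0) idw
  (near_sec_base (E := A) (@sig _ _ Om) (nbhs_filter w0) sa).
apply: (near_compact_sig (w0 := w0)).
apply: near_compact_ext (near_compactD (nbhs_filter w0) (k2 _ _) k3) => [w f|w f|w f|w f].
- by rewrite addrA subrK.
- have [arl _] := cb_bilinear (cyc_ar EP) (sig w).
  by rewrite -(linD (arl _)) addrA subrK.
- rewrite /= -alE -lE (om_opP cP (cyc_lp (cyc_pair EC)) (cyc_tl (cyc_op EC))) //.
- rewrite /= -alE -rE (om_opP cP (cyc_rp (cyc_pair EC)) (cyc_tr (cyc_op EC))) //.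
Qed.

End InverseIso.

(** * From cycles to classes *)

Section Classes.
Variables (R : realType) (G : groupoid) (A A1 B B1 : galg R G).
Variables (iA : forall x, A x -> A1 x) (iB : forall x, B x -> B1 x).
Hypotheses (hA : alg_iso iA) (hB : alg_iso iB) (HA : is_galg A1) (HB : is_galg B1).

(** By restriction of scalars every [K] in the class of [D] is isomorphic to some [E'] over the old
    algebras, so the transported set is the whole class. *)
Lemma kk_transport_class (E : kkdata A B) (D : kkdata A1 B1) : is_cycle E -> iso_pair_over iA iB E D ->
  kk_transport iA iB (kk_class E) = kk_class D.
Proof.
move=> EC ED.
have [jA [kA jAK iAK]] := alg_iso_inv hA; have [jB [kB jBK iBK]] := alg_iso_inv hB.
have rev E' D' : iso_pair_over iA iB E' D' -> iso_pair_over jA jB D' E'.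
  by move=> [ul [ur uo]]; have [vl [vr vo]] := iso_over_inv hB iAK iBK uo; exists vl, vr.
have GA := alg_iso_galg hA HA; have GB := alg_iso_galg hB HB.
have DC : is_cycle D by have [ul [ur uo]] := rev _ _ ED; exact: iso_cycle uo kA kB EC.
apply/funext => K; apply/propext; split.
  move=> [CK [E' EE' E'K]].
  exact: (kk_class_transport kA kB GA GB (rev _ _ ED) (rev _ _ E'K) EC EE').
move=> DK; have [CK _] := DK; split=> //.
have [E' [ul [ur uo]]] := iso_over_restr hA hB K; exists E'; last by exists ul, ur.
by apply: (kk_class_transport hA hB HA HB ED _ DC DK); exists ul, ur.
Qed.

Lemma kk_transport_KKban X : KKban X -> exists E D, [/\ is_cycle E, X = kk_class E, iso_pair_over iA iB E D & is_cycle D].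
Proof.
move=> [E EC XE]; have [jA [kA jAK iAK]] := alg_iso_inv hA; have [jB [kB jBK iBK]] := alg_iso_inv hB.
have [D [vl [vr vo]]] := iso_over_restr kA kB E.
exists E, D; split=> //; last exact: iso_cycle vo kA kB EC.
by have [ul [ur uo]] := iso_over_inv kB jAK jBK vo; exists ul, ur.
Qed.

Lemma kk_transport_inj X Y : KKban X -> KKban Y ->
  kk_transport iA iB X = kk_transport iA iB Y -> X = Y.
Proof.
move=> /kk_transport_KKban[E [D [EC -> ED DC]]] /kk_transport_KKban[E' [D' [EC' -> ED' DC']]].
rewrite (kk_transport_class EC ED) (kk_transport_class EC' ED') => DD'.
apply: (kk_class_eq EC); apply: (kk_class_transport hA hB HA HB ED ED' DC).
by rewrite DD'; exact: kk_class_refl.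
Qed.

End Classes.

Section Star.
Variables (R : realType) (G H : groupoid) (Om : equivalence G H) (lam : haar_system R H).
Variables (A B : galg R H).
Hypotheses (HA : is_galg A) (HB : is_galg B).

(** The union over representatives and cut-off functions collapses to one class, since changing
    either changes the pull-back by homotopies only. *)
Lemma om_star_class (E : kkdata A B) c : is_cycle E -> is_cutoff Om lam c ->
  om_star Om lam (kk_class E) = kk_class (om_cycle Om lam c E).
Proof.
move=> EC cP; apply/funext => K; apply/propext; split.
  move=> [E' [c' [EE' cP' h]]].
  exact: (kk_class_trans (om_kk_class cP HA HB cP' EC EE') h).
by move=> h; exists E, c; split=> //; exact: kk_class_refl.
Qed.

Hypothesis sc : sigma_compact (obj G).

Lemma om_star_KKban X : KKban X -> KKban (om_star Om lam (A := A) (B := B) X).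
Proof.
move=> [E EC ->]; have [c cP] := cutoff_exists Om lam sc.
by exists (om_cycle Om lam c E); [exact: om_is_cycle|exact: om_star_class].
Qed.

Lemma om_star_add X Y : KKban X -> KKban Y ->
  om_star Om lam (A := A) (B := B) (kk_add X Y) = kk_add (om_star Om lam X) (om_star Om lam Y).
Proof.
move=> [E EC ->] [F FC ->]; have [c cP] := cutoff_exists Om lam sc.
have [GA GB] := (om_is_galg Om lam HA, om_is_galg Om lam HB).
have SC := kksum_cycle HB (cyc_pair EC) (cyc_pair FC) EC FC.
rewrite (kk_add_class HA HB EC FC) (om_star_class SC cP) (om_star_class EC cP) (om_star_class FC cP).
have [DE DF] := (om_is_cycle cP HA HB EC, om_is_cycle cP HA HB FC).
rewrite (kk_add_class GA GB DE DF).
apply: kk_class_eq; first exact: om_is_cycle.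
exact: homotopic_class (om_kksum cP HA HB EC FC).
Qed.

End Star.

Section StarInverse.
Variables (R : realType) (G H : groupoid) (Om : equivalence G H) (lam : haar_system R H) (lam' : haar_system R G).
Variables (A B : galg R H).
Hypotheses (HA : is_galg A) (HB : is_galg B) (sc : sigma_compact (obj G)) (sc' : sigma_compact (obj H)).

Lemma om_inv_star_om_star X : KKban X ->
  om_inv_star Om lam' (om_star Om lam (A := A) (B := B) X) = X.
Proof.
move=> [E EC ->]; have [c cP] := cutoff_exists Om lam sc.
have [c' cP'] := cutoff_exists (inv_equiv Om) lam' sc'.
have [GA GB] := (om_is_galg Om lam HA, om_is_galg Om lam HB).
have DC := om_is_cycle cP HA HB EC; have DDC := om_is_cycle cP' GA GB DC.
have [hA hB] := (om_inv_om_alg Om lam HA, om_inv_om_alg Om lam HB).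
have [jA [kA jAK iAK]] := alg_iso_inv hA; have [jB [kB jBK iBK]] := alg_iso_inv hB.
have [D [vl [vr vo]]] := iso_over_restr kA kB (om_cycle (inv_equiv Om) lam' c' (om_cycle Om lam c E)).
have [wl [wr wo]] := iso_over_inv kB jAK jBK vo.
have iD : iso_pair_over (@om_inv_om R G H Om A : forall x, om_alg (inv_equiv Om) (om_alg Om A) x -> A x)
   (@om_inv_om R G H Om B : forall x, om_alg (inv_equiv Om) (om_alg Om B) x -> B x)
   (om_cycle (inv_equiv Om) lam' c' (om_cycle Om lam c E)) D by exists wl, wr.
have ED := om_inv_om_homotopic cP cP' HA HB EC iD.
rewrite /om_inv_star (om_star_class HA HB EC cP) (om_star_class GA GB DC cP').
rewrite (kk_transport_class hA hB HA HB DDC iD).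
by apply/esym/(kk_class_eq EC); exact: homotopic_class.
Qed.

End StarInverse.

Theorem corollary4p22 (R : realType) (G H : groupoid)
    (lamG : haar_system R G) (lamH : haar_system R H)
    (scG : sigma_compact (obj G)) (scH : sigma_compact (obj H))
    (Om : equivalence G H) (A B : galg R H)
    (hA : is_galg A) (hB : is_galg B) :
  let F := om_star Om lamH (A := A) (B := B) in
  let F' := om_inv_star Om lamG (A := A) (B := B) in
  (is_galg (om_alg Om A) /\ is_galg (om_alg Om B)) /\
  (forall (E : kkdata A B) (c : pts Om -> R),
    is_cycle E -> is_cutoff Om lamH c ->
    is_cycle (om_cycle Om lamH c E) /\
    F (kk_class E) = kk_class (om_cycle Om lamH c E)) /\
  (forall X, KKban X -> KKban (F X)) /\
  (forall X1 X2, KKban X1 -> KKban X2 ->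
    F (kk_add X1 X2) = kk_add (F X1) (F X2)) /\
  (forall Y, KKban Y -> KKban (F' Y)) /\
  (forall X, KKban X -> F' (F X) = X) /\
  (forall Y, KKban Y -> F (F' Y) = Y).
Proof.
move=> F F'.
have [GA GB] := (om_is_galg Om lamH hA, om_is_galg Om lamH hB).
have [iA iB] := (om_inv_om_alg Om lamH hA, om_inv_om_alg Om lamH hB).
have F'K Y : KKban Y -> KKban (F' Y).
  move=> /(om_star_KKban (inv_equiv Om) lamG GA GB scH)/(kk_transport_KKban iA iB)[E [D [EC SE ED DC]]].
  by exists D => //; rewrite /F' /om_inv_star SE; exact: kk_transport_class.
have F'F X : KKban X -> F' (F X) = X by exact: om_inv_star_om_star.
split; first by [].
split; first by move=> E c EC cP; split; [exact: om_is_cycle|exact: om_star_class].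
split; first by move=> X; exact: om_star_KKban.
split; first by move=> X1 X2; exact: om_star_add.
split; first by [].
split; first by [].
move=> Y YK; have FK : KKban (F (F' Y)) by apply: om_star_KKban => //; exact: F'K.
(* [F (F' Y)] and [Y] have the same image under [om_star (inv_equiv Om)], which is injective by the
   one-sided inverse for [inv_equiv Om]. That inverse is formed with [inv_equiv (inv_equiv Om)],
   which is never compared with [Om]. *)
have S : om_star (inv_equiv Om) lamG (F (F' Y)) = om_star (inv_equiv Om) lamG Y.
  apply: (kk_transport_inj iA iB hA hB); [exact: om_star_KKban|exact: om_star_KKban|].
  by apply: F'F; exact: F'K.
rewrite -[RHS](om_inv_star_om_star (inv_equiv Om) lamG lamH GA GB scH scG YK) -S.
by rewrite (om_inv_star_om_star (inv_equiv Om) lamG lamH GA GB scH scG FK).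
Qed.
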